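(* Let $\Gamma$ be a quiver with vertices $1,\dots,n$, $\theta:\mathbb{Z}^n\to\mathbb{Z}$ a stability function and $\mu\in\mathbb{Q}$. For every $\alpha\in\Delta_\mu^+$, the functions $M_\mu^{ss}(\alpha,q)$, $I_\mu^{ss}(\alpha,q)$ and $A_\mu^{ss}(\alpha,q)$ are polynomials in $q$ with rational coefficients; that is, for each of these functions there exists a polynomial $f\in\mathbb{Q}[t]$ such that the function takes the value $f(q)$ for every prime power $q$.
   Context: A quiver $\Gamma$ has vertex set $\{1,\dots,n\}$ and finitely many arrows (loops and multiple arrows allowed). A representation over a field $k$ assigns a finite-dimensional $k$-vector space $V_i$ to each vertex and a linear map $V_i\to V_j$ to each arrow $i\to j$; its dimension vector is $(\dim V_1,\dots,\dim V_n)\in\mathbb{N}^n$. A representation over $\mathbb{F}_q$ is absolutely indecomposable if it stays indecomposable after extension of scalars to $\bar{\mathbb{F}}_q$. The stability function $\theta$ is additive; the slope of a nonzero representation with dimension vector $\alpha$ is $\theta(\alpha)/\mathrm{ht}(\alpha)$, where $\mathrm{ht}(\alpha)=\sum_i\alpha_i$. A representation is semistable if every nonzero proper subrepresentation has slope at most its slope (the zero representation counts as semistable). $\Delta_\mu^+=\{\alpha\in\mathbb{N}^n:\theta(\alpha)=\mu\cdot\mathrm{ht}(\alpha)\}$. For $\alpha\in\Delta_\mu^+$, $M_\mu^{ss}(\alpha,q)$, $I_\mu^{ss}(\alpha,q)$ and $A_\mu^{ss}(\alpha,q)$ denote the numbers of isomorphism classes of, respectively, semistable, indecomposable semistable, and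 absolutely indecomposable semistable representations of $\Gamma$ over $\mathbb{F}_q$ with dimension vector $\alpha$. *)

(* Defs.v *)
From HB Require Import structures.
From mathcomp Require Import all_boot all_order all_algebra all_field.

Set Implicit Arguments.
Unset Strict Implicit.
Unset Printing Implicit Defensive.

Import GRing.Theory Num.Theory passmx.
Local Open Scope ring_scope.

Record quiver (n : nat) := Quiver {
  arrow : finType;
  source : arrow -> 'I_n;
  target : arrow -> 'I_n
}.

Record rep (n : nat) (Q : quiver n) (k : fieldType) := Rep {
  rspace : 'I_n -> vectType k;
  rmap : forall a : arrow Q, 'Hom(rspace (source a), rspace (target a))
}.

Section Representations.
Variables (n : nat) (Q : quiver n) (k : fieldType).
Implicit Types V W : rep Q k.

Definition dimvec V : {ffun 'I_n -> nat} := [ffun i => \dim {: rspace V i}].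

Definition rep_iso V W : Prop :=
  exists phi : forall i, 'Hom(rspace V i, rspace W i),
    (forall i, bijective (phi i)) /\
    (forall (a : arrow Q) (v : rspace V (source a)),
       phi (target a) (rmap V a v) = rmap W a (phi (source a) v)).

Section Subreps.
Variable V : rep Q k.
Implicit Type U : forall i, {vspace rspace V i}.

Definition subrep U : Prop :=
  forall a : arrow Q, (rmap V a @: U (source a) <= U (target a))%VS.

Definition sub_dimvec U : {ffun 'I_n -> nat} := [ffun i => \dim (U i)].

Definition sub_nonzero U : Prop := exists i, U i <> 0%VS.

Definition sub_proper U : Prop := exists i, U i <> fullv.

Definition sub_direct_sum (U U' : forall i, {vspace rspace V i}) : Prop :=
  forall i, (U i + U' i)%VS = fullv /\ (U i :&: U' i)%VS = 0%VS.

End Subreps.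

(* The zero representation is not indecomposable. *)
Definition indecomposable V : Prop :=
  sub_nonzero (fun i => {: rspace V i}%VS) /\
  ~ exists U U' : forall i, {vspace rspace V i},
      [/\ subrep U, subrep U', sub_nonzero U, sub_nonzero U'
        & sub_direct_sum U U'].

(* There are exactly N isomorphism classes of representations satisfying P:
   r is a system of representatives of them. *)
Definition num_iso_classes (P : rep Q k -> Prop) (N : nat) : Prop :=
  exists r : 'I_N -> rep Q k,
    [/\ forall i, P (r i),
        forall i j, rep_iso (r i) (r j) -> i = j
      & forall V, P V -> exists i, rep_iso V (r i)].

End Representations.

(* Extension of scalars along iota, in coordinates: a basis of each V_i is a
   basis of its scalar extension, and the maps keep their matrices, which act
   on row vectors from the right. *)
Definition scalar_ext (n : nat) (Q : quiver n) (k K : fieldType)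
    (iota : {rmorphism k -> K}) (V : rep Q k) : rep Q K :=
  @Rep n Q K (fun i => 'rV[K]_(\dim {: rspace V i}))
    (fun a => linfun (mulmxr (map_mx iota
       (mxof (vbasis {: rspace V (source a)})
             (vbasis {: rspace V (target a)}) (rmap V a))))).

(* An algebraic closure of k is a closed field that is integral over the image
   of k. Algebraic closures are isomorphic over k, so it does not matter which
   one is taken; for finite k one is given by countable_algebraic_closure. *)
Definition abs_indecomposable (n : nat) (Q : quiver n) (k : fieldType)
    (V : rep Q k) : Prop :=
  forall (K : closedFieldType) (iota : {rmorphism k -> K}),
    integralRange iota -> indecomposable (scalar_ext iota V).

Section Stability.
Variables (n : nat) (theta : {additive {ffun 'I_n -> int} -> int}).
Implicit Types alpha : {ffun 'I_n -> nat}.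

Definition theta_nat alpha : int := theta [ffun i => (alpha i)%:Z].

Definition height alpha : nat := (\sum_i alpha i)%N.

(* Only meaningful for alpha nonzero. *)
Definition slope alpha : rat := (theta_nat alpha)%:~R / (height alpha)%:R.

Definition in_Delta (mu : rat) alpha : Prop :=
  (theta_nat alpha)%:~R = mu * (height alpha)%:R.

Definition semistable (Q : quiver n) (k : fieldType) (V : rep Q k) : Prop :=
  forall U : forall i, {vspace rspace V i},
    subrep U -> sub_nonzero U -> sub_proper U ->
    slope (sub_dimvec U) <= slope (dimvec V).

Variables (Q : quiver n) (alpha : {ffun 'I_n -> nat}) (k : fieldType).

(* M, I and A count the semistable, the indecomposable semistable and the
   absolutely indecomposable semistable representations of dimension vector
   alpha over k up to isomorphism; isM N means that there are exactly N. *)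
Definition isM : nat -> Prop :=
  num_iso_classes (fun V : rep Q k => dimvec V = alpha /\ semistable V).

Definition isI : nat -> Prop :=
  num_iso_classes (fun V : rep Q k =>
    [/\ dimvec V = alpha, semistable V & indecomposable V]).

Definition isA : nat -> Prop :=
  num_iso_classes (fun V : rep Q k =>
    [/\ dimvec V = alpha, semistable V & abs_indecomposable V]).

End Stability.

(* The finite fields are the F_q for q a prime power, and F_q is unique up to
   isomorphism; c F N says that the counting function has value N at q = #|F|. *)
Definition polynomial_count (c : fieldType -> nat -> Prop) : Prop :=
  exists f : {poly rat}, forall F : finFieldType,
    exists2 N : nat, c F N & N%:R = f.[#|F|%:R].

(* Main.v *)
(* A representation of dimension vector a is encoded by matrices acting on row
   vectors, isomorphism being conjugation by G_a = prod_i GL_{a_i}; write q for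
   the number of elements of k.

   The torsion pair attached to lam = theta - mu.ht gives a recursion for
   #{semistable x} / |G_a|, and the kernel of a nilpotent endomorphism gives one
   for #{(x, phi) : x semistable, phi nilpotent in End x} / |G_a|.  For f
   irreducible of degree e over k, the pairs with f(phi) nilpotent are the
   nilpotent pairs over k[t]/f, so their weighted number P_e(a) is a rational
   function of q.

   By Krull-Schmidt a semistable x is a sum of W_j^{m_j} with W_j indecomposable
   and End W_j modulo its radical a field with q^{d_j} elements; modulo its
   radical End x is the product of the matrix algebras M_{m_j}(F_{q^{d_j}}), so
   P_e(a) = sum_m prod_j c_e(m_j, d_j), where c_e(m, d) is the proportion to
   |GL_m| of the A in M_m(F_{q^d}) with f(A) nilpotent, and
   c_e(1, d) = e / (q^d - 1) if e divides d and 0 otherwise.  Taking logarithmic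
   derivatives and induction on ht a, every sum over the d divisible by e of
   I_d(a) / (q^d - 1) is rational in q, where I_d(a) is the number of
   indecomposables with d_j = d; hence so is each I_d(a), by descending induction
   on d.  The same recursion with c = 1 counts all semistables, I is the sum of
   the I_d, and A = I_1 since an indecomposable is absolutely so iff d = 1.  A
   rational function that takes integer values at all primes is a polynomial. *)

From HB Require Import structures.
Require Import Defs.
From mathcomp Require Import all_boot all_order all_fingroup all_algebra all_solvable all_field.
From mathcomp Require Import ring lra zify.
From Stdlib Require Import FunctionalExtensionality IndefiniteDescription Classical ClassicalEpsilon.

Set Implicit Arguments.
Unset Strict Implicit.
Unset Printing Implicit Defensive.

Import Order.TTheory GRing.Theory Num.Theory passmx.
Local Open Scope ring_scope.

(** * Rational functions of q *)

(** A weighted count #{x} / |G_a| sees an isomorphism class only through 1/|Aut x|, which varies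
    with the class, so it does not give the number of classes. Pairs (x, phi) repair this: in the
    ratio of the phi with f(phi) nilpotent to the automorphisms of x the order of the radical of End
    x cancels, and an indecomposable enters only through its dimension vector and its residue degree
    d. A single f does not separate the values of d. Every finite field has irreducible polynomials
    of each degree e, and the sums over the multiples of e form a triangular system, finite because
    d is bounded in terms of a.

    The torsion recursion for a has two unknowns, the torsion and the torsion-free count of a
    itself. For nonzero a one of these classes is empty, according to the sign of lam a, so one
    equation suffices.

    One rational function has to serve all finite fields, so it is always fixed before the field,
    the polynomial f and the index set of indecomposables. Its denominator has no zero at any
    integer above 1, a condition that survives replacing q by q^e. *)

Definition isrf (r : nat -> rat) := exists A B : {poly rat},
  (forall m : nat, (1 < m)%N -> B.[m%:R] != 0) /\
  (forall m : nat, (1 < m)%N -> r m = A.[m%:R] / B.[m%:R]).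

Section RationalFunctions.
Implicit Types r s : nat -> rat.

Lemma isrf_eq r s : (forall m, (1 < m)%N -> r m = s m) -> isrf r -> isrf s.
Proof. by move=> rs [A [B [B0 rE]]]; exists A, B; split=> // m m1; rewrite -rs ?rE. Qed.

Lemma isrf_poly (A : {poly rat}) : isrf (fun m => A.[m%:R]).
Proof. by exists A, 1; split=> m _; rewrite hornerC ?oner_eq0 ?divr1. Qed.

Lemma isrf_inv_poly (A : {poly rat}) :
  (forall m : nat, (1 < m)%N -> A.[m%:R] != 0) -> isrf (fun m => A.[m%:R]^-1).
Proof. by move=> A0; exists 1, A; split=> // m _; rewrite hornerC div1r. Qed.

Lemma isrf_const (c : rat) : isrf (fun=> c).
Proof. by apply: isrf_eq (isrf_poly c%:P) => m _; rewrite hornerC. Qed.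

Lemma isrf_add r s : isrf r -> isrf s -> isrf (fun m => r m + s m).
Proof.
move=> [A [B [B0 rE]]] [C [D [D0 sE]]]; exists (A * D + C * B), (B * D).
split=> m m1; first by rewrite hornerM mulf_neq0 ?B0 ?D0.
by rewrite rE ?sE // hornerD !hornerM addf_div ?B0 ?D0.
Qed.

Lemma isrf_mul r s : isrf r -> isrf s -> isrf (fun m => r m * s m).
Proof.
move=> [A [B [B0 rE]]] [C [D [D0 sE]]]; exists (A * C), (B * D).
split=> m m1; first by rewrite hornerM mulf_neq0 ?B0 ?D0.
by rewrite rE ?sE // !hornerM mulf_div.
Qed.

Lemma isrf_opp r : isrf r -> isrf (fun m => - r m).
Proof.
by move/(isrf_mul (isrf_const (-1))); apply: isrf_eq => m _; rewrite mulN1r.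
Qed.

Lemma isrf_sub r s : isrf r -> isrf s -> isrf (fun m => r m - s m).
Proof. by move=> rr rs; apply: isrf_add rr (isrf_opp rs). Qed.

Lemma isrf_sum (I : Type) (l : seq I) (P : pred I) (F : I -> nat -> rat) :
  (forall i, P i -> isrf (F i)) -> isrf (fun m => \sum_(i <- l | P i) F i m).
Proof.
move=> iF; elim: l => [|i l IHl].
  by apply: isrf_eq (isrf_const 0) => m _; rewrite big_nil.
case Pi: (P i).
  by apply: isrf_eq (isrf_add (iF i Pi) IHl) => m _; rewrite big_cons Pi.
by apply: isrf_eq IHl => m _; rewrite big_cons Pi.
Qed.

Lemma isrf_prod (I : Type) (l : seq I) (P : pred I) (F : I -> nat -> rat) :
  (forall i, P i -> isrf (F i)) -> isrf (fun m => \prod_(i <- l | P i) F i m).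
Proof.
move=> iF; elim: l => [|i l IHl].
  by apply: isrf_eq (isrf_const 1) => m _; rewrite big_nil.
case Pi: (P i).
  by apply: isrf_eq (isrf_mul (iF i Pi) IHl) => m _; rewrite big_cons Pi.
by apply: isrf_eq IHl => m _; rewrite big_cons Pi.
Qed.

Lemma isrf_natX j : isrf (fun m => (m ^ j)%:R).
Proof. by apply: isrf_eq (isrf_poly 'X^j) => m _; rewrite hornerXn natrX. Qed.

Lemma isrf_natXV j : isrf (fun m => (m ^ j)%:R^-1).
Proof.
apply: isrf_eq (isrf_inv_poly (A := 'X^j) _) => m m1; rewrite hornerXn ?natrX //.
by rewrite expf_neq0 // pnatr_eq0; case: m m1.
Qed.

Lemma isrf_comp_exp r e : (0 < e)%N -> isrf r -> isrf (fun m => r (m ^ e)%N).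
Proof.
move=> e0 [A [B [B0 rE]]]; exists (A \Po 'X^e), (B \Po 'X^e).
have gt1 m : (1 < m)%N -> (1 < m ^ e)%N by move=> m1; rewrite -{1}(exp1n e) ltn_exp2r.
by split=> m /gt1 m1; rewrite !horner_comp hornerXn -natrX ?B0 ?rE.
Qed.

Lemma isrf_natX_sub1V d : (0 < d)%N -> isrf (fun m => ((m ^ d)%:R - 1)^-1).
Proof.
move=> d0.
have E (m : nat) : ('X^d - 1 : {poly rat}).[m%:R] = (m ^ d)%:R - 1.
  by rewrite hornerD hornerN hornerC hornerXn natrX.
apply: isrf_eq (isrf_inv_poly (A := 'X^d - 1) _) => m m1; rewrite E //.
by rewrite subr_eq0 pnatr_eq1 -(exp1n d) eqn_exp2r //; case: m m1 => [|[]].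
Qed.

Lemma horner_nat_clear_denominator (Q : {poly rat}) :
  exists2 D : nat, (0 < D)%N & forall m : nat, exists z : int, D%:R * Q.[m%:R] = z%:~R.
Proof.
elim/poly_ind: Q => [|Q c [D D0 DQ]].
  by exists 1%N => // m; exists 0; rewrite horner0 mulr0.
exists (D * `|denq c|)%N => [|m]; first by rewrite muln_gt0 D0 absz_gt0 denq_eq0.
have [z zE] := DQ m; exists (z * m%:Z * denq c + D%:Z * numq c).
have dE : (`|denq c|%N)%:R = (denq c)%:~R :> rat.
  by rewrite -{2}(gez0_abs (denq_ge0 c)).
rewrite hornerMXaddC natrM dE rmorphD !rmorphM /= -zE numqE.
by rewrite -!pmulrn; ring.
Qed.

Lemma horner_nat_eventually_ge (P : {poly rat}) : 0 < lead_coef P ->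
  exists M : nat, exists2 eps : rat, 0 < eps & forall m, (M <= m)%N -> eps <= P.[m%:R].
Proof.
elim/poly_ind: P => [|P c IHP]; first by rewrite lead_coef0 ltxx.
have [->|P0] := eqVneq P 0.
  rewrite mul0r add0r lead_coefC => c0; exists 0%N, c => // m _.
  by rewrite hornerC.
have szXc : (size (c%:P : {poly rat}) < size (P * 'X)%R)%N.
  by rewrite size_mulX // (leq_ltn_trans (size_polyC_leq1 _)) // ltnS size_poly_gt0.
rewrite lead_coefDl // lead_coefMX => /IHP [M [eps eps0 PM]].
have [N NE] : exists N : nat, (1 + `|c|) / eps <= N%:R.
  exists (Num.bound ((1 + `|c|) / eps)); apply/ltW/archi_boundP.
  by rewrite divr_ge0 ?addr_ge0 ?(ltW eps0).
exists (maxn M N), 1 => // m; rewrite geq_max => /andP[/PM Pm Nm].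
rewrite hornerMXaddC; have mN : N%:R <= m%:R :> rat by rewrite ler_nat.
have := le_trans NE mN; rewrite ler_pdivrMr // => le1.
have : eps * m%:R <= P.[m%:R] * m%:R by rewrite ler_wpM2r.
have := lerNnormlW (lexx `|c|); rewrite (mulrC eps); lra.
Qed.

(** Division with remainder gives A = Q B + R. If D clears the denominators of Q at integers, then D
    r(p) - D Q(p) = D R(p) / B(p) is an integer at each prime p, and its absolute value is below 1
    for p large. So R vanishes at infinitely many primes. *)
Lemma nat_valued_isrf_poly r : isrf r ->
  (forall p, prime p -> exists N : nat, r p = N%:R) ->
  exists f : {poly rat}, forall m, (1 < m)%N -> r m = f.[m%:R].
Proof.
move=> [A [B [B0 rE]]] r_nat.
have Bn0 : B != 0 by apply/eqP=> B00; have := B0 2%N isT; rewrite B00 horner0 eqxx.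
pose Q := A %/ B; pose R := A %% B.
have AE : A = Q * B + R by exact: divp_eq.
have sRB : (size R < size B)%N by rewrite ltn_modp.
have [D D0 DQ] := horner_nat_clear_denominator Q.
have Dr0 : D%:R != 0 :> rat by rewrite pnatr_eq0 -lt0n.
(* Positivity of this polynomial at p says |D R(p) / B(p)| < 1 without absolute values; its leading
   term is that of B^2 because deg R < deg B. *)
pose P := B ^+ 2 - (D%:R *: R) ^+ 2.
have sP : (size (- (D%:R *: R) ^+ 2)%R < size (B ^+ 2)%R)%N.
  rewrite size_polyN; have [->|R0] := eqVneq R 0.
    by rewrite scaler0 expr0n size_poly0 size_poly_gt0 expf_neq0.
  have szsq (S : {poly rat}) : S != 0 -> size (S ^+ 2) = ((size S).-1 * 2).+1%N.
    by move=> S0; rewrite -(size_exp S) prednK // size_poly_gt0 expf_neq0.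
  have szR : size (D%:R *: R) = size R by rewrite size_scale.
  rewrite !szsq // -?size_poly_eq0 ?szR ?size_poly_eq0 // ltnS ltn_mul2r /=.
  by rewrite -ltnS !prednK // size_poly_gt0.
have lP : 0 < lead_coef P.
  by rewrite /P lead_coefDl // lead_coef_exp exprn_even_gt0 //= lead_coef_eq0.
have [M [eps eps0 PM]] := horner_nat_eventually_ge lP.
have Rroot p : prime p -> (M <= p)%N -> R.[p%:R] = 0.
  move=> pp Mp; have p1 := prime_gt1 pp; have Bp := B0 p p1.
  have [N rN] := r_nat p pp; have [z zE] := DQ p.
  have := rE p p1; rewrite rN AE hornerD hornerM mulrDl mulfK // => NE.
  have zE' : (D%:Z * N%:Z - z)%:~R = D%:R * R.[p%:R] / B.[p%:R].
    rewrite rmorphB rmorphM /= -zE -!pmulrn NE; ring.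
  have := PM p Mp; rewrite /P hornerD hornerN !horner_exp hornerZ => posP.
  have : ((D%:Z * N%:Z - z)%:~R : rat) ^+ 2 < 1.
    rewrite zE' expr_div_n ltr_pdivrMr ?exprn_even_gt0 // mul1r; lra.
  rewrite -rmorphXn /= -[1]/(1%:~R) ltr_int => z1.
  have : (D%:Z * N%:Z - z) ^+ 2 = 0 by have := sqr_ge0 (D%:Z * N%:Z - z); lia.
  move/eqP; rewrite sqrf_eq0 => /eqP z0; move/eqP: zE'; rewrite z0 eq_sym.
  by rewrite !mulf_eq0 (negbTE Dr0) invr_eq0 (negbTE Bp) orbF => /eqP.
have R0 : R = 0.
  have [s [us ss sp]] : exists s : seq nat, [/\ uniq s, size s = size R
      & {in s, forall p, prime p /\ (M <= p)%N}].
    elim: (size R) => [|j [s [us ss sp]]]; first by exists [::].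
    have [p pM pp] := prime_above (M + \max_(i <- s) i).
    exists (p :: s); split; first 1 last.
    - by rewrite /= ss.
    - move=> x; rewrite inE => /predU1P[->|/sp //]; split=> //.
      by rewrite (leq_trans _ (ltnW pM)) // leq_addr.
    rewrite /= us andbT; apply/negP => ps.
    have pm : (p <= \max_(i <- s) i)%N by apply: leq_bigmax_seq ps _.

    by have := leq_trans pM (leq_trans pm (leq_addl M _)); rewrite ltnn.
  apply/eqP/negP => /negP Rn0.
  have := max_poly_roots Rn0 (rs := [seq p%:R | p <- s]).
  rewrite size_map ss ltnn => F; suff: false by []; apply: F.
    apply/allP=> _ /mapP[p /sp[pp Mp] ->]; apply/rootP; exact: Rroot.
  by rewrite map_inj_uniq // => x y /eqP; rewrite eqr_nat => /eqP.
exists Q => m m1; rewrite rE // AE R0 addr0 hornerM mulfK //; exact: B0.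
Qed.

End RationalFunctions.

(** Both sides count the pairs (g, x) with g in A and [act g x] in Y; an injective map of a finite
    set to itself is bijective, so each g contributes #|Y|. In the applications Y consists of the
    objects in normal position, Z of those that can be moved there, and h is the number of g that
    move a given one. *)
Lemma double_count (G X : finType) (A : {set G}) (Y Z : {set X})
    (act : G -> X -> X) (h : nat) :
  (forall g, g \in A -> injective (act g)) ->
  (forall g x, g \in A -> act g x \in Y -> x \in Z) ->
  (forall x, x \in Z -> #|[set g in A | act g x \in Y]| = h) ->
  (#|Z| * h = #|A| * #|Y|)%N.
Proof.
move=> act_inj YZ Zh.
have -> : (#|Z| * h = \sum_(x in Z) \sum_(g in A) (act g x \in Y))%N.
  rewrite -sum_nat_const; apply: eq_bigr => x /Zh <-.
  by rewrite -sum1dep_card big_mkcondr /=; apply: eq_bigr => g _; case: ifP.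
rewrite exchange_big /= -sum_nat_const; apply: eq_bigr => g gA.
rewrite -(card_preimset _ (act_inj g gA)) -sum1dep_card big_mkcond [RHS]big_mkcond /=.
apply: eq_bigr => x _; case: ifP => [_|xZ]; first by case: ifP.
by case: ifP => // /(YZ g x gA); rewrite xZ.
Qed.

(** * Matrices over a finite field *)

(** The order of GL_n over a field with q elements, written for any integer q so that it can be
    treated as a function of q. *)
Definition gln (n q : nat) : nat := (q ^ 'C(n, 2) * \prod_(1 <= i < n.+1) (q ^ i - 1))%N.

Lemma gln_gt0 n q : (1 < q)%N -> (0 < gln n q)%N.
Proof.
move=> q1; rewrite muln_gt0 expn_gt0 (ltnW q1) /= big_nat.
elim/big_ind: _ => // [x y x0 y0|i /andP[i0 _]]; first by rewrite muln_gt0 x0.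
by rewrite subn_gt0 -(exp1n i) ltn_exp2r.
Qed.

Lemma isrf_glnV n : isrf (fun q => (gln n q)%:R^-1).
Proof.
have /isrf_mul : isrf (fun q => (q ^ 'C(n, 2))%:R^-1) := isrf_natXV _.
move/(_ _ (isrf_prod (iota 1 n) (P := fun i => (0 < i)%N)
  (F := fun i q => ((q ^ i)%:R - 1)^-1) _)).
move=> H; apply: isrf_eq (H _) => [q q1|i i0]; last exact: isrf_natX_sub1V.
rewrite natrM invfM natr_prod prodfV; congr (_ * _^-1).
rewrite /index_iota subn1 /= [RHS]big_seq [LHS]big_seq_cond; apply: eq_big => [i|i _].
  by rewrite mem_iota; case: i => [|i]; rewrite ?andbF ?andbT ?subn1.
by rewrite natrB // expn_gt0 ltnW.
Qed.

Lemma card_dffun_forall (I : finType) (T : I -> finType) (P : forall i, pred (T i)) :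
  #|[set f : {dffun forall i, T i} | [forall i, P i (f i)]]|
  = (\prod_i #|[set y | P i y]|)%N.
Proof.
rewrite -cardsXn; apply: eq_card => f; rewrite inE; apply/forallP/setXnP => fP i.
  by rewrite inE.
by have := fP i; rewrite inE.
Qed.

Lemma card_dffun (I : finType) (T : I -> finType) :
  #|{: {dffun forall i, T i}}| = (\prod_i #|T i|)%N.
Proof.
rewrite -cardsT -(eq_bigr _ (fun i _ => cardsT (T i))) -cardsXn.
by apply: eq_card => f; rewrite inE; apply/esym/setXnP => i; rewrite inE.
Qed.

Section FieldMatrices.
Variable F : fieldType.

Lemma row_free_unitP m n (J : 'M[F]_(m, m + n)) :
  reflect (exists2 g, g \in unitmx & J = row_mx 1%:M 0 *m g) (row_free J).
Proof.
apply: (iffP idP) => [Jf|[g gu ->]]; last first.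
  by rewrite /row_free mxrankMfree ?row_free_unit // rank_row_mx0 mxrank1.
have rJ : \rank J = m by apply/eqP.
exists (block_mx (col_ebase J) 0 0 1%:M *m row_ebase J).
  rewrite unitmx_mul row_ebase_unit andbT unitmxE det_ublock det1 mulr1.
  by rewrite -unitmxE col_ebase_unit.
rewrite mulmxA mul_row_block mul1mx !mul0mx mulmx0 !addr0.
rewrite -[LHS]mulmx_ebase rJ pid_mx_row mul_mx_row mulmx1 mulmx0 //.
Qed.

Lemma eqmx_unitP r m n (U : 'M[F]_(r, m + n)) : \rank U = m ->
  exists2 g, g \in unitmx & (row_mx 1%:M 0 *m g == U)%MS.
Proof.
move=> rU; move: (row_base_free U) (eq_row_base U); move: (row_base U); rewrite rU => B.
case/row_free_unitP=> g gu -> gU; exists g => //; exact/eqmxP.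
Qed.

(** Matrices act on row vectors from the right, so respecting the standard subspace [row_mx 1%:M 0]
    means being block lower triangular. *)
Lemma stab_rowP m n p r (h : 'M[F]_(m + n, p + r)) :
  (row_mx 1%:M 0 *m h <= (row_mx 1%:M 0 : 'M_(p, p + r)))%MS = (ursubmx h == 0).
Proof.
rewrite -{1}[h]submxK mul_row_block !mul1mx !mul0mx !addr0.
apply/submxP/eqP => [[D]|->]; last first.
  by exists (ulsubmx h); rewrite mul_mx_row mulmx1 mulmx0.
by rewrite mul_mx_row mulmx1 mulmx0 => /eq_row_mx[].
Qed.

Lemma unitmx_lblock m n a c d : 
  (block_mx a 0 c d \in @unitmx F (m + n)) = (a \in unitmx) && (d \in unitmx).
Proof. by rewrite !unitmxE det_lblock unitrM. Qed.

Lemma stab_row_eq m n (h : 'M[F]_(m + n)) : h \in unitmx ->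
  (row_mx 1%:M 0 *m h == (row_mx 1%:M 0 : 'M_(m, m + n)))%MS = (ursubmx h == 0).
Proof.
move=> hu; apply/idP/idP => [/andP[]|h0]; first by rewrite stab_rowP.
rewrite -stab_rowP in h0; rewrite h0 /=.
have := mxrank_leqif_eq h0; rewrite mxrankMfree ?row_free_unit //.
by case=> _; rewrite eqxx => /esym /andP[].
Qed.

End FieldMatrices.

Section FiniteMatrices.
Variable F : finFieldType.

Lemma card_fin_gt1 : (1 < #|F|)%N.
Proof. by rewrite (cardD1 0) (cardD1 1) !inE oner_eq0. Qed.

Lemma card_unitmx n : #|[set g : 'M[F]_n | g \in unitmx]| = gln n #|F|.
Proof.
case: n => [|n].
  rewrite /gln big_nil muln1 (_ : [set g | _] = setT) ?cardsT ?card_mx //.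
  by apply/setP => g; rewrite !inE unitmxE det_mx00 unitr1.
rewrite /gln -card_GL // cardsT card_sub; apply: eq_card => g.
by rewrite !inE unitmxE.
Qed.

(** One such g exists because U has rank m. The others differ from it by the parabolic subgroup of
    block lower triangular matrices, whose order is the right-hand side. *)
Lemma card_stab_row m n r (U : 'M[F]_(r, m + n)) : \rank U = m ->
  #|[set g : 'M[F]_(m + n) | (g \in unitmx) && (row_mx 1%:M 0 *m g == U)%MS]|
  = (gln m #|F| * gln n #|F| * #|F| ^ (n * m))%N.
Proof.
move=> /eqmx_unitP [g0 g0u /eqmxP g0U].
pose S := [set g : 'M[F]_m | g \in unitmx]; pose T := [set g : 'M[F]_n | g \in unitmx].
rewrite -card_mx -!card_unitmx -/S -/T -cardsT -!cardsX.
pose f (t : ('M[F]_m * 'M[F]_n) * 'M[F]_(n, m)) := block_mx t.1.1 0 t.2 t.1.2 *m g0.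
have f_inj : injective f.
  move=> [[a b] c] [[a' b'] c'] /(can_inj (mulmxK g0u)) /=.
  by case/eq_block_mx=> -> _ -> ->.
rewrite -(card_imset _ f_inj); apply: eq_card => g; rewrite !inE.
apply/andP/imsetP => [[gu gU]|[[[a b] c]]]; last first.
  rewrite !inE /= andbT => /andP[au bu] ->; rewrite unitmx_mul unitmx_lblock au bu g0u.
  split=> //; rewrite mulmxA; apply/eqmxP; apply: eqmx_trans g0U.
  apply: eqmxMr; apply/eqmxP; rewrite stab_row_eq ?unitmx_lblock ?au //.
  by rewrite block_mxKur.
pose h := g *m invmx g0.
have hu : h \in unitmx by rewrite unitmx_mul unitmx_inv gu g0u.
have h0 : ursubmx h = 0.
  apply/eqP; rewrite -stab_row_eq // /h mulmxA; apply/eqmxP.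
  rewrite -[X in (_ :=: X)%MS](mulmxK g0u); apply: eqmxMr.
  exact: eqmx_trans (eqmxP gU) (eqmx_sym g0U).
have hE : h = block_mx (ulsubmx h) 0 (dlsubmx h) (drsubmx h) by rewrite -h0 submxK.
exists ((ulsubmx h, drsubmx h), dlsubmx h); last by rewrite /f /= -hE mulmxKV.
by move: hu; rewrite !inE /= hE unitmx_lblock -hE andbT.
Qed.

(** GL_(m+n) permutes the matrices of full row rank transitively; the stabiliser of [row_mx 1%:M 0]
    consists of the invertible matrices with first block row (1, 0). *)
Lemma card_row_free m n :
  (#|[set J : 'M[F]_(m, m + n) | row_free J]| * (gln n #|F| * #|F| ^ (n * m))
   = gln (m + n) #|F|)%N.
Proof.
have := @double_count 'M[F]_(m + n) 'M[F]_(m, m + n) [set g | g \in unitmx]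
  [set row_mx 1%:M 0] [set J | row_free J] (fun g J => J *m g) (gln n #|F| * #|F| ^ (n * m)).
rewrite cards1 muln1 card_unitmx; apply=> [g|g J|J]; rewrite !inE.
- by move=> gu; apply: can_inj (mulmxK gu).
- move=> gu /eqP E; apply/row_free_unitP; exists (invmx g); rewrite ?unitmx_inv //.
  by rewrite -E mulmxK.
case/row_free_unitP=> g0 g0u ->.
pose T := [set g : 'M[F]_n | g \in unitmx].
rewrite -card_mx -card_unitmx -/T -cardsT -!cardsX.
pose f (t : 'M[F]_n * 'M[F]_(n, m)) := invmx g0 *m block_mx 1%:M 0 t.2 t.1.
have f_inj : injective f.
  move=> [a b] [a' b'] /(can_inj (mulKVmx g0u)) /=.
  by case/eq_block_mx=> _ _ -> ->.
rewrite -(card_imset _ f_inj); apply: eq_card => g; rewrite !inE.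
apply/andP/imsetP => [[gu /eqP gU]|[[a b]]]; last first.
  rewrite !inE /= andbT => au ->; rewrite unitmx_mul unitmx_inv unitmx_lblock unitmx1 au g0u.
  by rewrite mulmxA mulmxK // mul_row_block !mul1mx !mul0mx !addr0.
pose h := g0 *m g.
have hu : h \in unitmx by rewrite unitmx_mul gu g0u.
have hE : h = block_mx 1%:M 0 (dlsubmx h) (drsubmx h).
  move: gU; rewrite -mulmxA -/h -{1}[h]submxK mul_row_block !mul1mx !mul0mx !addr0.
  by case/eq_row_mx=> <- <-; rewrite submxK.
exists (drsubmx h, dlsubmx h); last by rewrite /f /= -hE mulKmx.
by move: hu; rewrite !inE /= hE unitmx_lblock -hE unitmx1 andbT.
Qed.

End FiniteMatrices.

(** * Irreducible polynomials over a finite field *)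

Section FinitePoly.
Variable F : finFieldType.
Implicit Types p h : {poly F}.
Local Notation q := #|F|.

Lemma monic_irreducible_dvdp p h :
  monic_irreducible_poly p -> monic_irreducible_poly h -> p %| h -> p = h.
Proof.
move=> [[p1 pI] pm] [[h1 hI] hm] ph; apply/eqP; rewrite -eqp_monic //.
by apply: hI => //; rewrite neq_ltn p1 orbT.
Qed.

Lemma exists_monic_irreducible_factor p : (1 < size p)%N ->
  exists2 h, monic_irreducible_poly h & h %| p.
Proof.
move=> p1; have p0 : p != 0 by rewrite -size_poly_gt0 ltnW.
(* Polynomials of bounded size over F form a finite type, so a nonconstant divisor of least degree
   exists. *)
pose good (d : {poly_(size p) F}) := (val d %| p) && (1 < size (val d))%N.
have good0 : good (npolyp (size p) p) by rewrite /good /= npolypK // dvdpp.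
case: (arg_minnP (fun d : {poly_(size p) F} => size (val d)) good0).
move=> d /andP[dp d1] dmin; have d0 : val d != 0 by rewrite -size_poly_gt0 ltnW.
have l0 : (lead_coef (val d))^-1 != 0 by rewrite invr_eq0 lead_coef_eq0.
exists ((lead_coef (val d))^-1 *: val d); last by rewrite dvdpZl.
split; last by rewrite monicE lead_coefZ mulVf ?lead_coef_eq0.
split; first by rewrite size_scale.
move=> g g1; rewrite dvdpZr // => gd.
have gp := dvdp_trans gd dp.
have sg : (size g <= size p)%N by rewrite dvdp_leq.
have g0 : g != 0 by apply: contraTneq gd => ->; rewrite dvd0p.
have := dmin (npolyp _ g); rewrite /good /= npolypK // gp ltn_neqAle eq_sym g1.
rewrite size_poly_gt0 g0 => /(_ isT) sdg.
have /eqp_trans -> // : g %= val d; last by rewrite eqp_sym eqp_scale.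
by rewrite -dvdp_size_eqp // eqn_leq sdg dvdp_leq.
Qed.

Lemma monic_irreducible_factorization p : p \is monic ->
  exists2 s : seq {poly F}, (forall h, h \in s -> monic_irreducible_poly h)
    & p = \prod_(h <- s) h.
Proof.
have [m] := ubnP (size p); elim: m p => // m IHm p; rewrite ltnS => pm pmon.
have p0 : p != 0 by apply: monic_neq0.
have [p1|p1] := leqP (size p) 1.
  exists [::] => //; rewrite big_nil; apply/eqP; rewrite -eqp_monic ?monic1 //.
  by rewrite -size_poly_eq1 eqn_leq p1 size_poly_gt0.
have [h hI hp] := exists_monic_irreducible_factor p1.
have pE : p = p %/ h * h by rewrite divpK.
have h1 : (1 < size h)%N by case: hI => [[]].
have dmon : p %/ h \is monic.
  by move: pmon; rewrite {1}pE monicMr; last by case: hI.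
have [|//|s sI sE] := IHm (p %/ h).
  have sp : size p = size (p %/ h * h)%R by rewrite -pE.
  apply: leq_trans pm; rewrite sp size_mul ?monic_neq0 //.
    by move: h1; case: (size h) => [|[|n]] // _; rewrite !addnS /= ltnS leq_addr.
  by case: hI.
exists (h :: s); last by rewrite big_cons -sE mulrC -pE.
by move=> g; rewrite inE => /predU1P[->|/sI].
Qed.

Lemma coprimep_monic_irreducible p h : monic_irreducible_poly p ->
  monic_irreducible_poly h -> p != h -> coprimep p h.
Proof.
move=> pI hI; rewrite irreducible_poly_coprime; last by case: pI.
by apply: contraNN => /monic_irreducible_dvdp -> //.
Qed.

Lemma dvdp_uniq_prod (s : seq {poly F}) p : uniq s ->
  (forall h, h \in s -> monic_irreducible_poly h) ->
  (forall h, h \in s -> h %| p) -> \prod_(h <- s) h %| p.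
Proof.
elim: s => [|h s IHs] /=; first by rewrite big_nil dvd1p.
case/andP=> hs us sI sp; rewrite big_cons Gauss_dvdp.
  rewrite sp ?mem_head // IHs // => g gs; [apply: sI|apply: sp]; exact: mem_behead.
rewrite big_seq; elim/big_ind: _ => [|x y cx cy|g gs]; first exact: coprimep1.
  by rewrite coprimepMr cx.
apply: coprimep_monic_irreducible; [exact/sI/mem_head|exact/sI/mem_behead|].
by apply: contraNneq hs => ->.
Qed.

Lemma card_pchar_nat (R : nzRingType) : (forall x, (x \in [pchar F]) = (x \in [pchar R])) ->
  forall j, [pchar R].-nat (q ^ j)%N.
Proof.
move=> FR j; have [p pp pc] := finPcharP F.
rewrite (card_pprimeChar pc) -expnM pnatX; apply/orP; left.
by rewrite (eq_pnat _ (fun x => esym (FR x))) pnatE.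
Qed.

(** The power map of exponent q^j is additive in this characteristic and fixes the coefficients. *)
Lemma poly_exp_card p j : p ^+ (q ^ j) = p \Po 'X^(q ^ j).
Proof.
have expc (c : F) : c ^+ (q ^ j) = c.
  by elim: j => [|j IH]; rewrite ?expr1 // expnSr exprM IH expf_card.
elim/poly_ind: p => [|p c IHp]; first by rewrite comp_poly0 expr0n expn_eq0 -leqn0 leqNgt (ltnW (card_fin_gt1 _)).
rewrite exprDn_pchar; last by apply: card_pchar_nat => x; rewrite pchar_poly.
by rewrite exprMn IHp -polyC_exp expc comp_polyD comp_polyM comp_polyX comp_polyC.
Qed.

End FinitePoly.

Section QuotientField.
Variables (F : finFieldType) (h : {poly F}).
Hypothesis hI : monic_irreducible_poly h.

(** What is used of F[t]/h from here on: its order, a root z of h, and the fact that the powers of z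
    below the degree form a basis over F. *)
Lemma poly_quotient_field : exists (K : finFieldType) (iota : {rmorphism F -> K}) (z : K),
  [/\ #|K| = (#|F| ^ (size h).-1)%N, root (map_poly iota h) z
    & bijective (fun v : 'rV[F]_(size h).-1 => \sum_j iota (v 0 j) * z ^+ j)].
Proof.
pose K : finFieldType := {poly %/ h with hI}.
pose iota : {rmorphism F -> K} := in_alg K.
have ioE (p : {poly F}) : (map_poly iota p).[in_qpoly h 'X : K] = in_qpoly h p.
  elim/poly_ind: p => [|p c IHp]; first by rewrite rmorph0 horner0 in_qpoly0.
  rewrite rmorphD rmorphM /= map_polyX map_polyC hornerMXaddC IHp in_qpolyD in_qpolyM.
  congr (_ + _); rewrite /= -alg_polyC in_qpolyZ in_qpoly1 //.
have Kc : #|K| = (#|F| ^ (size h).-1)%N by exact: card_qfpoly.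
exists K, iota, (in_qpoly h 'X); split=> //.
  rewrite /root ioE; apply/eqP/val_inj => /=; rewrite (mk_monicE hI) Pdiv.RingMonic.rmodpp //.
  by case: hI.
have sur (y : K) : \sum_j iota ((\row_(j < (size h).-1) (val y)`_j) 0 j) * (in_qpoly h 'X : K) ^+ j = y.
  rewrite (eq_bigr (fun j : 'I_(size h).-1 => iota (val y)`_j * (in_qpoly h 'X : K) ^+ j)); last by move=> j _; rewrite mxE.
  have sy : (size (val y) <= (size h).-1)%N.
    by apply: leq_trans (size_npoly y) _; rewrite (mk_monicE hI).
  transitivity (map_poly iota (val y)).[in_qpoly h 'X : K].
    rewrite (@horner_coef_wide _ (size h).-1) ?size_map_poly //.
    by apply: eq_bigr => j _; rewrite coef_map.
  rewrite ioE; apply: val_inj; apply: in_qpoly_small; exact: size_mk_monic.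
suff inj : injective (fun y : K => \row_(j < (size h).-1) (val y)`_j).
  have [g gK Kg] := inj_card_bij inj (eq_leq (etrans (card_mx _ 1 _) (etrans (congr1 _ (mul1n _)) (esym Kc)))).
  exists (fun y : K => \row_(j < (size h).-1) (val y)`_j) => [v|y]; last exact: sur.
  by rewrite -[v]Kg sur.
exact: (can_inj (g := fun v : 'rV[F]_(size h).-1 => \sum_j iota (v 0 j) * (in_qpoly h 'X : K) ^+ j)) sur.
Qed.

End QuotientField.

(** * The irreducible factors of X^(q^j) - X *)

Section FrobeniusPoly.
Variable F : finFieldType.
Implicit Types p h : {poly F}.
Local Notation q := #|F|.

Lemma size_XnsubX N : (1 < N)%N -> size ('X^N - 'X : {poly F}) = N.+1.
Proof.
by move=> N1; rewrite size_polyDl ?size_polyXn // size_polyN size_polyX.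
Qed.

Lemma monic_XnsubX N : (1 < N)%N -> ('X^N - 'X : {poly F}) \is monic.
Proof.
move=> N1; rewrite monicE lead_coefDl ?lead_coefXn // size_polyN size_polyX.
by rewrite size_polyXn.
Qed.

(** For the root z of h in K = F[t]/h, divisibility means z^(q^j) = z. As z generates K, the power
    map then fixes all of K. With j replaced by its remainder r modulo e = deg h, a nonzero r would
    give q^e roots to a polynomial of degree q^r < q^e. *)
Lemma irreducible_dvd_XqnX h j : monic_irreducible_poly h ->
  (h %| 'X^(q ^ j) - 'X) = ((size h).-1 %| j)%N.
Proof.
move=> hI; have [K [iota [z [Kc hz bij]]]] := poly_quotient_field hI.
set e := (size h).-1 in Kc bij *.
have e0 : (0 < e)%N by rewrite /e; case: hI => [[]]; case: (size h) => [|[]].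
have dvdE p : (h %| p) = root (map_poly iota p) z.
  apply/idP/idP => [/dvdpP[g ->]|rp]; first by rewrite rmorphM rootM hz orbT.
  apply: contraTT rp; rewrite -irreducible_poly_coprime; last by case: hI.
  rewrite -(coprimep_map iota) => /coprimep_root /(_ hz); exact.
have horE p N : z ^+ (q ^ N) = z -> (map_poly iota p).[z] ^+ (q ^ N) = (map_poly iota p).[z].
  move=> zN; rewrite -[in RHS]zN -[LHS]horner_exp -rmorphXn /= poly_exp_card.
  by rewrite map_comp_poly map_polyXn horner_comp hornerXn.
have rootE N : root (map_poly iota ('X^N - 'X)) z = (z ^+ N == z).
  by rewrite rmorphB /= map_polyXn map_polyX rootE hornerD hornerN hornerXn hornerX subr_eq0.
rewrite dvdE rootE; apply/eqP/dvdnP => [zj|[c ->]]; last first.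
  by rewrite mulnC expnM -Kc; elim: c => [|c IH]; rewrite ?expr1 // expnSr exprM IH expf_card.
have ze : z ^+ (q ^ e) = z by rewrite -Kc expf_card.
have zmod : z ^+ (q ^ (j %% e)) = z.
  have zc : z ^+ (q ^ (j %/ e * e)) = z.
    by rewrite mulnC expnM; elim: (j %/ e)%N => [|c IH]; rewrite ?expr1 // expnSr exprM IH.
  by rewrite -[RHS]zj {2}(divn_eq j e) expnD exprM zc.
have [j0|j0] := posnP (j %% e); first by exists (j %/ e)%N; rewrite {1}(divn_eq j e) j0 addn0.
pose P : {poly K} := 'X^(q ^ (j %% e)) - 'X.
have rP y : y \in enum K -> root P y.
  move=> _; have [g gK Kg] := bij; rewrite -[y]Kg.
  set v := g y; rewrite /root hornerD hornerN hornerXn hornerX subr_eq0.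
  have -> : \sum_j iota (v 0 j) * z ^+ j = (map_poly iota (rVpoly v)).[z].
    rewrite (@horner_coef_wide _ e) ?size_map_poly ?size_poly //.
    by apply: eq_bigr => i _; rewrite coef_map coef_rVpoly_ord.
  by rewrite horE.
have qj1 : (1 < q ^ (j %% e))%N by rewrite -(exp1n (j %% e)) ltn_exp2r // card_fin_gt1.
have P0 : P != 0.
  rewrite /P -size_poly_eq0 size_polyDl ?size_polyXn ?size_polyN ?size_polyX //.
have /(max_poly_roots P0) : all (root P) (enum K) by apply/allP.
rewrite enum_uniq -cardE Kc size_polyDl ?size_polyXn ?size_polyN ?size_polyX //.
by move/(_ isT); rewrite ltnS leq_exp2l ?card_fin_gt1 // leqNgt ltn_mod e0.
Qed.

(** The derivative of X^N - X is -1, so a repeated factor would divide a unit. *)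
Lemma XnsubX_squarefree N h : N%:R = 0 :> F -> (1 < size h)%N ->
  ~~ (h * h %| 'X^N - 'X).
Proof.
move=> N0 h1; apply/negP => /dvdpP[g gE].
have : h %| ('X^N - 'X)^`().
  rewrite gE !derivM; apply: dvdp_add; first by rewrite dvdp_mull // dvdp_mulr.
  by apply: dvdp_mull; apply: dvdp_add; [apply: dvdp_mull|apply: dvdp_mulr].
rewrite derivB derivXn derivX -scaler_nat N0 scale0r sub0r dvdpNr dvdp1.
by rewrite gtn_eqF.
Qed.

Lemma factors_XnsubX_uniq (s : seq {poly F}) N : N%:R = 0 :> F ->
  (forall h, h \in s -> monic_irreducible_poly h) ->
  \prod_(h <- s) h %| 'X^N - 'X -> uniq s.
Proof.
move=> N0; elim: s => //= h s IHs sI; rewrite big_cons => sd; apply/andP; split.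
  apply/negP => hs; have [[h1 _] _] := sI h (mem_head _ _).
  have /negP := XnsubX_squarefree N0 h1; apply; apply: dvdp_trans sd.
  by rewrite dvdp_mul2l -?size_poly_gt0 ?(ltnW h1) // (big_rem h) //= dvdp_mulr.
apply: IHs => [g gs|]; first by apply: sI; rewrite mem_behead.
by apply: dvdp_trans sd; rewrite dvdp_mull.
Qed.

Lemma card_eq0_in (L : finFieldType) (j : nat) : (0 < j)%N -> (#|L| ^ j)%:R = 0 :> L.
Proof.
case: j => // j _; have [p pp pc] := finPcharP L.
have p_dvd : (p %| #|L|)%N.
  have := card_fin_gt1 L; rewrite (card_pprimeChar pc); case: (logn _ _) => // n _.
  by rewrite expnS dvdn_mulr.
by apply/eqP; rewrite -(dvdn_pcharf pc) expnS dvdn_mulr.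
Qed.

(** The irreducible factors of X^(q^e) - X are distinct and have degrees dividing e. If none had
    degree e, each would divide some X^(q^r) - X with 1 <= r < e, so X^(q^e) - X would divide the
    product of these, whose degree q + ... + q^(e-1) is below q^e. *)
Lemma exists_monic_irreducible_of_degree e : (0 < e)%N ->
  exists2 h : {poly F}, monic_irreducible_poly h & size h = e.+1.
Proof.
move=> e0; have q1 := card_fin_gt1 F.
have qX j : (0 < j)%N -> (1 < q ^ j)%N by move=> j0; rewrite -(exp1n j) ltn_exp2r.
have [s sI sE] := monic_irreducible_factorization (monic_XnsubX (qX e e0)).
have us : uniq s by apply: factors_XnsubX_uniq (card_eq0_in F e0) sI _; rewrite -sE.
have [/hasP[h hs /eqP he]|/hasPn sn] := boolP (has (fun h => size h == e.+1) s).
  by exists h => //; apply: sI.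
pose R := \prod_(1 <= r < e) ('X^(q ^ r) - 'X : {poly F}).
have Rmon : R \is monic.
  by rewrite /R big_nat; apply: monic_prod => i /andP[i0 _]; rewrite monic_XnsubX ?qX.
have sR : (size R <= q ^ e)%N.
  rewrite /R; elim: (e) e0 => // -[|e'] IHe _.
    by rewrite big_geq // size_poly1 expn1 ltnW.
  rewrite big_nat_recr //= size_monicM ?size_XnsubX ?qX //; last first.
  - by rewrite monic_neq0 // monic_XnsubX ?qX.
  - by rewrite big_nat; apply: monic_prod => i /andP[i0 _]; rewrite monic_XnsubX ?qX.
  rewrite addnS /= (leq_trans (leq_add (IHe isT) (leqnn _))) // addnn -mul2n [leqRHS]expnS.
  by rewrite leq_mul2r q1 orbT.
have /dvdp_leq : 'X^(q ^ e) - 'X %| R.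
  rewrite sE; apply: (dvdp_uniq_prod us sI) => h hs; have hI := sI h hs.
  have hd : ((size h).-1 %| e)%N.
    by rewrite -irreducible_dvd_XqnX // sE (big_rem h) //= dvdp_mulr.
  have h1 : (0 < (size h).-1)%N by case: hI => [[]]; case: (size h) => [|[]].
  have hlt : ((size h).-1 < e)%N.
    rewrite ltn_neqAle (dvdn_leq e0 hd) andbT; apply: contra (sn h hs) => /eqP <-.
    by rewrite prednK //; case: (size h) h1.
  have hm : h %| 'X^(q ^ (size h).-1) - 'X by rewrite irreducible_dvd_XqnX.
  apply: dvdp_trans hm _; rewrite /R (big_rem (size h).-1) ?dvdp_mulr //.
  by rewrite mem_index_iota h1.
move/(_ (monic_neq0 Rmon)); rewrite size_XnsubX ?qX // => /leq_trans /(_ sR).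
by rewrite ltnn.
Qed.

End FrobeniusPoly.

(** * Irreducible polynomials over a finite extension of the base field *)

Section ExtendField.
Variables (k L : finFieldType) (iota : {rmorphism k -> L}) (f : {poly k}) (d : nat).
Hypotheses (fI : monic_irreducible_poly f) (cL : #|L| = (#|k| ^ d)%N).
Local Notation e := (size f).-1.
Local Notation fL := (map_poly iota f).

Let e0 : (0 < e)%N. Proof. by case: fI => [[]]; case: (size f) => [|[]]. Qed.
Let sf : size f = e.+1. Proof. by rewrite prednK // (leq_trans e0) ?leq_pred. Qed.
Let d0 : (0 < d)%N.
Proof. by case: (posnP d) cL (card_fin_gt1 L) => // -> ->. Qed.
Let qX j : (0 < j)%N -> (1 < #|k| ^ j)%N.
Proof. by move=> j0; rewrite -(exp1n j) ltn_exp2r // card_fin_gt1. Qed.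

Lemma map_XnsubX N : map_poly iota ('X^N - 'X) = 'X^N - 'X.
Proof. by rewrite rmorphB /= map_polyXn map_polyX. Qed.

(** All elements of L are roots of X^|L| - X. If e divides d, then f divides this polynomial, and
    the cofactor has too few roots for f to have fewer than e. Otherwise f is coprime to it. *)
Lemma card_roots_irreducible :
  #|[set a : L | root fL a]| = if (e %| d)%N then e else 0%N.
Proof.
have cop : (e %| d)%N = ~~ coprimep f ('X^(#|k| ^ d) - 'X).
  rewrite irreducible_poly_coprime; last by case: fI.
  by rewrite negbK irreducible_dvd_XqnX.
case: ifPn => ed; last first.
  apply/eqP; rewrite cards_eq0 -subset0; apply/subsetP => a; rewrite !inE => ra.
  have := ed; rewrite cop negbK -(coprimep_map iota) map_XnsubX => /coprimep_root.
  by move=> /(_ a ra); rewrite -cL hornerD hornerN hornerXn hornerX expf_card subrr eqxx.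
have /dvdpP[g gE] : f %| 'X^(#|k| ^ d) - 'X by rewrite irreducible_dvd_XqnX.
have f0 : f != 0 by apply: monic_neq0; case: fI.
have P0 : 'X^(#|k| ^ d) - 'X != 0 :> {poly k} by rewrite monic_neq0 ?monic_XnsubX ?qX.
have g0 : g != 0 by apply: contraNneq P0 => g0; rewrite gE g0 mul0r.
have sg : (size g + e)%N = #|L|.+1.
  have : size (g * f)%R = #|L|.+1 by rewrite -gE size_XnsubX ?qX ?cL.
  by rewrite size_mul // sf addnS.
have nroots (p : {poly k}) : p != 0 -> (#|[set a : L | root (map_poly iota p) a]| < size p)%N.
  move=> p0; rewrite -(size_map_poly iota) cardE.
  apply: max_poly_roots; rewrite ?map_poly_eq0 ?enum_uniq //.
  by apply/allP => a; rewrite mem_enum inE.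
apply/eqP; rewrite eqn_leq -ltnS -{1}sf nroots //=.
have : (#|L| <= #|[set a : L | root (map_poly iota g) a]| + #|[set a : L | root fL a]|)%N.
  rewrite -cardsT -cardsUI; apply: leq_trans (leq_addr _ _); apply: subset_leq_card.
  apply/subsetP => a _; rewrite !inE -rootM -rmorphM -gE /= map_XnsubX -cL.
  by rewrite /root hornerD hornerN hornerXn hornerX expf_card subrr.
move=> H; rewrite -(leq_add2l (size g)) sg.
by apply: leq_trans (leq_add (nroots g g0) (leqnn _)); rewrite addSn ltnS.
Qed.

(** A factor h of degree s divides X^(q^(dj)) - X iff s divides j. As h divides f, this holds for j
    = e / gcd(d, e). Conversely f is not coprime to X^(q^(ds)) - X, so e divides ds. The factors are
    distinct because f divides the squarefree polynomial X^(q^e) - X. *)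
Lemma irreducible_factors_extension : exists s : seq {poly L},
  [/\ uniq s, forall h, h \in s -> monic_irreducible_poly h,
      forall h, h \in s -> (size h).-1 = (e %/ gcdn d e)%N,
      fL = \prod_(h <- s) h & size s = gcdn d e].
Proof.
have fm : fL \is monic by rewrite map_monic; case: fI.
have [s sI sE] := monic_irreducible_factorization fm.
have fdvd j : (e %| j)%N -> fL %| 'X^(#|k| ^ j) - 'X.
  by rewrite -map_XnsubX dvdp_map irreducible_dvd_XqnX.
have us : uniq s.
  apply: (@factors_XnsubX_uniq _ _ (#|k| ^ e)) => //; last by rewrite -sE fdvd.
  by rewrite -(rmorph_nat iota) (card_eq0_in k e0) rmorph0.
have g0 : (0 < gcdn d e)%N by rewrite gcdn_gt0 d0.
have deg h : h \in s -> (size h).-1 = (e %/ gcdn d e)%N.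
  move=> hs; have hI := sI h hs; have hf : h %| fL by rewrite sE (big_rem h) //= dvdp_mulr.
  apply/eqP; rewrite eqn_dvd -irreducible_dvd_XqnX // cL -expnM; apply/andP; split.
    by apply: dvdp_trans hf (fdvd _ _); rewrite muln_divA ?dvdn_gcdr // mulnC -muln_divA ?dvdn_gcdl // dvdn_mulr.
  rewrite dvdn_divLR ?dvdn_gcdr //.
  have : (e %| d * (size h).-1)%N.
    apply: contraT; rewrite -(irreducible_dvd_XqnX _ fI) -irreducible_poly_coprime; last by case: fI.
    rewrite -(coprimep_map iota) map_XnsubX expnM -cL => co.
    have [[h1 _] _] := hI; move: co; rewrite coprimep_sym => /(coprimep_dvdl hf); rewrite coprimep_sym.
    by rewrite irreducible_poly_coprime ?irreducible_dvd_XqnX ?dvdnn //; case: hI.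
  move=> ed; rewrite muln_gcdr; apply: dvdn_trans (_ : e %| gcdn (d * (size h).-1) (e * (size h).-1))%N _.
    by rewrite dvdn_gcd ed dvdn_mulr.
  by rewrite mulnC (mulnC e).
exists s; split=> //.
have size_prod_monic (t : seq {poly L}) : all (fun h => h \is monic) t ->
    (size (\prod_(h <- t) h)%R).-1 = (\sum_(h <- t) (size h).-1)%N.
  elim: t => [|h t IH] /=; first by rewrite !big_nil size_poly1.
  case/andP=> hm tm; rewrite !big_cons -IH //.
  have tp : \prod_(h <- t) h \is monic.
    by rewrite big_seq; apply: monic_prod => g /(allP tm).
  rewrite size_monicM ?monic_neq0 //; move: (monic_neq0 hm) (monic_neq0 tp).
  by rewrite -!size_poly_gt0; case: (size h) => // n; case: (size _) => // n' _ _; rewrite addnS.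
have := size_prod_monic s; rewrite -sE size_map_poly => /(_ _) H.
have {}H : e = (\sum_(h <- s) (e %/ gcdn d e))%N.
  rewrite [LHS]H; last by apply/allP => h /sI [].
  by rewrite big_seq [RHS]big_seq; apply: eq_bigr => h /deg.
move: H; rewrite big_const_seq count_predT iter_addn_0 => /eqP.
rewrite -{1}(divnK (dvdn_gcdr d e)) eqn_mul2l => /orP[|/eqP //].
by rewrite eqn0Ngt divn_gt0 // dvdn_leq ?dvdn_gcdr.
Qed.

End ExtendField.

Lemma dependent_choice (I : Type) (T : I -> Type) (P : forall i, T i -> Prop) :
  (forall i, exists y, P i y) -> exists f : forall i, T i, forall i, P i (f i).
Proof.
move=> H; pose d i := constructive_indefinite_description _ (H i).
by exists (fun i => sval (d i)) => i; case: (d i).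
Qed.

(** * Semistable representations *)

(** Families of matrices are dependent functions on a finite type; over a finite field they form a
    finite type themselves, so representations and endomorphisms can be counted. *)
Notation vfam F a b := {dffun forall i, 'M[F]_(a i, b i)}.
Notation mrep F Q a :=
  {dffun forall c : arrow Q, 'M[F]_(a (source c), a (target c))}.

Definition dimD n (a b : 'I_n -> nat) i := (a i + b i)%N.
Definition dimB n (a b : 'I_n -> nat) i := (a i - b i)%N.
Definition ht n (a : 'I_n -> nat) := (\sum_i a i)%N.
Definition dim0 n (i : 'I_n) := 0%N.

Lemma dimDB n (a b : 'I_n -> nat) : (forall i, b i <= a i)%N -> dimD b (dimB a b) = a.
Proof. by move=> ba; apply: functional_extensionality => i; rewrite /dimD subnKC. Qed.

Lemma htD n (a b : 'I_n -> nat) : ht (dimD a b) = (ht a + ht b)%N.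
Proof. by rewrite /ht big_split. Qed.

Lemma leq_ht n (a : 'I_n -> nat) i : (a i <= ht a)%N.
Proof. by rewrite /ht (bigD1 i) //= leq_addr. Qed.

Lemma ht_eq0 n (a : 'I_n -> nat) : ht a = 0%N -> a = @dim0 n.
Proof.
move=> a0; apply: functional_extensionality => i; apply/eqP.
by rewrite -leqn0 -a0 leq_ht.
Qed.

Definition lam n (l : 'I_n -> rat) (b : 'I_n -> nat) : rat := \sum_i l i * (b i)%:R.

Lemma lamD n (l : 'I_n -> rat) a b : lam l (dimD a b) = lam l a + lam l b.
Proof. by rewrite -big_split; apply: eq_bigr => i _; rewrite natrD mulrDr. Qed.

Lemma lam0 n (l : 'I_n -> rat) : lam l (@dim0 n) = 0.
Proof. by apply: big1 => i _; rewrite mulr0. Qed.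

Section Subrepresentations.
Variables (n : nat) (Q : quiver n) (F : fieldType).
Implicit Types (a b : 'I_n -> nat).

Definition stab a (x : mrep F Q a) m (U : forall i, 'M[F]_(m i, a i)) : bool :=
  [forall c, (U (source c) *m x c <= U (target c))%MS].

Definition rk a m (U : forall i : 'I_n, 'M[F]_(m i, a i)) (i : 'I_n) : nat := \rank (U i).

Definition subf a m m' (U : forall i : 'I_n, 'M[F]_(m i, a i))
  (V : forall i : 'I_n, 'M[F]_(m' i, a i)) : bool := [forall i, (U i <= V i)%MS].

Definition sumf a m m' (U : forall i : 'I_n, 'M[F]_(m i, a i))
  (V : forall i : 'I_n, 'M[F]_(m' i, a i)) : vfam F a a := finfun (fun i => (U i + V i)%MS).
Definition capf a m m' (U : forall i : 'I_n, 'M[F]_(m i, a i))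
  (V : forall i : 'I_n, 'M[F]_(m' i, a i)) : vfam F a a := finfun (fun i => (U i :&: V i)%MS).
(** Replaces generators in any number by a square matrix, so that a quantifier over subspaces ranges
    over a finite type. *)
Definition genf a m (U : forall i : 'I_n, 'M[F]_(m i, a i)) : vfam F a a :=
  finfun (fun i => <<U i>>%MS).

Lemma subf_rk a m m' (U : forall i, 'M[F]_(m i, a i)) (V : forall i, 'M[F]_(m' i, a i)) :
  subf U V -> subf V U -> rk U = rk V.
Proof.
move=> /forallP UV /forallP VU; apply: functional_extensionality => i.
by apply/eqmx_rank/andP; split.
Qed.

Lemma subf_trans a m m' m'' (U : forall i, 'M[F]_(m i, a i))
  (V : forall i, 'M[F]_(m' i, a i)) (W : forall i, 'M[F]_(m'' i, a i)) :
  subf U V -> subf V W -> subf U W.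
Proof. by move=> /forallP UV /forallP VW; apply/forallP=> i; apply: submx_trans (VW i). Qed.

Lemma subf_gen a m (U : forall i, 'M[F]_(m i, a i)) : subf U (genf U) /\ subf (genf U) U.
Proof. by split; apply/forallP=> i; rewrite ffunE genmxE. Qed.

Lemma stab_eq a (x : mrep F Q a) m m' (U : forall i, 'M[F]_(m i, a i))
  (V : forall i, 'M[F]_(m' i, a i)) : subf U V -> subf V U -> stab x U -> stab x V.
Proof.
move=> /forallP UV /forallP VU /forallP xU; apply/forallP => c.
by apply: submx_trans (submx_trans (xU c) (UV _)); apply: submxMr.
Qed.

Lemma stab_sum a (x : mrep F Q a) m m' (U : forall i, 'M[F]_(m i, a i))
  (V : forall i, 'M[F]_(m' i, a i)) : stab x U -> stab x V -> stab x (sumf U V).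
Proof.
move=> /forallP xU /forallP xV; apply/forallP => c; rewrite !ffunE addsmxMr.
exact: addsmxS.
Qed.

Lemma stab_cap a (x : mrep F Q a) m m' (U : forall i, 'M[F]_(m i, a i))
  (V : forall i, 'M[F]_(m' i, a i)) : stab x U -> stab x V -> stab x (capf U V).
Proof.
move=> /forallP xU /forallP xV; apply/forallP => c; rewrite !ffunE sub_capmx.
apply/andP; split; first exact: submx_trans (submxMr _ (capmxSl _ _)) (xU c).
exact: submx_trans (submxMr _ (capmxSr _ _)) (xV c).
Qed.

Lemma lam_sum_cap l a m m' (U : forall i, 'M[F]_(m i, a i))
  (V : forall i, 'M[F]_(m' i, a i)) :
  lam l (rk (sumf U V)) + lam l (rk (capf U V)) = lam l (rk U) + lam l (rk V).
Proof.
rewrite -!lamD; congr lam; apply: functional_extensionality => i.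
by rewrite /dimD /rk !ffunE mxrank_sum_cap.
Qed.

Definition conj a (g : vfam F a a) (x : mrep F Q a) : mrep F Q a :=
  finfun (fun c => g (source c) *m x c *m invmx (g (target c))).

Definition unitf a (g : vfam F a a) : bool := [forall i, g i \in unitmx].

Lemma conj_inj a (g : vfam F a a) : unitf g -> injective (conj g).
Proof.
move=> /forallP gu x y /ffunP xy; apply/ffunP => c; have := xy c; rewrite !ffunE.
move/(can_inj (mulmxKV (gu _))); exact: (can_inj (mulKmx (gu _))).
Qed.

Lemma stab_conj a (g : vfam F a a) (x : mrep F Q a) m (U : forall i, 'M[F]_(m i, a i)) :
  unitf g -> stab (conj g x) U = stab x (fun i => U i *m g i).
Proof.
move=> /forallP gu; apply: eq_forallb => c; rewrite ffunE.
rewrite -[X in (_ <= X)%MS](mulmxK (gu (target c))) !mulmxA submxMfree //.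
by rewrite row_free_unit unitmx_inv.
Qed.

Lemma rk_conj a (g : vfam F a a) m (U : forall i, 'M[F]_(m i, a i)) :
  unitf g -> rk (fun i => U i *m g i) = rk U.
Proof.
move=> /forallP gu; apply: functional_extensionality => i.
by rewrite /rk mxrankMfree ?row_free_unit.
Qed.

Lemma subf_mulr a (g : vfam F a a) m m' (U : forall i, 'M[F]_(m i, a i))
  (V : forall i, 'M[F]_(m' i, a i)) :
  unitf g -> subf (fun i => U i *m g i) (fun i => V i *m g i) = subf U V.
Proof.
by move=> /forallP gu; apply: eq_forallb => i; rewrite submxMfree ?row_free_unit.
Qed.

End Subrepresentations.

(** * The torsion pair of a weight *)

Section TorsionPair.
Variables (n : nat) (Q : quiver n) (F : finFieldType) (l : 'I_n -> rat).
Implicit Types (a b : 'I_n -> nat).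

(* The weight l is lam = theta - mu.ht on the unit vectors; fss is the torsion-free
   class, and for lam a = 0 it is semistability of slope mu (King).  tss is the
   torsion class: every proper quotient has positive weight. *)
Definition fss a (x : mrep F Q a) : bool :=
  [forall U : vfam F a a, stab x U ==> (lam l (rk U) <= 0)].

Definition tss a (x : mrep F Q a) : bool :=
  [forall U : vfam F a a, stab x U ==>
     ([forall i, row_full (U i)] || (lam l (rk U) < lam l a))].

Lemma fssP a (x : mrep F Q a) : reflect
  (forall m (U : forall i, 'M[F]_(m i, a i)), stab x U -> lam l (rk U) <= 0) (fss x).
Proof.
apply: (iffP forallP) => [xF m U xU|xF U]; last by apply/implyP; apply: xF.
have [UG GU] := subf_gen U; rewrite (subf_rk UG GU).
by have /implyP := xF (genf U); apply; apply: stab_eq xU.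
Qed.

Lemma tssP a (x : mrep F Q a) : reflect
  (forall m (U : forall i, 'M[F]_(m i, a i)), stab x U ->
    (forall i, row_full (U i)) \/ lam l (rk U) < lam l a) (tss x).
Proof.
apply: (iffP forallP) => [xF m U xU|xF U].
  have [UG GU] := subf_gen U; rewrite (subf_rk UG GU).
  have /implyP/(_ (stab_eq UG GU xU))/orP[/forallP fU|] := xF (genf U); last by right.
  by left=> i; have := fU i; rewrite /row_full ffunE genmxE.
apply/implyP => /xF [fU|->]; rewrite ?orbT //.
by apply/orP; left; apply/forallP.
Qed.

(* U is in the torsion class and the quotient by U in the torsion-free class *)
Definition torsion_sub a (x : mrep F Q a) (U : vfam F a a) : bool :=
  [&& stab x U,
      [forall V : vfam F a a, stab x V ==> subf V U ==>
         (subf U V || (lam l (rk V) < lam l (rk U)))]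
    & [forall V : vfam F a a, stab x V ==> subf U V ==> (lam l (rk V) <= lam l (rk U))]].

Lemma torsion_subP a (x : mrep F Q a) (U : vfam F a a) : reflect
  [/\ stab x U,
      forall m (V : forall i, 'M[F]_(m i, a i)), stab x V -> subf V U ->
         subf U V \/ lam l (rk V) < lam l (rk U)
    & forall m (V : forall i, 'M[F]_(m i, a i)), stab x V -> subf U V ->
         lam l (rk V) <= lam l (rk U)] (torsion_sub x U).
Proof.
apply: (iffP and3P) => -[xU T1 T2]; split=> //.
- move=> m V xV VU; have [VG GV] := subf_gen V; rewrite (subf_rk VG GV).
  have /implyP/(_ (stab_eq VG GV xV))/implyP/(_ (subf_trans GV VU)) := forallP T1 (genf V).
  by case/orP=> [UV|]; [left; apply: subf_trans UV GV|right].
- move=> m V xV UV; have [VG GV] := subf_gen V; rewrite (subf_rk VG GV).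
  by have /implyP/(_ (stab_eq VG GV xV))/implyP/(_ (subf_trans UV VG)) := forallP T2 (genf V).
- apply/forallP => V; apply/implyP => xV; apply/implyP => VU; apply/orP.
  by case: (T1 _ V xV VU); [left|right].
- by apply/forallP => V; apply/implyP => xV; apply/implyP => UV; apply: T2.
Qed.

(** If U is not contained in V, then the intersection of U and V has smaller weight than U. Since
    weights of sum and intersection add up to those of U and V, the sum has larger weight than V,
    against the last clause for V. *)
Lemma torsion_sub_unique a (x : mrep F Q a) U V :
  torsion_sub x U -> torsion_sub x V -> subf U V.
Proof.
case/torsion_subP=> xU T1 _ /torsion_subP[xV _ T2].
have capU : subf (capf U V) U by apply/forallP=> i; rewrite ffunE capmxSl.
have sumV : subf V (sumf U V) by apply/forallP=> i; rewrite ffunE addsmxSr.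
have [UI|lt] := T1 _ _ (stab_cap xU xV) capU.
  by apply: subf_trans UI _; apply/forallP=> i; rewrite ffunE capmxSr.
have := T2 _ _ (stab_sum xU xV) sumV; have := lam_sum_cap l U V; lra.
Qed.

(** Among the subrepresentations of largest weight take one of least height: a proper part of it has
    smaller weight, and nothing above it has larger weight. *)
Lemma exists_torsion_sub a (x : mrep F Q a) : exists U, torsion_sub x U.
Proof.
pose U0 : vfam F a a := finfun (fun i => 0).
have xU0 : stab x U0 by apply/forallP => c; rewrite !ffunE mul0mx sub0mx.
case: (@arg_maxP _ _ _ _ (fun U : vfam F a a => stab x U) (fun U => lam l (rk U)) xU0) => U1 xU1 max1.
have {}max1 (V : vfam F a a) : stab x V -> lam l (rk V) <= lam l (rk U1) := max1 V.
pose P (U : vfam F a a) := stab x U && (lam l (rk U) == lam l (rk U1)).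
have PU1 : P U1 by rewrite /P xU1 eqxx.
case: (arg_minnP (fun U : vfam F a a => ht (rk U)) PU1) => U /andP[xU /eqP lU] minU.
exists U; apply/and3P; split=> //; apply/forallP => V; apply/implyP => xV; apply/implyP => UV.
  have := max1 V xV; rewrite -lU le_eqVlt => /orP[/eqP lV|->]; rewrite ?orbT //.
  have := minU V; rewrite /P xV lV lU eqxx => /(_ isT) htV.
  apply/orP; left; apply/forallP => i; have /forallP VU := UV.
  have rV j : (\rank (V j) <= \rank (U j))%N by apply: mxrankS.
  have [_ /esym VUi] := mxrank_leqif_sup (VU i).
  rewrite VUi eqn_leq rV /= leqNgt; apply/negP => lt.
  move: htV; apply/negP; rewrite -ltnNge /ht /rk (bigD1 i) //= [ltnRHS](bigD1 i) //=.
  by rewrite -addSn leq_add // leq_sum // => j _.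
by rewrite lU; apply: max1.
Qed.

End TorsionPair.

(** The corner block of an extension with a subrepresentation of dimension b and a quotient of
    dimension c. *)
Notation crep F Q c b :=
  {dffun forall a : arrow Q, 'M[F]_(c (source a), b (target a))}.

(** * Extensions as block triangular representations *)

Section Extensions.
Variables (n : nat) (Q : quiver n) (F : fieldType).
Implicit Types (b c : 'I_n -> nat).

Definition stdf b c i : 'M[F]_(b i, dimD b c i) := row_mx 1%:M 0.
Arguments stdf : clear implicits.

Definition bmx b c (x : mrep F Q b) (y : mrep F Q c) (z : crep F Q c b) : mrep F Q (dimD b c) :=
  finfun (fun a => block_mx (x a) 0 (z a) (y a) : 'M_(dimD b c _, dimD b c _)).

Lemma bmx_inj b c x y z x' y' z' :
  @bmx b c x y z = bmx x' y' z' -> [/\ x = x', y = y' & z = z'].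
Proof.
move=> /ffunP E; split; apply/ffunP => a; have := E a; rewrite !ffunE;
  by case/eq_block_mx.
Qed.

Lemma rk_stdf b c : rk (stdf b c) = b.
Proof. by apply: functional_extensionality => i; rewrite /rk /stdf rank_row_mx0 mxrank1. Qed.

Lemma stab_stdfP b c (w : mrep F Q (dimD b c)) :
  reflect (exists x y z, w = bmx x y z) (stab w (stdf b c)).
Proof.
apply: (iffP forallP) => [ws|[x [y [z ->]]] a]; last first.
  by rewrite ffunE stab_rowP block_mxKur.
exists (finfun (fun a => ulsubmx (w a : 'M_(b _ + c _, b _ + c _)))).
exists (finfun (fun a => drsubmx (w a : 'M_(b _ + c _, b _ + c _)))).
exists (finfun (fun a => dlsubmx (w a : 'M_(b _ + c _, b _ + c _)))).
apply/ffunP => a; rewrite !ffunE -[LHS](@submxK F (b _) (c _) (b _) (c _)).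
by have := ws a; rewrite stab_rowP => /eqP ->.
Qed.

Section Blocks.
Variables (b c : 'I_n -> nat) (x : mrep F Q b) (y : mrep F Q c) (z : crep F Q c b).
Local Notation w := (bmx x y z).

Definition inclf m (V : forall i, 'M[F]_(m i, b i)) i : 'M[F]_(m i, dimD b c i) :=
  row_mx (V i) 0.
Definition preimf m (V : forall i, 'M[F]_(m i, c i)) i : 'M[F]_(dimD b m i, dimD b c i) :=
  block_mx 1%:M 0 0 (V i).
Definition restf m (V : forall i, 'M[F]_(m i, dimD b c i)) i : 'M[F]_(m i, b i) :=
  lsubmx (V i : 'M_(m i, b i + c i)).
Definition quotf m (V : forall i, 'M[F]_(m i, dimD b c i)) i : 'M[F]_(m i, c i) :=
  rsubmx (V i : 'M_(m i, b i + c i)).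

Lemma rk_inclf m (V : forall i, 'M[F]_(m i, b i)) : rk (inclf V) = rk V.
Proof. by apply: functional_extensionality => i; rewrite /rk /inclf rank_row_mx0. Qed.

Lemma rk_preimf m (V : forall i, 'M[F]_(m i, c i)) : rk (preimf V) = dimD b (rk V).
Proof.
by apply: functional_extensionality => i; rewrite /rk /dimD rank_diag_block_mx mxrank1.
Qed.

Lemma stab_inclf m (V : forall i, 'M[F]_(m i, b i)) : stab w (inclf V) = stab x V.
Proof.
apply: eq_forallb => a; rewrite ffunE mul_row_block !mul0mx !mulmx0 !addr0.
apply/idP/idP => /submxP[D E]; last first.
  by apply/submxP; exists D; rewrite mul_mx_row mulmx0 E.
by move: E; rewrite mul_mx_row mulmx0 => /eq_row_mx[-> _]; exact: submxMl.
Qed.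

Lemma stab_preimf m (V : forall i, 'M[F]_(m i, c i)) : stab y V -> stab w (preimf V).
Proof.
move=> /forallP yV; apply/forallP => a; rewrite ffunE mulmx_block.
rewrite !mul1mx !mul0mx ?mulmx0 !addr0 !add0r.
have /submxP[D ->] := yV a; apply/submxP.
exists (block_mx (x a) 0 (V (source a) *m z a) D).
by rewrite mulmx_block !mulmx1 !mul0mx !mulmx0 !addr0 !add0r.
Qed.

Lemma stab_quotf m (V : forall i, 'M[F]_(m i, dimD b c i)) : stab w V -> stab y (quotf V).
Proof.
move=> /forallP wV; apply/forallP => a; have /submxP[D] := wV a; rewrite ffunE.
rewrite -[V (source a)](@hsubmxK F _ (b _) (c _)) mul_row_block !mulmx0 !add0r.
rewrite -[V (target a)](@hsubmxK F _ (b _) (c _)) mul_mx_row => /eq_row_mx[_ E].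
by rewrite /quotf E submxMl.
Qed.

Lemma sub_stdfP m (V : forall i, 'M[F]_(m i, dimD b c i)) :
  subf V (stdf b c) -> V = inclf (restf V).
Proof.
move=> /forallP Vs; apply: functional_extensionality_dep => i.
have /submxP[D] := Vs i; rewrite /inclf /restf /stdf mul_mx_row mulmx0 mulmx1 => ->.
by rewrite row_mxKl.
Qed.

Lemma sup_stdfP m (V : forall i, 'M[F]_(m i, dimD b c i)) :
  subf (stdf b c) V -> subf V (preimf (quotf V)) /\ subf (preimf (quotf V)) V.
Proof.
move=> /forallP sV; split; apply/forallP => i; have /submxP[D] := sV i; rewrite /stdf => DE;
  rewrite /preimf /quotf; set A : 'M_(m i, b i + c i) := V i.
  rewrite -/A -{1}[A]hsubmxK; apply/submxP; exists (row_mx (lsubmx A) 1%:M).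
  by rewrite mul_row_block mulmx1 !mul1mx ?mulmx0 addr0 add0r.
apply/submxP; exists (col_mx D (1%:M - lsubmx A *m D)).
rewrite mul_col_mx mulmxBl mul1mx -mulmxA -DE -{2}[A]hsubmxK mul_mx_row mulmx0 mulmx1.
by rewrite opp_row_mx add_row_mx subrr oppr0 addr0.
Qed.

(** Rank and nullity of the projection to the quotient, whose kernel is the standard subspace. *)
Lemma rk_cap_quot m (V : forall i, 'M[F]_(m i, dimD b c i)) :
  rk V = dimD (rk (capf V (stdf b c))) (rk (quotf V)).
Proof.
apply: functional_extensionality => i; rewrite /rk /dimD ffunE /quotf.
set A : 'M_(m i, b i + c i) := V i; pose B : 'M[F]_(b i + c i, c i) := col_mx 0 1%:M.
have -> : rsubmx A = A *m B by rewrite -{2}[A]hsubmxK mul_row_col mulmx0 add0r mulmx1.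
rewrite -[LHS](mxrank_mul_ker A B) [LHS]addnC; congr (_ + _)%N; apply/eqmx_rank/eqmxP.
apply: cap_eqmx => //; apply/eqmxP; rewrite sub_kermx /stdf.
rewrite mul_row_col mul0mx mulmx0 addr0 eqxx andbT.
have := submx_refl (kermx B); rewrite sub_kermx -[kermx B]hsubmxK mul_row_col.
rewrite mulmx0 mulmx1 add0r => /eqP ->; apply/submxP; exists (lsubmx (kermx B)).
by rewrite mul_mx_row mulmx1 mulmx0.
Qed.

End Blocks.
End Extensions.
Arguments stdf {n} F b c i.

(** * Counting representations by the dimension of their torsion part *)

Section TorsionCount.
Variables (n : nat) (Q : quiver n) (F : finFieldType) (l : 'I_n -> rat).
Local Notation lam := (lam l).

Section Blocks.
Variables (b c : 'I_n -> nat) (x : mrep F Q b) (y : mrep F Q c) (z : crep F Q c b).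
Local Notation w := (bmx x y z).

Lemma fss_sub : fss l w -> fss l x.
Proof.
move/fssP => wF; apply/fssP => m V; rewrite -(stab_inclf x y z) => /wF.
by rewrite rk_inclf.
Qed.

Lemma fss_quot : lam b = 0 -> fss l w -> fss l y.
Proof.
move=> b0 /fssP wF; apply/fssP => m V /(stab_preimf x z) /wF.
by rewrite rk_preimf lamD b0 add0r.
Qed.

Lemma stab_stdf : stab w (stdf F b c).
Proof. by apply/stab_stdfP; exists x, y, z. Qed.

Lemma fss_ext : fss l x -> fss l y -> fss l w.
Proof.
move=> /fssP xF /fssP yF; apply/fssP => m V wV; rewrite (rk_cap_quot V) lamD.
have wC := stab_cap wV stab_stdf.
have CV : subf (capf V (stdf F b c)) (stdf F b c) by apply/forallP=> i; rewrite ffunE capmxSr.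
move: wC; rewrite (sub_stdfP CV) rk_inclf stab_inclf => /xF.
by have := yF _ _ (stab_quotf wV); lra.
Qed.

(** Subrepresentations below the standard one are those of x, and those above it are the preimages
    of those of y. As weights are additive, the two clauses on subrepresentations become [tss] for x
    and [fss] for y. *)
Lemma torsion_sub_stdf : torsion_sub l w (genf (stdf F b c)) = tss l x && fss l y.
Proof.
have [SG GS] := subf_gen (stdf F b c).
apply/torsion_subP/andP; rewrite -(subf_rk SG GS) rk_stdf => -[].
  move=> _ T1 T2; split; [apply/tssP => m V xV|apply/fssP => m V yV].
    have [||sV|] := T1 _ (inclf c V); rewrite ?stab_inclf //.
    - apply: subf_trans SG; apply/forallP => i; apply/submxP; exists (V i).
      by rewrite mul_mx_row mulmx1 mulmx0.
    - left=> i; have /submxP[D] := forallP (subf_trans SG sV) i.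
      rewrite mul_mx_row mulmx0 => /eq_row_mx[E _].
      by rewrite -sub1mx; apply/submxP; exists D.
    - by rewrite rk_inclf; right.
  have := T2 _ (preimf b V) (stab_preimf x z yV); rewrite rk_preimf lamD gerDl; apply.
  apply: subf_trans GS _; apply/forallP => i; apply/submxP; exists (row_mx 1%:M 0).
  by rewrite mul_row_block !mul1mx !mul0mx !addr0.
move=> /tssP xT /fssP yF; split; first exact: stab_eq SG GS stab_stdf.
  move=> m V wV VG; have Vs := subf_trans VG GS.
  have VE := sub_stdfP Vs; rewrite VE in wV *.
  have [] := xT m (restf V); first by rewrite stab_inclf in wV.
    move=> Vf; left; apply: subf_trans GS _; apply/forallP => i.
    have /submxP[D DE] : (1%:M <= restf V i)%MS by rewrite sub1mx.
    by apply/submxP; exists D; rewrite mul_mx_row mulmx0 -DE.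
  by right; rewrite rk_inclf.
move=> m V wV GV; have [V1 V2] := sup_stdfP (subf_trans SG GV).
by rewrite (subf_rk V1 V2) rk_preimf lamD gerDl; apply: yF (stab_quotf wV).
Qed.

End Blocks.

Lemma torsion_sub_eq a (x : mrep F Q a) (U V : vfam F a a) :
  subf U V -> subf V U -> torsion_sub l x U -> torsion_sub l x V.
Proof.
move=> UV VU /torsion_subP[xU T1 T2]; apply/torsion_subP; rewrite -(subf_rk UV VU).
split; first exact: stab_eq UV VU xU.
- move=> m W xW WV; have [UW|] := T1 _ _ xW (subf_trans WV VU); last by right.
  by left; apply: subf_trans VU UW.
- by move=> m W xW VW; apply: T2 xW (subf_trans UV VW).
Qed.

Lemma torsion_sub_conj a (g : vfam F a a) (x : mrep F Q a) (U : vfam F a a) : unitf g ->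
  torsion_sub l (conj g x) U = torsion_sub l x (finfun (fun i => U i *m g i)).
Proof.
move=> gu; have fE (V : vfam F a a) : (finfun (fun i => V i *m g i) : vfam F a a) = (fun i => V i *m g i) :> (forall i, _).
  by apply: functional_extensionality_dep => i; rewrite ffunE.
apply/torsion_subP/torsion_subP; rewrite /= fE rk_conj // => -[]; rewrite stab_conj // => xU T1 T2.
  split=> // m V xV; pose W i := V i *m invmx (g i).
    have VE : V = (fun i => W i *m g i).
      apply: functional_extensionality_dep => i; rewrite mulmxKV //; exact: (forallP gu).
    by rewrite VE !subf_mulr // rk_conj //; apply: T1; rewrite stab_conj // -VE.
  have VE : V = (fun i => W i *m g i).
    apply: functional_extensionality_dep => i; rewrite mulmxKV //; exact: (forallP gu).
  by rewrite VE !subf_mulr // rk_conj //; apply: T2; rewrite stab_conj // -VE.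
split=> // m V; rewrite stab_conj // => xV.
  have := T1 _ _ xV; rewrite !subf_mulr // rk_conj //; exact.
have := T2 _ _ xV; rewrite !subf_mulr // rk_conj //; exact.
Qed.

Definition torsion_type a (b : 'I_n -> nat) : {set mrep F Q a} :=
  [set x | [exists U, torsion_sub l x U && [forall i, rk U i == b i]]].

Definition gv (a : 'I_n -> nat) (q : nat) : nat := (\prod_i gln (a i) q)%N.

(** [eulv] and [eula] are the vertex part and the arrow part of the Euler form of Q. *)
Definition eulv (a b : 'I_n -> nat) : nat := (\sum_i a i * b i)%N.
Definition eula (a b : 'I_n -> nat) : nat := (\sum_(c : arrow Q) a (source c) * b (target c))%N.

Lemma card_unitf a : #|[set g : vfam F a a | unitf g]| = gv a #|F|.
Proof.
rewrite (card_dffun_forall (fun i (g : 'M[F]_(a i)) => g \in unitmx)).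
by apply: eq_bigr => i _; rewrite card_unitmx.
Qed.

Lemma card_crep b c : #|{: crep F Q c b}| = (#|F| ^ eula c b)%N.
Proof.
rewrite card_dffun expn_sum; apply: eq_bigr => a _; exact: card_mx.
Qed.

Lemma card_stab_stdf b c (U : vfam F (dimD b c) (dimD b c)) : rk U = b ->
  #|[set g : vfam F (dimD b c) (dimD b c) | unitf g &&
      [forall i, (stdf F b c i *m g i == U i)%MS]]|
  = (gv b #|F| * gv c #|F| * #|F| ^ eulv c b)%N.
Proof.
move=> rU; pose P i (g : 'M[F]_(dimD b c i)) := (g \in unitmx) && (stdf F b c i *m g == U i)%MS.
rewrite (eq_card (B := [set g : vfam F (dimD b c) (dimD b c) | [forall i, P i (g i)]])).
  rewrite card_dffun_forall /gv /eulv expn_sum -!big_split; apply: eq_bigr => i _ /=.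
  by apply: card_stab_row; rewrite -[in RHS]rU.
move=> g; rewrite !inE; apply/andP/forallP => [[/forallP gu /forallP gU] i|gP].
  by rewrite /P gu gU.
by split; apply/forallP => i; have /andP[] := gP i.
Qed.

(** Double counting of the g that move the torsion part of x to the standard position. The normal
    forms are given by a torsion block, a torsion-free block and an arbitrary corner; as the torsion
    part of x is unique, the g for a given x form a coset of a parabolic subgroup. *)
Lemma card_torsion_type b c :
  (#|torsion_type (dimD b c) b| * (gv b #|F| * gv c #|F| * #|F| ^ eulv c b)
   = gv (dimD b c) #|F| *
     (#|[set x : mrep F Q b | tss l x]| * #|[set x : mrep F Q c | fss l x]| * #|F| ^ eula c b))%N.
Proof.
set S := genf (stdf F b c); have [SG GS] := subf_gen (stdf F b c).
pose Y := [set w : mrep F Q (dimD b c) | torsion_sub l w S].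
have -> : (#|[set x : mrep F Q b | tss l x]| * #|[set x : mrep F Q c | fss l x]| * #|F| ^ eula c b)%N = #|Y|.
  rewrite -card_crep -cardsT -!cardsX.
  pose f (t : (mrep F Q b * mrep F Q c) * crep F Q c b) := bmx t.1.1 t.1.2 t.2.
  rewrite -(card_imset _ (_ : injective f)).
    apply: eq_card => w; rewrite inE; apply/imsetP/idP => [[[[x y] z]]|wS].
      by rewrite !inE /= andbT => xy ->; rewrite torsion_sub_stdf.
    have /torsion_subP[/(stab_eq GS SG)] := wS.
    case/stab_stdfP=> [x [y [z wE]]] _ _; exists (x, y, z) => //.
    by rewrite !inE andbT /= -(torsion_sub_stdf x y z) -wE.
  by move=> [[x y] z] [[x' y'] z'] /bmx_inj[/= -> -> ->].
rewrite -(card_unitf (dimD b c)); apply: (@double_count _ _ _ _ _ (@conj _ _ _ _)).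
- by move=> g; rewrite inE; apply: conj_inj.
- move=> g w; rewrite !inE => gu; rewrite torsion_sub_conj // => tw.
  apply/existsP; exists (finfun (fun i => S i *m g i)); rewrite tw; apply/forallP => i.
  apply/eqP; rewrite -[in RHS](rk_stdf F b c) (subf_rk SG GS) /rk ffunE mxrankMfree //.
  by rewrite row_free_unit; apply: (forallP gu).
move=> w; rewrite inE => /existsP[U /andP[wU /forallP rU]].
rewrite -(@card_stab_stdf b c U); last by apply: functional_extensionality => i; apply/eqP.
apply: eq_card => g; rewrite !inE; case gu: (unitf g) => //=.
rewrite torsion_sub_conj //; apply/idP/forallP => [wS i|gU]; last first.
  apply: torsion_sub_eq wU; apply/forallP => i; rewrite !ffunE;
    have /andP[g1 g2] := gU i.
    by apply: submx_trans g2 _; apply: submxMr; rewrite genmxE.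
  by apply: submx_trans g1; apply: submxMr; rewrite genmxE.
have /forallP/(_ i) := torsion_sub_unique wS wU; rewrite ffunE => g1.
have /forallP/(_ i) := torsion_sub_unique wU wS; rewrite ffunE => g2.
apply/andP; split; first by apply: submx_trans g1; apply: submxMr; rewrite ffunE genmxE.
by apply: submx_trans g2 _; apply: submxMr; rewrite ffunE genmxE.
Qed.

End TorsionCount.

(** * Rationality of the weighted torsion and torsion-free counts *)

Section TorsionRational.
Variables (n : nat) (Q : quiver n) (l : 'I_n -> rat).

Lemma gv_gt0 a q : (1 < q)%N -> (0 < gv (n := n) a q)%N.
Proof. by move=> q1; apply: prodn_gt0 => i; apply: gln_gt0. Qed.

Lemma gv_neq0 a (F : finFieldType) : (gv (n := n) a #|F|)%:R != 0 :> rat.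
Proof. by rewrite pnatr_eq0 -lt0n gv_gt0 // card_fin_gt1. Qed.

Lemma cardF_neq0 (F : finFieldType) j : (#|F| ^ j)%:R != 0 :> rat.
Proof. by rewrite pnatr_eq0 -lt0n expn_gt0 (ltnW (card_fin_gt1 F)). Qed.

Lemma isrf_gvV a : isrf (fun q => (gv (n := n) a q)%:R^-1).
Proof.
apply: isrf_eq (isrf_prod (index_enum _) (P := xpredT) (fun i _ => isrf_glnV (a i))).
by move=> m _; rewrite natr_prod prodfV.
Qed.

Definition tcount (F : finFieldType) a : rat :=
  #|[set x : mrep F Q a | tss l x]|%:R / (gv a #|F|)%:R.
Definition fcount (F : finFieldType) a : rat :=
  #|[set x : mrep F Q a | fss l x]|%:R / (gv a #|F|)%:R.

(** Gives the dimension vectors with entries below h a finite index type for sums. *)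
Definition bdim h (b : {ffun 'I_n -> 'I_h}) i : nat := b i.

Lemma torsion_type_ratio (F : finFieldType) a b c : dimD b c = a ->
  #|@torsion_type n Q F l a b|%:R / (gv a #|F|)%:R
  = tcount F b * fcount F c * ((#|F| ^ eula Q c b)%:R / (#|F| ^ eulv c b)%:R) :> rat.
Proof.
move=> <-; have := congr1 (fun N => N%:R : rat) (@card_torsion_type n Q F l b c).
rewrite !natrM /tcount /fcount => E.
rewrite mulf_div mulf_div; apply/eqP; rewrite eqr_div ?gv_neq0 ?mulf_neq0 ?gv_neq0 ?cardF_neq0 //.
by rewrite E mulrC.
Qed.

(** Sorting all representations by the dimension b of the torsion part expresses q^(eula a a) /
    |G_a| through counts of smaller height, except that b = 0 and b = a give the two counts of a
    itself. For nonzero a one of these is zero: the zero subrepresentation violates [tss] if lam a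
    <= 0, and the whole space violates [fss] if lam a > 0. *)
Lemma fss_tss_isrf a : exists r s : nat -> rat, [/\ isrf r, isrf s
  & forall F : finFieldType, fcount F a = r #|F| /\ tcount F a = s #|F|].
Proof.
have [m] := ubnP (ht a); elim: m a => // m IHm a; rewrite ltnS => am.
have [/ht_eq0 a0|an0] := eqVneq (ht a) 0%N.
  exists (fun=> 1), (fun=> 1); split; try exact: isrf_const.
  move=> F; have gv0 : gv a #|F| = 1%N.
    by rewrite a0; apply: big1 => i _; rewrite /gln big_geq.
  have all1 (P : pred (mrep F Q a)) : (forall x, P x) -> #|[set x | P x]| = 1%N.
    move=> PT; rewrite (eq_card (B := setT)); last by move=> x; rewrite !inE PT.
    rewrite cardsT card_dffun big1 // => c _; rewrite card_mx a0 //.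
  have rk0 mm (U : forall i, 'M[F]_(mm i, a i)) : rk U = @dim0 n.
    apply: functional_extensionality => i; apply/eqP; rewrite -leqn0.
    by apply: leq_trans (rank_leq_col _) _; rewrite a0.
  rewrite /fcount /tcount gv0 !all1 ?divr1 //= => x.
    by apply/tssP => mm U _; left=> i; rewrite /row_full -[\rank _]/(rk U i) rk0 a0.
  by apply/fssP => mm U _; rewrite rk0 lam0.
have [rs rsP] : exists rs : ('I_n -> nat) -> (nat -> rat) * (nat -> rat), forall b,
    (ht b < ht a)%N -> [/\ isrf (rs b).1, isrf (rs b).2 & forall F : finFieldType,
      fcount F b = (rs b).1 #|F| /\ tcount F b = (rs b).2 #|F|].
  apply: (functional_choice (fun b (p : (nat -> rat) * (nat -> rat)) => (ht b < ht a)%N ->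
    [/\ isrf p.1, isrf p.2 & forall F : finFieldType, fcount F b = p.1 #|F| /\ tcount F b = p.2 #|F|])) => b.
  have [ba|_] := ltnP (ht b) (ht a); last by exists (fun=> 0, fun=> 0).
  by have [r [s [rr rs E]]] := IHm b (leq_trans ba am); exists (r, s).
pose wt b q : rat := (q ^ eula Q (dimB a b) b)%:R / (q ^ eulv (dimB a b) b)%:R.
have wtr b : isrf (wt b) by apply: isrf_mul (isrf_natX _) (isrf_natXV _).
pose D (b : {ffun 'I_n -> 'I_(ht a).+1}) := [forall i, b i <= a i]%N && (0 < ht (bdim b) < ht a)%N.
pose rest q := \sum_(b | D b) (rs (bdim b)).2 q * (rs (dimB a (bdim b))).1 q * wt (bdim b) q.
have htB b : (forall i, b i <= a i)%N -> ht (dimB a b) = (ht a - ht b)%N.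
  by move=> ba; rewrite -[in RHS](dimDB ba) htD addKn.
have rrest : isrf rest.
  apply: isrf_sum => b /andP[/forallP ba /andP[b0 blt]].
  have [_ r2 _] := rsP _ blt.
  have [r1 _ _] : [/\ isrf (rs (dimB a (bdim b))).1, True & True].
    by have [|r1 _ _] := rsP (dimB a (bdim b)); rewrite ?htB // ltn_subrL b0 (ltn_trans b0 blt).
  exact: isrf_mul (isrf_mul r2 r1) (wtr _).
pose tot q : rat := (q ^ eula Q a a)%:R / (gv a q)%:R.
have rtot : isrf tot by apply: isrf_mul (isrf_natX _) (isrf_gvV _).
(* [rest] collects the b strictly between 0 and a. *)
have main F : fcount F a + tcount F a = tot #|F| - rest #|F|.
  apply/eqP; rewrite eq_sym subr_eq; apply/eqP.
  have -> : tot #|F| = \sum_(b : {ffun 'I_n -> 'I_(ht a).+1}) #|@torsion_type n Q F l a (bdim b)|%:R / (gv a #|F|)%:R.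
    rewrite -mulr_suml -natr_sum; congr (_%:R / _); rewrite -card_crep -cardsT.
    have -> : setT = \bigcup_(b : {ffun 'I_n -> 'I_(ht a).+1}) @torsion_type n Q F l a (bdim b).
      apply/setP => x; rewrite inE; apply/esym/bigcupP.
      have [U xU] := exists_torsion_sub l x.
      exists [ffun i => inord (rk U i)] => //; rewrite inE; apply/existsP; exists U.
      rewrite xU; apply/forallP => i; rewrite /bdim ffunE inordK // ltnS.
      by apply: leq_trans (rank_leq_col _) (leq_ht _ _).
    rewrite -sum1_card partition_disjoint_bigcup /=; first by apply: eq_bigr => b _; rewrite sum1_card.
    move=> b b' bb'; rewrite -setI_eq0; apply/eqP/setP => x.
    rewrite !inE; apply/negP => /andP[/existsP[U /andP[xU /forallP rU]]].
    case/existsP=> V /andP[xV /forallP rV]; case/negP: bb'; apply/eqP/ffunP => i.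
    apply/val_inj; rewrite /= -[val _](eqP (rU i)) -[RHS](eqP (rV i)).
    by rewrite (subf_rk (torsion_sub_unique xU xV) (torsion_sub_unique xV xU)).
  pose b0 : {ffun 'I_n -> 'I_(ht a).+1} := [ffun=> ord0].
  pose ba : {ffun 'I_n -> 'I_(ht a).+1} := [ffun i => inord (a i)].
  have b0E : bdim b0 = @dim0 n by apply: functional_extensionality => i; rewrite /bdim ffunE.
  have baE : bdim ba = a.
    by apply: functional_extensionality => i; rewrite /bdim ffunE inordK // ltnS leq_ht.
  have bab0 : ba != b0.
    by apply: contraNneq an0 => E; rewrite -baE E b0E /ht big1.
  have gt0 (b : {ffun 'I_n -> 'I_(ht a).+1}) : (ht (bdim b) == 0%N) = (b == b0).
    apply/eqP/eqP => [/ht_eq0 E|->]; last by rewrite b0E /ht big1.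
    by apply/ffunP => i; apply/val_inj; rewrite -[LHS]/(bdim b i) E ffunE.
  have term (b : {ffun 'I_n -> 'I_(ht a).+1}) : (forall i, b i <= a i)%N ->
    #|@torsion_type n Q F l a (bdim b)|%:R / (gv a #|F|)%:R
    = tcount F (bdim b) * fcount F (dimB a (bdim b)) * wt (bdim b) #|F|.
    by move=> le; apply: torsion_type_ratio; apply: dimDB.
  have cnt0 (P : pred (mrep F Q (@dim0 n))) : (forall x, P x) -> #|[set x | P x]| = 1%N.
    move=> PT; rewrite (eq_card (B := setT)); last by move=> x; rewrite !inE PT.
    by rewrite cardsT card_dffun big1 // => c _; rewrite card_mx.
  have rk0 mm (U : forall i, 'M[F]_(mm i, @dim0 n i)) : rk U = @dim0 n.
    apply: functional_extensionality => i; apply/eqP; rewrite -leqn0.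
    exact: rank_leq_col.
  have gv00 : gv (@dim0 n) #|F| = 1%N by apply: big1 => i _; rewrite /gln big_geq.
  have t0 : tcount F (@dim0 n) = 1.
    rewrite /tcount gv00 cnt0 ?divr1 // => x.
    by apply/tssP => mm U _; left=> i; rewrite /row_full -[\rank _]/(rk U i) rk0.
  have f0 : fcount F (@dim0 n) = 1.
    by rewrite /fcount gv00 cnt0 ?divr1 // => x; apply/fssP => mm U _; rewrite rk0 lam0.
  rewrite (bigD1 b0) //= (bigD1 ba) //= addrA; congr (_ + _ + _).
  - rewrite term => [|i]; last by rewrite ffunE.
    rewrite b0E t0 mul1r (_ : dimB a (@dim0 n) = a).
      by rewrite /wt /eula /eulv !big1 ?divr1 ?mulr1 // => *; rewrite muln0.
    by apply: functional_extensionality => i; rewrite /dimB subn0.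
  - rewrite term => [|i]; last by rewrite -[nat_of_ord _]/(bdim ba i) baE.
    rewrite baE (_ : dimB a a = @dim0 n); last first.
      by apply: functional_extensionality => i; rewrite /dimB subnn.
    by rewrite f0 mulr1 /wt /eula /eulv /dimB !big1 ?divr1 ?mulr1 // => *; rewrite subnn mul0n.
  rewrite /rest [RHS]big_mkcond [LHS]big_mkcond; apply: eq_bigr => b _.
  rewrite /D lt0n gt0; case: (boolP [forall i, b i <= a i]%N) => [/forallP le|nle] /=.
    have hle : (ht (bdim b) <= ht a)%N by apply: leq_sum => i _; apply: le.
    have -> : (ht (bdim b) < ht a)%N = (b != ba).
      apply/idP/idP => [|bna]; first by apply: contraTneq => ->; rewrite baE ltnn.
      rewrite ltn_neqAle hle andbT; apply: contra bna => /eqP hE.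
      have := htB (bdim b) le; rewrite hE subnn => /ht_eq0 dE.
      apply/eqP/ffunP => i; apply/val_inj; rewrite -[LHS]/(bdim b i) -[RHS]/(bdim ba i) baE.
      by apply/eqP; rewrite eqn_leq le /= -subn_eq0 -[(_ - _)%N]/(dimB a (bdim b) i) dE.
    rewrite andbC; case: ifP => // /andP[bn0 bna].
    have blt : (ht (bdim b) < ht a)%N.
      rewrite ltn_neqAle hle andbT; apply: contra bn0 => /eqP hE.
      have := htB (bdim b) le; rewrite hE subnn => /ht_eq0 dE.
      apply/eqP/ffunP => i; apply/val_inj; rewrite -[LHS]/(bdim b i) -[RHS]/(bdim ba i) baE.
      by apply/eqP; rewrite eqn_leq le /= -subn_eq0 -[(_ - _)%N]/(dimB a (bdim b) i) dE.
    have clt : (ht (dimB a (bdim b)) < ht a)%N.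
      by rewrite htB // ltn_subrL !lt0n an0 gt0 bna.
    have [_ _ E1] := rsP _ blt; have [_ _ E2] := rsP _ clt.
    by rewrite term //; have [_ ->] := E1 F; have [-> _] := E2 F.
  case: ifP => // _; rewrite (_ : torsion_type _ _ _ _ _ = set0) ?cards0 ?mul0r //.
  apply/setP => x; rewrite !inE; apply: negbTE; apply/negP => /existsP[U /andP[_ /forallP rU]].
  case/negP: nle; apply/forallP => i; have := eqP (rU i); rewrite /bdim => <-.
  exact: rank_leq_col.
have [la|la] := leP (lam l a) 0.
  have t0 F : tcount F a = 0.
    rewrite /tcount (_ : [set x | _] = set0) ?cards0 ?mul0r //; apply/setP => x; rewrite !inE.
    apply: negbTE; apply/negP => /tssP /(_ _ (fun i => 0 : 'M_(a i))) [].
    - by apply/forallP => c; rewrite mul0mx sub0mx.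
    - move=> full; case/negP: an0; rewrite /ht big1 // => i _.
      by have := full i; rewrite /row_full mxrank0 => /eqP.
    rewrite (_ : rk _ = @dim0 n) ?lam0 ?ltNge ?la //.
    by apply: functional_extensionality => i; rewrite /rk mxrank0.
  exists (fun q => tot q - rest q), (fun=> 0); split; [exact: isrf_sub|exact: isrf_const|].
  by move=> F; rewrite t0 -main t0 addr0.
have f0 F : fcount F a = 0.
  rewrite /fcount (_ : [set x | _] = set0) ?cards0 ?mul0r //; apply/setP => x; rewrite !inE.
  apply: negbTE; apply/negP => /fssP /(_ _ (fun i => 1%:M : 'M_(a i))) H.
  have : lam l a <= 0; last by rewrite leNgt la.
  rewrite {1}(_ : a = rk (fun i => 1%:M : 'M[F]_(a i))) ?H //.
    by apply/forallP => c; rewrite submx1.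
  by apply: functional_extensionality => i; rewrite /rk mxrank1.
exists (fun=> 0), (fun q => tot q - rest q); split; [exact: isrf_const|exact: isrf_sub|].
by move=> F; rewrite f0 -main f0 add0r.
Qed.

End TorsionRational.

(** * Nilpotent endomorphisms of semistable representations *)

Section MatrixLemmas.
Variable F : fieldType.

Definition nilpm n (A : 'M[F]_n) : bool := A ^+ n == 0.

(** The minimal polynomial divides a power of X, so it is X^m, and m <= n because it divides the
    characteristic polynomial. *)
Lemma nilpmP n (A : 'M[F]_n) : reflect (exists N, A ^+ N = 0) (nilpm A).
Proof.
apply: (iffP eqP) => [A0|[N AN]]; first by exists n.
case: n A AN => [|n] A AN; first exact: flatmx0.
have pX : mxminpoly A %| ('X - 0%:P) ^+ N.
  apply: mxminpoly_min; rewrite subr0 rmorphXn /= horner_mx_X; exact: AN.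
have /dvdp_exp_XsubCP[m mN pE] := pX.
have : mxminpoly A = ('X - 0%:P) ^+ m.
  apply/eqP; rewrite -eqp_monic ?mxminpoly_monic //.
  by rewrite monic_exp // monicXsubC.
move=> pA; have : horner_mx A (mxminpoly A) = 0 by exact: mx_root_minpoly.
rewrite pA subr0 rmorphXn /= horner_mx_X => Am0.
have mn : (m <= n.+1)%N.
  have := dvdp_leq (monic_neq0 (char_poly_monic A)) (mxminpoly_dvd_char A).
  by rewrite size_char_poly pA size_exp_XsubC.
have Ale (j : nat) : (m <= j)%N -> A ^+ j = 0 by move/subnKC=> <-; rewrite exprD Am0 mul0r.
exact: Ale.
Qed.

Lemma nilpm_conj n (g A : 'M[F]_n) : g \in unitmx -> nilpm (g *m A *m invmx g) = nilpm A.
Proof.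
move=> gu; rewrite /nilpm.
have -> N : (g *m A *m invmx g) ^+ N = g *m A ^+ N *m invmx g.
  elim: N => [|N IH]; first by rewrite !expr0 mulmx1 mulmxV.
  rewrite !exprS IH -!mulmxE !mulmxA; congr (_ *m _); rewrite -!mulmxA; congr (_ *m (_ *m _)).
  by rewrite !mulmxA mulVmx // mul1mx.
apply/eqP/eqP => [|->]; last by rewrite mulmx0 mul0mx.
move=> E; have -> : A ^+ n = invmx g *m (g *m A ^+ n *m invmx g) *m g.
  by rewrite !mulmxA mulVmx // mul1mx mulmxKV.
by rewrite E mulmx0 mul0mx.
Qed.

(** A solution is [pinvmx N *m B], since the rows of 1 - N *m pinvmx N lie in the left kernel of
    N. *)
Lemma kermx_solve m n p (N : 'M[F]_(m, n)) (B : 'M_(m, p)) : kermx N *m B = 0 ->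
  exists z, N *m z = B.
Proof.
move=> KB; exists (pinvmx N *m B); apply/eqP; rewrite eq_sym -subr_eq0.
have : (1%:M - N *m pinvmx N <= kermx N)%MS.
  by rewrite sub_kermx mulmxBl mul1mx mulmxKpV ?subrr.
case/submxP=> D DE; rewrite mulmxA -{1}[B]mul1mx -mulmxBl DE -mulmxA KB mulmx0 //.
Qed.

Lemma nilpm_block n m (A : 'M[F]_(m, n)) (N : 'M_m) :
  nilpm (block_mx 0 0 A N : 'M_(n + m)) = nilpm N.
Proof.
have E k : (block_mx 0 0 A N : 'M_(n + m)) ^+ k.+1 = block_mx 0 0 (N ^+ k *m A) (N ^+ k.+1).
  elim: k => [|k IH]; first by rewrite expr0 mul1mx.
  rewrite exprS IH -mulmxE mulmx_block !mul0mx !mulmx0 !add0r mulmxA.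
  by rewrite (exprS N k) (exprS N k.+1) (exprS N k).
apply/nilpmP/nilpmP => -[k]; last first.
  by move=> k0; exists k.+1; rewrite E exprS k0 mul0mx mulr0 block_mx0.
move=> k0; exists k.+1; have := E k; rewrite exprS k0 mulr0.
by rewrite -[LHS]block_mx0 => /eq_block_mx[].
Qed.

End MatrixLemmas.

Section CardSolutions.
Variable F : finFieldType.

Lemma card_submx m n p (K : 'M[F]_(p, n)) :
  #|[set D : 'M[F]_(m, n) | (D <= K)%MS]| = (#|F| ^ (m * \rank K))%N.
Proof.
pose f (D : 'M[F]_(m, \rank K)) := D *m row_base K.
have fi : injective f by apply: row_free_inj; apply: row_base_free.
rewrite -card_mx -cardsT -(card_imset _ fi); apply: eq_card => D; rewrite inE.
apply/idP/imsetP => [|[E _ ->]]; last by apply: mulmx_sub; rewrite eq_row_base.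
by rewrite -(eq_row_base K) => /submxP[E ->]; exists E.
Qed.

Lemma card_mulmx_eq m n p (N : 'M[F]_(m, n)) (B : 'M_(m, p)) z0 : N *m z0 = B ->
  #|[set z | N *m z == B]| = (#|F| ^ ((n - \rank N) * p))%N.
Proof.
move=> z0B; rewrite mulnC -[\rank N]mxrank_tr -mxrank_ker -card_submx.
pose f (D : 'M[F]_(p, n)) := D^T + z0.
have fi : injective f by move=> D E /addIr /trmx_inj.
rewrite -(card_imset _ fi); apply: eq_card => z; rewrite inE.
apply/eqP/imsetP => [zB|[D]]; last first.
  rewrite inE sub_kermx => /eqP DN ->.
  by rewrite mulmxDr z0B -[N]trmxK -trmx_mul DN trmx0 add0r.
exists (z - z0)^T; last by rewrite /f trmxK subrK.
by rewrite inE sub_kermx -trmx_mul mulmxBr zB z0B subrr trmx0.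
Qed.

Lemma card_row_free_mul u w v (K : 'M[F]_(u, v)) : row_free K ->
  (#|[set A : 'M[F]_(v, u + w) | row_free (K *m A)]| * (gln w #|F| * #|F| ^ (w * u))
  = gln (u + w) #|F| * #|F| ^ ((v - u) * (u + w)))%N.
Proof.
move=> Kf; rewrite -card_row_free mulnAC; congr (_ * _)%N.
have rK : \rank K = u by apply/eqP.
rewrite -sum1_card (partition_big (fun A => K *m A) (fun J => J \in [set J | row_free J])) /=; last first.
  by move=> A; rewrite !inE.
rewrite -sum_nat_const; apply: eq_bigr => J; rewrite inE => Jf.
have [z0 z0J] : exists z, K *m z = J.
  by apply: kermx_solve; move: Kf; rewrite -kermx_eq0 => /eqP ->; rewrite mul0mx.
have := card_mulmx_eq z0J; rewrite rK => <-; rewrite -sum1_card; apply: eq_bigl => A; rewrite !inE.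
by case: eqP => [->|]; rewrite ?Jf ?andbT ?andbF.
Qed.

End CardSolutions.

Definition endof n (Q : quiver n) (F : fieldType) a (x : mrep F Q a) (f : vfam F a a) : bool :=
  [forall c, x c *m f (target c) == f (source c) *m x c].

Definition nilpf n (F : fieldType) (a : 'I_n -> nat) (f : vfam F a a) : bool :=
  [forall i, nilpm (f i)].

Definition conjv n (F : fieldType) (a : 'I_n -> nat) (g f : vfam F a a) : vfam F a a :=
  finfun (fun i => g i *m f i *m invmx (g i)).

Section KernelImage.
Variables (n : nat) (Q : quiver n) (F : fieldType).

Lemma stab_ker a (x : mrep F Q a) f : endof x f -> stab x (fun i => kermx (f i)).
Proof.
move=> /forallP xf; apply/forallP => c; rewrite sub_kermx -mulmxA (eqP (xf c)).
by rewrite mulmxA mulmx_ker mul0mx.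
Qed.

Lemma stab_im a (x : mrep F Q a) f : endof x f -> stab x (fun i => f i).
Proof.
by move=> /forallP xf; apply/forallP => c; rewrite -(eqP (xf c)) submxMl.
Qed.

End KernelImage.

Section Nilpotent.
Variables (n : nat) (Q : quiver n) (l : 'I_n -> rat).

Section OneField.
Variable F : finFieldType.

(** Semistability of slope mu. Fixing the weight to be 0 makes the class closed under extensions and
    under kernels of endomorphisms. *)
Definition sss a (x : mrep F Q a) : bool := fss l x && (lam l a == 0).

Lemma sss_conj a (g : vfam F a a) (x : mrep F Q a) : unitf g -> sss (conj g x) = sss x.
Proof.
move=> gu; rewrite /sss; congr andb; apply/fssP/fssP => xF m U xU; last first.
  by have := xF _ _ (etrans (esym (stab_conj x U gu)) xU); rewrite rk_conj.
have := xF m (fun i => U i *m invmx (g i)); rewrite stab_conj //.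
have E : (fun i => U i *m invmx (g i) *m g i) = U.
  by apply: functional_extensionality_dep => i; rewrite mulmxKV //; apply: (forallP gu).
rewrite E => /(_ xU); rewrite (_ : rk _ = rk U) //.
by rewrite -[in RHS]E rk_conj.
Qed.

Lemma sss_bmx b c (x : mrep F Q b) (y : mrep F Q c) z : lam l b = 0 ->
  sss (bmx x y z) = sss x && sss y.
Proof.
move=> b0; rewrite /sss lamD b0 add0r eqxx andbT; apply/andP/and3P.
  by case=> wF c0; split=> //; [apply: fss_sub wF|apply: fss_quot wF].
by case=> xF yF c0; split=> //; apply: fss_ext.
Qed.

(** Kernel and image are subrepresentations, hence of weight <= 0, and their weights add up to lam a
    = 0. *)
Lemma lam_ker a (x : mrep F Q a) f : sss x -> endof x f ->
  lam l (rk (fun i => kermx (f i))) = 0.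
Proof.
case/andP=> /fssP xF /eqP a0 xf.
have H1 := xF _ _ (stab_ker xf); have H2 := xF _ _ (stab_im xf).
have : lam l (rk (fun i => kermx (f i))) + lam l (rk (fun i => f i)) = 0.
  rewrite -lamD -[RHS]a0; congr lam; apply: functional_extensionality => i.
  by rewrite /dimD /rk mxrank_ker subnK // rank_leq_row.
lra.
Qed.

Lemma sss_stab a (x : mrep F Q a) b (K : forall i, 'M[F]_(b i, a i)) (y : mrep F Q b) :
  (forall i, row_free (K i)) -> (forall c, K (source c) *m x c = y c *m K (target c)) ->
  lam l b = 0 -> sss x -> sss y.
Proof.
move=> Kf Ky b0 /andP[/fssP xF _]; rewrite /sss b0 eqxx andbT.
apply/fssP => m V /forallP yV; have := xF m (fun i => V i *m K i).
rewrite (_ : rk _ = rk V); last first.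
  by apply: functional_extensionality => i; rewrite /rk mxrankMfree.
apply; apply/forallP => c; rewrite -mulmxA Ky mulmxA; exact: submxMr.
Qed.

Definition nset a (u : 'I_n -> nat) : {set mrep F Q a * vfam F a a} :=
  [set p | [&& sss p.1, endof p.1 p.2, nilpf p.2 & [forall i, \rank (kermx (p.2 i)) == u i]]].

(** * Lifting a nilpotent pair to one with a prescribed kernel *)

Section Fiber.
Variables (u v k w : 'I_n -> nat).
Hypothesis ukw : u = dimD k w.
Variables (x : mrep F Q v) (f : vfam F v v) (K : forall i, 'M[F]_(k i, v i)).
Hypotheses (xs : sss x) (xf : endof x f) (Kker : forall i, (K i :=: kermx (f i))%MS).
Hypothesis Kf : forall i, row_free (K i).

Let rK i : \rank (kermx (f i)) = k i.
Proof. by rewrite -Kker; apply/eqP/Kf. Qed.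

Let k0 : lam l k = 0.
Proof.
rewrite -[RHS](lam_ker xs xf); congr lam; apply: functional_extensionality => i.
by rewrite /rk rK.
Qed.

Let y0 : mrep F Q k := finfun (fun c => K (source c) *m x c *m pinvmx (K (target c))).

Let Ky c : K (source c) *m x c = y0 c *m K (target c).
Proof.
rewrite ffunE mulmxKpV // Kker; have /forallP/(_ c) sk := stab_ker xf.
by apply: submx_trans sk; apply: submxMr; rewrite Kker.
Qed.

Let y0s : sss y0. Proof. exact: sss_stab Kf Ky k0 xs. Qed.

Let Kf0 i : K i *m f i = 0.
Proof. by apply/eqP; rewrite -sub_kermx Kker. Qed.

(** An endomorphism of the extension [bmx y x z] that kills y and induces f on x has block rows (0,
    0) and (A, f). The three conditions say that its kernel is not larger than y, that y is
    semistable, and that it commutes with the arrows. *)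
Definition fiber : {set ({dffun forall i, 'M[F]_(v i, u i)} * mrep F Q u) * crep F Q v u} :=
  [set t : ({dffun forall i, 'M[F]_(v i, u i)} * mrep F Q u) * crep F Q v u |
     [&& [forall i, row_free (row_mx (t.1.1 i) (f i))], sss t.1.2 &
     [forall c, x c *m t.1.1 (target c) == t.1.1 (source c) *m t.1.2 c + f (source c) *m t.2 c]]].

(** A vector killed by (A, f) lies in the kernel of f, which is the span of K. *)
Lemma row_free_fiber m i (A : 'M[F]_(v i, m)) : row_free (row_mx A (f i)) = row_free (K i *m A).
Proof.
rewrite -!kermx_eq0; apply/eqP/eqP => [r0|r0].
  apply/eqP; rewrite -submx0; set E := kermx (K i *m A).
  have : (E *m K i <= kermx (row_mx A (f i)))%MS.
    by rewrite sub_kermx mul_mx_row -[E *m _ *m A]mulmxA mulmx_ker -[E *m _ *m f i]mulmxA Kf0 mulmx0 row_mx0.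
  by rewrite r0 submx0 => /eqP/(canRL (mulmxKp (Kf i))) ->; rewrite mul0mx.
set E := kermx _; have : E *m row_mx A (f i) = 0 by exact: mulmx_ker.
rewrite mul_mx_row -[0]row_mx0 => /eq_row_mx[EA Ef].
have /submxP[D DE] : (E <= K i)%MS by rewrite Kker sub_kermx Ef.
have : (D <= kermx (K i *m A))%MS by rewrite sub_kermx mulmxA -DE EA.
by rewrite r0 submx0 DE => /eqP ->; rewrite mul0mx.
Qed.

(** Completing J to an invertible matrix moves it to the standard position. Then y becomes block
    triangular with subrepresentation y0, and as y0 is semistable of weight 0, y is semistable iff
    its quotient of dimension w is. *)
Lemma card_fiber_reps (J : {dffun forall i, 'M[F]_(k i, dimD k w i)}) :
  (forall i, row_free (J i)) ->
  #|[set y : mrep F Q (dimD k w) | sss y && [forall c, J (source c) *m y c == y0 c *m J (target c)]]|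
  = (#|[set y : mrep F Q w | sss y]| * #|F| ^ eula Q w k)%N.
Proof.
move=> Jf.
have [g gP] : exists g : forall i, 'M[F]_(dimD k w i),
    forall i, g i \in unitmx /\ J i = row_mx 1%:M 0 *m g i.
  apply: (@dependent_choice _ _ (fun i g => g \in unitmx /\ J i = row_mx 1%:M 0 *m g)) => i.
  by have /row_free_unitP[g gu JE] := Jf i; exists g.
pose G : vfam F (dimD k w) (dimD k w) := finfun g.
have Gu : unitf G by apply/forallP => i; rewrite ffunE; case: (gP i).
have GE i : G i = g i by rewrite ffunE.
pose h (t : mrep F Q w * crep F Q w k) := conj (finfun (fun i => invmx (G i))) (bmx y0 t.1 t.2).
have Gu' : unitf (finfun (fun i => invmx (G i)) : vfam F (dimD k w) (dimD k w)).
  by apply/forallP => i; rewrite ffunE unitmx_inv; apply: (forallP Gu).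
have hi : injective h.
  by move=> [y z] [y' z'] /(conj_inj Gu') /bmx_inj[_ /= -> ->].
rewrite -card_crep -cardsT -cardsX -(card_imset _ hi); apply: eq_card => y; rewrite inE.
have hE t c : h t c = invmx (G (source c)) *m bmx y0 t.1 t.2 c *m G (target c).
  by rewrite /h !ffunE invmxK.
apply/andP/imsetP => [[ys /forallP yJ]|[t]]; last first.
  rewrite !inE andbT => ts ->; split; first by rewrite sss_conj // sss_bmx // y0s.
  apply/forallP => c; rewrite hE; have [gu ->] := gP (source c); have [_ ->] := gP (target c).
  rewrite !GE !mulmxA mulmxK // ffunE mul_row_block !mul1mx !mul0mx !addr0.
  by rewrite mul_mx_row mulmx1 mulmx0.
have : stab (conj G y) (stdf F k w).
  apply/forallP => c; rewrite ffunE /stdf; apply/submxP; exists (y0 c).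
  have [gus Js] := gP (source c); have [gut Jt] := gP (target c).
  by rewrite !GE !mulmxA -Js (eqP (yJ c)) Jt !mulmxA mulmxK.
case/stab_stdfP=> [y1 [y2 [z yE]]].
have y10 : y1 = y0.
  apply/ffunP => c; have [gus Js] := gP (source c); have [gut Jt] := gP (target c).
  have E : g (source c) *m y c *m invmx (g (target c))
      = block_mx (y1 c) 0 (z c) (y2 c) :> 'M_(k _ + w _, k _ + w _).
    by have /ffunP/(_ c) := yE; rewrite !ffunE.
  have := eqP (yJ c); rewrite Js Jt -mulmxA => /(congr1 (mulmx^~ (invmx (g (target c))))).
  rewrite -!mulmxA (mulmxA (g _)) E mulmxV // mulmx1 mul_row_block !mul1mx !mul0mx !addr0.
  by rewrite mul_mx_row mulmx1 mulmx0 => /eq_row_mx[].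
exists (y2, z).
  by have := sss_conj y Gu; rewrite yE sss_bmx ?y10 // y0s /= !inE andbT ys.
apply/ffunP => c; rewrite hE /= -y10 -yE [conj _ _ _]ffunE !mulmxA mulmxKV; last exact: (forallP Gu).
by rewrite mulVmx ?mul1mx //; apply: (forallP Gu).
Qed.

(** First A is chosen with K A injective. Restricted to ker f, the compatibility condition says that
    K A is a morphism to y from y0, the representation on ker f. Conversely this makes f z = x A - A
    y solvable at each arrow, the solutions forming a translate of the matrices with columns killed
    by f. *)
Lemma card_fiber :
  (#|fiber| * (gv w #|F| * #|F| ^ eulv w k)
   = gv u #|F| * #|F| ^ (\sum_i (v i - k i) * u i) * #|[set y : mrep F Q w | sss y]|
     * #|F| ^ eula Q w k * #|F| ^ eula Q k u)%N.
Proof.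
pose S := [set A : {dffun forall i, 'M[F]_(v i, u i)} | [forall i, row_free (K i *m A i)]].
have -> : #|fiber| = (#|S| * (#|[set y : mrep F Q w | sss y]| * #|F| ^ eula Q w k * #|F| ^ eula Q k u))%N.
  rewrite -sum1_card (partition_big (fun t => t.1.1) (fun A => A \in S)) /=; last first.
    by move=> t; rewrite !inE => /and3P[/forallP tf _ _]; apply/forallP => i; rewrite -row_free_fiber.
  rewrite -sum_nat_const; apply: eq_bigr => A; rewrite inE => /forallP Af.
  pose J : {dffun forall i, 'M[F]_(k i, u i)} := finfun (fun i => K i *m A i).
  pose SY := [set y : mrep F Q u | sss y && [forall c, J (source c) *m y c == y0 c *m J (target c)]].
  transitivity (#|SY| * #|F| ^ eula Q k u)%N; last first.
    have Jf i : row_free (J i) by rewrite ffunE.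
    (* The equality of u and [dimD k w] is only propositional; after generalising u it can be
       eliminated. *)
    have aux (u' : 'I_n -> nat) : u' = dimD k w -> forall J' : {dffun forall i, 'M[F]_(k i, u' i)},
        (forall i, row_free (J' i)) ->
        #|[set y : mrep F Q u' | sss y && [forall c, J' (source c) *m y c == y0 c *m J' (target c)]]|
        = (#|[set y : mrep F Q w | sss y]| * #|F| ^ eula Q w k)%N.
      by move=> -> J'; apply: card_fiber_reps.
    by rewrite /SY (aux u ukw J Jf).
  rewrite (partition_big (fun t => t.1.2) (fun y => y \in SY)) /=; last first.
    move=> t; rewrite !inE => /andP[/and3P[_ ys /forallP tE] /eqP tA]; rewrite ys; apply/forallP => c.
    have := congr1 (mulmx (K (source c))) (eqP (tE c)); rewrite mulmxDr !mulmxA Kf0 mul0mx addr0 tA.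
    by rewrite Ky -mulmxA !ffunE => ->.
  rewrite -sum_nat_const; apply: eq_bigr => y; rewrite inE => /andP[ys /forallP yJ].
  transitivity #|[set z : crep F Q v u | [forall c, f (source c) *m z c == x c *m A (target c) - A (source c) *m y c]]|.
    have zi : injective (fun z : crep F Q v u => ((A, y), z)) by move=> z z' [].
    rewrite sum1dep_card -(card_imset _ zi); apply: eq_card => t; rewrite !inE.
    apply/andP/imsetP => [[/andP[/and3P[_ _ /forallP tE] /eqP tA] /eqP ty]|[z]].
      exists t.2; last by rewrite -tA -ty -!surjective_pairing.
      rewrite inE; apply/forallP => c; have := tE c; rewrite tA ty => /eqP ->.
      by rewrite addrC addKr.
    rewrite inE => /forallP zE ->; rewrite /= !eqxx andbT ys /=; split=> //.
    apply/andP; split; first by apply/forallP => i; rewrite row_free_fiber.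
    by apply/forallP => c; rewrite (eqP (zE c)) addrC subrK.
  rewrite (card_dffun_forall (fun c (z : 'M[F]_(v (source c), u (target c))) =>
    f (source c) *m z == x c *m A (target c) - A (source c) *m y c)).
  rewrite /eula expn_sum; apply: eq_bigr => c _.
  have [z0 z0E] : exists z, f (source c) *m z = x c *m A (target c) - A (source c) *m y c.
    apply: kermx_solve; have /submxP[D ->] : (kermx (f (source c)) <= K (source c))%MS by rewrite Kker.
    have JE i : J i = K i *m A i by rewrite ffunE.
    have := eqP (yJ c); rewrite !JE mulmxA => E.
    by rewrite -mulmxA mulmxBr !mulmxA Ky E subrr mulmx0.
  rewrite (card_mulmx_eq z0E); congr (_ ^ (_ * _))%N.
  by rewrite -mxrank_ker rK.
have -> : (#|S| * (#|[set y : mrep F Q w | sss y]| * #|F| ^ eula Q w k * #|F| ^ eula Q k u)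
    * (gv w #|F| * #|F| ^ eulv w k) = #|S| * (gv w #|F| * #|F| ^ eulv w k) *
    (#|[set y : mrep F Q w | sss y]| * #|F| ^ eula Q w k * #|F| ^ eula Q k u))%N by ring.
suff -> : (#|S| * (gv w #|F| * #|F| ^ eulv w k)
  = gv u #|F| * #|F| ^ (\sum_i (v i - k i) * u i))%N by ring.
rewrite /S (card_dffun_forall (fun i (A : 'M[F]_(v i, u i)) => row_free (K i *m A))).
rewrite /gv /eulv !expn_sum -!big_split; apply: eq_bigr => i _ /=.
have : u i = (k i + w i)%N by rewrite ukw.
by move: (u i) => _ ->; apply: card_row_free_mul.
Qed.

End Fiber.
End OneField.
End Nilpotent.

Section EndoConj.
Variables (n : nat) (Q : quiver n) (F : fieldType).
Variable a : 'I_n -> nat.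
Implicit Types (x : mrep F Q a) (f g h : vfam F a a).

Lemma conjv_inj g : unitf g -> injective (conjv g).
Proof.
move=> /forallP gu x y /ffunP xy; apply/ffunP => c; have := xy c; rewrite !ffunE.
move/(can_inj (mulmxKV (gu _))); exact: (can_inj (mulKmx (gu _))).
Qed.

Lemma nilpf_conj g f : unitf g -> nilpf (conjv g f) = nilpf f.
Proof.
by move=> /forallP gu; apply: eq_forallb => i; rewrite ffunE nilpm_conj.
Qed.

Lemma endof_conj g x f : unitf g -> endof (conj g x) (conjv g f) = endof x f.
Proof.
move=> /forallP gu; apply: eq_forallb => c; rewrite !ffunE.
have gs := gu (source c); have gt := gu (target c).
have E (A B : 'M_(a (source c), a (target c))) :
    (g (source c) *m A *m invmx (g (target c)) == g (source c) *m B *m invmx (g (target c))) = (A == B).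
  apply/eqP/eqP => [|-> //]; move/(congr1 (fun M => invmx (g (source c)) *m M *m g (target c))).
  by rewrite !mulmxA !mulVmx // !mul1mx !mulmxKV.
by rewrite -[RHS]E !mulmxA !mulmxKV.
Qed.

End EndoConj.

Lemma fiber_ratio_arith (X u w q A s B C : rat) : u != 0 -> w != 0 -> q != 0 ->
  X * (w * q) = u * A * s * B * C -> X / u = s / w * (A * B * C / q).
Proof.
move=> u0 w0 q0 E; apply: (mulIf (mulf_neq0 w0 q0)).
have -> : X / u * (w * q) = X * (w * q) / u by ring.
rewrite E; field; by rewrite u0 w0 q0.
Qed.

(** * The recursion over the kernel of a nilpotent endomorphism *)

Section NilpotentCount.
Variables (n : nat) (Q : quiver n) (l : 'I_n -> rat).

Section OneField.
Variable F : finFieldType.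
Local Notation nset := (@nset n Q l F).
Local Notation sss := (@sss n Q l F _).
Local Notation lam := (lam l).

Definition nstd u v : {set mrep F Q (dimD u v) * vfam F (dimD u v) (dimD u v)} :=
  [set p | [&& sss p.1, endof p.1 p.2, nilpf p.2 &
    [forall i, (kermx (p.2 i) == stdf F u v i)%MS]]].

Lemma card_nset_nstd u v :
  (#|nset (dimD u v) u| * (gv u #|F| * gv v #|F| * #|F| ^ eulv v u)
   = gv (dimD u v) #|F| * #|nstd u v|)%N.
Proof.
rewrite -(card_unitf F (dimD u v)).
apply: (@double_count _ _ _ _ _ (fun g p => (conj g p.1, conjv g p.2))).
- move=> g; rewrite inE => gu [x f] [y h] [].
  by move=> /(conj_inj gu) -> /(conjv_inj gu) ->.
- move=> g [x f]; rewrite !inE /= => gu.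
  rewrite sss_conj // endof_conj // nilpf_conj // => /and4P[-> -> -> /forallP kf] /=.
  apply/forallP => i; rewrite mxrank_ker; apply/eqP.
  have := eqmx_rank (kf i); rewrite mxrank_ker rank_row_mx0 mxrank1 ffunE => <-.
  have gi := forallP gu i.
  by rewrite mxrankMfree ?row_free_unit ?unitmx_inv // (eqmxMfull _ (_ : row_full (g i))) // row_full_unit.
move=> [x f]; rewrite inE /= => /and4P[xs xf fn /forallP kf].
pose U : vfam F (dimD u v) (dimD u v) := finfun (fun i => kermx (f i)).
rewrite -(@card_stab_stdf n F u v U); last first.
  by apply: functional_extensionality => i; rewrite /rk ffunE; apply/eqP.
apply: eq_card => g; rewrite !inE; case gu: (unitf g) => //=.
rewrite sss_conj // endof_conj // nilpf_conj // xs xf fn /=.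
apply: eq_forallb => i; rewrite !ffunE; have gi := forallP gu i.
have kE : (kermx (g i *m f i *m invmx (g i)) *m g i :=: kermx (f i))%MS.
  apply/eqmxP/andP; split.
    have := mulmx_ker (g i *m f i *m invmx (g i)); set E := kermx _ => /(congr1 (mulmx^~ (g i))).
    by rewrite !mulmxA mulmxKV // mul0mx sub_kermx => ->.
  rewrite -{1}[kermx (f i)](mulmxKV gi); apply: submxMr; rewrite sub_kermx !mulmxA mulmxKV //.
  by rewrite mulmx_ker mul0mx.
have E : (stdf F u v i *m g i == kermx (f i))%MS
       = (stdf F u v i *m g i == kermx (g i *m f i *m invmx (g i)) *m g i)%MS by rewrite !kE.
by rewrite E !submxMfree ?row_free_unit // andbC.
Qed.

Lemma block_endof u v (y : mrep F Q u) (x : mrep F Q v) (z : crep F Q v u)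
  (A : {dffun forall i, 'M[F]_(v i, u i)}) (f : vfam F v v) :
  endof (bmx y x z) (finfun (fun i => block_mx 0 0 (A i) (f i) : 'M_(dimD u v i)))
  = endof x f && [forall c, x c *m A (target c) == A (source c) *m y c + f (source c) *m z c].
Proof.
rewrite /endof; apply/forallP/andP => [H|[/forallP H1 /forallP H2] c].
  split; apply/forallP => c; have := H c; rewrite !ffunE !mulmx_block;
  rewrite ?mul0mx ?mulmx0 ?add0r ?addr0 => /eqP /eq_block_mx[_ _ E1 E2].
    exact/eqP.
  exact/eqP.
rewrite !ffunE !mulmx_block ?mul0mx ?mulmx0 ?add0r ?addr0.
by rewrite (eqP (H1 c)) (eqP (H2 c)).
Qed.

Definition nall v : {set mrep F Q v * vfam F v v} :=
  [set p | [&& sss p.1, endof p.1 p.2 & nilpf p.2]].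

(** With its kernel in standard position, the endomorphism has only the blocks A and f. The kernel
    has weight 0, so the representation is semistable iff its two diagonal blocks are. *)
Lemma card_nstd u v : #|nstd u v| = (\sum_(p in nall v) #|fiber l u p.1 p.2|)%N.
Proof.
pose h (t : (mrep F Q v * vfam F v v) *
   (({dffun forall i, 'M[F]_(v i, u i)} * mrep F Q u) * crep F Q v u)) :=
  (bmx t.2.1.2 t.1.1 t.2.2,
   finfun (fun i => block_mx 0 0 (t.2.1.1 i) (t.1.2 i) : 'M_(dimD u v i)) : vfam F (dimD u v) (dimD u v)).
have hi : injective h.
  move=> [[x f] [[A y] z]] [[x' f'] [[A' y'] z']] [/= /bmx_inj[-> -> ->] /ffunP E].
  suff [-> ->] : A = A' /\ f = f' by [].
  by split; apply/ffunP => i; have := E i; rewrite !ffunE => /eq_block_mx[].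
have -> : (\sum_(p in nall v) #|fiber l u p.1 p.2|)%N =
  #|[set t | (t.1 \in nall v) && (t.2 \in fiber l u t.1.1 t.1.2)]|.
  rewrite -sum1dep_card -(pair_big_dep (fun p => p \in nall v) (fun p t => t \in fiber l u p.1 p.2) (fun _ _ => 1%N)) /=.
  by apply: eq_bigr => p _; rewrite sum1_card.
rewrite -(card_imset _ hi); apply: eq_card => -[w g]; apply/idP/imsetP.
  rewrite inE /= => /and4P[ws wg gn /forallP kg].
  have wstd : stab w (stdf F u v).
    by apply: stab_eq (stab_ker wg); apply/forallP => i; have /andP[] := kg i.
  have u0 : lam u = 0.
    rewrite -[RHS](lam_ker ws wg); congr lam; apply: functional_extensionality => i.
    by rewrite /rk (eqmx_rank (kg i)) rank_row_mx0 mxrank1.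
  have [y [x [z wE]]] := stab_stdfP _ wstd.
  pose A : {dffun forall i, 'M[F]_(v i, u i)} := finfun (fun i => dlsubmx (g i : 'M_(u i + v i, u i + v i))).
  pose f : vfam F v v := finfun (fun i => drsubmx (g i : 'M_(u i + v i, u i + v i))).
  have gE : g = finfun (fun i => block_mx 0 0 (A i) (f i) : 'M_(dimD u v i)).
    apply/ffunP => i; rewrite !ffunE; have /andP[_] := kg i.
    rewrite sub_kermx /stdf; move: (g i : 'M_(u i + v i)) => G.
    rewrite -[in X in X -> _](submxK G) mul_row_block !mul1mx !mul0mx !addr0 -row_mx0.
    by move=> /eqP /eq_row_mx[ul0 ur0]; rewrite -[LHS]submxK ul0 ur0.
  exists ((x, f), ((A, y), z)); last by rewrite /h /= -wE -gE.
  move: wg ws; rewrite wE gE block_endof sss_bmx // => /andP[xf xA] /andP[ys xs].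
  rewrite !inE /= xs xf xA ys /= andbT; apply/andP; split.
    by apply/forallP => i; have := forallP gn i; rewrite gE ffunE nilpm_block.
  apply/forallP => i; rewrite -kermx_eq0 -submx0.
  have /andP[kg1 _] := kg i; set E := kermx _.
  have : (row_mx 0 E <= kermx (g i))%MS.
    rewrite sub_kermx gE ffunE mul_row_block !mul0mx !add0r -mul_mx_row.
    by rewrite mulmx_ker.
  move=> /submx_trans /(_ kg1) /submxP[D]; rewrite mul_mx_row mulmx1 mulmx0.
  by case/eq_row_mx=> _ ->.
case=> -[[x f] [[A y] z]]; rewrite !inE /= => /andP[/and3P[xs xf fn] /and3P[Af ys xA]] [-> ->].
rewrite block_endof xf xA sss_bmx ?xs ?ys /=; last by case/andP: ys => _ /eqP.
apply/andP; split; first by apply/forallP => i; rewrite ffunE nilpm_block; apply: (forallP fn).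
apply/forallP => i; rewrite ffunE; apply/andP; split; last first.
  by rewrite sub_kermx mul_row_block !mul1mx !mul0mx !addr0 row_mx0.
set E := kermx _; have : E *m block_mx 0 0 (A i) (f i) = 0 by exact: mulmx_ker.
rewrite -{1}[E](@hsubmxK F _ (u i) (v i)) mul_row_block !mulmx0 !add0r -mul_mx_row.
move/eqP; rewrite -sub_kermx; have := forallP Af i; rewrite -kermx_eq0 => /eqP ->.
rewrite submx0 => /eqP E0; rewrite -[E](@hsubmxK F _ (u i) (v i)) E0.
by apply/submxP; exists (lsubmx E); rewrite mul_mx_row mulmx1 mulmx0.
Qed.

Definition sscount a : rat := #|[set x : mrep F Q a | sss x]|%:R / (gv a #|F|)%:R.
Definition ncount a u : rat := #|nset a u|%:R / (gv a #|F|)%:R.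

Lemma card_fiber_ratio u v (x : mrep F Q v) f : sss x -> endof x f ->
  (forall i, \rank (kermx (f i)) <= u i)%N ->
  let k := rk (fun i => kermx (f i)) in
  #|fiber l u x f|%:R / (gv u #|F|)%:R =
  sscount (dimB u k) * ((#|F| ^ (\sum_i (v i - k i) * u i))%:R * (#|F| ^ eula Q (dimB u k) k)%:R
   * (#|F| ^ eula Q k u)%:R / (#|F| ^ eulv (dimB u k) k)%:R).
Proof.
move=> xs xf ku k; have uE : u = dimD k (dimB u k) by rewrite dimDB.
have Kk i : (row_base (kermx (f i)) :=: kermx (f i))%MS by exact: eq_row_base.
have := card_fiber uE xs xf Kk (fun i => row_base_free _) => /(congr1 (fun N => N%:R : rat)).
rewrite !natrM /sscount => E.
by apply: fiber_ratio_arith E; rewrite ?gv_neq0 ?cardF_neq0.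
Qed.

End OneField.
End NilpotentCount.

Lemma ncount_arith (N u v q g S : rat) : N * (u * v * q) = g * S ->
  u != 0 -> v != 0 -> g != 0 -> q != 0 -> N / g = S / u / v / q.
Proof.
move=> E u0 v0 g0 q0; apply: (mulIf (mulf_neq0 (mulf_neq0 u0 v0) q0)).
have -> : N / g * (u * v * q) = N * (u * v * q) / g by ring.
by rewrite E; field; rewrite u0 v0 q0.
Qed.

Lemma mul_divKA (N g h S : rat) : g != 0 -> N * (g * S) / g / h = N / h * S.
Proof. by move=> g0; rewrite mulrCA [g * _]mulrC mulfK // mulrAC. Qed.

Section NilpotentRational.
Variables (n : nat) (Q : quiver n) (l : 'I_n -> rat).
Local Notation nset := (@nset n Q l).
Local Notation nall := (@nall n Q l).
Local Notation nstd := (@nstd n Q l).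
Local Notation ncount := (@ncount n Q l).
Local Notation sscount := (@sscount n Q l).

Definition fiber_weight u v k (q : nat) : rat :=
  (q ^ (\sum_i (v i - k i) * u i))%:R * (q ^ eula Q (dimB u k) k)%:R
   * (q ^ eula Q k u)%:R / (q ^ eulv (dimB u k) k)%:R.

Lemma isrf_fiber_weight u v k : isrf (fiber_weight u v k).
Proof. by repeat apply: isrf_mul; try apply: isrf_natXV; apply: isrf_natX. Qed.

Lemma sum_nall (F : finFieldType) a (E : mrep F Q a * vfam F a a -> nat) :
  (\sum_(p in nall F a) E p = \sum_(b : {ffun 'I_n -> 'I_(ht a).+1}) \sum_(p in nset F a (bdim b)) E p)%N.
Proof.
have -> : nall F a = \bigcup_(b : {ffun 'I_n -> 'I_(ht a).+1}) nset F a (bdim b).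
  apply/setP => p; rewrite inE; apply/idP/bigcupP => [/and3P[p1 p2 p3]|[b _]]; last first.
    by rewrite inE => /and4P[-> -> ->].
  exists [ffun i => inord (\rank (kermx (p.2 i)))] => //; rewrite inE p1 p2 p3 /=.
  apply/forallP => i; rewrite /bdim ffunE inordK // ltnS.
  exact: leq_trans (rank_leq_row _) (leq_ht _ _).
apply: partition_disjoint_bigcup.
move=> b b' bb'; rewrite -setI_eq0; apply/eqP/setP => p; rewrite !inE.
apply: negbTE; apply/negP => /andP[/and4P[_ _ _ /forallP rb] /and4P[_ _ _ /forallP rb']].
case/negP: bb'; apply/eqP/ffunP => i; apply/val_inj; rewrite /=.
by have := rb i; have := rb' i; rewrite /bdim => /eqP <- /eqP <-.
Qed.

(** Here b is the dimension of the kernel of the map induced by phi on the quotient by ker phi, that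
    is of ker phi^2 / ker phi. The map phi embeds this space in ker phi, whence the condition b <=
    u. *)
Lemma ncount_rec (F : finFieldType) u v :
  ncount F (dimD u v) u =
  (\sum_(b : {ffun 'I_n -> 'I_(ht v).+1} | [forall i, b i <= u i]%N)
     ncount F v (bdim b) * (sscount F (dimB u (bdim b)) * fiber_weight u v (bdim b) #|F|))
  / (#|F| ^ eulv v u)%:R.
Proof.
have g0 a := @gv_neq0 n a F; have g3 := cardF_neq0 F (eulv v u).
have := congr1 (fun N => N%:R : rat) (card_nset_nstd Q l F u v); rewrite !natrM => E.
have -> : ncount F (dimD u v) u = #|nstd F u v|%:R / (gv u #|F|)%:R / (gv v #|F|)%:R / (#|F| ^ eulv v u)%:R.
  rewrite /ncount; move: E (g0 u) (g0 v) (g0 (dimD u v)) g3.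
  by apply: ncount_arith.
congr (_ / _); rewrite card_nstd sum_nall natr_sum !mulr_suml [RHS]big_mkcond.
apply: eq_bigr => b _; case: ifP => [/forallP bu|/negP nbu]; last first.
  rewrite big1 ?mul0r // => -[x f]; rewrite inE /= => /and4P[xs xf fn /forallP rb].
  apply/eqP; rewrite cards_eq0 -subset0; apply/subsetP => -[[A y] z]; rewrite !inE /=.
  case/and3P=> /forallP Af _ _; case: nbu; apply/forallP => i.
  have := rb i; rewrite /bdim => /eqP <-.
  have := row_free_fiber (K := fun i => row_base (kermx (f i))) (fun i => eq_row_base _) (fun i => row_base_free _) (A i).
  by rewrite Af => /esym /eqP {1}<-; apply: rank_leq_col.
have fE p : p \in nset F v (bdim b) -> #|fiber l u p.1 p.2|%:R =
   (gv u #|F|)%:R * (sscount F (dimB u (bdim b)) * fiber_weight u v (bdim b) #|F|) :> rat.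
  case: p => x f; rewrite inE /= => /and4P[xs xf fn /forallP rb].
  have kE : rk (fun i => kermx (f i)) = bdim b.
    by apply: functional_extensionality => i; apply/eqP/rb.
  have ku i : (\rank (kermx (f i)) <= u i)%N by have /eqP -> := rb i; apply: bu.
  have := card_fiber_ratio xs xf ku; rewrite /= kE -/(fiber_weight u v (bdim b) #|F|) => <-.
  by rewrite mulrC divfK.
rewrite natr_sum (eq_bigr _ fE) sumr_const -[_ *+ #|nset F v _|]mulr_natl /ncount.
exact: mul_divKA.
Qed.

Lemma sscount_isrf a : exists2 r, isrf r & forall F, sscount F a = r #|F|.
Proof.
have [la|la] := eqVneq (lam l a) 0.
  have [r [s [rr _ H]]] := fss_tss_isrf Q l a; exists r => // F; have [E _] := H F; rewrite -E.
  rewrite /sscount /fcount; congr (_%:R / _); apply: eq_card => x.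
  by rewrite !inE /sss la eqxx andbT.
exists (fun=> 0) => [|F]; first exact: isrf_const.
rewrite /sscount (_ : [set x | _] = set0) ?cards0 ?mul0r //.
by apply/setP => x; rewrite !inE /sss (negbTE la) andbF.
Qed.

(** A nilpotent endomorphism of a nonzero space has a nonzero kernel, so u = 0 contributes nothing
    unless a = 0; otherwise the recursion descends from a to a - u. *)
Lemma ncount_isrf a u : exists2 r, isrf r & forall F, ncount F a u = r #|F|.
Proof.
have [m] := ubnP (ht a); elim: m a u => // m IHm a u; rewrite ltnS => am.
have empty : (forall F, nset F a u = set0) -> exists2 r, isrf r & forall F, ncount F a u = r #|F|.
  move=> n0; exists (fun=> 0) => [|F]; first exact: isrf_const.
  by rewrite /ncount n0 cards0 mul0r.
have [/forallP ua|nua] := boolP [forall i, u i <= a i]%N; last first.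
  apply: empty => F; apply/setP => p; rewrite !inE; apply: negbTE; apply/negP.
  case/and4P=> _ _ _ /forallP rp; case/negP: nua; apply/forallP => i.
  by have /eqP <- := rp i; apply: rank_leq_row.
have [u0|un0] := posnP (ht u).
  have [/ht_eq0 a0|an0] := posnP (ht a).
    exists (fun=> 1) => [|F]; first exact: isrf_const.
    rewrite /ncount a0 (_ : nset _ _ _ = setT); last first.
      apply/setP => -[x f]; rewrite !inE /=.
      have rk0 mm (U : forall i, 'M[F]_(mm i, @dim0 n i)) : rk U = @dim0 n.
        by apply: functional_extensionality => i; apply/eqP; rewrite -leqn0; apply: rank_leq_col.
      apply/and4P; split.
      - by rewrite /sss lam0 eqxx andbT; apply/fssP => mm U _; rewrite rk0 lam0.
      - by apply/forallP => c; apply/eqP/matrixP => -[].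
      - by apply/forallP => i; apply/eqP/matrixP => -[].
      - by apply/forallP => i; rewrite -[\rank _]/(rk (fun i => kermx (f i)) i) rk0 (ht_eq0 u0).
    rewrite cardsT card_prod !card_dffun !big1 => [|i _|c _]; try by rewrite card_mx.
    by rewrite (_ : gv _ _ = 1%N) ?divr1 //; apply: big1 => i _; rewrite /gln big_geq.
  apply: empty => F; apply/setP => -[x f]; rewrite !inE /=; apply: negbTE; apply/negP.
  case/and4P=> _ _ /forallP fn /forallP rp.
  have [i ai] : exists i, (0 < a i)%N.
    apply/existsP; rewrite -[[exists i, _]]negbK negb_exists; apply/negP => /forallP a0.
    by move: an0; rewrite /ht big1 // => i _; apply/eqP; have := a0 i; rewrite lt0n negbK.
  have fu : f i \in unitmx.
    have := rp i; rewrite mxrank_ker (ht_eq0 u0) subn_eq0 => rf.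
    by rewrite -row_free_unit /row_free eqn_leq rank_leq_row.
  have := fn i; rewrite /nilpm => /eqP fi0.
  have fju j : f i ^+ j \in unitmx.
    elim: j => [|j IH]; first by rewrite expr0 unitmx1.
    by rewrite exprS unitmx_mul fu.
  have := fju (a i).
  move: ai; rewrite fi0; case: (a i) => // j _.
  by rewrite unitmxE det0 unitr0.
have aE : a = dimD u (dimB a u) by rewrite dimDB.
have vlt : (ht (dimB a u) < m)%N.
  by apply: leq_trans am; rewrite [in X in (_ < X)%N]aE htD -[X in (X < _)%N]add0n ltn_add2r.
have [R RP] : exists R : {ffun 'I_n -> 'I_(ht (dimB a u)).+1} -> nat -> rat,
    forall b, isrf (R b) /\ forall F, ncount F (dimB a u) (bdim b) = R b #|F|.
  apply: (@dependent_choice _ (fun=> nat -> rat) (fun b r => isrf r /\ forall F, ncount F (dimB a u) (bdim b) = r #|F|)).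
  by move=> b; have [r rr rE] := IHm _ (bdim b) vlt; exists r.
have [S SP] : exists S : {ffun 'I_n -> 'I_(ht (dimB a u)).+1} -> nat -> rat,
    forall b, isrf (S b) /\ forall F, sscount F (dimB u (bdim b)) = S b #|F|.
  apply: (@dependent_choice _ (fun=> nat -> rat) (fun b r => isrf r /\ forall F, sscount F (dimB u (bdim b)) = r #|F|)).
  by move=> b; have [r rr rE] := sscount_isrf (dimB u (bdim b)); exists r.
exists (fun q => (\sum_(b : {ffun 'I_n -> 'I_(ht (dimB a u)).+1} | [forall i, b i <= u i]%N)
  R b q * (S b q * fiber_weight u (dimB a u) (bdim b) q)) * (q ^ eulv (dimB a u) u)%:R^-1).
  apply: isrf_mul (isrf_natXV _); apply: isrf_sum => b _.
  by apply: isrf_mul (RP b).1 (isrf_mul (SP b).1 (isrf_fiber_weight _ _ _)).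
move=> F; rewrite {1}aE ncount_rec; congr (_ / _); apply: eq_bigr => b _.
by rewrite (RP b).2 (SP b).2.
Qed.

Definition nilcount (F : finFieldType) a : rat := #|nall F a|%:R / (gv a #|F|)%:R.

Lemma nilcount_isrf a : exists2 r, isrf r & forall F, nilcount F a = r #|F|.
Proof.
have [R RP] : exists R : {ffun 'I_n -> 'I_(ht a).+1} -> nat -> rat,
    forall b, isrf (R b) /\ forall F, ncount F a (bdim b) = R b #|F|.
  apply: (@dependent_choice _ (fun=> nat -> rat) (fun b r => isrf r /\ forall F, ncount F a (bdim b) = r #|F|)).
  by move=> b; have [r rr rE] := ncount_isrf a (bdim b); exists r.
exists (fun q => \sum_b R b q); first by apply: isrf_sum => b _; case: (RP b).
move=> F; rewrite /nilcount -sum1_card sum_nall natr_sum mulr_suml; apply: eq_bigr => b _.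
by rewrite -(RP b).2 sum1_card.
Qed.

End NilpotentRational.

(** * Endomorphisms with f(phi) nilpotent *)

(* horner_mx is restricted to matrices of positive size *)
Section HornerMatrix.
Variable F : fieldType.
Implicit Types p : {poly F}.

Definition hmx n p (A : 'M[F]_n) : 'M[F]_n := \sum_(j < size p) p`_j *: A ^+ j.

Lemma hmxE n p (A : 'M[F]_n.+1) : hmx p A = horner_mx A p.
Proof.
rewrite /horner_mx /horner_morph horner_coef size_map_poly; apply: eq_bigr => j _.
by rewrite coef_map /= -mul_scalar_mx.
Qed.

Lemma hmx0 n (A : 'M[F]_n) : hmx 0 A = 0.
Proof. by rewrite /hmx size_poly0 big_ord0. Qed.

Lemma hmxD n p q (A : 'M[F]_n) : hmx (p + q) A = hmx p A + hmx q A.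
Proof. by case: n A => [|n] A; rewrite ?[LHS]flatmx0 ?[RHS]flatmx0 // !hmxE rmorphD. Qed.

Lemma hmxB n p q (A : 'M[F]_n) : hmx (p - q) A = hmx p A - hmx q A.
Proof. by case: n A => [|n] A; rewrite ?[LHS]flatmx0 ?[RHS]flatmx0 // !hmxE rmorphB. Qed.

Lemma hmxM n p q (A : 'M[F]_n) : hmx (p * q) A = hmx p A *m hmx q A.
Proof. by case: n A => [|n] A; rewrite ?[LHS]flatmx0 ?[RHS]flatmx0 // !hmxE rmorphM. Qed.

Lemma hmxX n (A : 'M[F]_n) : hmx 'X A = A.
Proof. by case: n A => [|n] A; rewrite ?[LHS]flatmx0 ?[RHS]flatmx0 // !hmxE horner_mx_X. Qed.

Lemma hmxC n c (A : 'M[F]_n) : hmx c%:P A = c%:M.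
Proof. by case: n A => [|n] A; rewrite ?[LHS]flatmx0 ?[RHS]flatmx0 // !hmxE horner_mx_C. Qed.

Lemma hmx_exp n p N (A : 'M[F]_n) : hmx (p ^+ N) A = hmx p A ^+ N.
Proof. by elim: N => [|N IH]; rewrite ?expr0 ?hmxC // !exprS hmxM IH. Qed.

Lemma hmxXn n N (A : 'M[F]_n) : hmx 'X^N A = A ^+ N.
Proof. by rewrite hmx_exp hmxX. Qed.

Lemma hmx_comp n p N (A : 'M[F]_n) : hmx (p \Po 'X^N) A = hmx p (A ^+ N).
Proof.
elim/poly_ind: p => [|p c IH]; first by rewrite comp_poly0 !hmx0.
by rewrite comp_polyD comp_polyM comp_polyX comp_polyC !hmxD !hmxM IH hmxXn hmxX !hmxC.
Qed.

Lemma hmx_comm m n p (A : 'M[F]_m) (B : 'M[F]_n) (x : 'M[F]_(m, n)) :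
  A *m x = x *m B -> hmx p A *m x = x *m hmx p B.
Proof.
move=> AB; elim/poly_ind: p => [|p c IH]; first by rewrite !hmx0 mul0mx mulmx0.
by rewrite !hmxD !hmxM !hmxX !hmxC mulmxDl mulmxDr -mulmxA AB !mulmxA IH scalar_mxC.
Qed.

Lemma hmx_conj n p (g A : 'M[F]_n) : g \in unitmx ->
  hmx p (g *m A *m invmx g) = g *m hmx p A *m invmx g.
Proof.
move=> gu; have := @hmx_comm n n p (g *m A *m invmx g) A g; rewrite mulmxKV // => /(_ erefl) <-.
by rewrite mulmxK.
Qed.

Lemma exp_conj n N (g A : 'M[F]_n) : g \in unitmx ->
  (g *m A *m invmx g) ^+ N = g *m A ^+ N *m invmx g.
Proof. by move=> gu; rewrite -!hmxXn hmx_conj. Qed.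

Lemma nilpm_mul_comm n (A B : 'M[F]_n) : A *m B = B *m A -> nilpm A -> nilpm (A *m B).
Proof.
move=> AB /nilpmP[N A0]; apply/nilpmP; exists N.
have -> : (A *m B) ^+ N = A ^+ N *m B ^+ N by apply: exprMn_comm.
by rewrite A0 mul0mx.
Qed.

Lemma nilpm_hmx_mul n p q (A : 'M[F]_n) : nilpm (hmx p A) -> nilpm (hmx (p * q) A).
Proof. by rewrite hmxM; apply: nilpm_mul_comm; rewrite -!hmxM mulrC. Qed.

End HornerMatrix.

Lemma linear_rV_mx (K : fieldType) m n (T : 'rV[K]_m -> 'rV[K]_n) : linear T ->
  exists A, forall v, T v = v *m A.
Proof.
move=> Tl; pose mT := GRing.isLinear.Build K _ _ _ T Tl.
pose L : {linear 'rV[K]_m -> 'rV[K]_n} := HB.pack T mT.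
by exists (lin1_mx L) => v; rewrite mul_rV_lin1.
Qed.

Lemma row_ext (F : fieldType) m n (A B : 'M[F]_(m, n)) :
  (forall v : 'rV_m, v *m A = v *m B) -> A = B.
Proof. by move=> AB; apply/row_matrixP => i; rewrite !rowE. Qed.

(** * Restriction of scalars *)

Section Restriction.
Variables (k K : fieldType) (iota : {rmorphism k -> K}) (z : K) (e : nat).
Variable co : K -> 'rV[k]_e.
Let phi (v : 'rV[k]_e) : K := \sum_j iota (v 0 j) * z ^+ j.
Hypotheses (phiK : cancel phi co) (coK : cancel co phi).

Let phiD u v : phi (u + v) = phi u + phi v.
Proof. by rewrite -big_split; apply: eq_bigr => j _; rewrite mxE rmorphD mulrDl. Qed.

Let phiZ c v : phi (c *: v) = iota c * phi v.
Proof. by rewrite mulr_sumr; apply: eq_bigr => j _; rewrite mxE rmorphM mulrA. Qed.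

Let coD x y : co (x + y) = co x + co y.
Proof. by apply: (can_inj phiK); rewrite phiD !coK. Qed.

Let coZ c x : co (iota c * x) = c *: co x.
Proof. by apply: (can_inj phiK); rewrite phiZ !coK. Qed.

Definition flat m (v : 'rV[K]_m) : 'rV[k]_(m * e) := mxvec (\matrix_(i, j) co (v 0 i) 0 j).
Definition unflat m (w : 'rV[k]_(m * e)) : 'rV[K]_m :=
  \row_i \sum_j iota (vec_mx w i j) * z ^+ j.

Lemma flatK m : cancel (@flat m) (@unflat m).
Proof.
move=> v; apply/rowP => i; rewrite mxE /flat mxvecK -[RHS]coK /phi.
by apply: eq_bigr => j _; rewrite mxE.
Qed.

Lemma unflatK m : cancel (@unflat m) (@flat m).
Proof.
move=> w; rewrite /flat -[RHS]vec_mxK; congr mxvec; apply/matrixP => i j.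
transitivity (co (phi (row i (vec_mx w))) 0 j); last by rewrite phiK mxE.
by rewrite mxE [unflat w 0 i]mxE; congr (co _ 0 j); apply: eq_bigr => j' _; rewrite !mxE.
Qed.

Lemma flatD m (u v : 'rV[K]_m) : flat (u + v) = flat u + flat v.
Proof. by rewrite /flat -linearD; congr mxvec; apply/matrixP => i j; rewrite !mxE coD mxE. Qed.

Lemma flatZ m c (v : 'rV[K]_m) : flat (iota c *: v) = c *: flat v.
Proof. by rewrite /flat -linearZ; congr mxvec; apply/matrixP => i j; rewrite !mxE coZ mxE. Qed.

Lemma unflatD m (u v : 'rV[k]_(m * e)) : unflat (u + v) = unflat u + unflat v.
Proof. by rewrite -[u in LHS]unflatK -[v in LHS]unflatK -flatD flatK. Qed.

Lemma unflatZ m c (v : 'rV[k]_(m * e)) : unflat (c *: v) = iota c *: unflat v.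
Proof. by rewrite -[v in LHS]unflatK -flatZ flatK. Qed.

(* Restriction of scalars along k -> K = k[z], in the k-basis of the powers of z. *)
Definition resmx m n (A : 'M[K]_(m, n)) : 'M[k]_(m * e, n * e) :=
  \matrix_i flat (unflat (delta_mx 0 i) *m A).

Lemma flat_resmx m n (A : 'M[K]_(m, n)) v : flat v *m resmx A = flat (v *m A).
Proof.
have Tl : linear (fun w : 'rV[k]_(m * e) => flat (unflat w *m A)).
  by move=> c u w; rewrite unflatD unflatZ mulmxDl -scalemxAl flatD flatZ.
have [B BE] := linear_rV_mx Tl.
suff -> : resmx A = B by rewrite -BE flatK.
by apply/row_matrixP => i; rewrite rowK BE rowE.
Qed.

Lemma resmx_ext m n (M N : 'M[k]_(m * e, n)) : (forall v : 'rV[K]_m, flat v *m M = flat v *m N) -> M = N.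
Proof. by move=> MN; apply: row_ext => w; rewrite -[w]unflatK MN. Qed.

Lemma resmxM m n p (A : 'M[K]_(m, n)) (B : 'M_(n, p)) : resmx (A *m B) = resmx A *m resmx B.
Proof. by apply: resmx_ext => v; rewrite mulmxA !flat_resmx mulmxA. Qed.

Lemma resmx1 m : resmx (1%:M : 'M_m) = 1%:M.
Proof. by apply: resmx_ext => v; rewrite flat_resmx !mulmx1. Qed.

Lemma resmxD m n (A B : 'M[K]_(m, n)) : resmx (A + B) = resmx A + resmx B.
Proof. by apply: resmx_ext => v; rewrite mulmxDr !flat_resmx -flatD mulmxDr. Qed.

Lemma resmxZ m n c (A : 'M[K]_(m, n)) : resmx (iota c *: A) = c *: resmx A.
Proof. by apply: resmx_ext => v; rewrite -scalemxAr !flat_resmx -flatZ scalemxAr. Qed.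

Lemma resmx0 m n : resmx (0 : 'M[K]_(m, n)) = 0.
Proof. by rewrite -[0](scale0r 0) -(rmorph0 iota) resmxZ scale0r. Qed.

Lemma resmx_inj m n : injective (@resmx m n).
Proof.
move=> A B AB; apply: row_ext => v; apply: (can_inj (@flatK n)).
by rewrite -!flat_resmx AB.
Qed.

Lemma resmxX m N (A : 'M[K]_m) : resmx (A ^+ N) = resmx A ^+ N.
Proof.
by elim: N => [|N IH]; [exact: resmx1 | rewrite !exprS -IH; exact: resmxM].
Qed.

Lemma resmx_hmx m p (A : 'M[K]_m) : resmx (hmx (map_poly iota p) A) = hmx p (resmx A).
Proof.
rewrite /hmx size_map_poly; elim/big_ind2: _ => [|A1 B1 A2 B2 <- <-|j _]; first exact: resmx0.
  exact: resmxD.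
by rewrite coef_map /= resmxZ resmxX.
Qed.

Lemma nilpm_resmx m (A : 'M[K]_m) : nilpm (resmx A) = nilpm A.
Proof.
apply/nilpmP/nilpmP => -[N AN]; exists N; last by rewrite -resmxX AN resmx0.
by apply: resmx_inj; rewrite resmxX AN resmx0.
Qed.

Lemma row_free_resmx m n (A : 'M[K]_(m, n)) : row_free A -> row_free (resmx A).
Proof. by case/row_freeP=> B AB; apply/row_freeP; exists (resmx B); rewrite -resmxM AB resmx1. Qed.

Lemma row_full_resmx m n (A : 'M[K]_(m, n)) : row_full A -> row_full (resmx A).
Proof. by case/row_fullP=> B AB; apply/row_fullP; exists (resmx B); rewrite -resmxM AB resmx1. Qed.

Lemma rank_resmx m n (A : 'M[K]_(m, n)) : \rank (resmx A) = (\rank A * e)%N.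
Proof.
rewrite -{1}(mulmx_base A) resmxM mxrankMfree; last exact/row_free_resmx/row_base_free.
exact/eqP/row_full_resmx/col_base_full.
Qed.

(** As z generates K over k, a k-linear map that commutes with multiplication by z is K-linear. *)
Lemma resmx_scalarP m n (M : 'M[k]_(m * e, n * e)) :
  (resmx z%:M *m M = M *m resmx z%:M) <-> exists A, M = resmx A.
Proof.
split=> [Mz|[A ->]]; last by rewrite -!resmxM scalar_mxC.
have Mzj j : resmx (z ^+ j)%:M *m M = M *m resmx (z ^+ j)%:M.
  elim: j => [|j IH]; first by rewrite !resmx1 mul1mx mulmx1.
  by rewrite !exprS !scalar_mxM !resmxM -mulmxA IH mulmxA Mz mulmxA.
have MK y : resmx y%:M *m M = M *m resmx y%:M.
  rewrite -[y]coK /phi; elim/big_ind: _ => [|a b Ma Mb|j _].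
  - by rewrite !raddf0 !resmx0 mul0mx mulmx0.
  - by rewrite !raddfD /= !resmxD mulmxDl mulmxDr Ma Mb.
  - by rewrite -!scale_scalar_mx !resmxZ -scalemxAl Mzj scalemxAr.
pose T v := unflat (flat v *m M).
have TZ c v : T (c *: v) = c *: T v.
  have flatS p (u : 'rV[K]_p) : flat (c *: u) = flat u *m resmx c%:M.
    by rewrite flat_resmx mul_mx_scalar.
  apply: (can_inj (@flatK n)); rewrite unflatK flatS -mulmxA MK mulmxA.
  by rewrite flatS unflatK.
have Tl : linear T by move=> c u v; rewrite -TZ /T flatD mulmxDl unflatD.
have [A AE] := linear_rV_mx Tl.
by exists A; apply: resmx_ext => v; rewrite flat_resmx -AE /T unflatK.
Qed.

End Restriction.

Lemma exprD_card_comm (K : finFieldType) n (A B : 'M[K]_n) N :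
  A *m B = B *m A -> (A + B) ^+ (#|K| ^ N) = A ^+ (#|K| ^ N) + B ^+ (#|K| ^ N).
Proof.
case: n A B => [|n] A B AB; first by rewrite [LHS]flatmx0 [RHS]flatmx0.
have [p pp pc] := finPcharP K.
have pM : p \in [pchar 'M[K]_n.+1] by rewrite pchar_lalg.
rewrite (card_pprimeChar pc) -expnM; elim: (_ * N)%N => [|j IH]; first by rewrite !expr1.
rewrite expnSr !exprM IH -!(pFrobenius_autE pM) pFrobenius_autD_comm //.
by apply: commrX; apply/commr_sym; apply: commrX; apply/commr_sym.
Qed.

(** * Matrices annihilated by f, and semisimple parts *)

Section SemisimplePart.
Variables (k K : finFieldType) (iota : {rmorphism k -> K}) (f : {poly k}) (z : K).
Hypotheses (fI : monic_irreducible_poly f) (fz : root (map_poly iota f) z).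
Local Notation e := (size f).-1.
Variable co : K -> 'rV[k]_e.
Let phi (v : 'rV[k]_e) : K := \sum_j iota (v 0 j) * z ^+ j.
Hypotheses (phiK : cancel phi co) (coK : cancel co phi).
Local Notation res := (resmx iota z co).
Local Notation flat := (@flat k K e co _).
Local Notation unflat := (@unflat k K iota z e _).

Lemma degree_gt0 : (0 < e)%N. Proof. by case: fI => [[]]; case: (size f) => [|[]]. Qed.
Let e0 := degree_gt0.

Lemma card_restriction : #|K| = (#|k| ^ e)%N.
Proof.
rewrite -[e]mul1n -card_mx; apply/esym/(@bij_eq_card _ _ phi).
by exists co.
Qed.

Lemma unitmx_resmx m (A : 'M[K]_m) : (res A \in unitmx) = (A \in unitmx).
Proof.
by rewrite -!row_free_unit /row_free (rank_resmx phiK coK) eqn_pmul2r.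
Qed.

Let polyP p : root (map_poly iota p) z -> f %| p.
Proof.
move=> pz; apply: contraTT pz; rewrite -irreducible_poly_coprime; last by case: fI.
by rewrite -(coprimep_map iota) => /coprimep_root /(_ fz).
Qed.

Let rV (y : K) : (map_poly iota (rVpoly (co y))).[z] = y.
Proof.
rewrite -[RHS]coK /phi (@horner_coef_wide _ e) ?size_map_poly ?size_poly //.
by apply: eq_bigr => j _; rewrite coef_map coef_rVpoly_ord.
Qed.

Section Structure.
Variables (m : nat) (s : 'M[k]_m).
Hypothesis fs : hmx f s = 0.

(** S turns k^m into a K-vector space on which z acts as s. This is consistent because f(s) = 0 and
    f divides every polynomial over k that vanishes at z. *)
Let S (y : K) : 'M[k]_m := hmx (rVpoly (co y)) s.

Let S_eq p q : f %| p - q -> hmx p s = hmx q s.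
Proof.
case/dvdpP=> g gE; apply/eqP; rewrite -subr_eq0 -hmxB gE hmxM fs.
by rewrite mulmx0.
Qed.

Let SE p : hmx p s = S (map_poly iota p).[z].
Proof. by apply: S_eq; apply: polyP; rewrite /root rmorphB hornerD hornerN /= rV subrr. Qed.

Let SM x y : S (x * y) = S x *m S y.
Proof. by have := SE (rVpoly (co x) * rVpoly (co y)); rewrite hmxM rmorphM hornerM /= !rV => <-. Qed.

Let SD x y : S (x + y) = S x + S y.
Proof. by have := SE (rVpoly (co x) + rVpoly (co y)); rewrite hmxD rmorphD hornerD /= !rV => <-. Qed.

Let SC c : S (iota c) = c%:M.
Proof. by have := SE c%:P; rewrite hmxC map_polyC hornerC /= => <-. Qed.

Let S1 : S 1 = 1%:M.
Proof. by rewrite -(rmorph1 iota) SC. Qed.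

Let Sz : S z = s.
Proof. by have := SE 'X; rewrite hmxX map_polyX hornerX => <-. Qed.

Let S0 : S 0 = 0.
Proof. by rewrite -(rmorph0 iota) SC raddf0. Qed.

Definition comb b (V : 'M[k]_(b, m)) (w : 'rV[K]_b) : 'rV[k]_m := \sum_i row i V *m S (w 0 i).

Let combD b (V : 'M_(b, m)) u w : comb V (u + w) = comb V u + comb V w.
Proof. by rewrite -big_split; apply: eq_bigr => i _; rewrite mxE SD mulmxDr. Qed.

Let combZ b (V : 'M_(b, m)) c w : comb V (c *: w) = comb V w *m S c.
Proof. by rewrite mulmx_suml; apply: eq_bigr => i _; rewrite mxE mulrC SM mulmxA. Qed.

Let comb_inj b (V : 'M_(b, m)) : (forall w, comb V w = 0 -> w = 0) -> injective (comb V).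
Proof.
move=> V0 u w uw; apply/eqP; rewrite -subr_eq0; apply/eqP/V0.
by rewrite combD -scaleN1r combZ uw -[X in X + _]mulmx1 -S1 -mulmxDr -SD subrr S0 mulmx0.
Qed.

Let inj_dim b (V : 'M_(b, m)) : injective (comb V) -> (b * e <= m)%N.
Proof.
move/leq_card; rewrite !card_mx !mul1n card_restriction -expnM leq_exp2l ?card_fin_gt1 //.
by rewrite mulnC.
Qed.

(** A K-basis found greedily: a vector outside the span of an independent family can be added to it,
    and the length b of an independent family satisfies b e <= m. *)
Let exists_bij : exists b, exists V : 'M[k]_(b, m), bijective (comb V).
Proof.
suff H d b (V : 'M_(b, m)) : injective (comb V) -> (m - b < d)%N ->
    exists b, exists V : 'M[k]_(b, m), bijective (comb V).
  by apply: (H m.+1 0%N 0); rewrite ?subn0 // => u w _; rewrite [u]thinmx0 [w]thinmx0.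
elim: d b V => // d IHd b V Vi; rewrite ltnS => md.
have [sV|/subsetPn[v _ vV]] := boolP ([set: 'rV[k]_m] \subset [set comb V w | w in [set: 'rV[K]_b]]).
  exists b, V; apply: inj_card_bij => //; rewrite -!cardsT -(card_imset _ Vi).
  exact: subset_leq_card.
have V'i : injective (comb (col_mx v V : 'M_(1 + b, m))).
  have cE w : comb (col_mx v V : 'M_(1 + b, m)) w
      = v *m S (lsubmx (w : 'rV_(1 + b)) 0 0) + comb V (rsubmx (w : 'rV_(1 + b))).
    rewrite /comb big_split_ord big_ord1; congr (_ + _).
      by rewrite rowKu [row _ v]row_id mxE; congr (_ *m S (w 0 _)); apply: val_inj.
    by apply: eq_bigr => i _; rewrite rowKd mxE.
  apply: comb_inj => w; rewrite cE; set c := lsubmx _ 0 0 => E.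
  have [c0|c0] := eqVneq c 0.
    move: E; rewrite c0 S0 mulmx0 add0r => E.
    have r0 : rsubmx (w : 'rV_(1 + b)) = 0.
      apply: Vi; rewrite E /comb big1 // => i _; by rewrite mxE S0 mulmx0.
    rewrite -[w](@hsubmxK _ _ 1 b) r0 -[RHS](@row_mx0 _ 1 1 b); congr row_mx.
    by apply/rowP => i; rewrite ord1 -/c c0 mxE.
  case/negP: vV; apply/imsetP; exists (- c^-1 *: rsubmx (w : 'rV_(1 + b))) => //.
  rewrite combZ; have -> : comb V (rsubmx (w : 'rV_(1 + b))) = - (v *m S c).
    by apply/eqP; rewrite -addr_eq0 addrC E.
  rewrite mulNmx -mulmxA -SM mulrN divff // -(rmorphN1 iota) SC mul_mx_scalar.
  by rewrite scaleN1r opprK.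
have := inj_dim V'i => bm.
have b1 : (b < m)%N.
  by apply: leq_trans bm; rewrite leq_pmulr.
apply: (IHd _ _ V'i); apply: leq_trans md; rewrite add1n subnS prednK ?subn_gt0 //.
Qed.

(** In coordinates with respect to a K-basis s becomes multiplication by z. The matrix g keeps the
    format b e by m, so that the equality of dimensions does not enter its type. *)
Lemma conj_scalar : exists b, exists2 g : 'M[k]_(b * e, m),
  m = (b * e)%N & row_free g /\ res z%:M *m g = g *m s.
Proof.
have [b [V Vb]] := exists_bij; have Vi := bij_inj Vb; exists b.
have Tl : linear (fun w : 'rV[k]_(b * e) => comb V (unflat w)).
  move=> c u w; rewrite (unflatD phiK coK) (unflatZ phiK coK) combD combZ SC mul_mx_scalar //.
have [g gE] := linear_rV_mx Tl; exists g.
  have := bij_eq_card Vb; rewrite !card_mx !mul1n card_restriction -expnM => /eqP.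
  by rewrite eqn_exp2l ?card_fin_gt1 // => /eqP <-; rewrite mulnC.
split.
  rewrite -kermx_eq0; apply/eqP/row_matrixP => i; rewrite row0.
  have : row i (kermx g) *m g = 0 *m g by rewrite -row_mul mulmx_ker row0 mul0mx.
  by rewrite -!gE => /Vi /(can_inj (@unflatK _ _ _ _ _ _ phiK _)).
apply: (resmx_ext phiK) => w; rewrite mulmxA (flat_resmx phiK coK) mulmxA -!gE !(flatK coK).
by rewrite mul_mx_scalar combZ Sz.
Qed.

End Structure.

Lemma conj_scalar_unit b (s : 'M[k]_(b * e)) : hmx f s = 0 ->
  exists2 g, g \in unitmx & res z%:M *m g = g *m s.
Proof.
case/conj_scalar=> b' [g /eqP]; rewrite eqn_pmul2r // => /eqP bb'; subst b' => -[gf gs].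
by exists g; rewrite // -row_free_unit.
Qed.

Lemma hmx_eq0_dim m (s : 'M[k]_m) : hmx f s = 0 -> (e %| m)%N.
Proof. by case/conj_scalar=> b [g mE _]; apply/dvdnP; exists b. Qed.

(** The invertible intertwiners form a coset of the centraliser of multiplication by z, which is
    GL_b(K). *)
Lemma card_conj_scalar b (s : 'M[k]_(b * e)) : hmx f s = 0 ->
  #|[set g | (g \in unitmx) && (res z%:M *m g == g *m s)]| = gln b #|K|.
Proof.
case/conj_scalar_unit=> g0 g0u g0s; rewrite -card_unitmx.
have hi : injective (fun A : 'M[K]_b => res A *m g0).
  by move=> A B /(can_inj (mulmxK g0u)) /(resmx_inj phiK coK).
rewrite -(card_imset _ hi); apply: eq_card => g; rewrite inE.
apply/andP/imsetP => [[gu /eqP gs]|[A]]; last first.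
  rewrite inE => Au ->; rewrite unitmx_mul unitmx_resmx Au g0u; split=> //.
  by apply/eqP; rewrite -[RHS]mulmxA -g0s !mulmxA -!(resmxM phiK coK) scalar_mxC.
have [A AE] : exists A, g *m invmx g0 = res A.
  apply/(resmx_scalarP phiK coK); rewrite mulmxA gs -!mulmxA; congr (_ *m _).
  apply: (can_inj (mulmxK g0u)); rewrite -mulmxA -[in RHS]mulmxA mulVmx // mulmx1.
  by rewrite g0s mulKmx.
exists A; last by rewrite -AE mulmxKV.
by rewrite inE -unitmx_resmx -AE unitmx_mul gu unitmx_inv.
Qed.

(* If f(phi) is nilpotent, phi raised to the power q^(e N) is the semisimple part
   of phi for N large. *)
Definition ssexp N : nat := (#|k| ^ (e * N))%N.

Lemma ssexpE N : ssexp N = (#|K| ^ N)%N.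
Proof. by rewrite card_restriction -expnM. Qed.

(** The coefficients of f lie in k, so f(A^M) = f(A)^M for M = q^(eN), and M is at least the size m
    of A. *)
Lemma ss_root m (A : 'M[k]_m) N : nilpm (hmx f A) -> (m <= N)%N -> hmx f (A ^+ ssexp N) = 0.
Proof.
move=> /eqP fA mN; rewrite -hmx_comp -poly_exp_card hmx_exp.
have le : (m <= #|k| ^ (e * N))%N.
  apply: leq_trans mN (leq_trans (ltnW (ltn_expl N (card_fin_gt1 k))) _).
  by rewrite leq_exp2l ?card_fin_gt1 // leq_pmull.
by rewrite -(subnKC le) exprD fA mul0r.
Qed.

(** f divides X - X^(q^(eN)), because e divides e N. *)
Lemma ss_nil m (A : 'M[k]_m) N : nilpm (hmx f A) -> nilpm (A - A ^+ ssexp N).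
Proof.
move=> fA; have /dvdpP[g gE] : f %| 'X - 'X^(ssexp N).
  by rewrite -dvdpNr opprB irreducible_dvd_XqnX // dvdn_mulr.
by have := nilpm_hmx_mul g fA; rewrite mulrC -gE hmxB hmxX hmxXn.
Qed.

(** z and A commute, so the power is z^M + A^M with M = |K|^N; the first term is z and the second is
    0. *)
Lemma ss_resmx b (A : 'M[K]_b) N : nilpm A -> (b <= N)%N ->
  (res (z%:M + A)) ^+ ssexp N = res z%:M.
Proof.
move=> /eqP A0 bN; rewrite -(resmxX phiK coK) ssexpE exprD_card_comm ?scalar_mxC //.
have le : (b <= #|K| ^ N)%N.
  exact: leq_trans bN (ltnW (ltn_expl N (card_fin_gt1 K))).
rewrite -[in A ^+ _](subnKC le) exprD A0 mul0r addr0; congr (res _).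
have zN : z ^+ (#|K| ^ N) = z.
  by elim: N {bN le} => [|N IH]; rewrite ?expr1 // expnSr exprM IH expf_card.
rewrite -[in RHS]zN; elim: (_ ^ _)%N => [|j IH]; first by rewrite !expr0.
by rewrite !exprS IH scalar_mxM.
Qed.

Lemma nilpm_res_scalar b (A : 'M[K]_b) : nilpm A -> nilpm (hmx f (res (z%:M + A))).
Proof.
move=> An; rewrite -(resmx_hmx phiK coK) (nilpm_resmx phiK coK).
have /factor_theorem[g ->] := fz; rewrite mulrC.
apply: nilpm_hmx_mul; rewrite hmxB hmxX hmxC addrC addKr //.
Qed.

End SemisimplePart.

Definition dimM n (b : 'I_n -> nat) e i := (b i * e)%N.

Definition polynilf n (F : fieldType) (f : {poly F}) (a : 'I_n -> nat) (g : vfam F a a) : bool :=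
  [forall i, nilpm (hmx f (g i))].

Definition pset n (Q : quiver n) (l : 'I_n -> rat) (k : finFieldType) (f : {poly k}) a :
    {set mrep k Q a * vfam k a a} :=
  [set p | [&& sss l p.1, endof p.1 p.2 & polynilf f p.2]].

Definition polycount n (Q : quiver n) l (k : finFieldType) (f : {poly k}) a : rat :=
  #|pset Q l f a|%:R / (gv a #|k|)%:R.

Lemma polynilf_conj n (k : fieldType) (f : {poly k}) (a : 'I_n -> nat) (g h : vfam k a a) : unitf g ->
  polynilf f (conjv g h) = polynilf f h.
Proof.
by move=> /forallP gu; apply: eq_forallb => i; rewrite ffunE hmx_conj // nilpm_conj.
Qed.

(** * Pairs with f(phi) nilpotent as nilpotent pairs over the field k[t]/f *)

Section RestrictionFamilies.
Variables (n : nat) (Q : quiver n) (l : 'I_n -> rat).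
Variables (k K : finFieldType) (iota : {rmorphism k -> K}) (f : {poly k}) (z : K).
Hypotheses (fI : monic_irreducible_poly f) (fz : root (map_poly iota f) z).
Local Notation e := (size f).-1.
Variable co : K -> 'rV[k]_e.
Let phi (v : 'rV[k]_e) : K := \sum_j iota (v 0 j) * z ^+ j.
Hypotheses (phiK : cancel phi co) (coK : cancel co phi).
Local Notation res := (resmx iota z co).
Local Notation flat := (@flat k K e co _).
Local Notation unflat := (@unflat k K iota z e _).
Variable b : 'I_n -> nat.
Local Notation a := (dimM b e).
Let e0 := degree_gt0 fI.

Definition resrep (x : mrep K Q b) : mrep k Q a :=
  finfun (fun c => res (x c) : 'M_(dimM b e _, dimM b e _)).
Definition resfam (g : vfam K b b) : vfam k a a :=
  finfun (fun i => res (g i) : 'M_(dimM b e _, dimM b e _)).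

Lemma resrep_inj : injective resrep.
Proof.
move=> x y /ffunP E; apply/ffunP => c; have := E c; rewrite !ffunE.
exact: (resmx_inj phiK coK).
Qed.

Lemma resfam_inj : injective resfam.
Proof.
move=> x y /ffunP E; apply/ffunP => c; have := E c; rewrite !ffunE.
exact: (resmx_inj phiK coK).
Qed.

Lemma lam_dimM (u : 'I_n -> nat) : lam l (dimM u e) = e%:R * lam l u.
Proof. by rewrite mulr_sumr; apply: eq_bigr => i _; rewrite natrM; ring. Qed.

Lemma endof_res (x : mrep K Q b) (g : vfam K b b) :
  endof (resrep x) (resfam g) = endof x g.
Proof.
apply: eq_forallb => c; rewrite !ffunE -!(resmxM phiK coK).
by apply/eqP/eqP => [/(resmx_inj phiK coK)|->].
Qed.

(** The difficult direction is that restriction of scalars creates no destabilising subspace. The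
    torsion part W of the restricted representation is unique, hence invariant under its
    automorphisms, in particular under the nonzero scalars of K. So W comes from a
    K-subrepresentation of x and has weight <= 0, which forces W = 0. *)
Lemma fss_res (x : mrep K Q b) : fss l (resrep x) = fss l x.
Proof.
have er : 0 < e%:R :> rat by rewrite ltr0n.
apply/idP/idP => [/fssP xF|/fssP xF]; apply/fssP.
  move=> m U /forallP xU; have := xF _ (fun i => res (U i)); rewrite (_ : rk _ = dimM (rk U) e).
    rewrite lam_dimM pmulr_rle0 //; apply; apply/forallP => c; rewrite ffunE -(resmxM phiK coK).
    by have /submxP[D ->] := xU c; rewrite (resmxM phiK coK) submxMl.
  by apply: functional_extensionality => i; rewrite /rk (rank_resmx phiK coK).
have [W xW] := exists_torsion_sub l (resrep x).
have Wsc (y : K) i : (W i *m res y%:M <= W i)%MS.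
  have [->|y0] := eqVneq y 0; first by rewrite raddf0 (resmx0 phiK coK) mulmx0 sub0mx.
  pose g : vfam k a a := finfun (fun i => res y%:M : 'M_(dimM b e i)).
  have gu : unitf g.
    apply/forallP => j; rewrite ffunE (unitmx_resmx fI phiK coK) unitmxE det_scalar.
    by rewrite unitfE expf_neq0.
  have gx : conj g (resrep x) = resrep x.
    apply/ffunP => c; rewrite !ffunE -(resmxM phiK coK) -scalar_mxC (resmxM phiK coK) mulmxK //.
    by have := forallP gu (target c); rewrite ffunE.
  have := xW; rewrite -{1}gx torsion_sub_conj // => xWg.
  by have /forallP/(_ i) := torsion_sub_unique xWg xW; rewrite !ffunE.
have {xW} /torsion_subP[/forallP xW T1 T2] := xW.
pose W' i : 'M[K]_(dimM b e i, b i) := \matrix_r unflat (row r (W i)).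
have W'P i (v : 'rV[K]_(b i)) : (v <= W' i)%MS = (flat v <= W i)%MS.
  apply/idP/idP => [/submxP[c ->]|/submxP[c cE]]; last first.
    rewrite -[v](flatK coK) cE mulmx_sum_row; elim/big_ind: _ => [|s t sW tW|r _].
    - by rewrite -[0](scale0r 0) (unflatZ phiK coK) rmorph0 scale0r sub0mx.
    - by rewrite (unflatD phiK coK) addmx_sub.
    - by rewrite (unflatZ phiK coK) scalemx_sub // -(rowK (fun r => unflat (row r (W i)))) row_sub.
  rewrite mulmx_sum_row; elim/big_ind: _ => [|s t sW tW|r _].
  - by rewrite -[0](scale0r 0) -(rmorph0 iota) (flatZ phiK coK) scale0r sub0mx.
  - by rewrite (flatD phiK coK) addmx_sub.
  rewrite rowK -mul_mx_scalar -(flat_resmx phiK coK) (unflatK phiK).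
  by apply: submx_trans (Wsc (c 0 r) i); apply: submxMr; apply: row_sub.
have xW' : stab x W'.
  apply/forallP => c; apply/row_subP => r; rewrite W'P row_mul -(flat_resmx phiK coK).
  have /submxMr : (flat (row r (W' (source c))) <= W (source c))%MS by rewrite -W'P row_sub.
  move=> /(_ _ (res (x c))) /submx_trans; apply.
  by have := xW c; rewrite ffunE.
have rW : rk W = dimM (rk W') e.
  apply: functional_extensionality => i; rewrite /rk /dimM -(rank_resmx phiK coK).
  apply/eqmx_rank/andP; split; apply/row_subP => r.
    have : (unflat (row r (W i)) <= W' i)%MS by rewrite W'P (unflatK phiK) row_sub.
    case/submxP=> D DE; rewrite -[row r (W i)](unflatK phiK) DE -(flat_resmx phiK coK) submxMl //.
  rewrite rowE -[delta_mx 0 r](unflatK phiK) (flat_resmx phiK coK) -W'P submxMl //.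
have lW : lam l (rk W) <= 0 by rewrite rW lam_dimM pmulr_rle0 // xF.
have z0 : rk (fun i => 0 : 'M[k]_(a i)) = @dim0 n.
  by apply: functional_extensionality => i; rewrite /rk mxrank0.
have W0 : subf W (fun i => 0 : 'M[k]_(a i)).
  have [||//|] := T1 _ (fun i => 0 : 'M[k]_(a i)).
  - by apply/forallP => c; rewrite mul0mx sub0mx.
  - by apply/forallP => i; rewrite sub0mx.
  by rewrite z0 lam0 ltNge lW.
move=> m V xV; apply: le_trans (T2 _ _ xV _) lW.
by apply: subf_trans W0 _; apply/forallP => i; rewrite sub0mx.
Qed.

Lemma sss_res (x : mrep K Q b) : sss l (resrep x) = sss l x.
Proof.
by rewrite /sss fss_res lam_dimM mulf_eq0 pnatr_eq0 -leqn0 leqNgt e0.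
Qed.

(** Double counting of the g that turn the semisimple part of phi into multiplication by z at every
    vertex. After that x and phi commute with z, hence are defined over K, and phi is z plus a
    nilpotent endomorphism. *)
Lemma card_pset :
  (#|pset Q l f a| * gv b #|K| = gv a #|k| * #|nall Q l K b|)%N.
Proof.
(* A single exponent has to produce the semisimple part at all vertices. *)
pose N := (\max_i a i)%N.
have aN i : (a i <= N)%N by exact: (leq_bigmax i).
have bN i : (b i <= N)%N by apply: leq_trans (aN i); rewrite leq_pmulr.
pose M := ssexp f N.
pose Y := [set p in pset Q l f a | [forall i, (p.2 i : 'M_(a i)) ^+ M == res z%:M]].
have fM i (p : vfam k a a) : polynilf f p -> hmx f (p i ^+ M) = 0.
  by move=> /forallP pn; apply: (ss_root fI (pn i)).
have -> : #|nall Q l K b| = #|Y|.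
  pose h (p : mrep K Q b * vfam K b b) := (resrep p.1, resfam (finfun (fun i => z%:M + p.2 i))).
  have hi : injective h.
    move=> [x g] [x' g'] [/resrep_inj -> /resfam_inj /ffunP E]; congr pair.
    by apply/ffunP => i; have := E i; rewrite !ffunE => /addrI.
  have zend (x : mrep K Q b) (g : vfam K b b) : endof x (finfun (fun i => z%:M + g i)) = endof x g.
    apply: eq_forallb => c; rewrite !ffunE mulmxDr mulmxDl scalar_mxC.
    by rewrite (inj_eq (addrI _)).
  rewrite -(card_imset _ hi); apply: eq_card => -[y w]; rewrite inE.
  apply/imsetP/andP => [[[x g]]|].
    rewrite !inE /= => /and3P[xs xg gn] [-> ->]; rewrite sss_res endof_res zend xs xg /=.
    split; apply/forallP => i; rewrite !ffunE.
      by apply: (nilpm_res_scalar fz phiK coK); apply: (forallP gn).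
    by apply/eqP; apply: (ss_resmx phiK coK) => //; apply: (forallP gn).
  rewrite !inE /= => -[/and3P[ys yw wn] /forallP wM].
  have wz i : res z%:M *m w i = w i *m res z%:M.
    by rewrite -(eqP (wM i)) -!hmxXn; apply: hmx_comm.
  have [w' w'E] : exists w' : forall i, 'M[K]_(b i), forall i, w i = res (w' i).
    apply: (@dependent_choice _ _ (fun i w' => w i = res w')) => i.
    by apply/(resmx_scalarP phiK coK).
  have yz c : res z%:M *m y c = y c *m res z%:M.
    rewrite -(eqP (wM (source c))) -(eqP (wM (target c))) -!hmxXn; apply: hmx_comm.
    by rewrite (eqP (forallP yw c)).
  have [y' y'E] : exists y' : forall c, 'M[K]_(b (source c), b (target c)), forall c, y c = res (y' c).
    apply: (@dependent_choice _ _ (fun c y' => y c = res y')) => c.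
    by apply/(resmx_scalarP phiK coK).
  have yE : y = resrep (finfun y') by apply/ffunP => c; rewrite !ffunE y'E.
  have wE : w = resfam (finfun (fun i => z%:M + (finfun (fun i => w' i - z%:M) : vfam K b b) i)).
    by apply/ffunP => i; rewrite !ffunE w'E addrC subrK.
  exists (finfun y', finfun (fun i => w' i - z%:M)); last by rewrite /h /= -yE -wE.
  move: ys yw; rewrite !inE /= yE wE sss_res endof_res zend => -> -> /=.
  apply/forallP => i; rewrite ffunE -(nilpm_resmx phiK coK).
  rewrite (_ : res _ = w i - w i ^+ M); first exact: (ss_nil fI N (forallP wn i)).
  rewrite (eqP (wM i)) w'E -[z%:M in LHS]opprK opprK (resmxD phiK coK); congr (_ + _).
  by rewrite -scaleN1r -(rmorphN1 iota) (resmxZ phiK coK) scaleN1r.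
rewrite -(card_unitf k a).
apply: (@double_count _ _ _ _ _ (fun g p => (conj g p.1, conjv g p.2))).
- move=> g; rewrite inE => gu [x h] [y h'] [].
  by move=> /(conj_inj gu) -> /(conjv_inj gu) ->.
- move=> g [x h]; rewrite !inE /= => gu.
  by rewrite sss_conj // endof_conj // polynilf_conj // => /andP[].
move=> [x h]; rewrite inE /= => /and3P[xs xh hn].
pose P i (g : 'M[k]_(a i)) := (g \in unitmx) && (res z%:M *m g == g *m h i ^+ M).
transitivity #|[set g : vfam k a a | [forall i, P i (g i)]]|; last first.
  rewrite card_dffun_forall; apply: eq_bigr => i _.
  exact: (card_conj_scalar fI fz phiK coK (fM i h hn)).
apply: eq_card => g; rewrite !inE; case gu: (unitf g) => /=; last first.
  apply/esym/negbTE; apply/negP => /forallP gP; move/negP: gu; apply.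
  by apply/forallP => i; have /andP[] := gP i.
rewrite sss_conj // endof_conj // polynilf_conj // xs xh hn /=.
apply: eq_forallb => i; have gi := forallP gu i; rewrite /P gi ffunE exp_conj //=.
by apply/eqP/eqP => [<-|<-]; rewrite ?mulmxKV ?mulmxK.
Qed.

End RestrictionFamilies.

Lemma pset_eq0 n (Q : quiver n) l (k : finFieldType) (f : {poly k}) a :
  monic_irreducible_poly f -> ~~ [forall i, (size f).-1 %| a i]%N -> pset Q l f a = set0.
Proof.
move=> fI /forallPn[i ai]; have [K [iota [z [_ fz [co phiK coK]]]]] := poly_quotient_field fI.
apply/setP => -[x h]; rewrite !inE /=; apply: negbTE; apply/negP => /and3P[_ _ /forallP hn].
case/negP: ai; apply: (hmx_eq0_dim fI fz phiK coK (ss_root fI (hn i) (leqnn _))).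
Qed.

Lemma polycount_isrf n (Q : quiver n) l a e : (0 < e)%N -> exists2 r, isrf r &
  forall (k : finFieldType) (f : {poly k}), monic_irreducible_poly f -> (size f).-1 = e ->
  polycount Q l f a = r #|k|.
Proof.
move=> e0; have [/forallP ea|ea] := boolP [forall i, e %| a i]%N; last first.
  exists (fun=> 0) => [|k f fI fe]; first exact: isrf_const.
  by rewrite /polycount pset_eq0 ?fe // cards0 mul0r.
pose b i := (a i %/ e)%N; have [r rr rE] := nilcount_isrf Q l b.
exists (fun q => r (q ^ e)%N) => [|k f fI fe]; first exact: isrf_comp_exp.
have [K [iota [z [cK fz [co phiK coK]]]]] := poly_quotient_field fI.
have aE : a = dimM b (size f).-1.
  by apply: functional_extensionality => i; rewrite /dimM fe divnK.
rewrite -fe -cK -rE /polycount /nilcount aE.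
have := congr1 (fun N => N%:R : rat) (card_pset Q l fI fz phiK coK b); rewrite !natrM => E.
by apply/eqP; rewrite eqr_div ?gv_neq0 // E mulrC.
Qed.

(** * Krull-Schmidt decompositions *)

Section DependentFunZmod.
Variables (I : finType) (T : I -> zmodType).
Implicit Types f g h : {dffun forall i, T i}.

Definition dffun0 : {dffun forall i, T i} := finfun (fun i => 0).
Definition dffun_opp f : {dffun forall i, T i} := finfun (fun i => - f i).
Definition dffun_add f g : {dffun forall i, T i} := finfun (fun i => f i + g i).

Fact dffun_addA : associative dffun_add.
Proof. by move=> f g h; apply/ffunP => i; rewrite !ffunE addrA. Qed.
Fact dffun_addC : commutative dffun_add.
Proof. by move=> f g; apply/ffunP => i; rewrite !ffunE addrC. Qed.
Fact dffun_add0 : left_id dffun0 dffun_add.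
Proof. by move=> f; apply/ffunP => i; rewrite !ffunE add0r. Qed.
Fact dffun_addN : left_inverse dffun0 dffun_opp dffun_add.
Proof. by move=> f; apply/ffunP => i; rewrite !ffunE addNr. Qed.

HB.instance Definition _ := GRing.isZmodule.Build {dffun forall i, T i}
  dffun_addA dffun_addC dffun_add0 dffun_addN.

Lemma dffun0E i : (0 : {dffun forall i, T i}) i = 0. Proof. exact: ffunE. Qed.
Lemma dffunDE f g i : (f + g) i = f i + g i. Proof. exact: ffunE. Qed.
Lemma dffunNE f i : (- f) i = - f i. Proof. exact: ffunE. Qed.
End DependentFunZmod.

Section Fitting.
Variable F : fieldType.

(** The characteristic polynomial is X^r g with g(0) nonzero and r <= m <= N. A Bezout relation
    between X^N and g writes each vector as a sum of one in the image of A^N and one in the image of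
    g(A), which A^N kills. *)
Lemma matrix_fitting m (A : 'M[F]_m) N : (m <= N)%N ->
  (A ^+ N + kermx (A ^+ N) :=: 1%:M)%MS /\ (A ^+ N :&: kermx (A ^+ N) = 0)%MS.
Proof.
case: m A => [|m] A mN.
  split; last exact: flatmx0.
  by apply/eqmxP; rewrite (flatmx0 1%:M) sub0mx andbT; apply/submxP; exists 0; apply/matrixP => -[].
have [r [g g0 pE]] := multiplicity_XsubC (char_poly A) 0.
have cp0 : char_poly A != 0 by rewrite monic_neq0 ?char_poly_monic.
rewrite cp0 /= in g0; rewrite subr0 in pE.
have gn0 : g != 0 by apply: contraNneq g0 => ->; rewrite root0.
have rm : (r <= m.+1)%N.
  have := size_char_poly A; rewrite pE size_mulXn // => sE.
  by rewrite -ltnS -sE -[ltnLHS]addn0 ltn_add2l size_poly_gt0.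
have gA : A ^+ N *m hmx g A = 0.
  rewrite -hmxXn -hmxM -(subnK (leq_trans rm mN)) exprD -mulrA [_ * g]mulrC -pE hmxM.
  by rewrite [hmx (char_poly A) A]hmxE (Cayley_Hamilton A) mulmx0.
have /Bezout_eq1_coprimepP[[u v] /= uv] : coprimep ('X^N) g.
  by rewrite coprimep_expl // coprimep_sym coprimepX.
have vE (w : 'rV[F]_m.+1) : w = w *m hmx u A *m A ^+ N + w *m hmx v A *m hmx g A.
  by rewrite -hmxXn -!mulmxA -!hmxM -mulmxDr -hmxD uv hmxC mulmx1.
have gker : (hmx g A <= kermx (A ^+ N))%MS.
  by rewrite sub_kermx -hmxXn -hmxM mulrC hmxM hmxXn gA.
split.
  apply/eqmxP; rewrite submx1 andTb; apply/row_subP => i; rewrite [row i _]vE.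
  by rewrite addmx_sub // (submx_trans (submxMl _ _)) ?addsmxSl // (submx_trans gker) ?addsmxSr.
apply/eqP; rewrite -submx0; apply/row_subP => i; set w := row i _.
have wI : (w <= A ^+ N :&: kermx (A ^+ N))%MS by apply: row_sub.
rewrite sub_capmx sub_kermx in wI; have /andP[/submxP[D DE] /eqP w0] := wI.
have -> : w = 0; last exact: sub0mx.
rewrite [LHS]vE -[w *m _ *m A ^+ N]mulmxA -hmxXn -hmxM mulrC hmxM hmxXn mulmxA w0 mul0mx add0r.
by rewrite -mulmxA -hmxM mulrC hmxM mulmxA DE -!mulmxA (mulmxA (A ^+ N)) gA mul0mx mulmx0.
Qed.

End Fitting.

Section Hom.
Variables (n : nat) (F : fieldType).

(** In the row convention the left factor is applied first. *)
Definition cmp (a b c : 'I_n -> nat) (f : vfam F a b) (g : vfam F b c) : vfam F a c :=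
  finfun (fun i => f i *m g i).
Definition scf (a : 'I_n -> nat) (c : F) : vfam F a a := finfun (fun i => c%:M).

Lemma cmpA (a b c d : 'I_n -> nat) (f : vfam F a b) (g : vfam F b c) (h : vfam F c d) :
  cmp f (cmp g h) = cmp (cmp f g) h.
Proof. by apply/ffunP => i; rewrite !ffunE mulmxA. Qed.
Lemma cmpDl (a b c : 'I_n -> nat) (f g : vfam F a b) (h : vfam F b c) :
  cmp (f + g) h = cmp f h + cmp g h.
Proof. by apply/ffunP => i; rewrite !ffunE mulmxDl. Qed.
Lemma cmpDr (a b c : 'I_n -> nat) (f : vfam F a b) (g h : vfam F b c) :
  cmp f (g + h) = cmp f g + cmp f h.
Proof. by apply/ffunP => i; rewrite !ffunE mulmxDr. Qed.
Lemma cmp0l (a b c : 'I_n -> nat) (h : vfam F b c) : cmp (0 : vfam F a b) h = 0.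
Proof. by apply/ffunP => i; rewrite !ffunE mul0mx. Qed.
Lemma cmp0r (a b c : 'I_n -> nat) (h : vfam F a b) : cmp h (0 : vfam F b c) = 0.
Proof. by apply/ffunP => i; rewrite !ffunE mulmx0. Qed.
Lemma cmpNl (a b c : 'I_n -> nat) (f : vfam F a b) (h : vfam F b c) : cmp (- f) h = - cmp f h.
Proof. by apply/ffunP => i; rewrite !ffunE mulNmx. Qed.
Lemma cmpNr (a b c : 'I_n -> nat) (f : vfam F a b) (h : vfam F b c) : cmp f (- h) = - cmp f h.
Proof. by apply/ffunP => i; rewrite !ffunE mulmxN. Qed.
Lemma cmp1l (a b : 'I_n -> nat) (f : vfam F a b) : cmp (scf a 1) f = f.
Proof. by apply/ffunP => i; rewrite !ffunE mul1mx. Qed.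
Lemma cmp1r (a b : 'I_n -> nat) (f : vfam F a b) : cmp f (scf b 1) = f.
Proof. by apply/ffunP => i; rewrite !ffunE mulmx1. Qed.
Lemma cmp_suml (a b c : 'I_n -> nat) (I : Type) (r : seq I) (P : pred I) (f : I -> vfam F a b) (h : vfam F b c) :
  cmp (\sum_(i <- r | P i) f i) h = \sum_(i <- r | P i) cmp (f i) h.
Proof. by elim/big_rec2: _ => [|i y1 y2 _ <-]; rewrite ?cmp0l ?cmpDl. Qed.
Lemma cmp_sumr (a b c : 'I_n -> nat) (I : Type) (r : seq I) (P : pred I) (f : I -> vfam F b c) (h : vfam F a b) :
  cmp h (\sum_(i <- r | P i) f i) = \sum_(i <- r | P i) cmp h (f i).
Proof. by elim/big_rec2: _ => [|i y1 y2 _ <-]; rewrite ?cmp0r ?cmpDr. Qed.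

Variable Q : quiver n.
Implicit Types a b : 'I_n -> nat.

Definition homf a b (x : mrep F Q a) (y : mrep F Q b) (f : vfam F a b) : bool :=
  [forall c, x c *m f (target c) == f (source c) *m y c].

Lemma homf_cmp a b c (x : mrep F Q a) (y : mrep F Q b) (w : mrep F Q c) f g :
  homf x y f -> homf y w g -> homf x w (cmp f g).
Proof.
move=> /forallP xf /forallP yg; apply/forallP => d; rewrite !ffunE.
by rewrite mulmxA (eqP (xf d)) -mulmxA (eqP (yg d)) mulmxA.
Qed.

Lemma homf0 a b (x : mrep F Q a) (y : mrep F Q b) : homf x y 0.
Proof. by apply/forallP => d; rewrite !ffunE mul0mx mulmx0. Qed.

Lemma homfD a b (x : mrep F Q a) (y : mrep F Q b) f g :
  homf x y f -> homf x y g -> homf x y (f + g).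
Proof.
move=> /forallP xf /forallP yg; apply/forallP => d; rewrite !ffunE.
by rewrite mulmxDr mulmxDl (eqP (xf d)) (eqP (yg d)).
Qed.

Lemma homfN a b (x : mrep F Q a) (y : mrep F Q b) f : homf x y f -> homf x y (- f).
Proof.
by move=> /forallP xf; apply/forallP => d; rewrite !ffunE mulmxN mulNmx (eqP (xf d)).
Qed.

Lemma homf_sum a b (x : mrep F Q a) (y : mrep F Q b) (I : Type) (r : seq I) (P : pred I) (f : I -> vfam F a b) :
  (forall i, P i -> homf x y (f i)) -> homf x y (\sum_(i <- r | P i) f i).
Proof. by move=> H; elim/big_ind: _ => //; [exact: homf0 | exact: homfD]. Qed.

Lemma homf_sc a (x : mrep F Q a) c : homf x x (scf a c).
Proof. by apply/forallP => d; rewrite !ffunE scalar_mxC. Qed.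

Definition invf a (f : vfam F a a) : vfam F a a := finfun (fun i => invmx (f i)).

Lemma invf_l a (f : vfam F a a) : unitf f -> cmp (invf f) f = scf a 1.
Proof. by move=> /forallP fu; apply/ffunP => i; rewrite !ffunE mulVmx. Qed.
Lemma invf_r a (f : vfam F a a) : unitf f -> cmp f (invf f) = scf a 1.
Proof. by move=> /forallP fu; apply/ffunP => i; rewrite !ffunE mulmxV. Qed.
Lemma unitf_inv a (f : vfam F a a) : unitf f -> unitf (invf f).
Proof. by move=> /forallP fu; apply/forallP => i; rewrite ffunE unitmx_inv. Qed.
Lemma unitf_cmp a (f g : vfam F a a) : unitf (cmp f g) = unitf f && unitf g.
Proof.
apply/forallP/andP => [H|[/forallP H1 /forallP H2] i]; last by rewrite ffunE unitmx_mul H1 H2.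
by split; apply/forallP => i; have := H i; rewrite ffunE unitmx_mul => /andP[].
Qed.

Lemma homf_inv a (x y : mrep F Q a) f : unitf f -> homf x y f -> homf y x (invf f).
Proof.
move=> /forallP fu /forallP xf; apply/forallP => c; rewrite !ffunE.
apply/eqP; rewrite -[y c](mulKmx (fu (source c))) -(eqP (xf c)).
by rewrite -!mulmxA mulmxV ?mulmx1.
Qed.

Lemma homf_conj a (g : vfam F a a) (x : mrep F Q a) : unitf g -> homf (conj g x) x g.
Proof. by move=> /forallP gu; apply/forallP => c; rewrite ffunE mulmxKV. Qed.

Lemma homf_conjE a (x y : mrep F Q a) g : unitf g -> homf y x g -> y = conj g x.
Proof.
move=> /forallP gu /forallP yx; apply/ffunP => c; rewrite ffunE -(eqP (yx c)).
by rewrite mulmxK.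
Qed.

Definition indec a (x : mrep F Q a) : Prop := (0 < ht a)%N /\
  forall U V : forall i, 'M[F]_(a i), stab x U -> stab x V ->
    (forall i, (U i + V i :=: 1%:M)%MS /\ (U i :&: V i = 0)%MS) ->
    (forall i, U i = 0) \/ (forall i, V i = 0).

Definition expf a N (f : vfam F a a) : vfam F a a := finfun (fun i => f i ^+ N).

Lemma homf_exp a (x : mrep F Q a) N f : homf x x f -> homf x x (expf N f).
Proof.
move=> /forallP xf; apply/forallP => c; rewrite !ffunE -!hmxXn; apply/eqP/esym/hmx_comm.
by rewrite (eqP (xf c)).
Qed.

Lemma nilpf_exp a (f : vfam F a a) N : expf N f = 0 -> nilpf f.
Proof.
by move=> /ffunP f0; apply/forallP => i; apply/nilpmP; exists N; have := f0 i; rewrite !ffunE.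
Qed.

Lemma expf_nilpf a (f : vfam F a a) N : nilpf f -> (ht a <= N)%N -> expf N f = 0.
Proof.
move=> /forallP fn aN; apply/ffunP => i; rewrite !ffunE.
by rewrite -(subnKC (leq_trans (leq_ht a i) aN)) exprD (eqP (fn i)) mul0r.
Qed.

(** Fitting's lemma: image and kernel of a high power of f split the representation, so one of them
    is zero. *)
Lemma indec_local a (x : mrep F Q a) f : indec x -> homf x x f -> nilpf f \/ unitf f.
Proof.
(* The successor makes the exponent visibly positive, so that f is a factor of its power and
   inherits invertibility. *)
case=> _ xI xf; pose N := (ht a).+1; have xfN : endof x (expf N f) := homf_exp N xf.
have kerS : stab x (fun i => kermx (f i ^+ N)).
  have := stab_ker xfN; congr (stab _ _); apply: functional_extensionality_dep => i.
  by rewrite ffunE.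
have imS : stab x (fun i => f i ^+ N).
  have := stab_im xfN; congr (stab _ _); apply: functional_extensionality_dep => i.
  by rewrite ffunE.
case: (xI _ _ imS kerS) => [i|f0|k0].
- exact: matrix_fitting (leqW (leq_ht a i)).
- by left; apply: (nilpf_exp (N := N)); apply/ffunP => i; rewrite !ffunE f0.
right; apply/forallP => i; have /eqP := k0 i; rewrite kermx_eq0 row_free_unit.
by rewrite /N exprS unitmx_mul => /andP[].
Qed.

End Hom.

(** * The radical and the residue field of an indecomposable *)

Section LocalEndomorphisms.
Variables (n : nat) (Q : quiver n) (F : fieldType) (a : 'I_n -> nat) (x : mrep F Q a).
Hypothesis xI : indec x.
Local Notation endo := (homf x x).
Implicit Types f g h : vfam F a a.

Lemma indec_nil_nunit f : nilpf f -> unitf f -> False.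
Proof.
case: xI => ha _ /forallP fn /forallP fu.
have [i ai] : exists i, (0 < a i)%N.
  apply/existsP; rewrite -[[exists i, _]]negbK negb_exists; apply/negP => /forallP a0.
  by move: ha; rewrite /ht big1 // => i _; apply/eqP; have := a0 i; rewrite lt0n negbK.
have fju j : f i ^+ j \in unitmx.
  elim: j => [|j IH]; first by rewrite expr0 unitmx1.
  by rewrite exprS unitmx_mul fu.
have := fju (a i); have := eqP (fn i); rewrite /nilpm => ->.
by case: (a i) ai => // j _; rewrite unitmxE det0 unitr0.
Qed.

Lemma indec_unit f : endo f -> ~~ nilpf f -> unitf f.
Proof. by move=> xf nf; case: (indec_local xI xf) => // fn; rewrite fn in nf. Qed.

Lemma indec_nil_cmpl f g : endo f -> endo g -> nilpf f -> nilpf (cmp f g).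
Proof.
move=> xf xg fn; case: (indec_local xI (homf_cmp xf xg)) => //.
by rewrite unitf_cmp => /andP[/(indec_nil_nunit fn)].
Qed.

Lemma indec_nil_cmpr f g : endo f -> endo g -> nilpf g -> nilpf (cmp f g).
Proof.
move=> xf xg gn; case: (indec_local xI (homf_cmp xf xg)) => //.
by rewrite unitf_cmp => /andP[_ /(indec_nil_nunit gn)].
Qed.

Lemma nilpf_sub1 f : nilpf f -> unitf (scf a 1 - f).
Proof.
move=> /forallP fn; apply/forallP => i; rewrite dffunDE dffunNE !ffunE.
have := eqP (fn i); move: (f i) => A A0.
have E : (1%:M - A) *m (\sum_(j < a i) A ^+ j) = 1%:M.
  have := subrXX_comm (a i) (commr_sym (commr1 A)); rewrite expr1n A0 subr0.
  rewrite (eq_bigr (fun j : 'I_(a i) => A ^+ j)); first by move=> E; exact: (esym E).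
  by move=> j _; rewrite expr1n mul1r.
by have [] := mulmx1_unit E.
Qed.

(** If f + g had an inverse i, then i f would be nilpotent, so i g = 1 - i f would be invertible;
    but i g is nilpotent as well. *)
Lemma indec_nilD f g : endo f -> endo g -> nilpf f -> nilpf g -> nilpf (f + g).
Proof.
move=> xf xg fn gn; case: (indec_local xI (homfD xf xg)) => // fgu.
have xi := homf_inv fgu (homfD xf xg).
have n1 := indec_nil_cmpr xi xf fn; have n2 := indec_nil_cmpr xi xg gn.
have := nilpf_sub1 n1; rewrite -(invf_l fgu) cmpDr addrC addKr.
by move/(indec_nil_nunit n2).
Qed.

Lemma nilpfN f : nilpf (- f) = nilpf f :> bool.
Proof.
apply: eq_forallb => i; rewrite dffunNE; apply/nilpmP/nilpmP => -[N fN]; exists N.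
  by rewrite -[f i]opprK exprNn fN mulr0.
by rewrite exprNn fN mulr0.
Qed.

Lemma nilpf0 : nilpf (0 : vfam F a a).
Proof. by apply/forallP => i; apply/nilpmP; exists 1%N; rewrite dffun0E expr1. Qed.

End LocalEndomorphisms.

Section ResidueField.
Variables (n : nat) (Q : quiver n) (F : finFieldType) (a : 'I_n -> nat) (x : mrep F Q a).
Local Notation endo := (homf x x).
Implicit Types f g h : vfam F a a.
Local Notation one := (scf a (1 : F)).

(* A representative of the class of f modulo the radical, so that the residue ring
   can be carried by the canonical endomorphisms. *)
Definition canon (f : vfam F a a) : vfam F a a := odflt f [pick g | endo g && nilpf (f - g)].

(** The proof of [indec x] is a parameter of the type, so that ring structures that depend on it can
    be attached to the type. *)
Definition residue of indec x := {f : vfam F a a | endo f && (canon f == f)}.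

Hypothesis xI : indec x.
Local Notation R := (residue xI).
HB.instance Definition _ := Finite.on R.
HB.instance Definition _ := SubType.on R.

Lemma canonP f : endo f -> endo (canon f) /\ nilpf (f - canon f).
Proof.
move=> xf; rewrite /canon; case: pickP => [g /andP[]//|/(_ f)].
by rewrite xf subrr nilpf0.
Qed.

Lemma nil_eqv f g h : endo f -> endo g -> endo h -> nilpf (f - g) -> nilpf (f - h) = nilpf (g - h).
Proof.
move=> xf xg xh fg.
have xD u v : endo u -> endo v -> endo (u - v) by move=> xu xv; apply/homfD/homfN.
apply/idP/idP => H.
  rewrite (_ : g - h = (f - h) + - (f - g)); last by rewrite opprB [RHS]addrC addrA subrK.
  by apply: (indec_nilD xI); rewrite ?homfN ?nilpfN ?xD.
rewrite (_ : f - h = (f - g) + (g - h)); last by rewrite addrA subrK.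
by apply: (indec_nilD xI); rewrite ?xD.
Qed.

Lemma canon_eq f g : endo f -> endo g -> (canon f == canon g) = nilpf (f - g).
Proof.
move=> xf xg; have [xcf ncf] := canonP xf; have [xcg ncg] := canonP xg.
apply/eqP/idP => [E|fg].
  rewrite (nil_eqv xf xcf xg ncf) E -nilpfN opprB //.
rewrite /canon (_ : [pick h | endo h && nilpf (f - h)] = [pick h | endo h && nilpf (g - h)]).
  case: pickP => // /(_ g); by rewrite xg subrr nilpf0.
apply: eq_pick => h /=; case xh: (endo h) => //=; exact: nil_eqv.
Qed.

Lemma canon_canon f : endo f -> canon (canon f) = canon f.
Proof.
move=> xf; have [xc nc] := canonP xf.
by apply/eqP; rewrite canon_eq // -nilpfN opprB.
Qed.

Fact cls0_subproof : endo (canon 0) && (canon (canon 0) == canon 0).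
Proof. by rewrite canon_canon ?homf0 // eqxx andbT; case: (canonP (homf0 x x)). Qed.
Definition cls0 : R := Sub (canon 0) cls0_subproof.

Definition cls f : R := insubd cls0 (canon f).

Lemma val_cls f : endo f -> val (cls f) = canon f.
Proof.
move=> xf; apply: insubdK; have [xc _] := canonP xf.
by rewrite unfold_in canon_canon // eqxx andbT.
Qed.

Lemma cls_val (u : R) : cls (val u) = u.
Proof.
have /andP[xu /eqP cu] := valP u.
by apply: val_inj; rewrite /= val_cls.
Qed.

Lemma endo_val (u : R) : endo (val u). Proof. by have /andP[] := valP u. Qed.

Lemma cls_eq f g : endo f -> endo g -> (cls f == cls g) = nilpf (f - g).
Proof. by move=> xf xg; rewrite -val_eqE /= !val_cls // canon_eq. Qed.

Definition radd (u v : R) : R := cls (val u + val v).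
Definition ropp (u : R) : R := cls (- val u).
Definition rmul (u v : R) : R := cls (cmp (val u) (val v)).
Definition rinv (u : R) : R := if u == cls0 then u else cls (invf (val u)).

Lemma cls_nil f : endo f -> nilpf (f - val (cls f)).
Proof. by move=> xf; rewrite val_cls //; case: (canonP xf). Qed.

Lemma clsD f g : endo f -> endo g -> radd (cls f) (cls g) = cls (f + g).
Proof.
move=> xf xg; apply/eqP; rewrite cls_eq ?homfD ?endo_val // -nilpfN opprB.
rewrite (_ : _ - _ = (f - val (cls f)) + (g - val (cls g))); last by rewrite opprD addrACA.
by apply: (indec_nilD xI); rewrite ?cls_nil // homfD ?homfN ?endo_val.
Qed.

Lemma clsN f : endo f -> ropp (cls f) = cls (- f).
Proof.
move=> xf; apply/eqP; rewrite cls_eq ?homfN ?endo_val // opprK addrC.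
exact: cls_nil.
Qed.

Lemma clsM f g : endo f -> endo g -> rmul (cls f) (cls g) = cls (cmp f g).
Proof.
move=> xf xg; have xf' := endo_val (cls f); have xg' := endo_val (cls g).
apply/eqP; rewrite cls_eq ?(homf_cmp (y := x)) // -nilpfN opprB.
rewrite (_ : _ - _ = cmp (f - val (cls f)) g + cmp (val (cls f)) (g - val (cls g))); last first.
  by rewrite cmpDl cmpNl cmpDr cmpNr addrA subrK.
have H1 : endo (f - val (cls f)) by rewrite homfD ?homfN.
have H2 : endo (g - val (cls g)) by rewrite homfD ?homfN.
apply: (indec_nilD xI); rewrite ?(homf_cmp (y := x)) //.
  by apply: (indec_nil_cmpl xI) => //; apply: cls_nil.
by apply: (indec_nil_cmpr xI) => //; apply: cls_nil.
Qed.

Lemma clsP (u : R) : exists2 f, endo f & u = cls f.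
Proof. by exists (val u); rewrite ?endo_val ?cls_val. Qed.

Lemma cls0E : cls0 = cls 0.
Proof. by apply: val_inj; rewrite /= val_cls ?homf0. Qed.

Fact raddA : associative radd.
Proof.
move=> u v w; have [f xf ->] := clsP u; have [g xg ->] := clsP v; have [h xh ->] := clsP w.
by rewrite !clsD ?homfD // addrA.
Qed.
Fact raddC : commutative radd.
Proof. by move=> u v; rewrite /radd addrC. Qed.
Fact radd0 : left_id cls0 radd.
Proof.
by move=> u; have [f xf ->] := clsP u; rewrite cls0E clsD ?homf0 // add0r.
Qed.
Fact raddN : left_inverse cls0 ropp radd.
Proof.
by move=> u; have [f xf ->] := clsP u; rewrite clsN // clsD ?homfN // addNr cls0E.
Qed.
HB.instance Definition _ := GRing.isZmodule.Build R raddA raddC radd0 raddN.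

Fact rmulA : associative rmul.
Proof.
move=> u v w; have [f xf ->] := clsP u; have [g xg ->] := clsP v; have [h xh ->] := clsP w.
by rewrite !clsM ?(homf_cmp (y := x)) // cmpA.
Qed.
Fact rmul1 : left_id (cls one) rmul.
Proof. by move=> u; have [f xf ->] := clsP u; rewrite clsM ?homf_sc // cmp1l. Qed.
Fact rmulr1 : right_id (cls one) rmul.
Proof. by move=> u; have [f xf ->] := clsP u; rewrite clsM ?homf_sc // cmp1r. Qed.
Fact rmulDl : left_distributive rmul +%R.
Proof.
move=> u v w; have [f xf ->] := clsP u; have [g xg ->] := clsP v; have [h xh ->] := clsP w.
by rewrite -[cls f + cls g]/(radd _ _) -[RHS]/(radd _ _) !(clsD, clsM) ?homfD ?(homf_cmp (y := x)) // cmpDl.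
Qed.
Fact rmulDr : right_distributive rmul +%R.
Proof.
move=> u v w; have [f xf ->] := clsP u; have [g xg ->] := clsP v; have [h xh ->] := clsP w.
by rewrite -[cls g + cls h]/(radd _ _) -[RHS]/(radd _ _) !(clsD, clsM) ?homfD ?(homf_cmp (y := x)) // cmpDr.
Qed.
Lemma cls_eq0 f : endo f -> (cls f == cls0) = nilpf f.
Proof. by move=> xf; rewrite cls0E cls_eq ?homf0 // subr0. Qed.
Lemma unitf1 : unitf one.
Proof. by apply/forallP => i; rewrite ffunE unitmx1. Qed.
Fact rone_neq0 : cls one != 0.
Proof.
rewrite -[0]/cls0 cls_eq0 ?homf_sc //; apply/negP => H.
exact: (indec_nil_nunit xI H unitf1).
Qed.
HB.instance Definition _ := GRing.Zmodule_isNzRing.Build R rmulA rmul1 rmulr1 rmulDl rmulDr rone_neq0.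

Definition runit : pred R := fun u => u != 0.

Lemma unit_val (u : R) : u != 0 -> unitf (val u).
Proof.
rewrite -{1}[u]cls_val cls_eq0 ?endo_val //; exact/(indec_unit xI)/endo_val.
Qed.
Fact rmulV : {in runit, left_inverse 1 rinv *%R}.
Proof.
move=> u u0; rewrite /rinv (negbTE u0) -{2}[u]cls_val; have vu := unit_val u0.
rewrite -[LHS]/(rmul _ _) clsM ?endo_val ?(homf_inv vu) ?endo_val //.
by rewrite invf_l.
Qed.
Fact rmulrV : {in runit, right_inverse 1 rinv *%R}.
Proof.
move=> u u0; rewrite /rinv (negbTE u0) -{1}[u]cls_val; have vu := unit_val u0.
rewrite -[LHS]/(rmul _ _) clsM ?endo_val ?(homf_inv vu) ?endo_val //.
by rewrite invf_r.
Qed.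
Fact runitP (u v : R) : v * u = 1 /\ u * v = 1 -> runit u.
Proof.
by case=> vu _; apply/eqP => u0; move: vu; rewrite u0 mulr0 => /eqP; rewrite eq_sym oner_eq0.
Qed.
Fact rinv_out : {in [predC runit], rinv =1 id}.
Proof. by move=> u; rewrite inE /= negbK /rinv => ->. Qed.
HB.instance Definition _ := GRing.NzRing_hasMulInverse.Build R rmulV rmulrV runitP rinv_out.

Fact rdomain : GRing.integral_domain_axiom R.
Proof.
move=> u v uv; apply/orP; case: (eqVneq u 0) => [|u0]; first by left.
by right; rewrite -[v](mulKr (u0 : u \is a GRing.unit)) uv mulr0.
Qed.

(** An endomorphism that is not nilpotent is invertible, so the residue ring is a finite division
    ring, commutative by Wedderburn's theorem. *)
Lemma exists_residue_field : exists (L : finFieldType) (r : vfam F a a -> L)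
   (iota : {rmorphism F -> L}),
  [/\ (forall f g, endo f -> endo g -> r (f + g) = r f + r g),
      (forall f g, endo f -> endo g -> r (cmp f g) = r f * r g),
      (forall f, endo f -> (r f == 0) = nilpf f),
      (forall y, exists2 f, endo f & r f = y)
    & (forall c, r (scf a c) = iota c)].
Proof.
pose L := FinDomainFieldType rdomain.
have clsZ : zmod_morphism (fun c : F => cls (scf a c) : L).
  move=> c d; apply/eqP; rewrite eq_sym -[X in X == _]/(radd _ (ropp _)).
  rewrite clsN ?homf_sc // clsD ?homf_sc ?homfN ?homf_sc //; apply/eqP; congr cls.
  by apply/ffunP => i; rewrite dffunDE dffunNE !ffunE -raddfB.
have clsR : monoid_morphism (fun c : F => cls (scf a c) : L).
  split=> // c d; rewrite -[RHS]/(rmul _ _) clsM ?homf_sc //; congr cls.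
  by apply/ffunP => i; rewrite !ffunE scalar_mxM.
pose mZ := GRing.isZmodMorphism.Build F L _ clsZ.
pose mR := GRing.isMonoidMorphism.Build F L _ clsR.
pose iota : {rmorphism F -> L} := HB.pack (fun c : F => cls (scf a c) : L) mZ mR.
exists L, cls, iota; split; last by [].
- by move=> f g xf xg; rewrite -clsD.
- by move=> f g xf xg; rewrite -clsM.
- by move=> f xf; rewrite -cls_eq0.
- by move=> y; have [f xf ->] := clsP y; exists f.
Qed.

End ResidueField.

(** * Biproducts and isomorphisms *)

Section Splitting.
Variables (n : nat) (Q : quiver n) (F : fieldType).
Local Notation one a := (scf a (1 : F)).

Record biproduct a b c (x : mrep F Q a) (y : mrep F Q b) (z : mrep F Q c)
  (i1 : vfam F b a) (p1 : vfam F a b) (i2 : vfam F c a) (p2 : vfam F a c) : Prop := Biproduct {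
  bi1 : homf y x i1; bp1 : homf x y p1; bi2 : homf z x i2; bp2 : homf x z p2;
  bi11 : cmp i1 p1 = one b; bi22 : cmp i2 p2 = one c;
  bi12 : cmp i1 p2 = 0; bi21 : cmp i2 p1 = 0;
  bsum : cmp p1 i1 + cmp p2 i2 = one a }.

(** Bases of U and V together form an invertible matrix: its two blocks of rows are the injections,
    and the two blocks of columns of its inverse are the projections. *)
Lemma split_biproduct a (x : mrep F Q a) (U V : forall i, 'M[F]_(a i)) :
  stab x U -> stab x V -> (forall i, (U i + V i :=: 1%:M)%MS /\ (U i :&: V i = 0)%MS) ->
  exists (y : mrep F Q (rk U)) (z : mrep F Q (rk V)) i1 p1 i2 p2,
    [/\ biproduct x y z i1 p1 i2 p2, forall i, (i1 i :=: U i)%MS & forall i, (i2 i :=: V i)%MS].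
Proof.
move=> /forallP xU /forallP xV UV.
pose g i : 'M[F]_(rk U i + rk V i, a i) := col_mx (row_base (U i)) (row_base (V i)).
have gUV i : (g i :=: U i + V i)%MS.
  apply: eqmx_trans (eqmx_sym (addsmxE _ _)) _.
  by apply: adds_eqmx; apply: eq_row_base.
have gfull i : row_full (g i) by rewrite -col_leq_rank gUV (UV i).1 mxrank1.
have gfree i : row_free (g i).
  rewrite /row_free gUV; have := mxrank_sum_cap (U i) (V i).
  by rewrite (UV i).2 mxrank0 addn0 => ->.
pose h i : 'M[F]_(a i, rk U i + rk V i) := pinvmx (g i).
have gh i : g i *m h i = 1%:M by apply: mulmxVp.
have hg i : h i *m g i = 1%:M by rewrite mulVpmx.
pose i1 : vfam F (rk U) a := finfun (fun i => row_base (U i)).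
pose i2 : vfam F (rk V) a := finfun (fun i => row_base (V i)).
pose p1 : vfam F a (rk U) := finfun (fun i => lsubmx (h i)).
pose p2 : vfam F a (rk V) := finfun (fun i => rsubmx (h i)).
have hE i : h i = row_mx (p1 i) (p2 i) by rewrite !ffunE hsubmxK.
have gE i : g i = col_mx (i1 i) (i2 i) by rewrite !ffunE.
have E i : block_mx (i1 i *m p1 i) (i1 i *m p2 i) (i2 i *m p1 i) (i2 i *m p2 i) = 1%:M.
  by rewrite -mul_col_row -hE -gE gh.
have E11 i : i1 i *m p1 i = 1%:M by have := E i; rewrite [RHS]scalar_mx_block => /eq_block_mx[].
have E12 i : i1 i *m p2 i = 0 by have := E i; rewrite [RHS]scalar_mx_block => /eq_block_mx[].
have E21 i : i2 i *m p1 i = 0 by have := E i; rewrite [RHS]scalar_mx_block => /eq_block_mx[].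
have E22 i : i2 i *m p2 i = 1%:M by have := E i; rewrite [RHS]scalar_mx_block => /eq_block_mx[].
have Es i : p1 i *m i1 i + p2 i *m i2 i = 1%:M by rewrite -mul_row_col -hE -gE hg.
have i1U i : (i1 i :=: U i)%MS by rewrite ffunE; apply: eq_row_base.
have i2V i : (i2 i :=: V i)%MS by rewrite ffunE; apply: eq_row_base.
pose y : mrep F Q (rk U) := finfun (fun c => i1 (source c) *m x c *m p1 (target c)).
pose z : mrep F Q (rk V) := finfun (fun c => i2 (source c) *m x c *m p2 (target c)).
have yi c : i1 (source c) *m x c = y c *m i1 (target c).
  have /submxP[D DE] : (i1 (source c) *m x c <= i1 (target c))%MS.
    by rewrite i1U; apply: submx_trans (xU c); apply: submxMr; rewrite i1U.
  by rewrite [y c]ffunE DE -!mulmxA (mulmxA (i1 _)) E11 mul1mx.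
have zi c : i2 (source c) *m x c = z c *m i2 (target c).
  have /submxP[D DE] : (i2 (source c) *m x c <= i2 (target c))%MS.
    by rewrite i2V; apply: submx_trans (xV c); apply: submxMr; rewrite i2V.
  by rewrite [z c]ffunE DE -!mulmxA (mulmxA (i2 _)) E22 mul1mx.
have xE c : x c = p1 (source c) *m y c *m i1 (target c) + p2 (source c) *m z c *m i2 (target c).
  by rewrite -[LHS]mul1mx -Es mulmxDl -!mulmxA yi zi.
exists y, z, i1, p1, i2, p2; split=> //; split; try (by apply/ffunP => i; rewrite ?dffunDE ?dffun0E !ffunE -?[finfun _ _]/(i1 i) -?E11 -?E22 -?E12 -?E21 -?Es !ffunE).
- by apply/forallP => c; apply/eqP/esym/yi.
- apply/forallP => c; apply/eqP; rewrite {1}xE mulmxDl -!mulmxA E11 E21 !mulmx0 addr0 mulmx1.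
  by [].
- by apply/forallP => c; apply/eqP/esym/zi.
- apply/forallP => c; apply/eqP; rewrite {1}xE mulmxDl -!mulmxA E12 E22 !mulmx0 add0r mulmx1.
  by [].
Qed.

Lemma biproduct_dim a b c (x : mrep F Q a) (y : mrep F Q b) (z : mrep F Q c) i1 p1 i2 p2 :
  biproduct x y z i1 p1 i2 p2 -> a = dimD b c.
Proof.
case=> _ _ _ _ /ffunP e11 /ffunP e22 /ffunP e12 /ffunP e21 /ffunP es.
apply: functional_extensionality => i; rewrite /dimD.
have E1 : row_mx (p1 i) (p2 i) *m col_mx (i1 i) (i2 i) = 1%:M.
  by have := es i; rewrite dffunDE !ffunE mul_row_col.
have E2 : col_mx (i1 i) (i2 i) *m row_mx (p1 i) (p2 i) = 1%:M.
  have := (e11 i, e22 i, e12 i, e21 i); rewrite !dffun0E !ffunE => -[[[A1 A2] A3] A4].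
  by rewrite mul_col_row A1 A2 A3 A4 -scalar_mx_block.
by apply/eqP; rewrite eqn_leq (mulmx1_min E1) (mulmx1_min E2).
Qed.

Definition dsum b c (y : mrep F Q b) (z : mrep F Q c) : mrep F Q (dimD b c) :=
  bmx y z (finfun (fun=> 0)).

Lemma dsum_biproduct b c (y : mrep F Q b) (z : mrep F Q c) :
  exists i1 p1 i2 p2, biproduct (dsum y z) y z i1 p1 i2 p2.
Proof.
pose i1 : vfam F b (dimD b c) := finfun (fun i => row_mx 1%:M 0 : 'M_(b i, dimD b c i)).
pose i2 : vfam F c (dimD b c) := finfun (fun i => row_mx 0 1%:M : 'M_(c i, dimD b c i)).
pose p1 : vfam F (dimD b c) b := finfun (fun i => col_mx 1%:M 0 : 'M_(dimD b c i, b i)).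
pose p2 : vfam F (dimD b c) c := finfun (fun i => col_mx 0 1%:M : 'M_(dimD b c i, c i)).
exists i1, p1, i2, p2; split.
- by apply/forallP => d; rewrite !ffunE mul_row_block mul_mx_row !(mul0mx, mulmx0, addr0, add0r) mul1mx mulmx1.
- by apply/forallP => d; rewrite !ffunE mul_block_col mul_col_mx !(mul0mx, mulmx0, addr0, add0r) mul1mx mulmx1.
- by apply/forallP => d; rewrite !ffunE mul_row_block mul_mx_row !(mul0mx, mulmx0, addr0, add0r) mul1mx mulmx1.
- by apply/forallP => d; rewrite !ffunE mul_block_col mul_col_mx !(mul0mx, mulmx0, addr0, add0r) mul1mx mulmx1.
- by apply/ffunP => i; rewrite !ffunE mul_row_col mulmx0 mulmx1 addr0.
- by apply/ffunP => i; rewrite !ffunE mul_row_col mulmx0 mulmx1 add0r.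
- by apply/ffunP => i; rewrite dffun0E !ffunE mul_row_col mulmx0 mulmx1 addr0.
- by apply/ffunP => i; rewrite dffun0E !ffunE mul_row_col mulmx0 mulmx1 add0r.
- apply/ffunP => i; rewrite dffunDE !ffunE !mul_col_row !mulmx0 !mul0mx !mulmx1 add_block_mx.
  by rewrite !addr0 !add0r -scalar_mx_block.
Qed.

Definition repiso a b (x : mrep F Q a) (y : mrep F Q b) : Prop :=
  exists f g, [/\ homf x y f, homf y x g, cmp f g = one a & cmp g f = one b].

Lemma repiso_refl a (x : mrep F Q a) : repiso x x.
Proof. by exists (one a), (one a); rewrite !homf_sc !cmp1l. Qed.

Lemma repiso_sym a b (x : mrep F Q a) (y : mrep F Q b) : repiso x y -> repiso y x.
Proof. by case=> f [g [xf yg fg gf]]; exists g, f. Qed.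

Lemma repiso_trans a b c (x : mrep F Q a) (y : mrep F Q b) (z : mrep F Q c) :
  repiso x y -> repiso y z -> repiso x z.
Proof.
case=> f [g [xf yg fg gf]] [f' [g' [yf' zg' fg' gf']]]; exists (cmp f f'), (cmp g' g).
split; [exact: homf_cmp xf yf'|exact: homf_cmp zg' yg|..].
  by rewrite cmpA -(cmpA f) fg' cmp1r fg.
by rewrite cmpA -(cmpA g') gf cmp1r gf'.
Qed.

Lemma repiso_dim a b (x : mrep F Q a) (y : mrep F Q b) : repiso x y -> a = b.
Proof.
case=> f [g [_ _ /ffunP fg /ffunP gf]]; apply: functional_extensionality => i.
have := fg i; have := gf i; rewrite !ffunE => g1 f1.
by apply/eqP; rewrite eqn_leq (mulmx1_min f1) (mulmx1_min g1).
Qed.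

Lemma repiso_conj a (x y : mrep F Q a) : repiso y x <-> exists2 g, unitf g & y = conj g x.
Proof.
split=> [[f [g [yf xg /ffunP fg /ffunP gf]]]|[g gu ->]]; last first.
  exists g, (invf g); rewrite invf_l // invf_r //; split=> //; first exact: homf_conj.
  exact: homf_inv gu (homf_conj x gu).
have fu : unitf f.
  by apply/forallP => i; have := fg i; rewrite !ffunE => /mulmx1_unit[].
by exists f => //; apply: homf_conjE.
Qed.

(** If f g is invertible, then f has a right inverse g', and g' f is an idempotent in the local ring
    End y. It is either nilpotent, hence 0, which makes the identity of x zero, or invertible, hence
    1, which makes x and y isomorphic. *)
Lemma noniso_radical a b (x : mrep F Q a) (y : mrep F Q b) f g :
  indec x -> indec y -> ~ repiso x y -> homf x y f -> homf y x g -> nilpf (cmp f g).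
Proof.
move=> xI yI nxy xf yg; have xfg := homf_cmp xf yg.
case: (indec_local xI xfg) => // u; case: nxy.
have xu := homf_inv u xfg; pose g' := cmp g (invf (cmp f g)).
have yg' : homf y x g' by exact: homf_cmp yg xu.
have fg' : cmp f g' = one a by rewrite cmpA invf_r.
have yE := homf_cmp yg' xf.
have idem : cmp (cmp g' f) (cmp g' f) = cmp g' f by rewrite -cmpA (cmpA f) fg' cmp1l.
case: (indec_local yI yE) => e.
  have e0 N : expf N.+1 (cmp g' f) = cmp g' f.
    move: idem; move: (cmp g' f) => v vv; elim: N => [|N IH]; first by apply/ffunP => i; rewrite ffunE.
    rewrite -[RHS]vv -{3}IH; by apply/ffunP => i; rewrite !ffunE exprS.
  have z : cmp g' f = 0 by rewrite -(e0 (ht b)) (expf_nilpf e (leqnSn _)).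
  have one0 : one a = 0.
    have : cmp (cmp f g') (cmp f g') = one a by rewrite fg' cmp1l.
    by rewrite -cmpA (cmpA g') z cmp0l cmp0r => <-.
  case: (@indec_nil_nunit _ _ _ _ _ xI (one a)); first by rewrite one0 nilpf0.
  by apply/forallP => i; rewrite ffunE unitmx1.
exists f, g'; split=> //.
by rewrite -[LHS]cmp1l -(invf_l e) -cmpA idem.
Qed.

End Splitting.

(** * Decompositions and the endomorphism ring modulo its radical *)

Section KrullSchmidt.
Variables (n : nat) (Q : quiver n) (F : finFieldType) (J : finType).
Variables (dW : J -> 'I_n -> nat) (mW : forall j, mrep F Q (dW j)).
Hypothesis WI : forall j, indec (mW j).
Hypothesis Wnoniso : forall j j', repiso (mW j) (mW j') -> j = j'.
Variables (L : J -> finFieldType) (r : forall j, vfam F (dW j) (dW j) -> L j)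
  (iota : forall j, {rmorphism F -> L j}).
Arguments r : clear implicits.
Hypothesis rD : forall j f g, homf (mW j) (mW j) f -> homf (mW j) (mW j) g -> r j (f + g) = r j f + r j g.
Hypothesis rM : forall j f g, homf (mW j) (mW j) f -> homf (mW j) (mW j) g -> r j (cmp f g) = r j f * r j g.
Hypothesis r0 : forall j f, homf (mW j) (mW j) f -> (r j f == 0) = nilpf f.
Hypothesis rsur : forall j y, exists2 f, homf (mW j) (mW j) f & r j f = y.
Hypothesis rsc : forall j c, r j (scf (dW j) c) = iota j c.
Local Notation one a := (scf a (1 : F)).

Let r00 j : r j 0 = 0. Proof. by apply/eqP; rewrite r0 ?homf0 ?nilpf0. Qed.
Let r1 j : r j (one _) = 1. Proof. by rewrite rsc rmorph1. Qed.

Let r_sum j (I : Type) (s : seq I) (P : pred I) (f : I -> vfam F (dW j) (dW j)) :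
  (forall i, P i -> homf (mW j) (mW j) (f i)) -> r j (\sum_(i <- s | P i) f i) = \sum_(i <- s | P i) r j (f i).
Proof.
move=> H; elim: s => [|i s IH]; first by rewrite !big_nil r00.
rewrite !big_cons; case: ifP => // Pi; rewrite rD ?IH ?H //.
by apply: homf_sum.
Qed.

Record dec a (x : mrep F Q a) := Dec {
  mult : J -> nat;
  inj : forall j, 'I_(mult j) -> vfam F (dW j) a;
  prj : forall j, 'I_(mult j) -> vfam F a (dW j);
  inj_hom : forall j p, homf (mW j) x (@inj j p);
  prj_hom : forall j p, homf x (mW j) (@prj j p);
  inj_prj : forall j p q, cmp (@inj j p) (@prj j q) = if p == q then one _ else 0;
  inj_prj0 : forall j j' p q, j != j' -> cmp (@inj j p) (@prj j' q) = 0;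
  dec_dim : forall i, a i = (\sum_j mult j * dW j i)%N;
  dec_sum : \sum_j \sum_p cmp (@prj j p) (@inj j p) = one a }.
Arguments inj {a x} d j p.
Arguments prj {a x} d j p.

(* The matrix of f modulo the radical; pi is a functor because a composite
   W_j -> W_j' -> W_j with j <> j' is nilpotent. *)
Definition pi a b (x : mrep F Q a) (y : mrep F Q b) (D : dec x) (D' : dec y) j
    (f : vfam F a b) : 'M[L j]_(mult D j, mult D' j) :=
  \matrix_(p, q) r j (cmp (inj D j p) (cmp f (prj D' j q))).

Section Functor.
Variables (a b c : 'I_n -> nat) (x : mrep F Q a) (y : mrep F Q b) (z : mrep F Q c).
Variables (D : dec x) (D' : dec y) (D'' : dec z).

Lemma pi_entry_hom j p q f : homf x y f ->
  homf (mW j) (mW j) (cmp (inj D j p) (cmp f (prj D' j q))).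
Proof.
by move=> xf; exact: (homf_cmp (inj_hom _) (homf_cmp xf (prj_hom _))).
Qed.

Lemma piD j f g : homf x y f -> homf x y g -> pi D D' j (f + g) = pi D D' j f + pi D D' j g.
Proof.
by move=> xf xg; apply/matrixP => p q; rewrite !mxE cmpDl cmpDr rD ?pi_entry_hom.
Qed.

Lemma pi0 j : pi D D' j 0 = 0.
Proof. by apply/matrixP => p q; rewrite !mxE cmp0l cmp0r r00. Qed.

Lemma pi_opp j f : homf x y f -> pi D D' j (- f) = - pi D D' j f.
Proof. by move=> xf; apply/eqP; rewrite -addr_eq0 -piD ?homfN // addNr pi0. Qed.

Lemma piM j f g : homf x y f -> homf y z g ->
  pi D D'' j (cmp f g) = pi D D' j f *m pi D' D'' j g.
Proof.
move=> xf yg; apply/matrixP => p q; rewrite !mxE.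
have -> : cmp (inj D j p) (cmp (cmp f g) (prj D'' j q)) =
  \sum_j' \sum_s cmp (cmp (inj D j p) (cmp f (prj D' j' s))) (cmp (inj D' j' s) (cmp g (prj D'' j q))).
  rewrite -[f in LHS]cmp1r -(dec_sum D') cmp_sumr !cmp_suml cmp_sumr; apply: eq_bigr => j' _.
  rewrite cmp_sumr !cmp_suml cmp_sumr; apply: eq_bigr => s _.
  by rewrite !cmpA.
have hom1 j' s : homf (mW j) (mW j') (cmp (inj D j p) (cmp f (prj D' j' s))).
  exact: (homf_cmp (inj_hom _) (homf_cmp xf (prj_hom _))).
have hom2 j' s : homf (mW j') (mW j) (cmp (inj D' j' s) (cmp g (prj D'' j q))).
  exact: (homf_cmp (inj_hom _) (homf_cmp yg (prj_hom _))).
have hom3 j' s := homf_cmp (hom1 j' s) (hom2 j' s).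
rewrite r_sum; last by move=> j' _; apply: homf_sum.
rewrite (bigD1 j) //= [X in _ + X]big1 ?addr0 => [|j' jj']; last first.
  rewrite r_sum // big1 // => s _; apply/eqP; rewrite r0 //.
  apply: noniso_radical (WI j) (WI j') _ (hom1 j' s) (hom2 j' s) => /Wnoniso E.
  by rewrite E eqxx in jj'.
by rewrite r_sum //; apply: eq_bigr => s _; rewrite rM ?mxE.
Qed.

Lemma pi_surj (M : forall j, 'M[L j]_(mult D j, mult D' j)) :
  exists2 f, homf x y f & forall j, pi D D' j f = M j.
Proof.
have [h hP] : exists h : forall jpq : {j : J & ('I_(mult D j) * 'I_(mult D' j))%type},
    vfam F (dW (tag jpq)) (dW (tag jpq)), forall jpq,
    homf (mW (tag jpq)) (mW (tag jpq)) (h jpq) /\ r _ (h jpq) = M _ (tagged jpq).1 (tagged jpq).2.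
  apply: (@dependent_choice _ _ (fun jpq h => homf (mW (tag jpq)) (mW (tag jpq)) h /\
    r _ h = M _ (tagged jpq).1 (tagged jpq).2)) => -[j [p q]] /=.
  by have [f xf rf] := rsur (M j p q); exists f.
pose H j p q := h (Tagged (fun j => ('I_(mult D j) * 'I_(mult D' j))%type) (p, q)) : vfam F (dW j) (dW j).
have HM j p q : r j (H j p q) = M j p q by have [_] := hP (Tagged (fun j => ('I_(mult D j) * 'I_(mult D' j))%type) (p, q)).
have Hh j p q : homf (mW j) (mW j) (H j p q) by have [] := hP (Tagged (fun j => ('I_(mult D j) * 'I_(mult D' j))%type) (p, q)).
pose f := \sum_j \sum_p \sum_q cmp (prj D j p) (cmp (H j p q) (inj D' j q)).
have xf : homf x y f.
  apply: homf_sum => j _; apply: homf_sum => p _; apply: homf_sum => q _.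
  exact: (homf_cmp (prj_hom _) (homf_cmp (Hh j p q) (inj_hom _))).
exists f => // j; apply/matrixP => p q; rewrite mxE -HM; congr (r j _).
rewrite /f cmp_suml cmp_sumr (bigD1 j) //= [X in _ + X]big1 ?addr0 => [|j' jj']; last first.
  rewrite cmp_suml cmp_sumr big1 // => s _; rewrite cmp_suml cmp_sumr big1 // => t _.
  by rewrite !cmpA inj_prj0 ?cmp0l // eq_sym.
rewrite cmp_suml cmp_sumr (bigD1 p) //= [X in _ + X]big1 ?addr0 => [|s sp]; last first.
  rewrite cmp_suml cmp_sumr big1 // => t _.
  by rewrite !cmpA inj_prj eq_sym (negbTE sp) !cmp0l.
rewrite cmp_suml cmp_sumr (bigD1 q) //= [X in _ + X]big1 ?addr0 => [|t tq]; last first.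
  by rewrite -!cmpA inj_prj (negbTE tq) !cmp0r.
by rewrite -!cmpA inj_prj eqxx cmp1r cmpA inj_prj eqxx cmp1l.
Qed.

End Functor.

Section Endomorphisms.
Variables (a : 'I_n -> nat) (x : mrep F Q a) (D : dec x).

Lemma pi_sc j c : pi D D j (scf a c) = (iota j c)%:M.
Proof.
apply/matrixP => p q; rewrite !mxE; have -> : cmp (inj D j p) (cmp (scf a c) (prj D j q))
    = cmp (scf _ c) (cmp (inj D j p) (prj D j q)).
  by apply/ffunP => i; rewrite !ffunE mulmxA scalar_mxC !mulmxA.
rewrite inj_prj; case: eqP => _; last by rewrite cmp0r r00.
by rewrite cmp1r rsc mulr1n.
Qed.

Lemma pi1 j : pi D D j (one a) = 1%:M.
Proof. by rewrite pi_sc rmorph1. Qed.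

Lemma piX j N f : homf x x f -> pi D D j (expf N f) = pi D D j f ^+ N.
Proof.
move=> xf; elim: N => [|N IH].
  by rewrite expr0 -[RHS]pi1; congr pi; apply/ffunP => i; rewrite !ffunE.
rewrite exprS -IH (_ : expf N.+1 f = cmp f (expf N f)) ?(piM D D) ?homf_exp //.
by apply/ffunP => i; rewrite !ffunE exprS.
Qed.

End Endomorphisms.

Lemma mult_iso a b (x : mrep F Q a) (y : mrep F Q b) (D : dec x) (D' : dec y) :
  repiso x y -> mult D = mult D'.
Proof.
case=> f [g [xf yg fg gf]]; apply: functional_extensionality => j.
have P : pi D D' j f *m pi D' D j g = 1%:M by rewrite -piM // fg pi1.
have R : pi D' D j g *m pi D D' j f = 1%:M by rewrite -piM // gf pi1.
by apply/eqP; rewrite eqn_leq (mulmx1_min P) (mulmx1_min R).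
Qed.

Lemma iso_of_mult a b (x : mrep F Q a) (y : mrep F Q b) (D : dec x) (D' : dec y) :
  mult D = mult D' -> repiso x y.
Proof.
case: D => m i p ih ph ip ip0 _ ds /=; case: D' => m' i' p' ih' ph' ip' ip0' _ ds' /= mm'.
case: _ / mm' in i' p' ih' ph' ip' ip0' ds' *.
exists (\sum_j \sum_s cmp (p j s) (i' j s)), (\sum_j \sum_s cmp (p' j s) (i j s)).
have E (a1 a2 a3 : 'I_n -> nat) (P1 : forall j, 'I_(m j) -> vfam F a1 (dW j)) (I2 : forall j, 'I_(m j) -> vfam F (dW j) a2)
    (P2 : forall j, 'I_(m j) -> vfam F a2 (dW j)) (I3 : forall j, 'I_(m j) -> vfam F (dW j) a3) :
    (forall j s t, cmp (I2 j s) (P2 j t) = if s == t then one _ else 0) ->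
    (forall j j' s t, j != j' -> cmp (I2 j s) (P2 j' t) = 0) ->
    cmp (\sum_j \sum_s cmp (P1 j s) (I2 j s)) (\sum_j \sum_s cmp (P2 j s) (I3 j s))
    = \sum_j \sum_s cmp (P1 j s) (I3 j s).
  move=> H1 H2; rewrite cmp_suml; apply: eq_bigr => j _; rewrite cmp_suml; apply: eq_bigr => s _.
  rewrite cmp_sumr (bigD1 j) //= [X in _ + X]big1 ?addr0 => [|j' jj']; last first.
    rewrite cmp_sumr big1 // => t _; rewrite -cmpA (cmpA (I2 _ _)) H2 ?cmp0l ?cmp0r //.
    by rewrite eq_sym.
  rewrite cmp_sumr (bigD1 s) //= [X in _ + X]big1 ?addr0 => [|t ts]; last first.
    by rewrite -cmpA (cmpA (I2 _ _)) H1 eq_sym (negbTE ts) cmp0l cmp0r.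
  by rewrite -cmpA (cmpA (I2 _ _)) H1 eqxx cmp1l.
split.
- by do 2!apply: homf_sum => ? _; exact: homf_cmp (ph _ _) (ih' _ _).
- by do 2!apply: homf_sum => ? _; exact: homf_cmp (ph' _ _) (ih _ _).
- by rewrite E.
- by rewrite E.
Qed.

Lemma dec_zero a (x : mrep F Q a) : ht a = 0%N -> exists D : dec x, forall j, mult D j = 0%N.
Proof.
move=> a0.
have ai i : a i = 0%N by apply/eqP; rewrite -leqn0 -a0 leq_ht.
unshelve eexists (@Dec _ x (fun=> 0%N) (fun j p => 0) (fun j p => 0) _ _ _ _ _ _) => //.
- by move=> j p; case: p.
- by move=> j p; case: p.
- by move=> j p; case: p.
- by move=> j j' p; case: p.
- by move=> i; rewrite ai big1.
- apply/ffunP => i; by apply/matrixP => -[p pa]; exfalso; rewrite ai in pa.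
Qed.

(* The identity when a = b; for a <> b a junk value, which avoids casts. *)
Definition idm (a b : 'I_n -> nat) : vfam F a b :=
  finfun (fun i => \matrix_(s, t) (s == t :> nat)%:R).

Lemma idm1 a : idm a a = one a.
Proof. by apply/ffunP => i; rewrite !ffunE; apply/matrixP => s t; rewrite !mxE -val_eqE; case: eqP. Qed.

Lemma dec_single j : exists D : dec (mW j), forall j', mult D j' = (j' == j).
Proof.
have ordE j' (p : 'I_(j' == j)) : j' = j by apply/eqP; case: p => [[|m]]; case: eqP.
have ord1E j' (p q : 'I_(j' == j)) : p = q.
  by apply: val_inj; case: p q => p hp [q hq] /=; move: hp hq; case: (j' == j) => //; rewrite !ltnS !leqn0 => /eqP -> /eqP ->.
unshelve eexists (@Dec _ (mW j) (fun j' => nat_of_bool (j' == j)) (fun j' p => idm (dW j') (dW j)) (fun j' p => idm (dW j) (dW j')) _ _ _ _ _ _) => //.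
- by move=> j' p /=; have e := ordE _ p; clear p; subst j'; rewrite idm1 homf_sc.
- by move=> j' p /=; have e := ordE _ p; clear p; subst j'; rewrite idm1 homf_sc.
- by move=> j' p q; rewrite (ord1E _ p q) eqxx /=; have e := ordE _ q; clear p q; subst j'; rewrite idm1 cmp1l.
- by move=> j1 j2 p q jj; exfalso; rewrite (ordE _ p) (ordE _ q) eqxx in jj.
- by move=> i; rewrite (bigD1 j) //= eqxx mul1n big1 ?addn0 // => j' /negbTE ->.
- rewrite (bigD1 j) //= [X in _ + X]big1 ?addr0 => [|j' j'j]; last first.
    by rewrite big1 // => p; exfalso; rewrite (ordE _ p) eqxx in j'j.
  rewrite (eq_bigr (fun=> one (dW j))) => [|p _]; last by rewrite !idm1 cmp1l.
  by rewrite sumr_const card_ord eqxx.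
Qed.

Lemma dec_iso a b (x : mrep F Q a) (y : mrep F Q b) (D : dec x) :
  repiso x y -> exists D' : dec y, mult D' = mult D.
Proof.
move=> xy; have ab := repiso_dim xy; case: xy => f [g [xf yg fg gf]].
unshelve eexists (@Dec _ y (mult D) (fun j p => cmp (inj D j p) f) (fun j p => cmp g (prj D j p)) _ _ _ _ _ _) => //.
- by move=> j p; exact: homf_cmp (inj_hom _) xf.
- by move=> j p; exact: homf_cmp yg (prj_hom _).
- by move=> j p q; rewrite -cmpA (cmpA f) fg cmp1l inj_prj.
- by move=> j j' p q jj'; rewrite -cmpA (cmpA f) fg cmp1l inj_prj0.
- by move=> i; rewrite -(dec_dim D) ab.
- rewrite -[RHS]gf -[g in RHS]cmp1r -(dec_sum D) cmp_sumr cmp_suml; apply: eq_bigr => j _.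
  by rewrite cmp_sumr cmp_suml; apply: eq_bigr => s _; rewrite !cmpA.
Qed.

Lemma dec_biproduct a b c (x : mrep F Q a) (y : mrep F Q b) (z : mrep F Q c) i1 p1 i2 p2
    (D1 : dec y) (D2 : dec z) : biproduct x y z i1 p1 i2 p2 ->
  exists D : dec x, forall j, mult D j = (mult D1 j + mult D2 j)%N.
Proof.
move=> bp; have abc := biproduct_dim bp; case: bp => h1 k1 h2 k2 e11 e22 e12 e21 es.
pose ii j (p : 'I_(mult D1 j + mult D2 j)) := match split p with
  inl s => cmp (inj D1 j s) i1 | inr s => cmp (inj D2 j s) i2 end.
pose pp j (p : 'I_(mult D1 j + mult D2 j)) := match split p with
  inl s => cmp p1 (prj D1 j s) | inr s => cmp p2 (prj D2 j s) end.
have C b1 b2 b3 b4 (u : vfam F b1 b2) (v : vfam F b2 a) (w : vfam F a b3) (t : vfam F b3 b4) :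
  cmp (cmp u v) (cmp w t) = cmp u (cmp (cmp v w) t) by rewrite !cmpA.
unshelve eexists (@Dec _ x (fun j => mult D1 j + mult D2 j)%N ii pp _ _ _ _ _ _) => //.
- by move=> j p; rewrite /ii; case: (split p) => s; [exact: homf_cmp (inj_hom _) h1|exact: homf_cmp (inj_hom _) h2].
- by move=> j p; rewrite /pp; case: (split p) => s; [exact: homf_cmp k1 (prj_hom _)|exact: homf_cmp k2 (prj_hom _)].
- move=> j p q; rewrite -(inj_eq (can_inj splitK)) /ii /pp.
  case: (split p) => s; case: (split q) => t; rewrite C ?e11 ?e12 ?e21 ?e22 ?cmp1l ?cmp0l ?cmp0r ?inj_prj //.
- move=> j j' p q jj'; rewrite /ii /pp.
  by case: (split p) => s; case: (split q) => t; rewrite C ?e11 ?e12 ?e21 ?e22 ?cmp1l ?cmp0l ?cmp0r ?inj_prj0.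
- by move=> i; under eq_bigr do rewrite mulnDl; rewrite big_split -!dec_dim abc.
- under eq_bigr do rewrite big_split_ord.
  rewrite big_split /= -es; congr (_ + _).
    rewrite -[p1 in RHS]cmp1r -(dec_sum D1) cmp_sumr cmp_suml; apply: eq_bigr => j _.
    rewrite cmp_sumr cmp_suml; apply: eq_bigr => s _.
    by rewrite /ii /pp -[lshift _ s]/(unsplit (inl s)) unsplitK !cmpA.
  rewrite -[p2 in RHS]cmp1r -(dec_sum D2) cmp_sumr cmp_suml; apply: eq_bigr => j _.
  rewrite cmp_sumr cmp_suml; apply: eq_bigr => s _.
  by rewrite /ii /pp -[rshift _ s]/(unsplit (inr s)) unsplitK !cmpA.
Qed.

Variable l : 'I_n -> rat.

Lemma fss_embed b a (y : mrep F Q b) (x : mrep F Q a) i p : homf y x i -> cmp i p = one b ->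
  fss l x -> fss l y.
Proof.
move=> /forallP yi /ffunP ip /fssP xF; apply/fssP => m U /forallP yU.
have <- : rk (fun j => U j *m i j) = rk U.
  apply: functional_extensionality => j; apply: mxrankMfree; apply/row_freeP; exists (p j).
  by have := ip j; rewrite !ffunE.
apply: xF; apply/forallP => c; rewrite -mulmxA -(eqP (yi c)) mulmxA; exact: submxMr.
Qed.

(** Both summands embed in x, so their weights are <= 0; as the weights add up to 0, both vanish. *)
Lemma sss_biproduct a b c (x : mrep F Q a) (y : mrep F Q b) (z : mrep F Q c) i1 p1 i2 p2 :
  biproduct x y z i1 p1 i2 p2 -> sss l x -> sss l y /\ sss l z.
Proof.
move=> bp /andP[xF /eqP xl]; have abc := biproduct_dim bp; case: bp => h1 _ h2 _ e11 e22 _ _ _.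
have yF := fss_embed h1 e11 xF; have zF := fss_embed h2 e22 xF.
have top d (w : mrep F Q d) : fss l w -> lam l d <= 0.
  move/fssP/(_ d (fun i => 1%:M)); rewrite (_ : rk _ = d); last first.
    by apply: functional_extensionality => i; rewrite /rk mxrank1.
  by apply; apply/forallP => e; rewrite mul1mx submx1.
have := (top _ _ yF, top _ _ zF); rewrite /sss yF zF; move: xl; rewrite abc lamD => ? [? ?].
by split; apply/eqP; lra.
Qed.

(** Induction on the height: an x that is nonzero and not indecomposable splits into two nonzero
    semistable summands of smaller height. The family of the W_j is finite, so it is complete only
    up to a height h. *)
Lemma exists_dec h : (forall b (y : mrep F Q b), (ht b <= h)%N -> sss l y -> indec y -> exists j, repiso (mW j) y) ->
  forall a (x : mrep F Q a), (ht a <= h)%N -> sss l x -> inhabited (dec x).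
Proof.
move=> Wc a; move: {2}(ht a).+1 (ltnSn (ht a)) => N; elim: N a => // N IH a aN x ah xs.
case: (posnP (ht a)) => [/dec_zero H|a0]; first by have [D _] := H x.
case: (excluded_middle_informative (indec x)) => [/(Wc _ _ ah xs) [j]|nI].
  by have [D _] := dec_single j; move/(dec_iso D) => [D' _].
have [U [V [xU xV UV [[i Ui] [i' Vi]]]]] : exists U V : forall i, 'M[F]_(a i),
    [/\ stab x U, stab x V, forall i, (U i + V i :=: 1%:M)%MS /\ (U i :&: V i = 0)%MS &
     (exists i, U i <> 0) /\ exists i, V i <> 0].
  apply: NNPP => H; apply: nI; split=> // U V xU xV UV.
  apply: NNPP => H'; apply: H; exists U, V; split=> //.
  by split; apply: not_all_ex_not => H0; apply: H'; [left|right].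
have [y [z [i1 [p1 [i2 [p2 [bp _ _]]]]]]] := split_biproduct xU xV UV.
have [ys zs] := sss_biproduct bp xs.
have htE : ht a = (ht (rk U) + ht (rk V))%N by rewrite {1}(biproduct_dim bp) htD.
have pos (W : forall i, 'M[F]_(a i)) e : W e <> 0 -> (0 < ht (rk W))%N.
  by move=> We; apply: leq_trans (leq_ht _ e); rewrite lt0n mxrank_eq0; apply/eqP.
have hU := pos _ _ Ui; have hV := pos _ _ Vi.
have [] := IH (rk U) _ y _ ys; [lia|lia|move=> D1].
have [] := IH (rk V) _ z _ zs; [lia|lia|move=> D2].
by have [D _] := dec_biproduct D1 D2 bp.
Qed.

Lemma exists_mult (Ws : forall j, sss l (mW j)) (m : J -> nat) (a : 'I_n -> nat) :
  (forall i, a i = \sum_j m j * dW j i)%N ->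
  exists (x : mrep F Q a) (D : dec x), sss l x /\ mult D = m.
Proof.
move=> am; have [b [x [D [xs Dm]]]] : exists b (x : mrep F Q b) (D : dec x), sss l x /\ mult D = m.
  move: {2}(\sum_j m j)%N (leqnn (\sum_j m j)%N) => N; elim: N m {am} => [|N IH] m mN.
    have m0 j : m j = 0%N.
      by apply/eqP; rewrite -leqn0 (leq_trans _ mN) // (bigD1 j) //= leq_addr.
    pose x : mrep F Q (@dim0 n) := finfun (fun=> 0).
    have h0 : ht (@dim0 n) = 0%N by rewrite /ht big1.
    have [D D0] := dec_zero x h0; exists (@dim0 n), x, D; split; last first.
      by apply: functional_extensionality => j; rewrite D0 m0.
    rewrite /sss lam0 eqxx andbT; apply/fssP => u U _.
    by rewrite (_ : rk U = @dim0 n) ?lam0 //; apply: functional_extensionality => i; rewrite /rk thinmx0 mxrank0.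
  case: (posnP (\sum_j m j)) => [m0|mpos]; first by apply: IH; rewrite m0.
  have [j mj] : exists j, (0 < m j)%N.
    apply/existsP; apply: contraLR mpos; rewrite negb_exists -leqNgt leqn0 => /forallP H.
    by rewrite big1 // => j _; apply/eqP; rewrite -leqn0 leqNgt.
  have [|b [x [D [xs Dm]]]] := IH (fun j' => m j' - (j' == j))%N.
    move: mN; rewrite (bigD1 j) //= [in X in _ -> X](bigD1 j) //= eqxx.
    have -> : (\sum_(j' | j' != j) (m j' - (j' == j)) = \sum_(j' | j' != j) m j')%N.
      by apply: eq_bigr => j' /negbTE ->; rewrite subn0.
    by move=> H; move: mj H; clear; lia.
  have [D1 D1m] := dec_single j.
  have [i1 [p1 [i2 [p2 bp]]]] := dsum_biproduct (mW j) x.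
  have [D2 D2m] := dec_biproduct D1 D bp.
  exists (dimD (dW j) b), (dsum (mW j) x), D2; split.
    by rewrite sss_bmx ?Ws ?xs //; have /andP[_ /eqP] := Ws j.
  apply: functional_extensionality => j'; rewrite D2m D1m Dm.
  by rewrite subnKC //; case: eqP => // ->.
have ba : b = a by apply: functional_extensionality => i; rewrite am (dec_dim D) Dm.
by case: _ / ba; exists x, D.
Qed.

(** For large N the image of f^N is a direct summand on which f^N is invertible. If it is nonzero,
    some W_j occurs in it; there [pi] of an invertible endomorphism would be 0, although [pi]
    respects products and sends the identity to the identity. *)
Lemma pi_nil h (Wc : forall b (y : mrep F Q b), (ht b <= h)%N -> sss l y -> indec y -> exists j, repiso (mW j) y)
  a (x : mrep F Q a) (D : dec x) f : (ht a <= h)%N -> sss l x -> homf x x f ->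
  (forall j, pi D D j f = 0) -> nilpf f.
Proof.
move=> ah xs xf pf; pose N := (ht a).+1; have xfN := homf_exp N xf.
pose U i : 'M[F]_(a i) := f i ^+ N; pose V i : 'M[F]_(a i) := kermx (f i ^+ N).
have xV : stab x V.
  have := stab_ker xfN; congr (stab _ _); apply: functional_extensionality_dep => i.
  by rewrite ffunE.
have xU : stab x U.
  have := stab_im xfN; congr (stab _ _); apply: functional_extensionality_dep => i.
  by rewrite ffunE.
have UV i : (U i + V i :=: 1%:M)%MS /\ (U i :&: V i = 0)%MS := matrix_fitting (f i) (leqW (leq_ht a i)).
have [y [z [i1 [p1 [i2 [p2 [bp i1U _]]]]]]] := split_biproduct xU xV UV.
case: (posnP (ht (rk U))) => [U0|hU].
  apply: (nilpf_exp (N := N)); apply/ffunP => i; rewrite dffun0E ffunE.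
  by apply/eqP; rewrite -mxrank_eq0 -leqn0 -U0; exact: (leq_ht (rk U) i).
have htE : ht a = (ht (rk U) + ht (rk V))%N by rewrite {1}(biproduct_dim bp) htD.
have [ys _] := sss_biproduct bp xs.
have [D'] := exists_dec Wc (leq_trans (leq_addr (ht (rk V)) _) (eq_ind _ (fun t => t <= h)%N ah _ htE)) ys.
have [j mj] : exists j, (0 < mult D' j)%N.
  apply/existsP; apply: contraLR hU; rewrite negb_exists -leqNgt leqn0 => /forallP H.
  rewrite /ht big1 // => i _; rewrite (dec_dim D') big1 // => j _.
  by have := H j; rewrite lt0n negbK => /eqP ->.
case: bp => h1 k1 _ _ e11 _ _ _ _.
pose psi := cmp i1 (cmp (expf N f) p1).
have ypsi : homf y y psi := homf_cmp h1 (homf_cmp xfN k1).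
have psiu : unitf psi.
  apply/forallP => i; rewrite -row_free_unit !ffunE.
  have e1 : i1 i *m p1 i = 1%:M by have /ffunP/(_ i) := e11; rewrite !ffunE.
  have fU : f i ^+ N *m p1 i *m i1 i = f i ^+ N.
    have /submxP[B BE] : (f i ^+ N <= i1 i)%MS by rewrite i1U.
    by rewrite BE -!mulmxA (mulmxA (i1 i)) e1 mul1mx.
  have free : row_free (i1 i *m f i ^+ N).
    apply/row_freeP; apply/row_freeP; rewrite -kermx_eq0 -submx0; set K := kermx _.
    have K0 : K *m i1 i *m f i ^+ N = 0 by rewrite -mulmxA mulmx_ker.
    have : (K *m i1 i <= U i :&: V i)%MS.
      by rewrite sub_capmx -i1U submxMl sub_kermx K0 eqxx.
    rewrite (UV i).2 !submx0 => /eqP Ki; rewrite -[K]mulmx1 -e1 mulmxA Ki mul0mx //.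
  have rke : \rank (i1 i *m f i ^+ N) = rk U i by apply/eqP.
  rewrite /row_free eqn_leq rank_leq_row /=.
  apply: (@leq_trans (\rank (i1 i *m f i ^+ N))); first by rewrite rke.
  have -> : i1 i *m f i ^+ N = i1 i *m (f i ^+ N *m p1 i) *m i1 i by rewrite -mulmxA fU.
  exact: mxrankM_maxl.
have P0 : pi D' D' j psi = 0.
  rewrite (piM D' D) ?(homf_cmp xfN) // (piM D D) // piX // pf exprS mul0r.
  by rewrite mul0mx mulmx0.
have yinv := homf_inv psiu ypsi.
have : pi D' D' j (one _) = 0 by rewrite -(invf_r psiu) (piM D' D') // P0 mul0mx.
rewrite pi1 => /matrixP/(_ (Ordinal mj) (Ordinal mj)); rewrite !mxE eqxx => /eqP.
by rewrite oner_eq0.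
Qed.

Section Count.
Variables (h : nat) (a : 'I_n -> nat) (x : mrep F Q a) (D : dec x).
Hypothesis Wc : forall b (y : mrep F Q b), (ht b <= h)%N -> sss l y -> indec y -> exists j, repiso (mW j) y.
Hypotheses (ah : (ht a <= h)%N) (xs : sss l x).

Lemma nilpf_pi f : homf x x f -> nilpf f = [forall j, nilpm (pi D D j f)].
Proof.
move=> xf; apply/idP/forallP => [fn j|pn].
  by apply/nilpmP; exists (ht a); rewrite -piX // (expf_nilpf fn) // pi0.
pose N := (\sum_j mult D j)%N.
have : nilpf (expf N f).
  apply: (pi_nil (D := D) Wc) => //; first exact: homf_exp.
  move=> j; rewrite piX //; have /eqP nj := pn j.
  rewrite -(subnKC (_ : mult D j <= N)%N) ?exprD ?nj ?mul0r //.
  by rewrite /N (bigD1 j) //= leq_addr.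
move/forallP => H; apply/forallP => i; have /nilpmP[M] := H i.
by rewrite ffunE -exprM => E; apply/nilpmP; exists (N * M)%N.
Qed.

(** The inverse of the reduction lifts to an endomorphism g. Then 1 - f g reduces to 0, so it is
    nilpotent and f g is invertible. *)
Lemma unitf_pi f : homf x x f -> unitf f = [forall j, pi D D j f \in unitmx].
Proof.
move=> xf; apply/idP/forallP => [fu j|pu].
  have xi := homf_inv fu xf.
  have : pi D D j f *m pi D D j (invf f) = 1%:M by rewrite -piM // invf_r // pi1.
  by case/mulmx1_unit.
have [g xg gE] := @pi_surj _ _ x x D D (fun j => invmx (pi D D j f)).
have xfg := homf_cmp xf xg.
have : nilpf (one a - cmp f g).
  apply: (pi_nil (D := D) Wc) => //; first by apply: homfD; rewrite ?homfN ?homf_sc.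
  move=> j; rewrite piD ?homfN ?homf_sc // pi1 pi_opp //.
  by rewrite (piM D D) // gE mulmxV ?pu ?subrr.
by move/nilpf_sub1; rewrite subKr unitf_cmp => /andP[].
Qed.

Definition hmxf (p : {poly F}) (f : vfam F a a) : vfam F a a := finfun (fun i => hmx p (f i)).

Lemma homf_hmxf p f : homf x x f -> homf x x (hmxf p f).
Proof.
move=> /forallP xf; apply/forallP => c; rewrite !ffunE; apply/eqP/esym/hmx_comm.
by rewrite (eqP (xf c)).
Qed.

Lemma pi_hmxf j p f : homf x x f -> pi D D j (hmxf p f) = hmx (map_poly (iota j) p) (pi D D j f).
Proof.
move=> xf; elim/poly_ind: p => [|p c IH].
  rewrite rmorph0 hmx0 -[RHS](pi0 D D); congr pi; apply/ffunP => i; rewrite dffun0E ffunE hmx0 //.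
have -> : hmxf (p * 'X + c%:P) f = cmp (hmxf p f) f + scf a c.
  by apply/ffunP => i; rewrite dffunDE !ffunE hmxD hmxM hmxX hmxC.
rewrite piD ?(homf_cmp (homf_hmxf p xf)) ?homf_sc // (piM D D) ?homf_hmxf // IH pi_sc.
by rewrite rmorphD rmorphM /= map_polyX map_polyC hmxD hmxM hmxX hmxC.
Qed.

Lemma polynilf_pi p f : homf x x f ->
  polynilf p f = [forall j, nilpm (hmx (map_poly (iota j) p) (pi D D j f))].
Proof.
move=> xf; transitivity (nilpf (hmxf p f)).
  by apply: eq_forallb => i; rewrite ffunE.
by rewrite nilpf_pi ?homf_hmxf //; apply: eq_forallb => j; rewrite pi_hmxf.
Qed.

Definition pif (f : vfam F a a) : {dffun forall j, 'M[L j]_(mult D j)} := finfun (fun j => pi D D j f).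

Lemma card_pif (P : pred {dffun forall j, 'M[L j]_(mult D j)}) :
  #|[set f : vfam F a a | homf x x f & P (pif f)]|
  = (#|[set M | P M]| * #|[set f : vfam F a a | homf x x f & pif f == 0%R]|)%N.
Proof.
rewrite -sum1_card (partition_big pif P) => [|f]; last by rewrite inE => /andP[].
rewrite -[RHS]sum_nat_const (eq_bigl (fun M => M \in [set M | P M])) => [|M]; last by rewrite inE.
apply: eq_bigr => M; rewrite inE => PM; have [g xg gM] := @pi_surj _ _ x x D D M.
rewrite sum1dep_card -[RHS](card_imset _ (addrI g)); apply: eq_card => f.
rewrite !inE; apply/idP/imsetP => [/andP[/andP[xf _] /eqP fM]|[f']].

  exists (f - g); last by rewrite addrC subrK.
  rewrite inE homfD ?homfN //=; apply/eqP/ffunP => j; rewrite dffun0E ffunE piD ?homfN // pi_opp //.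
  by rewrite gM -fM ffunE subrr.
rewrite inE => /andP[xf' /eqP f0] ->.
have E : pif (g + f') = M.
  apply/ffunP => j; rewrite ffunE piD // gM.
  by have /ffunP/(_ j) := f0; rewrite dffun0E ffunE => ->; rewrite addr0.
by rewrite homfD // E eqxx PM.
Qed.

(** Both conditions on f depend only on its reduction [pif]. Reduction is onto and all its fibres
    are cosets of its kernel, whose order cancels. *)
Lemma polynil_aut_ratio p :
  #|[set f : vfam F a a | homf x x f & polynilf p f]|%:R / #|[set f : vfam F a a | homf x x f & unitf f]|%:R
  = \prod_j (#|[set A : 'M[L j]_(mult D j) | nilpm (hmx (map_poly (iota j) p) A)]|%:R
      / (gln (mult D j) #|L j|)%:R) :> rat.
Proof.
have K0 : (0 < #|[set f : vfam F a a | homf x x f & pif f == 0%R]|)%N.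
  apply/card_gt0P; exists 0; rewrite inE homf0; apply/eqP/ffunP => j.
  by rewrite dffun0E ffunE pi0.
have -> : [set f : vfam F a a | homf x x f & polynilf p f] = [set f | homf x x f &
    [forall j, nilpm (hmx (map_poly (iota j) p) (pif f j))]].
  apply/setP => f; rewrite 2!in_set; case xf: (homf x x f); last by rewrite 2!andFb.
  by rewrite 2!andTb (polynilf_pi _ xf); apply: eq_forallb => j; rewrite [pif f j]ffunE.
have -> : [set f : vfam F a a | homf x x f & unitf f] = [set f | homf x x f &
    [forall j, pif f j \in unitmx]].
  apply/setP => f; rewrite 2!in_set; case xf: (homf x x f); last by rewrite 2!andFb.
  by rewrite 2!andTb unitf_pi //; apply: eq_forallb => j; rewrite [pif f j]ffunE.
rewrite (card_pif (fun M => [forall j, nilpm (hmx (map_poly (iota j) p) (M j))])).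
rewrite (card_pif (fun M => [forall j, M j \in unitmx])).
rewrite (card_dffun_forall (fun j (A : 'M[L j]_(mult D j)) => nilpm (hmx (map_poly (iota j) p) A))).
rewrite (card_dffun_forall (fun j (A : 'M[L j]_(mult D j)) => A \in unitmx)).
rewrite !natrM -mulf_div divff ?mulr1 ?pnatr_eq0 -?lt0n //.
rewrite prodf_div !natr_prod; congr (_ / _); apply: eq_bigr => j _.
by rewrite card_unitmx.
Qed.

End Count.
End KrullSchmidt.

(** * Matrices over a field with f(A) nilpotent *)

Definition nilset (L : finFieldType) (P : {poly L}) m : {set 'M[L]_m} :=
  [set A | nilpm (hmx P A)].
(** For P an irreducible polynomial of degree e over k, viewed over L with q^d elements, this is the
    proportion c_e(m, d) of the overview. *)
Definition nilratio (L : finFieldType) (P : {poly L}) m : rat :=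
  #|nilset P m|%:R / (gln m #|L|)%:R.

Section CoprimeSplitting.
Variables (L : finFieldType) (P R : {poly L}).
Hypothesis PR : coprimep P R.

Lemma hmx_diag u v p (B : 'M[L]_u) (C : 'M[L]_v) :
  hmx p (block_mx B 0 0 C : 'M_(u + v)) = block_mx (hmx p B) 0 0 (hmx p C).
Proof.
elim/poly_ind: p => [|p c IH].
  by rewrite !hmx0; apply/esym/block_mx0.
rewrite !hmxD !hmxM !hmxX !hmxC IH mulmx_block !mulmx0 !mul0mx !addr0 !add0r.
by rewrite (scalar_mx_block u v c) add_block_mx !addr0.
Qed.

Lemma diag_exp u v (B : 'M[L]_u) (C : 'M[L]_v) N :
  (block_mx B 0 0 C : 'M_(u + v)) ^+ N = block_mx (B ^+ N) 0 0 (C ^+ N).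
Proof. by rewrite -hmxXn hmx_diag !hmxXn. Qed.

Lemma coprime_nil_unit m (A : 'M[L]_m) p q N : coprimep p q -> hmx q A ^+ N = 0 -> hmx p A \in unitmx.
Proof.
move=> pq qA; have /Bezout_eq1_coprimepP[[s t] /= st] : coprimep p (q ^+ N) by rewrite coprimep_expr.
have : hmx s A *m hmx p A = 1%:M.
  by rewrite -[RHS](hmxC 1 A) polyC1 -st hmxD !hmxM hmx_exp qA mulmx0 addr0.
by case/mulmx1_unit.
Qed.

Lemma unit_exp m (A : 'M[L]_m) N : A \in unitmx -> A ^+ N \in unitmx.
Proof. by move=> uA; elim: N => [|N IH]; rewrite ?expr0 ?unitmx1 // exprS unitmx_mul uA. Qed.

Variables u v : nat.
Local Notation m := (u + v)%N.

(** The primary decomposition in standard position: P(A) is nilpotent on the first u coordinates and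
    R(A) on the last v. The matrices conjugate to these are exactly those of [partset]. *)
Definition diagset : {set 'M[L]_(u + v)} :=
  [set block_mx p.1 0 0 p.2 | p in setX (nilset P u) (nilset R v)].

Definition partset : {set 'M[L]_(u + v)} :=
  [set A in nilset (P * R) (u + v) | \rank (kermx (hmx P A ^+ (u + v))) == u].

Lemma diagsetP (A : 'M[L]_(u + v)) : reflect (exists B C, [/\ hmx P B ^+ (u + v) = 0,
  hmx R C ^+ (u + v) = 0 & A = block_mx B 0 0 C]) (A \in diagset).
Proof.
apply: (iffP imsetP) => [[[B C]]|[B [C [B0 C0 ->]]]]; last first.
  by exists (B, C) => //; rewrite !inE; apply/andP; split; apply/nilpmP; exists (u + v)%N.
rewrite !inE /= => /andP[/eqP B0 /eqP C0] ->; exists B, C.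
by rewrite !exprD B0 C0 mul0r mulr0.
Qed.

Lemma exists_basis p (K : 'M[L]_(p, u + v)) w : \rank K = w -> exists g : 'M_(w, u + v), (g :=: K)%MS.
Proof. by move=> <-; exists (row_base K); apply: eq_row_base. Qed.

(** There is no nonzero intertwiner between a block where P is nilpotent and one where R is, since
    by coprimality P is invertible on the latter and R on the former. *)
Lemma diag_comm (g A A' : 'M[L]_(u + v)) : A \in diagset -> A' \in diagset -> g *m A = A' *m g ->
  exists g1 g2, g = block_mx g1 0 0 g2.
Proof.
move=> /diagsetP[B [C [B0 C0 ->]]] /diagsetP[B' [C' [B0' C0' ->]]].
rewrite -[g]submxK; set g11 := ulsubmx g; set g12 := ursubmx g; set g21 := dlsubmx g; set g22 := drsubmx g.
rewrite !mulmx_block !mulmx0 !mul0mx !addr0 !add0r => /eq_block_mx[_ e12 e21 _].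
have RP : coprimep R P by rewrite coprimep_sym.
have z12 : g12 = 0.
  have := hmx_comm P (esym e12); move/(hmx_comm 'X^(u + v)); rewrite !hmxXn B0' mul0mx => /esym/eqP.
  have uC := unit_exp (u + v) (coprime_nil_unit PR C0).
  by move/eqP => z; rewrite -[g12](mulmxK uC) z mul0mx.
have z21 : g21 = 0.
  have := hmx_comm R (esym e21); move/(hmx_comm 'X^(u + v)); rewrite !hmxXn C0' mul0mx => /esym z.
  have uB := unit_exp (u + v) (coprime_nil_unit RP B0).
  by rewrite -[g21](mulmxK uB) z mul0mx.
by exists g11, g22; rewrite z12 z21.
Qed.

Lemma unit_diag (g1 : 'M[L]_u) (g2 : 'M[L]_v) :
  ((block_mx g1 0 0 g2 : 'M_(u + v)) \in unitmx) = (g1 \in unitmx) && (g2 \in unitmx).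
Proof. by rewrite !unitmxE det_ublock unitrM. Qed.

Definition cj (g A : 'M[L]_(u + v)) : 'M[L]_(u + v) := g *m A *m invmx g.

Lemma cj_diag_partset g A : g \in unitmx -> cj g A \in diagset -> A \in partset.
Proof.
move=> gu /diagsetP[B [C [B0 C0 DE]]].
have AE : A = invmx g *m cj g A *m g by rewrite /cj !mulmxA mulVmx // mul1mx mulmxKV.
rewrite DE in AE.
have gv : invmx g \in unitmx by rewrite unitmx_inv.
rewrite -[X in _ *m X]invmxK in AE.
rewrite !inE AE !hmx_conj // nilpm_conj // exp_conj // !hmx_diag; apply/andP; split.
  apply/nilpmP; exists (u + v)%N; rewrite diag_exp !hmxM.
  have -> : (hmx P B *m hmx R B) ^+ (u + v) = hmx P B ^+ (u + v) *m hmx R B ^+ (u + v).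
    by apply: exprMn_comm; rewrite /GRing.comm -!mulmxE -!hmxM mulrC.
  have -> : (hmx P C *m hmx R C) ^+ (u + v) = hmx P C ^+ (u + v) *m hmx R C ^+ (u + v).
    by apply: exprMn_comm; rewrite /GRing.comm -!mulmxE -!hmxM mulrC.
  by rewrite B0 C0 mul0mx mulmx0 block_mx0.
rewrite diag_exp B0 mxrank_ker mxrankMfree ?row_free_unit ?unitmx_inv //.
have -> : \rank (invmx g *m block_mx 0 0 0 (hmx P C ^+ (u + v)) : 'M_(u + v)) = v.
  have gfull : row_full (invmx g) by rewrite row_full_unit.
  rewrite (eqmxMfull _ gfull).
  rewrite rank_diag_block_mx mxrank0 add0n; apply: mxrank_unit.
  exact: unit_exp (coprime_nil_unit PR C0).
by rewrite addnK.
Qed.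

Lemma partset_conj A : A \in partset -> exists2 g, g \in unitmx & cj g A \in diagset.
Proof.
rewrite !inE => /andP[/eqP AN /eqP Ku]; set M := hmx P A in Ku *.
have [F1 F2] := matrix_fitting M (leqnn (u + v)).
have Mv : \rank (M ^+ (u + v)) = v by move: Ku; rewrite mxrank_ker; have := rank_leq_row (M ^+ (u + v)); lia.
have [g1 g1E] := exists_basis Ku; have [g2 g2E] := exists_basis Mv.
pose g : 'M_(u + v) := col_mx g1 g2.
have gu : g \in unitmx.
  rewrite -row_full_unit -sub1mx -F1 /g -addsmxE.
  by rewrite addsmxC addsmxS ?g1E ?g2E.
have gf : row_free g by rewrite row_free_unit.
have cMA : M *m A = A *m M.
  by have : hmx (P * 'X) A = hmx ('X * P) A; [rewrite mulrC|rewrite !hmxM hmxX].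
have cA := hmx_comm 'X^(u + v) cMA; rewrite !hmxXn in cA.
have g1A : (g1 *m A <= g1)%MS.
  rewrite g1E sub_kermx -mulmxA -cA mulmxA (_ : g1 *m _ = 0) ?mul0mx //.
  by apply/sub_kermxP; rewrite g1E.
have g2A : (g2 *m A <= g2)%MS.
  by rewrite g2E (submx_trans (submxMr _ (_ : g2 <= M ^+ (u + v))%MS)) ?g2E // cA submxMl.
have [[B BE] [C CE]] := (submxP g1A, submxP g2A).
exists g => //; apply/diagsetP; exists B, C.
have row_free1 : row_free g1 by rewrite /row_free g1E Ku.
have row_free2 : row_free g2 by rewrite /row_free g2E Mv.
have g1K : g1 *m M ^+ (u + v) = 0 by apply/sub_kermxP; rewrite g1E.
have e1 := hmx_comm 'X^(u + v) (hmx_comm P (esym BE)).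
have e2 := hmx_comm 'X^(u + v) (hmx_comm R (esym CE)).
rewrite !hmxXn in e1 e2; split.
- by apply: (row_free_inj row_free1); rewrite mul0mx e1.
- apply: (row_free_inj row_free2); rewrite mul0mx e2.
  have /submxP[W ->] : (g2 <= M ^+ (u + v))%MS by rewrite g2E.
  rewrite -mulmxA (_ : M ^+ _ *m _ = 0) ?mulmx0 // -!hmx_exp -hmxM -exprMn hmx_exp; exact: AN.
- apply: (can_inj (mulmxK gu)); rewrite /cj mulmxKV // mul_col_mx mul_block_col !mul0mx addr0 add0r.
  by rewrite BE CE.
Qed.

Lemma cj_mul g h A : g \in unitmx -> h \in unitmx -> cj (g *m h) A = cj g (cj h A).
Proof.
move=> gu hu; have ghu : g *m h \in unitmx by rewrite unitmx_mul gu.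
apply: (can_inj (mulmxK ghu)); rewrite /cj mulmxKV //.
by rewrite !mulmxA mulmxKV // mulmxKV.
Qed.

Lemma card_fiber_diag A : A \in partset ->
  #|[set g in [set g : 'M[L]_(u + v) | g \in unitmx] | cj g A \in diagset]| = (gln u #|L| * gln v #|L|)%N.
Proof.
case/partset_conj=> g0 g0u D0.
rewrite -!card_unitmx -cardsX -(card_imset _ (f := fun p => block_mx p.1 0 0 p.2 *m g0)).
  apply: eq_card => g; rewrite !inE; apply/andP/imsetP => [[gu gD]|[[p q]]].
    have e : g *m invmx g0 *m cj g0 A = cj g A *m (g *m invmx g0).
      by rewrite /cj !mulmxA mulmxKV // mulmxKV.
    have [p [q pq]] := diag_comm D0 gD e.
    have : g *m invmx g0 \in unitmx by rewrite unitmx_mul gu unitmx_inv.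
    rewrite pq unit_diag => pqu; exists (p, q); first by rewrite !inE.
    by rewrite /= -pq mulmxKV.
  rewrite !inE /= => /andP[pu qu] ->; have du : (block_mx p 0 0 q : 'M_(u + v)) \in unitmx by rewrite unit_diag pu.
  rewrite unitmx_mul du g0u; split=> //; rewrite cj_mul //.
  case/diagsetP: D0 => B [C [B0 C0 ->]]; apply/diagsetP.
  exists (p *m B *m invmx p), (q *m C *m invmx q); rewrite !hmx_conj // !exp_conj // B0 C0 !mulmx0 !mul0mx; split=> //.
  apply: (can_inj (mulmxK du)); rewrite /cj mulmxKV // !mulmx_block !mulmx0 !mul0mx !addr0 !add0r.
  by rewrite !mulmxKV.
move=> [p q] [p' q'] /= /(can_inj (mulmxK g0u)) /eq_block_mx[-> _ _ ->] //.
Qed.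

Lemma card_partset :
  (#|partset| * (gln u #|L| * gln v #|L|) = gln (u + v) #|L| * (#|nilset P u| * #|nilset R v|))%N.
Proof.
have -> : (#|nilset P u| * #|nilset R v| = #|diagset|)%N.
  rewrite -cardsX card_imset // => -[B C] [B' C'] /= /eq_block_mx[-> _ _ ->] //.
rewrite -(card_unitmx L (u + v)); apply: (double_count (act := cj)) => [g|g A|A]; last exact: card_fiber_diag.
  rewrite inE => gu A A' /(can_inj (mulmxKV gu)); exact: (can_inj (mulKmx gu)).
by rewrite inE; apply: cj_diag_partset.
Qed.
End CoprimeSplitting.

(** The matrices are sorted by the dimension u of their P-primary part. *)
Lemma nilratioM (L : finFieldType) (P R : {poly L}) m : coprimep P R ->
  nilratio (P * R) m = \sum_(u < m.+1) nilratio P u * nilratio R (m - u).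
Proof.
move=> PR; have q1 := card_fin_gt1 L.
have g0 w : (gln w #|L|)%:R != 0 :> rat by rewrite pnatr_eq0 -lt0n gln_gt0.
rewrite {1}/nilratio -sum1_card.
rewrite (partition_big (fun A => inord (\rank (kermx (hmx P A ^+ m))) : 'I_m.+1) xpredT) //=.
rewrite natr_sum mulr_suml; apply: eq_bigr => w _.
have wm : (w <= m)%N by rewrite -ltnS.
have -> : (\sum_(A in nilset (P * R) m | inord (\rank (kermx (hmx P A ^+ m))) == w) 1)%N
   = #|[set A in nilset (P * R) m | \rank (kermx (hmx P A ^+ m)) == w]|.
  rewrite sum1dep_card; apply: eq_card => A; rewrite !inE -val_eqE /= inordK //.
  by rewrite ltnS rank_leq_row.
move: (nat_of_ord w) wm => {}w wm; move: (m - w)%N (subnKC wm) => v E {wm}; case: _ / E; have H := card_partset PR w v.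
rewrite /nilratio mulf_div; apply/eqP; rewrite eqr_div ?mulf_neq0 // -!natrM.
by rewrite /partset in H; rewrite H mulnC.
Qed.

Lemma nilratio0 (L : finFieldType) (P : {poly L}) : nilratio P 0 = 1.
Proof.
rewrite /nilratio (_ : nilset P 0 = setT); last first.
  by apply/setP => A; rewrite !inE; apply/eqP; apply: flatmx0.
by rewrite cardsT card_mx expn0 /gln big_nil !muln1 divr1.
Qed.

Lemma nilratio_unit (L : finFieldType) m : nilratio (1 : {poly L}) m = (m == 0)%:R.
Proof.
case: m => [|m]; first exact: nilratio0.
rewrite /nilratio (_ : nilset 1 m.+1 = set0) ?cards0 ?mul0r //.
apply/setP => A; rewrite !inE; apply/negbTE/negP => /nilpmP[N].
by rewrite -polyC1 hmxC expr1n => /eqP; rewrite oner_eq0.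
Qed.

Lemma hmx_scalar (L : fieldType) m (P : {poly L}) c : hmx P (c%:M : 'M_m) = P.[c]%:M.
Proof.
elim/poly_ind: P => [|p d IH]; first by rewrite hmx0 horner0 raddf0.
by rewrite hmxD hmxM hmxX hmxC IH -scalar_mxM -raddfD /= !hornerE.
Qed.

Lemma nilratio1 (L : finFieldType) (P : {poly L}) :
  nilratio P 1 = #|[set c : L | root P c]|%:R / (#|L|%:R - 1).
Proof.
have q1 := card_fin_gt1 L; rewrite /nilratio; congr (_%:R / _).
  rewrite -(card_imset _ (f := fun c : L => c%:M : 'M_1)) => [|c d]; last first.
    by move/matrixP/(_ 0 0); rewrite !mxE eqxx.
  apply: eq_card => A; rewrite inE; apply/idP/imsetP => [|[c]].
    rewrite /nilpm expr1 => /eqP A0; exists (A 0 0); last exact: mx11_scalar.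
    move: A0; rewrite inE [in hmx _ _](mx11_scalar A) hmx_scalar => /matrixP/(_ 0 0).
    by rewrite !mxE eqxx mulr1n /root => ->.
  by rewrite inE => /eqP c0 ->; rewrite /nilpm expr1 hmx_scalar c0 raddf0.
rewrite /gln big_nat1 expn1 bin_small // expn0 mul1n natrB //; exact: ltnW.
Qed.

(** The coefficients of the g-th power of the generating series of r. *)
Definition convpow (r : nat -> rat) : nat -> nat -> rat :=
  fix loop g m := if g is g'.+1 then \sum_(u < m.+1) r u * loop g' (m - u)%N else (m == 0)%:R.

Lemma nilratio_prod (L : finFieldType) (r : nat -> rat) (s : seq {poly L}) m : uniq s ->
  (forall h, h \in s -> monic_irreducible_poly h /\ forall u, nilratio h u = r u) ->
  nilratio (\prod_(h <- s) h) m = convpow r (size s) m.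
Proof.
elim: s m => [|h s IH] m; first by rewrite big_nil nilratio_unit.
move=> /= /andP[hs us] H; have [hI hr] := H h (mem_head _ _).
have Hs h' : h' \in s -> monic_irreducible_poly h' /\ forall u, nilratio h' u = r u.
  by move=> h's; apply: H; rewrite inE h's orbT.
rewrite big_cons nilratioM.
  by apply: eq_bigr => u _; rewrite hr IH.
rewrite big_seq; elim/big_ind: _ => [|p q hp hq|h' h's]; first exact: coprimep1.
  by rewrite coprimepMr hp.
apply: coprimep_monic_irreducible => //; first by case: (Hs h' h's).
by apply: contraNneq hs => ->.
Qed.

(** Its representations are vector spaces, all semistable for the weight 0, and its weighted number
    of pairs is [nilratio]. The rationality of the proportions for irreducible f is thus a case of
    the result for quivers. *)
Definition loopless_vertex : quiver 1 :=
  @Quiver 1 void (fun v : void => match v with end) (fun v : void => match v with end).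

Lemma card_pset_vertex (L : finFieldType) (h : {poly L}) m :
  #|pset loopless_vertex (fun=> 0) h (fun=> m)| = #|nilset h m|.
Proof.
pose x0 : mrep L loopless_vertex (fun=> m) := finfun (fun v : void => match v with end).
have x0s : sss (fun=> 0) x0.
  rewrite /sss (_ : lam _ _ = 0) ?eqxx ?andbT; last by apply: big1 => i _; rewrite mul0r.
  by apply/fssP => p U _; rewrite (_ : lam _ _ = 0) //; apply: big1 => i _; rewrite mul0r.
pose P (f : vfam L (fun _ : 'I_1 => m) (fun=> m)) := polynilf h f.
have -> : pset loopless_vertex (fun=> 0) h (fun=> m) = [set (x0, f) | f in [set f | P f]].
  apply/setP => -[x f]; have -> : x = x0 by apply/ffunP => -[].
  rewrite inE; cbn [fst snd]; rewrite x0s.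
  have -> : endof x0 f by apply/forallP => -[].
  apply/idP/imsetP => [fP|[g]]; first by exists f; rewrite ?inE.
  by rewrite inE => gP [->].
rewrite card_imset => [|f g [] //].
rewrite /P /polynilf; set T := [set f | _].
have -> : #|T| = (\prod_(i < 1) #|nilset h m|)%N.
  exact: (card_dffun_forall (fun (_ : 'I_1) (A : 'M[L]_m) => nilpm (hmx h A))).
by rewrite big_ord1.
Qed.

Lemma irreducible_nilratio_isrf e m : (0 < e)%N -> exists2 r, isrf r &
  forall (L : finFieldType) (h : {poly L}), monic_irreducible_poly h -> (size h).-1 = e ->
  nilratio h m = r #|L|.
Proof.
move=> e0; have [r rI rP] := polycount_isrf loopless_vertex (fun=> 0) (fun=> m) e0.
exists r => // L h hI he; rewrite -(rP L h hI he) /polycount /nilratio /gv.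
by rewrite big_ord1 card_pset_vertex.
Qed.

Lemma convpow_isrf (r : nat -> nat -> rat) g m : (forall u, isrf (r u)) ->
  isrf (fun q => convpow (fun u => r u q) g m).
Proof.
move=> rI; elim: g m => [|g IH] m; first exact: isrf_const.
by apply: isrf_sum => u _; apply: isrf_mul.
Qed.

(** Over L the polynomial f is a product of gcd(d, e) distinct irreducible factors of degree e /
    gcd(d, e), so the proportion is a convolution power of the one for that degree, taken at q^d. *)
Lemma nilratio_extension_isrf e d m : (0 < e)%N -> (0 < d)%N -> exists2 c, isrf c &
  forall (k L : finFieldType) (iota : {rmorphism k -> L}) (f : {poly k}),
    monic_irreducible_poly f -> (size f).-1 = e -> #|L| = (#|k| ^ d)%N ->
    nilratio (map_poly iota f) m = c #|k|.
Proof.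
move=> e0 d0; pose e' := (e %/ gcdn d e)%N.
have e'0 : (0 < e')%N by rewrite divn_gt0 ?gcdn_gt0 ?d0 // dvdn_leq // dvdn_gcdr.
have [r rP] : exists r : nat -> nat -> rat, forall u, isrf (r u) /\
    forall (L : finFieldType) (h : {poly L}), monic_irreducible_poly h -> (size h).-1 = e' ->
    nilratio h u = r u #|L|.
  apply: (@dependent_choice _ (fun=> nat -> rat) (fun u ru => isrf ru /\
    forall (L : finFieldType) (h : {poly L}), monic_irreducible_poly h -> (size h).-1 = e' ->
    nilratio h u = ru #|L|)) => u.
  by have [r rI rP] := irreducible_nilratio_isrf u e'0; exists r.
exists (fun q => convpow (fun u => r u (q ^ d)%N) (gcdn d e) m).
  by apply: (convpow_isrf (r := fun u q => r u (q ^ d)%N)) => u; apply: isrf_comp_exp (rP u).1.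
move=> k L iota f fI fe cL.
have [s [us sI ss -> sz]] := irreducible_factors_extension iota fI cL.
rewrite (nilratio_prod (r := fun u => r u (#|k| ^ d)%N)) ?sz ?fe // => h hs.
split; first exact: sI.
by move=> u; rewrite -cL; apply: (rP u).2; rewrite ?ss ?fe //; apply: sI.
Qed.

(** * Counting isomorphism classes *)

(** Excluded middle as a boolean, so that [indec] can occur in a finite set comprehension. *)
Definition asb (P : Prop) : bool := if excluded_middle_informative P then true else false.

Lemma asbP P : reflect P (asb P).
Proof. by rewrite /asb; case: excluded_middle_informative => H; constructor. Qed.

Section IndependentSpan.
Variables (k K : fieldType) (iota : {rmorphism k -> K}).

Definition lcomb r (c : 'I_r -> K) (u : {ffun 'I_r -> k}) : K := \sum_i iota (u i) * c i.

Definition independent_over r (c : 'I_r -> K) : Prop :=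
  forall u : {ffun 'I_r -> k}, lcomb c u = 0 -> u = 0.

Lemma lcombB r (c : 'I_r -> K) u v : lcomb c (u - v) = lcomb c u - lcomb c v.
Proof.
by rewrite -sumrB; apply: eq_bigr => i _; rewrite !ffunE rmorphB mulrBl.
Qed.

Lemma lcomb_inj r (c : 'I_r -> K) : independent_over c -> injective (lcomb c).
Proof.
by move=> ci u v E; apply/eqP; rewrite -subr_eq0; apply/eqP/ci; rewrite lcombB E subrr.
Qed.

(** An element outside the span of an independent family can be added to it. Only finitely many
    elements are spanned, as K may be infinite over k. *)
Lemma independent_span (s : seq K) : exists r (c : 'I_r -> K),
  independent_over c /\ forall y, y \in s -> exists u, y = lcomb c u.
Proof.
elim: s => [|y s [r [c [ci cs]]]].
  by exists 0%N, (fun=> 0); split=> // u _; apply/ffunP => -[].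
case: (classic (exists u, y = lcomb c u)) => [yc|nyc].
  by exists r, c; split=> // z; rewrite inE => /orP[/eqP ->|/cs].
pose c' (i : 'I_r.+1) := if unlift ord0 i is Some j then c j else y.
have c'E (u : {ffun 'I_r.+1 -> k}) :
    lcomb c' u = iota (u ord0) * y + lcomb c [ffun j => u (lift ord0 j)].
  rewrite /lcomb big_ord_recl /c' unlift_none; congr (_ + _).
  by apply: eq_bigr => j _; rewrite liftK ffunE.
exists r.+1, c'; split=> [u|z].
  rewrite c'E => u0; case: (eqVneq (u ord0) 0) => [u00|un0].
    rewrite u00 rmorph0 mul0r add0r in u0; have /ffunP v0 := ci _ u0.
    apply/ffunP => i; rewrite ffunE; case: (unliftP ord0 i) => [j|] -> //.
    by have := v0 j; rewrite !ffunE.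
  case: nyc; exists [ffun j => - (u ord0)^-1 * u (lift ord0 j)].
  have iu : iota (u ord0) != 0 by rewrite fmorph_eq0.
  apply: (mulfI iu); move/eqP: u0; rewrite addr_eq0 => /eqP ->.
  rewrite /lcomb mulr_sumr -sumrN; apply: eq_bigr => j _; rewrite !ffunE rmorphM rmorphN fmorphV.
  by rewrite !mulrA mulrN divff // mulN1r mulNr.
rewrite inE => /orP[/eqP ->|/cs [u ->]].
  exists [ffun i => if i == ord0 then 1 else 0]; rewrite c'E ffunE eqxx rmorph1 mul1r.
  by rewrite [X in _ + X]big1 ?addr0 // => j _; rewrite !ffunE rmorph0 mul0r.
exists [ffun i => if unlift ord0 i is Some j then u j else 0].
rewrite c'E ffunE unlift_none rmorph0 mul0r add0r; apply: eq_bigr => j _.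
by rewrite !ffunE liftK.
Qed.

End IndependentSpan.

Lemma card_field_extension (k L : finFieldType) (iota : {rmorphism k -> L}) :
  exists2 d, (0 < d)%N & #|L| = (#|k| ^ d)%N.
Proof.
have [d [c [ci cs]]] := independent_span iota (enum L).
have E : #|L| = (#|k| ^ d)%N.
  rewrite -[d in RHS]card_ord -card_ffun -!cardsT -(card_imset _ (lcomb_inj ci)).
  apply: eq_card => y; rewrite !inE; apply/esym/imsetP.
  by have [u ->] := cs y (mem_enum _ _); exists u; rewrite ?inE.
exists d => //; case: (posnP d) E => // -> E.
by have := card_fin_gt1 L; rewrite E.
Qed.

Section IsomorphismClasses.
Variables (n : nat) (Q : quiver n) (k : finFieldType) (a : 'I_n -> nat).
Implicit Types x y : mrep k Q a.

Definition conjb x y : bool := [exists g, unitf g && (y == conj g x)].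

Lemma conjbP x y : reflect (repiso x y) (conjb x y).
Proof.
apply: (iffP existsP) => [[g /andP[gu /eqP ->]]|/repiso_sym/repiso_conj[g gu ->]].
  by apply: repiso_sym; apply/repiso_conj; exists g.
by exists g; rewrite gu eqxx.
Qed.

(** A canonical element of the isomorphism class: the choice depends only on the predicate
    [conjb x], which is the same for isomorphic representations. The default never occurs, because x
    is isomorphic to itself. *)
Definition repcan x := odflt x [pick y | conjb x y].

Lemma repcan_iso x : repiso x (repcan x).
Proof. by rewrite /repcan; case: pickP => [y /conjbP|_] //; apply: repiso_refl. Qed.

Lemma repcan_eq x y : repiso x y -> repcan x = repcan y.
Proof.
move=> xy; rewrite /repcan (eq_pick (Q := conjb y)) => [|z].
  by case: pickP => // /(_ y) /conjbP[]; apply: repiso_refl.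
apply/conjbP/conjbP => [xz|yz]; first exact: repiso_trans (repiso_sym xy) xz.
exact: repiso_trans xy yz.
Qed.

Definition classes (P : mrep k Q a -> bool) : {set mrep k Q a} := [set x | P x && (repcan x == x)].

(* The residue field of End x has q^d elements. *)
Definition has_resdeg x d : bool :=
  #|[set f | homf x x f]| == (#|k| ^ d * #|[set f | homf x x f && nilpf f]|)%N.

Lemma card_residue x (L : finFieldType) (r : vfam k a a -> L) :
  (forall f g, homf x x f -> homf x x g -> r (f + g) = r f + r g) ->
  (forall f, homf x x f -> (r f == 0) = nilpf f) ->
  (forall z, exists2 f, homf x x f & r f = z) ->
  #|[set f | homf x x f]| = (#|L| * #|[set f | homf x x f && nilpf f]|)%N.
Proof.
move=> rD r0 rsur; rewrite -sum1_card (partition_big r xpredT) //= -sum_nat_const.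
apply: eq_bigr => y _; have [g xg <-] := rsur y.
rewrite sum1dep_card -[RHS](card_imset _ (addrI g)); apply: eq_card => f; rewrite !inE.
have rB u v : homf x x u -> homf x x v -> r (u - v) = r u - r v.
  move=> xu xv; have e : r u = r (u - v) + r v by rewrite -rD ?homfD ?homfN // subrK.
  by rewrite e addrK.
apply/andP/imsetP => [[xf /eqP fg]|[f']].
  exists (f - g); last by rewrite addrC subrK.
  by rewrite inE -r0 ?homfD ?homfN //= rB // fg subrr eqxx.
rewrite inE => /andP[xf' fn] ->; split; first exact: homfD.
by rewrite rD //; move: fn; rewrite -r0 // => /eqP ->; rewrite addr0.
Qed.

Lemma has_resdegP x (L : finFieldType) d : #|[set f | homf x x f]| = (#|L| * #|[set f | homf x x f && nilpf f]|)%N ->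
  has_resdeg x d = (#|L| == #|k| ^ d)%N.
Proof.
move=> E; rewrite /has_resdeg E eqn_pmul2r //; apply/card_gt0P; exists 0.
by rewrite inE homf0 nilpf0.
Qed.

Lemma indec_repiso b x (y : mrep k Q b) : repiso x y -> indec x -> indec y.
Proof.
move=> xy; have ab := repiso_dim xy; case: _ / ab y xy => y /repiso_sym/repiso_conj[g gu ->].
case=> a0 xI; split=> // U V; rewrite !stab_conj // => xU xV UV.
have gi i := forallP gu i.
case: (xI _ _ xU xV) => [i|U0|V0].
- have [UV1 UV2] := UV i; split.
    apply: eqmx_trans (eqmx_sym (addsmxMr _ _ _)) _; apply: eqmx_trans (eqmxMr _ UV1) _.
    by rewrite mul1mx; apply/eqmxP; rewrite submx1 sub1mx row_full_unit (gi i).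
  apply/eqP; rewrite -submx0; set X := (_ :&: _)%MS.
  have : (X *m invmx (g i) <= U i :&: V i)%MS.
    rewrite sub_capmx -{1}[U i](mulmxK (gi i)) -{1}[V i](mulmxK (gi i)).
    by rewrite !submxMr ?capmxSl ?capmxSr.
  by rewrite UV2 !submx0 => /eqP X0; rewrite -[X](mulmxKV (gi i)) X0 mul0mx.
- by left=> i; rewrite -[U i](mulmxK (gi i)) U0 mul0mx.
- by right=> i; rewrite -[V i](mulmxK (gi i)) V0 mul0mx.
Qed.

End IsomorphismClasses.

(** * Sums over multiplicities and their logarithmic derivative *)

Section MultiplicitySums.
Variables (n : nat) (J : finType) (dW : J -> 'I_n -> nat) (H : nat).
Hypothesis dW_gt0 : forall j, (0 < ht (dW j))%N.
Variables c ell : J -> nat -> rat.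
Hypothesis c0 : forall j, c j 0 = 1.
Hypothesis cE : forall j m, m%:R * c j m = \sum_(t < m) ell j t.+1 * c j (m - t.+1)%N.
Implicit Types (m : {ffun J -> 'I_H.+1}) (a : 'I_n -> nat).

Definition hasdim m a : bool := [forall i, (\sum_j m j * dW j i)%N == a i].

(* The coefficient at t^a of prod_j sum_m c_j(m) t^(m dW_j); multsum_rec is its
   logarithmic derivative. *)
Definition multsum a : rat := \sum_(m | hasdim m a) \prod_j c j (m j).

Lemma hasdim_ht m a : hasdim m a -> ht a = (\sum_j m j * ht (dW j))%N.
Proof.
move=> /forallP ma; rewrite /ht (eq_bigr (fun i => \sum_j m j * dW j i)%N).
  by rewrite exchange_big; apply: eq_bigr => j _; rewrite big_distrr.
by move=> i _; apply/esym/eqP.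
Qed.

Lemma multsum0 a : ht a = 0%N -> multsum a = 1.
Proof.
move=> a0; rewrite /multsum (big_pred1 [ffun=> ord0]).
  by apply: big1 => j _; rewrite ffunE c0.
move=> m; rewrite (ht_eq0 a0); apply/forallP/eqP => [m0|-> i]; last first.
  by rewrite big1 // => j _; rewrite ffunE.
apply/ffunP => j; rewrite ffunE; apply/val_inj/eqP => /=.
have [i di] : exists i, (0 < dW j i)%N.
  apply/existsP; rewrite -[[exists i, _]]negbK negb_exists; apply/negP => /forallP d0.
  by have := dW_gt0 j; rewrite /ht big1 // => i _; apply/eqP; rewrite -leqn0 leqNgt.
have := m0 i; rewrite (bigD1 j) //= addn_eq0 muln_eq0 => /andP[/orP[//|]].
by rewrite eqn0Ngt di.
Qed.

Definition shiftm j t m : {ffun J -> 'I_H.+1} := [ffun i => inord (m i + (i == j) * t.+1)].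
Definition unshiftm j t m : {ffun J -> 'I_H.+1} := [ffun i => inord (m i - (i == j) * t.+1)].

Lemma shiftmE j t m : (m j + t.+1 <= H)%N -> forall i, shiftm j t m i = (m i + (i == j) * t.+1)%N :> nat.
Proof.
move=> mt i; rewrite ffunE inordK //; case: eqP => [->|_]; first by rewrite mul1n ltnS.
by rewrite mul0n addn0.
Qed.

(** Above H the function [inord] returns 0, which does not exceed t. *)
Lemma shiftm_gt j t m : (t < shiftm j t m j)%N -> (m j + t.+1 <= H)%N.
Proof.
case: (leqP (m j + t.+1) H) => // gt; rewrite ffunE eqxx mul1n /inord /insubd insubF //=.
by rewrite ltnS leqNgt gt.
Qed.

Lemma unshiftmE j t m i : unshiftm j t m i = (m i - (i == j) * t.+1)%N :> nat.
Proof. by rewrite ffunE inordK // (leq_ltn_trans (leq_subr _ _)). Qed.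

(** Adding t + 1 copies of W_j carries the decompositions of a - (t + 1) dW_j to those of a with
    more than t copies of W_j. The bound H is respected because each W_j is nonzero and ht a <=
    H. *)
Lemma shiftm_dim j t m a : (ht a <= H)%N ->
  [&& hasdim (shiftm j t m) a, t < shiftm j t m j & unshiftm j t (shiftm j t m) == m]%N
  = [forall i, t.+1 * dW j i <= a i]%N && hasdim m (fun i => a i - t.+1 * dW j i)%N.
Proof.
move=> aH.
have dimE i : (m j + t.+1 <= H)%N ->
    (\sum_j' shiftm j t m j' * dW j' i = \sum_j' m j' * dW j' i + t.+1 * dW j i)%N.
  move=> mt; under eq_bigr do rewrite shiftmE // mulnDl.
  rewrite big_split; congr addn; rewrite (bigD1 j) //= eqxx mul1n big1 ?addn0 //.
  by move=> j' /negbTE ->.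
apply/and3P/andP => [[/forallP d /shiftm_gt mt _]|[/forallP le dm]].
  split; apply/forallP => i; have /eqP := d i; rewrite dimE // => <-; rewrite ?leq_addl //.
  by rewrite addnK.
have mt : (m j + t.+1 <= H)%N.
  apply: leq_trans aH; have := hasdim_ht dm.
  rewrite (bigD1 j) //= => E.
  have -> : ht a = (ht (fun i => a i - t.+1 * dW j i) + t.+1 * ht (dW j))%N.
    rewrite /ht big_distrr -big_split; apply: eq_bigr => i _ /=.
    by rewrite subnK.
  rewrite E; apply: (@leq_trans (m j * ht (dW j) + t.+1 * ht (dW j))); last by lia.
  by rewrite -mulnDl leq_pmulr.
split.
- apply/forallP => i; rewrite dimE // (eqP (forallP dm i)) subnK //.
- by rewrite shiftmE // eqxx mul1n leq_addl.
- by apply/eqP/ffunP => i; apply: val_inj; rewrite /= unshiftmE shiftmE // addnK.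
Qed.

Lemma multsum_shift j t a : (ht a <= H)%N ->
  \sum_(m | hasdim m a && (t < m j)%N) \prod_i c i (m i - (i == j) * t.+1)%N
  = if [forall i, t.+1 * dW j i <= a i]%N then multsum (fun i => a i - t.+1 * dW j i)%N else 0.
Proof.
move=> aH; rewrite (reindex_onto (shiftm j t) (unshiftm j t)); last first.
  move=> m /andP[_ tm]; apply/ffunP => i; apply: val_inj.
  have um : (unshiftm j t m j + t.+1 <= H)%N by rewrite unshiftmE eqxx mul1n subnK // -ltnS.
  by rewrite /= shiftmE // unshiftmE subnK //; case: eqP => [->|_]; rewrite ?mul1n.
transitivity (\sum_(m | [forall i, t.+1 * dW j i <= a i]%N && hasdim m (fun i => a i - t.+1 * dW j i)%N)
    \prod_i c i (m i)).
  apply: eq_big => [m|m /andP[/andP[_ /shiftm_gt mt] _]]; first by rewrite -shiftm_dim // andbA.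
  by apply: eq_bigr => i _; rewrite shiftmE // addnK.
by case: ifP => //= _; rewrite big_pred0.
Qed.

Lemma multsum_rec a : (ht a <= H)%N ->
  (ht a)%:R * multsum a = \sum_j \sum_(t < H) (ht (dW j))%:R * ell j t.+1 *
    (if [forall i, t.+1 * dW j i <= a i]%N then multsum (fun i => a i - t.+1 * dW j i)%N else 0).
Proof.
move=> aH; rewrite /multsum mulr_sumr.
(* The factor ht a is the sum of the m_j ht(dW_j); the factor m_j is then absorbed by the recursion
   [cE], which removes t + 1 copies of W_j. *)
transitivity (\sum_(m | hasdim m a) \sum_j (m j * ht (dW j))%:R * \prod_i c i (m i)).
  by apply: eq_bigr => m /hasdim_ht ->; rewrite natr_sum mulr_suml.
rewrite exchange_big; apply: eq_bigr => j _ /=.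
transitivity (\sum_(m | hasdim m a) \sum_(t < H | (t < m j)%N) (ht (dW j))%:R * ell j t.+1 *
    \prod_i c i (m i - (i == j) * t.+1)%N).
  have E4 (x y z w : rat) : x * y * (z * w) = y * (x * z * w) by ring.
  apply: eq_bigr => m _; rewrite natrM (bigD1 j) //= E4 cE.
  have mH : (m j <= H)%N by rewrite -ltnS.
  rewrite (big_ord_widen H (fun t => ell j t.+1 * c j (m j - t.+1)%N) mH) mulr_suml mulr_sumr.
  apply: eq_bigr => t _; rewrite [in RHS](bigD1 j) //= eqxx mul1n !mulrA; congr (_ * _).
  by apply: eq_bigr => i /negbTE ->; rewrite mul0n subn0.
rewrite (exchange_big_dep xpredT) //=; apply: eq_bigr => t _.
rewrite -mulr_sumr; congr (_ * _); rewrite -(multsum_shift _ _ aH).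
by apply: eq_bigl => m; rewrite andbC.
Qed.

End MultiplicitySums.

(** * Classes and weighted pair counts as sums over multiplicities *)

Section Bridge.
Variables (n : nat) (Q : quiver n) (F : finFieldType) (J : finType).
Variables (dW : J -> 'I_n -> nat) (mW : forall j, mrep F Q (dW j)).
Hypothesis WI : forall j, indec (mW j).
Hypothesis Wnoniso : forall j j', repiso (mW j) (mW j') -> j = j'.
Variables (L : J -> finFieldType) (r : forall j, vfam F (dW j) (dW j) -> L j)
  (iota : forall j, {rmorphism F -> L j}).
Arguments r : clear implicits.
Hypothesis rD : forall j f g, homf (mW j) (mW j) f -> homf (mW j) (mW j) g -> r j (f + g) = r j f + r j g.
Hypothesis rM : forall j f g, homf (mW j) (mW j) f -> homf (mW j) (mW j) g -> r j (cmp f g) = r j f * r j g.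
Hypothesis r0 : forall j f, homf (mW j) (mW j) f -> (r j f == 0) = nilpf f.
Hypothesis rsur : forall j y, exists2 f, homf (mW j) (mW j) f & r j f = y.
Hypothesis rsc : forall j c, r j (scf (dW j) c) = iota j c.
Variables (l : 'I_n -> rat) (h : nat).
Hypothesis Ws : forall j, sss l (mW j).
Hypothesis Wc : forall b (y : mrep F Q b), (ht b <= h)%N -> sss l y -> indec y -> exists j, repiso (mW j) y.
Variable a : 'I_n -> nat.
Hypothesis ah : (ht a <= h)%N.
Implicit Types (x : mrep F Q a) (m : {ffun J -> 'I_h.+1}).

Lemma exists_multiplicity : exists mu : mrep F Q a -> {ffun J -> 'I_h.+1},
  forall x, sss l x -> exists D : dec mW x, forall j, mult D j = mu x j.
Proof.
apply: (@dependent_choice _ _ (fun x m => sss l x -> exists D : dec mW x, forall j, mult D j = m j)) => x.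
case xs: (sss l x); last by exists [ffun=> ord0].
have [D] := exists_dec Wc ah xs.
have Dh j : (mult D j < h.+1)%N.
  rewrite ltnS (leq_trans _ ah) // /ht (eq_bigr _ (fun i _ => dec_dim D i)) exchange_big /=.
  rewrite (bigD1 j) //= -big_distrr /= (leq_trans _ (leq_addr _ _)) // leq_pmulr //.
  by case: (WI j).
exists [ffun j => Ordinal (Dh j)] => _; exists D => j; by rewrite ffunE.
Qed.

Variable mu : mrep F Q a -> {ffun J -> 'I_h.+1}.
Hypothesis muP : forall x, sss l x -> exists D : dec mW x, forall j, mult D j = mu x j.

Lemma mu_hasdim x : sss l x -> hasdim dW (mu x) a.
Proof.
move=> xs; have [D Dm] := muP xs; apply/forallP => i; rewrite (dec_dim D i).
by apply/eqP/eq_bigr => j _; rewrite Dm.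
Qed.

Lemma mu_iso x y : sss l x -> sss l y -> repiso x y <-> mu x = mu y.
Proof.
move=> xs ys; have [[D Dm] [D' Dm']] := (muP xs, muP ys); split=> [xy|E].
  apply/ffunP => j; apply: val_inj; rewrite /= -Dm -Dm'.
  by rewrite (mult_iso WI Wnoniso rD rM r0 rsc D D' xy).
apply: (iso_of_mult (D := D) (D' := D')); apply: functional_extensionality => j.
by rewrite Dm Dm' E.
Qed.

Lemma mu_surj m : hasdim dW m a -> exists2 x, sss l x & mu x = m.
Proof.
move=> /forallP ma; have [|x [D [xs Dm]]] := @exists_mult _ _ _ _ _ mW _ Ws (fun j => m j : nat) a.
  by move=> i; apply/esym/eqP/ma.
have [D' Dm'] := muP xs; exists x => //; apply/ffunP => j; apply: val_inj; rewrite /= -Dm'.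
by rewrite (mult_iso WI Wnoniso rD rM r0 rsc D' D (repiso_refl x)) Dm.
Qed.

Lemma card_classes_mult :
  #|classes (fun x => sss l x)| = #|[set m : {ffun J -> 'I_h.+1} | hasdim dW m a]|.
Proof.
rewrite -(card_in_imset (f := mu)) => [|x y].
  apply: eq_card => m; rewrite inE; apply/imsetP/idP => [[x]|/mu_surj[x xs <-]].
    by rewrite inE => /andP[xs _] ->; apply: mu_hasdim.
  have xc := repcan_iso x.
  have cs : sss l (repcan x) by move/repiso_sym/repiso_conj: xc => [g gu ->]; rewrite (sss_conj _ _ gu).
  exists (repcan x); last by apply/(mu_iso xs cs).
  by rewrite inE cs; apply/eqP/esym/repcan_eq.
rewrite !inE => /andP[xs /eqP xc] /andP[ys /eqP yc] /(mu_iso xs ys) /repcan_eq.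
by rewrite xc yc.
Qed.

(** Pairs whose representation is isomorphic to x0 are moved to x0 itself; the g that do this for a
    given pair form a coset of Aut x0. *)
Lemma card_mult_fiber f x0 : sss l x0 ->
  (#|[set p in pset Q l f a | mu p.1 == mu x0]| * #|[set u | homf x0 x0 u & unitf u]|
   = gv a #|F| * #|[set u | homf x0 x0 u & polynilf f u]|)%N.
Proof.
move=> x0s.
have -> : #|[set u | homf x0 x0 u & polynilf f u]| = #|[set p in pset Q l f a | p.1 == x0]|.
  rewrite -(card_imset _ (f := fun u => (x0, u))) => [|u v [] //].
  apply: eq_card => -[x u]; rewrite !inE /=; apply/imsetP/andP => [[v]|[/and3P[xs xu pu] /eqP xx0]].
    by rewrite inE => /andP[xv pv] [-> ->]; rewrite x0s eqxx pv andbT /=; split.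
  by subst x; exists u => //; rewrite inE pu andbT.
rewrite -card_unitf.
apply: (double_count (act := fun g p => (conj g p.1, conjv g p.2))) => [g|g [x u]|[x u]].
- by rewrite inE => gu [x u] [y v] [/(conj_inj gu) -> /(conjv_inj gu) ->].
- rewrite !inE /= => gu; rewrite sss_conj // endof_conj // polynilf_conj // => /andP[/and3P[xs -> ->] /eqP E].
  rewrite xs /=; apply/eqP/(mu_iso xs x0s); apply: repiso_sym; apply/repiso_conj.
  by exists g.
rewrite !inE /= => /andP[/and3P[xs xu pu] /eqP /(mu_iso xs x0s)].
move=> /repiso_sym/repiso_conj[g gu gx].
have gh : homf x0 x g by rewrite gx; apply: homf_conj.
have ginv := unitf_inv gu.
have cK (v w : vfam F a a) : unitf w -> cmp (cmp v w) (invf w) = v.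
  by move=> wu; rewrite -cmpA invf_r // cmp1r.
have cK' (v w : vfam F a a) : unitf w -> cmp (cmp v (invf w)) w = v.
  by move=> wu; rewrite -cmpA invf_l // cmp1r.
rewrite -[RHS](card_imset _ (f := fun v => cmp v g)) => [|v w E]; last by rewrite -[v](cK _ g) // E cK.
apply: eq_card => v; rewrite !inE /=; apply/andP/imsetP => [[vu /andP[_ /eqP E]]|[w]].
  exists (cmp v (invf g)); last by rewrite cK'.
  have xv : homf x0 x v by rewrite -E; apply: homf_conj.
  by rewrite inE unitf_cmp vu ginv (homf_cmp xv (homf_inv gu gh)).
rewrite inE => /andP[xw wu] ->.
have cu : unitf (cmp w g) by rewrite unitf_cmp wu.
rewrite cu sss_conj // xs endof_conj // polynilf_conj // xu pu; split=> //=; apply/eqP/esym.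
exact: (homf_conjE cu (homf_cmp xw gh)).
Qed.

Lemma polycount_mult (f : {poly F}) (c : J -> nat -> rat) :
  (forall j t, nilratio (map_poly (iota j) f) t = c j t) ->
  polycount Q l f a = multsum dW h c a.
Proof.
move=> cE; rewrite /polycount -sum1_card (partition_big (fun p => mu p.1) (fun m => hasdim dW m a)).
  rewrite natr_sum mulr_suml; apply: eq_bigr => m ma; have [x0 x0s x0m] := mu_surj ma.
  have [D Dm] := muP x0s.
  have := polynil_aut_ratio WI Wnoniso rD rM r0 rsur rsc D Wc ah x0s f.
  rewrite [X in _ = X -> _](eq_bigr (fun j => c j (m j))); last first.
    by move=> j _; rewrite -cE /nilratio Dm x0m.
  move=> <-; rewrite sum1dep_card; have := card_mult_fiber f x0s; rewrite x0m => E.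
  have A0 : (0 < #|[set u | homf x0 x0 u & unitf u]|)%N.
    by apply/card_gt0P; exists (scf a 1); rewrite inE homf_sc; apply/forallP => i; rewrite ffunE unitmx1.
  apply/eqP; rewrite eqr_div ?gv_neq0 ?pnatr_eq0 -?lt0n // -!natrM E mulnC eqxx //.
by move=> [x u]; rewrite inE => /and3P[xs _ _]; apply: mu_hasdim.
Qed.

End Bridge.

(** * A finite index set for the indecomposable semistables *)

Section IndecomposableClasses.
Variables (n : nat) (Q : quiver n) (l : 'I_n -> rat).

Definition indec_classes (k : finFieldType) (b : 'I_n -> nat) d : {set mrep k Q b} :=
  classes (fun x => [&& sss l x, asb (indec x) & has_resdeg x d]).

Variables (k : finFieldType) (h : nat).
Local Notation box := {ffun 'I_n -> 'I_h.+1}.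
Local Notation boxdim := (@bdim n h.+1).
Definition indec_word (w : {b : box & mrep k Q (boxdim b)}) : bool :=
  tagged w \in classes (fun x => sss l x && asb (indec x)).
Definition mkword (b : box) (x : mrep k Q (boxdim b)) : {b : box & mrep k Q (boxdim b)} :=
  existT (fun b => mrep k Q (boxdim b)) b x.
Definition indec_index := {w | indec_word w}.
Local Notation J := indec_index.
Definition index_box (j : J) : box := tag (val j).
Definition index_rep (j : J) : mrep k Q (boxdim (index_box j)) := tagged (val j).

Lemma index_repP j : [/\ sss l (index_rep j), indec (index_rep j) & repcan (index_rep j) = index_rep j].
Proof.
case: j => -[b x] P; rewrite /index_rep /index_box /=.
have /setIdP[/andP[xs xI] /eqP xc] : x \in classes (fun x => sss l x && asb (indec x)) := P.
by split; [|exact/asbP|].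
Qed.

Lemma bdim_inj : injective boxdim.
Proof.
move=> b b' E; apply/ffunP => i; apply: val_inj.
by have := congr1 (fun f => f i) E.
Qed.

Lemma index_rep_inj j j' : repiso (index_rep j) (index_rep j') -> j = j'.
Proof.
move=> jj'; apply: val_inj; move: (index_repP j) (index_repP j') jj'.
rewrite /index_rep /index_box; case: (val j) => b x; case: (val j') => b' x' /=.
move=> [_ _ xc] [_ _ xc'] xx'; have /bdim_inj E := repiso_dim xx'.
by subst b'; rewrite -xc -xc' (repcan_eq xx').
Qed.

Lemma index_rep_complete b (y : mrep k Q b) : (ht b <= h)%N -> sss l y -> indec y ->
  exists j : J, repiso (index_rep j) y.
Proof.
move=> bh; have [b' E] : exists b' : box, b = boxdim b'.
  have bi i : (b i < h.+1)%N by rewrite ltnS (leq_trans (leq_ht b i)).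
  by exists [ffun i => Ordinal (bi i)]; apply: functional_extensionality => i; rewrite /bdim ffunE.
subst b => ys yI.
have yc := repcan_iso y.
have cs : sss l (repcan y) by move/repiso_sym/repiso_conj: yc => [g gu ->]; rewrite sss_conj.
have P : indec_word (mkword (repcan y)).
  rewrite /indec_word inE /= cs (introT (asbP _) (indec_repiso yc yI)); apply/eqP/esym/repcan_eq.
  exact: yc.
by exists (exist indec_word _ P); apply: repiso_sym.
Qed.

(** Hides the residue fields: from here on an indecomposable is known only by its dimension vector
    and its degree [dj], which determine both the class counts and the weighted pair counts. *)
Lemma indec_bridge : exists (dj : J -> nat),
 [/\ forall j, (0 < dj j)%N,
     forall j, (dj j <= n * h.+1 ^ 2)%N,
     forall b d, #|[set j | (index_box j == b) && (dj j == d)]| = #|indec_classes k (boxdim b) d|,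
     forall a, (ht a <= h)%N -> #|classes (fun x : mrep k Q a => sss l x)|
       = #|[set m : {ffun J -> 'I_h.+1} | hasdim (fun j => boxdim (index_box j)) m a]|
   & forall (f : {poly k}) (c : nat -> nat -> rat),
       (forall (L : finFieldType) (iota : {rmorphism k -> L}) d m, (0 < d)%N -> #|L| = (#|k| ^ d)%N ->
         nilratio (map_poly iota f) m = c d m) ->
       forall a, (ht a <= h)%N -> polycount Q l f a
         = multsum (fun j => boxdim (index_box j)) h (fun j => c (dj j)) a].
Proof.
pose dW (j : J) := boxdim (index_box j).
pose T (j : J) := {L : finFieldType & ((vfam k (dW j) (dW j) -> L) * {rmorphism k -> L})%type}.
pose mW j := index_rep j.
have [R RP] : exists R : forall j, T j, forall j, let r := (projT2 (R j)).1 in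
   [/\ forall f g, homf (mW j) (mW j) f -> homf (mW j) (mW j) g -> r (f + g) = r f + r g,
       forall f g, homf (mW j) (mW j) f -> homf (mW j) (mW j) g -> r (cmp f g) = r f * r g,
       forall f, homf (mW j) (mW j) f -> (r f == 0) = nilpf f,
       forall y, exists2 f, homf (mW j) (mW j) f & r f = y
     & forall c, r (scf (dW j) c) = (projT2 (R j)).2 c].
  apply: (@dependent_choice _ T (fun j Rj => let r := (projT2 Rj).1 in
   [/\ forall f g, homf (mW j) (mW j) f -> homf (mW j) (mW j) g -> r (f + g) = r f + r g,
       forall f g, homf (mW j) (mW j) f -> homf (mW j) (mW j) g -> r (cmp f g) = r f * r g,
       forall f, homf (mW j) (mW j) f -> (r f == 0) = nilpf f,
       forall y, exists2 f, homf (mW j) (mW j) f & r f = y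
     & forall c, r (scf (dW j) c) = (projT2 Rj).2 c])) => j.
  have [_ jI _] := index_repP j; have [L [r [iota H]]] := exists_residue_field jI.
  by exists (existT _ L (r, iota)).
pose L j := projT1 (R j); pose r j := (projT2 (R j)).1 : vfam k (dW j) (dW j) -> L j.
pose iota j := (projT2 (R j)).2 : {rmorphism k -> L j}.
have rD j f g : homf (mW j) (mW j) f -> homf (mW j) (mW j) g -> r j (f + g) = r j f + r j g.
  by case: (RP j) => H _ _ _ _; apply: H.
have rM j f g : homf (mW j) (mW j) f -> homf (mW j) (mW j) g -> r j (cmp f g) = r j f * r j g.
  by case: (RP j) => _ H _ _ _; apply: H.
have r0 j f : homf (mW j) (mW j) f -> (r j f == 0) = nilpf f.
  by case: (RP j) => _ _ H _ _; apply: H.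
have rsur j y : exists2 f, homf (mW j) (mW j) f & r j f = y.
  by case: (RP j) => _ _ _ H _; apply: H.
have rsc j c : r j (scf (dW j) c) = iota j c by case: (RP j) => _ _ _ _ H; apply: H.
have [dj djP] : exists dj : J -> nat, forall j, (0 < dj j)%N /\ #|L j| = (#|k| ^ dj j)%N.
  apply: (@dependent_choice _ (fun=> nat) (fun j d => (0 < d)%N /\ #|L j| = (#|k| ^ d)%N)) => j.
  by have [d] := card_field_extension (iota j); exists d.
have WI j : indec (mW j) by case: (index_repP j).
have Ws j : sss l (mW j) by case: (index_repP j).
have resE j := card_residue (rD j) (r0 j) (rsur j).
have resP j d : has_resdeg (mW j) d = (dj j == d).
  rewrite (has_resdegP _ (resE j)) (djP j).2 eqn_exp2l ?card_fin_gt1 //.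
exists dj; split.
- by move=> j; case: (djP j).
(* The residue field has at most as many elements as End W_j, which lies in a product of n matrix
   algebras of sizes below h + 1. *)
- move=> j; rewrite -(leq_exp2l _ _ (card_fin_gt1 k)) -(djP j).2.
  have N0 : (0 < #|[set f | homf (mW j) (mW j) f && nilpf f]|)%N.
    by apply/card_gt0P; exists 0; rewrite inE homf0 nilpf0.
  apply: leq_trans (leq_pmulr _ N0) _; rewrite -(resE j).
  apply: leq_trans (max_card _) _; rewrite card_dffun.
  rewrite (eq_bigr (fun i => #|k| ^ (dW j i * dW j i))%N) => [|i _]; last exact: card_mx.
  rewrite -expn_sum leq_exp2l ?card_fin_gt1 //.
  rewrite -[n in (_ <= n * _)%N]card_ord -sum_nat_const; apply: leq_sum => i _.
  have bi : (dW j i <= h.+1)%N := ltnW (ltn_ord _).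
  by rewrite -mulnn leq_mul.
- move=> b d; rewrite -(card_imset _ val_inj) -[RHS](card_imset _ (f := @mkword b)).
    apply: eq_card => w; apply/imsetP/imsetP => [[j]|[x]].
      rewrite !inE -resP => /andP[/eqP jb dd] ->.
      move: (index_repP j) dd jb; rewrite /mW /index_rep /index_box.
      case: (val j) => b' x /= [xs xI xc] dd bb; subst b'; exists x => //.
      by rewrite inE xs dd xc eqxx (introT (asbP _) xI).
    rewrite inE => /andP[/and3P[xs xI dd] xc] ->.
    have P : indec_word (mkword x) by rewrite /indec_word inE xs xI.
    exists (exist indec_word _ P) => //; rewrite inE -resP eqxx /mW /index_rep /=; exact: dd.
  by move=> x y /eqP; rewrite eq_Tagged /= => /eqP.
- move=> a ah; have [mu muP] := exists_multiplicity WI index_rep_complete ah.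
  exact: (card_classes_mult WI index_rep_inj rD rM r0 rsc Ws muP).
move=> f c cE a ah; have [mu muP] := exists_multiplicity WI index_rep_complete ah.
apply: (polycount_mult WI index_rep_inj rD rM r0 rsur rsc Ws index_rep_complete ah muP).
by move=> j t; case: (djP j) => d0 dE; apply: cE.
Qed.

End IndecomposableClasses.

(** * Solving the recursion for the numbers of indecomposables *)

Definition rfc (phi : finFieldType -> rat) : Prop :=
  exists2 r, isrf r & forall k, phi k = r #|k|.

Lemma rfc_eq phi psi : (forall k, phi k = psi k) -> rfc phi -> rfc psi.
Proof. by move=> E [r rI rP]; exists r => // k; rewrite -E. Qed.
Lemma rfc_isrf r : isrf r -> rfc (fun k => r #|k|).
Proof. by exists r. Qed.
Lemma rfc_const c : rfc (fun=> c).
Proof. by exists (fun=> c) => //; apply: isrf_const. Qed.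
Lemma rfc_mul phi psi : rfc phi -> rfc psi -> rfc (fun k => phi k * psi k).
Proof.
move=> [r rI rP] [s sI sP]; exists (fun m => r m * s m); first exact: isrf_mul.
by move=> k; rewrite rP sP.
Qed.
Lemma rfc_sub phi psi : rfc phi -> rfc psi -> rfc (fun k => phi k - psi k).
Proof.
move=> [r rI rP] [s sI sP]; exists (fun m => r m - s m); first exact: isrf_sub.
by move=> k; rewrite rP sP.
Qed.
Lemma rfc_sum (I : eqType) (s : seq I) (P : pred I) (phi : I -> finFieldType -> rat) :
  (forall i, P i -> rfc (phi i)) -> rfc (fun k => \sum_(i <- s | P i) phi i k).
Proof.
move=> H; elim: s => [|i s [r rI rP]].
  by apply: rfc_eq (rfc_const 0) => k; rewrite big_nil.
case Pi: (P i); last by exists r => // k; rewrite big_cons Pi.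
have [t tI tP] := H i Pi; exists (fun m => t m + r m); first exact: isrf_add.
by move=> k; rewrite big_cons Pi rP tP.
Qed.

Section LogarithmicCoefficients.
Variable c : nat -> rat.
Hypothesis c0 : c 0 = 1.

(* The coefficients of t C'(t) / C(t), where C(t) = sum_m c(m) t^m. *)
Fixpoint logs m : seq rat :=
  if m is m'.+1 then
    rcons (logs m') (m%:R * c m - \sum_(t < m') (logs m')`_t * c (m - t.+1)%N)
  else [::].

Definition logc t : rat := (logs t)`_t.-1.

Lemma size_logs m : size (logs m) = m.
Proof. by elim: m => //= m IH; rewrite size_rcons IH. Qed.

Lemma nth_logs m t : (t < m)%N -> (logs m)`_t = logc t.+1.
Proof.
elim: m => // m IH; rewrite ltnS leq_eqVlt => /orP[/eqP -> //|tm].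
by rewrite /= nth_rcons size_logs tm IH.
Qed.

Lemma logcE m : m%:R * c m = \sum_(t < m) logc t.+1 * c (m - t.+1)%N.
Proof.
case: m => [|m]; first by rewrite big_ord0 mul0r.
rewrite big_ord_recr /= subnn c0 mulr1 /logc /= nth_rcons size_logs ltnn eqxx.
rewrite [X in X + _](eq_bigr (fun t : 'I_m => (logs m)`_t * c (m.+1 - t.+1)%N)).
  by rewrite addrC subrK.
by move=> t _; rewrite nth_logs.
Qed.

Lemma logc1 : logc 1 = c 1.
Proof. by have := logcE 1; rewrite mul1r big_ord1 subnn c0 mulr1 => ->. Qed.
End LogarithmicCoefficients.

Lemma logc_isrf (c : nat -> nat -> rat) : (forall q, c 0 q = 1) -> (forall m, isrf (c m)) ->
  forall t, isrf (fun q => logc (fun m => c m q) t.+1).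
Proof.
move=> c0 cI t; move: {2}t.+1 (ltnSn t) => N; elim: N t => // N IH t tN.
apply: (isrf_eq (r := fun q => t.+1%:R * c t.+1 q - \sum_(s < t) logc (fun m => c m q) s.+1 * c (t.+1 - s.+1)%N q)).
  by move=> q _; rewrite (logcE (c := fun m => c m q) (c0 q)) big_ord_recr /= subnn c0 mulr1 addrAC subrr add0r.
apply: isrf_sub; first by apply: isrf_mul => //; apply: isrf_const.
apply: isrf_sum => s _; apply: isrf_mul => //; apply: IH.
exact: leq_trans (ltn_ord s) tN.
Qed.

Section Counting.
Variables (n : nat) (Q : quiver n) (l : 'I_n -> rat).
Local Notation box h := {ffun 'I_n -> 'I_h.+1}.

Lemma sum_over_types (J : finType) h (ib : J -> box h) (dj : J -> nat) N (G : box h -> nat -> rat) :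
  (forall j, (dj j <= N)%N) ->
  \sum_j G (ib j) (dj j) = \sum_b \sum_(d < N.+1)
    #|[set j | (ib j == b) && (dj j == d)]|%:R * G b d.
Proof.
move=> djN; rewrite pair_big /=.
rewrite (partition_big (fun j => (ib j, inord (dj j) : 'I_N.+1)) xpredT) //=.
apply: eq_bigr => -[b d] _ /=; rewrite mulr_natl -sumr_const.
apply: eq_big => [j|j /eqP[<- <-]]; last by rewrite inordK // ltnS.
by rewrite inE xpair_eqE -(inj_eq val_inj) /= inordK // ltnS.
Qed.

Lemma exists_box (a : 'I_n -> nat) h : (ht a <= h)%N -> exists b : box h, a = bdim b.
Proof.
move=> ah; have bi i : (a i < h.+1)%N by rewrite ltnS (leq_trans (leq_ht a i)).
by exists [ffun i => Ordinal (bi i)]; apply: functional_extensionality => i; rewrite /bdim ffunE.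
Qed.

(** The box also contains vectors b of height at least ht a; apart from a itself none of them
    satisfies b <= a, so they do not contribute to the recursion for a. *)
Lemma box_lt (a : 'I_n -> nat) (b b0 : box (ht a)) t : a = bdim b0 -> b != b0 ->
  [forall i, t.+1 * bdim b i <= a i]%N -> (ht (bdim b) < ht a)%N.
Proof.
move=> ab0 bb0 /forallP le.
have ba i : (bdim b i <= a i)%N by apply: leq_trans (le i); rewrite leq_pmull.
rewrite ltn_neqAle leq_sum // andbT; apply: contra bb0 => /eqP E.
apply/eqP/ffunP => i; apply: val_inj; rewrite /= -/(bdim b i) -/(bdim b0 i) -ab0.
apply/eqP; rewrite eqn_leq ba /= leqNgt; apply/negP => lt; move: E; apply/eqP; rewrite ltn_eqF //.
by rewrite /ht (bigD1 i) //= [ltnRHS](bigD1 i) //= -addSn leq_add // leq_sum.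
Qed.

Lemma ht_sub (a b : 'I_n -> nat) t : (ht (fun i => a i - t * b i)%N <= ht a)%N.
Proof. by apply: leq_sum => i _; apply: leq_subr. Qed.

Lemma ht_sub_lt (a b : 'I_n -> nat) t : (0 < ht b)%N -> [forall i, t.+1 * b i <= a i]%N ->
  (ht (fun i => a i - t.+1 * b i)%N < ht a)%N.
Proof.
move=> b0 /forallP le; have -> : ht a = (ht (fun i => a i - t.+1 * b i) + t.+1 * ht b)%N.
  by rewrite /ht big_distrr -big_split; apply: eq_bigr => i _ /=; rewrite subnK.
by rewrite -[ltnLHS]addn0 ltn_add2l muln_gt0.
Qed.

Lemma index_ht_gt0 (k : finFieldType) h (j : indec_index Q l k h) : (0 < ht (bdim (index_box j)))%N.
Proof. by case: (index_repP j) => _ []. Qed.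

Lemma indec_classes_eq0 (k : finFieldType) (a : 'I_n -> nat) d :
  [|| ht a == 0, d == 0 | n * (ht a).+1 ^ 2 < d]%N -> #|indec_classes Q l k a d| = 0%N.
Proof.
case/orP=> [/eqP a0|dN].
  apply/eqP; rewrite cards_eq0; apply/eqP/setP => x; rewrite !inE.
  by apply/negbTE/negP => /andP[/and3P[_ /asbP[]]]; rewrite a0.
have [b E] := exists_box (leqnn (ht a)).
have [dj [d0 djN dc _ _]] := indec_bridge Q l k (ht a).
rewrite (congr1 (fun a' => #|indec_classes Q l k a' d|) E) -dc; apply/eqP; rewrite cards_eq0; apply/eqP/setP => j; rewrite !inE.
apply/negbTE/negP => /andP[_ /eqP jd]; case/orP: dN => [/eqP z|].
  by have := d0 j; rewrite jd z.
by rewrite -jd ltnNge djN.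
Qed.

(** With all c equal to 1 the generating series of each W_j is 1 / (1 - t), whose logarithmic
    coefficients are all 1. *)
Lemma ss_count_rfc_step : (forall a d, rfc (fun k => #|indec_classes Q l k a d|%:R)) ->
  forall a, rfc (fun k => #|classes (fun x : mrep k Q a => sss l x)|%:R).
Proof.
move=> HI a; move: {2}(ht a).+1 (ltnSn (ht a)) => N0; elim: N0 a => // N0 IH a aN.
pose h := ht a; pose N := (n * h.+1 ^ 2)%N.
have cardE (k : finFieldType) a' : (ht a' <= h)%N ->
    #|classes (fun x : mrep k Q a' => sss l x)|%:R =
    multsum (fun j : indec_index Q l k h => bdim (index_box j)) h (fun _ _ => 1) a'.
  move=> ah; have [dj [_ _ _ H _]] := indec_bridge Q l k h; rewrite H //.
  rewrite /multsum -sum1_card natr_sum; apply: eq_big => m; first by rewrite inE.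
  by rewrite inE big1.
case: (posnP (ht a)) => [a0|apos].
  by apply: rfc_eq (rfc_const 1) => k; rewrite cardE // multsum0 //; apply: index_ht_gt0.
pose cnt (k : finFieldType) (a' : 'I_n -> nat) : rat := #|classes (fun x : mrep k Q a' => sss l x)|%:R.
pose term (k : finFieldType) (b : box h) t := if [forall i, t.+1 * bdim b i <= a i]%N then
      cnt k (fun i => a i - t.+1 * bdim b i)%N else 0.
apply: (rfc_eq (phi := fun k => (ht a)%:R^-1 * \sum_(b : box h) \sum_(d < N.+1)
    (#|indec_classes Q l k (bdim b) d|%:R * \sum_(t < h) (ht (bdim b))%:R * term k b t))).
  move=> k; have [dj [d0 djN dc _ _]] := indec_bridge Q l k h.
  have := multsum_rec (@index_ht_gt0 k h) (c := fun _ _ => 1) (ell := fun _ _ => 1) _ (leqnn h).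
  rewrite -cardE // => rec; apply: (mulfI (x := (ht a)%:R)); first by rewrite pnatr_eq0 -lt0n.
  rewrite rec => [|_ m]; last first.
    by rewrite mulr1 (eq_bigr (fun=> 1)) => [|t _]; rewrite ?mulr1 // sumr_const card_ord.
  rewrite mulVKf ?pnatr_eq0 -?lt0n //; apply/esym.
  pose G (b : box h) (d : nat) := \sum_(t < h) (ht (bdim b))%:R * term k b t.
  transitivity (\sum_(j : indec_index Q l k h) G (index_box j) (dj j)).
    apply: eq_bigr => j _; apply: eq_bigr => t _; rewrite mulr1 /term; congr (_ * _).
    by case: ifP => // _; rewrite /cnt cardE // ht_sub.
  rewrite (sum_over_types _ _ djN); apply: eq_bigr => b _; apply: eq_bigr => d _.
  by rewrite dc.
apply: rfc_mul; first exact: rfc_const.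
apply: rfc_sum => b _; apply: rfc_sum => d _; case: (posnP (ht (bdim b))) => [b0|b0].
  apply: rfc_eq (rfc_const 0) => k; rewrite indec_classes_eq0 ?mul0r // b0 //.
apply: rfc_mul; first exact: HI.
apply: rfc_sum => t _; apply: rfc_mul; first exact: rfc_const.
rewrite /term; case le: [forall i, t.+1 * bdim b i <= a i]%N; last exact: rfc_const.
by apply: IH; apply: leq_trans (ht_sub_lt b0 le) _.
Qed.

Lemma ss_pair_rfc e : (0 < e)%N -> exists P : ('I_n -> nat) -> nat -> rat,
  (forall a, isrf (P a)) /\ forall (k : finFieldType) (f : {poly k}) a,
    monic_irreducible_poly f -> (size f).-1 = e -> polycount Q l f a = P a #|k|.
Proof.
move=> e0; have [P PP] := @dependent_choice ('I_n -> nat) (fun=> nat -> rat) (fun a r => isrf r /\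
  forall (k : finFieldType) (f : {poly k}), monic_irreducible_poly f -> (size f).-1 = e ->
    polycount Q l f a = r #|k|) (fun a => match polycount_isrf Q l a e0 with ex_intro2 r rI rP =>
      ex_intro _ r (Logic.conj rI rP) end).
by exists P; split=> [a|k f a fI fe]; [case: (PP a)|apply: (PP a).2].
Qed.

(** The functions are overridden at m = 0 and m = 1: the logarithmic recursion needs c(0) = 1 at
    every integer q, and c(1) has to be the explicit coefficient of the unknown number of
    indecomposables. At d = 0, m = 1 the value is a default. *)
Lemma nilratio_values e : (0 < e)%N -> exists c : nat -> nat -> nat -> rat,
  [/\ forall d q, c d 0%N q = 1, forall d m, isrf (c d m),
      forall d q, (0 < d)%N -> c d 1%N q = (if (e %| d)%N then e else 0%N)%:R * ((q ^ d)%:R - 1)^-1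
    & forall (k L : finFieldType) (iota : {rmorphism k -> L}) (f : {poly k}) d m, (0 < d)%N ->
      monic_irreducible_poly f -> (size f).-1 = e -> #|L| = (#|k| ^ d)%N ->
      nilratio (map_poly iota f) m = c d m #|k|].
Proof.
move=> e0; have [c cP] : exists c : forall dm : nat * nat, nat -> rat, forall dm, isrf (c dm) /\
    ((0 < dm.1)%N -> forall (k L : finFieldType) (iota : {rmorphism k -> L}) (f : {poly k}),
      monic_irreducible_poly f -> (size f).-1 = e -> #|L| = (#|k| ^ dm.1)%N ->
      nilratio (map_poly iota f) dm.2 = c dm #|k|).
  apply: (@dependent_choice _ (fun=> nat -> rat) (fun dm c => isrf c /\
    ((0 < dm.1)%N -> forall (k L : finFieldType) (iota : {rmorphism k -> L}) (f : {poly k}),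
      monic_irreducible_poly f -> (size f).-1 = e -> #|L| = (#|k| ^ dm.1)%N ->
      nilratio (map_poly iota f) dm.2 = c #|k|))) => -[d m] /=.
  case: (posnP d) => [d0|d0]; first by exists (fun=> 0); split; [exact: isrf_const|rewrite d0].
  have [r rI rP] := nilratio_extension_isrf m e0 d0; exists r; split=> [|_ k L iota f fI fe cL] //.
  exact: (rP k L iota f fI fe cL).
pose v1 d q : rat := (if (e %| d)%N then e else 0%N)%:R * ((q ^ d)%:R - 1)^-1.
exists (fun d m q => match m with 0%N => 1 | 1%N => if d == 0%N then 0 else v1 d q | _ => c (d, m) q end).
split=> [d q //|d [|[|m]]|d q|k L iota f d [|[|m]] d0 fI fe cL].
- exact: isrf_const.
- case: (posnP d) => [_|d0]; first exact: isrf_const.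
  by apply: isrf_mul; [exact: isrf_const|exact: isrf_natX_sub1V].
- by case: (cP (d, m.+2)).
- by rewrite lt0n => /negbTE ->.
- exact: nilratio0.
- by rewrite nilratio1 (card_roots_irreducible iota fI cL) cL fe /v1 (gtn_eqF d0).
by apply: (cP (d, m.+2)).2.
Qed.

(** In the recursion for a, indecomposables of dimension a occur only with t = 0, since a multiple
    of a above a itself does not fit. With u_d = I_d(a) / (q^d - 1) they contribute ht a times e
    times the sum of the u_d over the d divisible by e; everything else is known by induction on the
    height. *)
Lemma indec_count_rfc a d : rfc (fun k => #|indec_classes Q l k a d|%:R).
Proof.
move: {2}(ht a).+1 (ltnSn (ht a)) d => N0; elim: N0 a => // N0 IH a aN.
pose h := ht a; pose N := (n * h.+1 ^ 2)%N.
case: (posnP (ht a)) => [a0|apos] d.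
  by apply: rfc_eq (rfc_const 0) => k; rewrite indec_classes_eq0 ?a0.
have [b0 ab0] := exists_box (leqnn (ht a)).
pose u d (k : finFieldType) : rat := #|indec_classes Q l k a d|%:R * ((#|k| ^ d)%:R - 1)^-1.
have Srfc e : (0 < e)%N -> rfc (fun k => \sum_(d < N.+1 | (e %| d)%N) u d k).
  move=> e0; have [P [PI PP]] := ss_pair_rfc e0; have [c [c0 cI c1 cP]] := nilratio_values e0.
  pose ell d t q := logc (fun m => c d m q) t.
  have ellI d' t : isrf (ell d' t.+1) by apply: logc_isrf.
  pose term (k : finFieldType) (b : box h) t := if [forall i, t.+1 * bdim b i <= a i]%N then
      P (fun i => a i - t.+1 * bdim b i)%N #|k| else 0.
  pose rest (k : finFieldType) : rat := \sum_(b : box h | b != b0) \sum_(d < N.+1)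
    (#|indec_classes Q l k (bdim b) d|%:R * \sum_(t < h) (ht (bdim b))%:R * ell d t.+1 #|k| * term k b t).
  apply: (rfc_eq (phi := fun k => e%:R^-1 * (P a #|k| - (ht a)%:R^-1 * rest k))); last first.
    apply: rfc_mul; first exact: rfc_const.
    apply: rfc_sub; first exact: rfc_isrf.
    apply: rfc_mul; first exact: rfc_const.
    apply: rfc_sum => b bb0; apply: rfc_sum => d' _.
    case: (posnP (ht (bdim b))) => [b00|bpos].
      by apply: rfc_eq (rfc_const 0) => k; rewrite indec_classes_eq0 ?mul0r // b00.
    case: (ltnP (ht (bdim b)) (ht a)) => [ba|ba].
      apply: rfc_mul; first by apply: IH; apply: leq_trans ba _.
      apply: rfc_sum => t _; apply: rfc_mul.
        by apply: rfc_mul; [exact: rfc_const|apply: (rfc_isrf (ellI _ _))].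
      rewrite /term; case le: [forall i, t.+1 * bdim b i <= a i]%N; last exact: rfc_const.
      exact: rfc_isrf.
    apply: rfc_eq (rfc_const 0) => k; rewrite big1 ?mulr0 // => t _.
    rewrite /term; case: ifP => [le|_]; last by rewrite mulr0.
    by have := box_lt ab0 bb0 le; rewrite ltnNge ba.
  (* Any irreducible polynomial of degree e over this field will do; the identity to be proved does
     not mention it. *)
  move=> k; have [f fI fs] := @exists_monic_irreducible_of_degree k _ e0.
  have fe : (size f).-1 = e by rewrite fs.
  have [dj [d0 djN dc _ dP]] := indec_bridge Q l k h.
  have PE a' : (ht a' <= h)%N -> P a' #|k| = multsum (fun j : indec_index Q l k h => bdim (index_box j)) h
      (fun j m => c (dj j) m #|k|) a'.
    move=> a'h; rewrite -(PP k f a' fI fe); apply: (dP f (fun d m => c d m #|k|)) => // L iota d' m d'0 cL.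
    exact: cP.
  have := multsum_rec (@index_ht_gt0 k h) (c := fun j m => c (dj j) m #|k|)
    (ell := fun j t => ell (dj j) t #|k|) _ (leqnn h).
  rewrite -PE // => rec.
  pose G (b : box h) (d : nat) := \sum_(t < h) (ht (bdim b))%:R * ell d t.+1 #|k| * term k b t.
  have {}rec : (ht a)%:R * P a #|k| = \sum_(j : indec_index Q l k h) G (index_box j) (dj j).
    rewrite rec => [|j m]; last exact: (logcE (c := fun m => c (dj j) m #|k|)).
    apply: eq_bigr => j _; apply: eq_bigr => t _; rewrite /term; congr (_ * _).
    by case: ifP => // _; rewrite PE // ht_sub.
  rewrite (sum_over_types _ _ djN) (bigD1 b0) //= in rec.
  rewrite [X in _ = _ + X](eq_bigr (fun b : box h => \sum_(d < N.+1) (#|indec_classes Q l k (bdim b) d|%:R * G b d))) in rec; last first.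
    by move=> b _; apply: eq_bigr => d' _; rewrite dc.
  rewrite -/(rest k) in rec.
  have h0 : (ht a)%:R != 0 :> rat by rewrite pnatr_eq0 -lt0n.
  have en0 : e%:R != 0 :> rat by rewrite pnatr_eq0 -lt0n.
  apply: (mulfI en0); rewrite mulVKf //; apply: (mulfI h0).
  rewrite mulrBr mulVKf // rec addrK mulr_sumr.
  rewrite [RHS]mulr_sumr [RHS]big_mkcond /=; apply: eq_bigr => d' _.
  rewrite dc (congr1 (fun a' => #|indec_classes Q l k a' d'|) (esym ab0)).
  case: (posnP d') => [z|d'0].
    by rewrite z /u indec_classes_eq0 ?orbT // !mul0r !mulr0 if_same.
  have GE : G b0 d' = (ht a)%:R * c d' 1%N #|k|.
    rewrite /G -ab0; have hE : h = (ht a).-1.+1 by rewrite prednK.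
    rewrite (bigD1 (Ordinal apos)) //= [X in _ + X]big1 ?addr0 => [|t t0].
      rewrite /term -ab0; case: ifP => [_|/negbT/forallP[] i]; last by rewrite mul1n.
      have -> : P (fun i => a i - 1 * a i)%N #|k| = 1.
        rewrite PE; last exact: ht_sub.
        apply: multsum0 => [j|j|]; [exact: index_ht_gt0|exact: c0|].
        by rewrite /ht big1 // => i _; rewrite mul1n subnn.
      by rewrite mulr1 /ell logc1.
    rewrite /term -ab0; case: ifP => [/forallP le|_]; last by rewrite mulr0.
    have t1 : (0 < t)%N by rewrite lt0n; apply: contra t0 => /eqP z; apply/eqP/val_inj.
    have [i ai] : exists i, (0 < a i)%N.
      apply/existsP; rewrite -[[exists i, _]]negbK negb_exists; apply/negP => /forallP a0.
      by have := apos; rewrite /ht big1 // => i _; apply/eqP; rewrite -leqn0 leqNgt.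
    by have := le i; rewrite leqNgt -{1}[a i]mul1n ltn_pmul2r // ltnS t1.
  rewrite GE c1 // /u; case: ifP => _; last by rewrite mul0r !mulr0.
  have E4 (x y z w : rat) : x * (y * (z * w)) = y * (z * (x * w)) by ring.
  exact: E4.
(* Downward in d': from the sum over all multiples of d' up to N the terms with a larger index are
   subtracted. Beyond N there are no indecomposables. *)
have urfc d' : rfc (u d').
  move: {2}(N - d').+1 (ltnSn (N - d')) => M; elim: M d' => // M IHM d' dM.
  case: (boolP ((d' == 0%N) || (N < d')%N)) => [triv|].
    apply: rfc_eq (rfc_const 0) => k; rewrite /u indec_classes_eq0 ?mul0r //.
    by rewrite triv orbT.
  rewrite negb_or -lt0n -leqNgt => /andP[d'0 d'N].
  have d'N1 : (d' < N.+1)%N by [].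
  apply: (rfc_eq (phi := fun k => \sum_(x < N.+1 | (d' %| x)%N) u x k - \sum_(x < N.+1 | (d' %| x)%N && (x != Ordinal d'N1)) u x k)).
    by move=> k; rewrite (bigD1 (Ordinal d'N1)) //= addrK.
  apply: rfc_sub; first exact: Srfc.
  apply: rfc_sum => x /andP[dx xd]; case: (posnP x) => [x0|x0].
    by apply: rfc_eq (rfc_const 0) => k; rewrite /u indec_classes_eq0 ?mul0r // x0 orbT.
  apply: IHM; have lt : (d' < x)%N.
    by rewrite ltn_neqAle dvdn_leq // andbT eq_sym; apply: contra xd => /eqP E; apply/eqP/val_inj.
  have := ltn_ord x; lia.
case: (posnP d) => [z|d0].
  by apply: rfc_eq (rfc_const 0) => k; rewrite indec_classes_eq0 // z orbT.
apply: (rfc_eq (phi := fun k => u d k * ((#|k| ^ d)%:R - 1))).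
  move=> k; rewrite mulfVK // subr_eq0 (eqr_nat _ _ 1) gtn_eqF // -(exp1n d) ltn_exp2r //.
  exact: card_fin_gt1.
apply: rfc_mul => //; apply: rfc_sub; last exact: rfc_const.
by apply: (rfc_isrf (r := fun q => (q ^ d)%:R)); apply: isrf_natX.
Qed.

Lemma ss_count_rfc a : rfc (fun k => #|classes (fun x : mrep k Q a => sss l x)|%:R).
Proof. exact/ss_count_rfc_step/indec_count_rfc. Qed.

End Counting.

(** * Absolute indecomposability *)

Lemma card_field_pnat (k : finFieldType) : [pchar k].-nat #|k|.
Proof.
have [p pp pk] := finPcharP k.
have := abelem_pgroup (fin_ring_pchar_abelem pk); rewrite /pgroup cardsT.
by apply: sub_in_pnat => r _ /eqnP ->.
Qed.

Section Frobenius.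
Variables (k : finFieldType) (K : fieldType) (iota : {rmorphism k -> K}).

Lemma frob_pnat N : [pchar K].-nat (#|k| ^ N)%N.
Proof.
have := card_field_pnat k; rewrite (eq_pnat _ (fun p => esym (fmorph_pchar iota p))) => H.
by rewrite pnatX H.
Qed.

Lemma frob_sub (x y : K) N : (x - y) ^+ (#|k| ^ N)%N = x ^+ (#|k| ^ N)%N - y ^+ (#|k| ^ N)%N.
Proof. by rewrite exprDn_pchar ?exprNn_pchar ?frob_pnat. Qed.

Lemma frob_XsubC (c : K) N :
  ('X - c%:P) ^+ (#|k| ^ N)%N = 'X^(#|k| ^ N) - (c ^+ (#|k| ^ N)%N)%:P.
Proof.
have P : [pchar {poly K}].-nat (#|k| ^ N)%N.
  by rewrite (eq_pnat _ (pchar_poly K)) frob_pnat.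
by rewrite exprDn_pchar // exprNn_pchar // rmorphXn.
Qed.

Lemma frob_fix (b : k) N : b ^+ (#|k| ^ N)%N = b.
Proof. by elim: N => [|N IH]; rewrite ?expr1 // expnSr exprM IH expf_card. Qed.
End Frobenius.

Section ScalarExtension.
Variables (n : nat) (Q : quiver n) (k K : fieldType) (iota : {rmorphism k -> K}).

Definition mapf (a b : 'I_n -> nat) (f : vfam k a b) : vfam K a b := finfun (fun i => map_mx iota (f i)).
Definition mapr (a : 'I_n -> nat) (x : mrep k Q a) : mrep K Q a := finfun (fun c => map_mx iota (x c)).

Lemma homf_map a b (x : mrep k Q a) (y : mrep k Q b) f : homf (mapr x) (mapr y) (mapf f) = homf x y f.
Proof.
apply: eq_forallb => c; rewrite !ffunE -!map_mxM; apply/eqP/eqP => [|-> //].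
exact: map_mx_inj.
Qed.

Lemma nilpf_map a (f : vfam k a a) : nilpf (mapf f) = nilpf f.
Proof.
have mapX i N : map_mx iota (f i) ^+ N = map_mx iota (f i ^+ N).
  elim: N => [|N IH]; first by rewrite !expr0 map_mx1.
  by rewrite !exprS IH -!mulmxE map_mxM.
apply: eq_forallb => i; rewrite ffunE /nilpm mapX; apply/eqP/eqP => [E|->].
  by apply: (map_mx_inj (f := iota)); rewrite E map_mx0.
by rewrite map_mx0.
Qed.

Lemma mapf_sub_sc a (f : vfam k a a) b : mapf (f - scf a b) = mapf f - scf a (iota b).
Proof.
apply/ffunP => i; rewrite [RHS]dffunDE [X in _ = _ + X]dffunNE !ffunE map_mxB map_scalar_mx.
by [] .
Qed.

Lemma indec_of_map a (x : mrep k Q a) : indec (mapr x) -> indec x.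
Proof.
case=> a0 xI; split=> // U V xU xV UV.
have st (W : forall i, 'M[k]_(a i)) : stab x W -> stab (mapr x) (fun i => map_mx iota (W i)).
  by move/forallP => xW; apply/forallP => c; rewrite ffunE -map_mxM map_submx.
have z (W : forall i, 'M[k]_(a i)) : (forall i, map_mx iota (W i) = 0) -> forall i, W i = 0.
  by move=> W0 i; apply: (map_mx_inj (f := iota)); rewrite W0 map_mx0.
case: (xI _ _ (st _ xU) (st _ xV)) => [i|/z|/z]; [|by left|by right].
have [UV1 UV2] := UV i; split; last by apply/eqP; rewrite -submx0 -map_capmx UV2 map_mx0.
apply/eqmxP/andP; split; first exact: submx1.
have /eqmxP/andP[_ H] := UV1; rewrite -(map_mx1 iota) -map_addsmx map_submx; exact: H.
Qed.

End ScalarExtension.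

Section AbsolutelyIndecomposable.
Variables (n : nat) (Q : quiver n) (k : finFieldType) (a : 'I_n -> nat) (x : mrep k Q a).

(** Residue degree 1 says that k maps onto the residue field. *)
Lemma resdeg1_scalar : indec x ->
  has_resdeg x 1 <-> forall f, homf x x f -> exists b, nilpf (f - scf a b).
Proof.
move=> xI; have [L [r [iota [rD rM r0 rsur rsc]]]] := exists_residue_field xI.
have rB f g : homf x x f -> homf x x g -> r (f - g) = r f - r g.
  move=> xf xg; have e : r f = r (f - g) + r g by rewrite -rD ?homfD ?homfN // subrK.
  by rewrite e addrK.
rewrite (has_resdegP _ (card_residue rD r0 rsur)) expn1; split=> [/eqP cL f xf|H].
  have := inj_card_onto (fmorph_inj iota); rewrite cL => /(_ (leqnn _) (r f)) /codomP[b rb].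
  by exists b; rewrite -r0 ?homfD ?homfN ?homf_sc // rB ?homf_sc // rsc rb subrr.
rewrite -(card_codom (fmorph_inj iota)); apply/eqP/eq_card => y; rewrite inE; apply/esym/codomP.
have [f xf <-] := rsur y; have [b] := H f xf; exists b; apply/eqP.
by rewrite -subr_eq0 -rsc -rB ?homf_sc // r0 ?homfD ?homfN ?homf_sc.
Qed.

(** An endomorphism f over k has an eigenvalue c in K at some vertex, and f - c is nilpotent because
    End is local over K. A high q-power of f is then the scalar c^(q^N), so c^(q^N) lies in k; as
    the power map is injective on K and fixes k, already c lies in k. *)
Lemma resdeg1_of_map (K : closedFieldType) (iota : {rmorphism k -> K}) :
  indec (mapr iota x) -> has_resdeg x 1.
Proof.
move=> xKI; have xI := indec_of_map xKI; apply/(resdeg1_scalar xI) => f xf.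
have [i ai] : exists i, (0 < a i)%N.
  apply/existsP; rewrite -[[exists i, _]]negbK negb_exists; apply/negP => /forallP a0.
  by have := xI.1; rewrite /ht big1 // => i _; apply/eqP; rewrite -leqn0 leqNgt.
have xfK : homf (mapr iota x) (mapr iota x) (mapf iota f) by rewrite homf_map.
have [c ec] : exists c, eigenvalue (mapf iota f i) c.
  have [|c rc] := @closed_rootP K (char_poly (mapf iota f i)) _.
    by rewrite size_char_poly eqSS -lt0n.
  by exists c; rewrite eigenvalue_root_char.
have xfc := homfD xfK (homfN (homf_sc (mapr iota x) c)).
have fcn : nilpf (mapf iota f - scf a c).
  case: (indec_local xKI xfc) => // /forallP/(_ i).
  rewrite dffunDE dffunNE ![in X in X -> _]ffunE => u.
  case/eigenvalueP: ec => v; rewrite ffunE => vc v0; case/eqP: v0.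
  apply: (can_inj (mulmxK u)); rewrite mul0mx mulmxBr vc -scalemx1 -scalemxAr mulmx1 subrr //.
set N := ht a; set q := (#|k| ^ N)%N.
have qN : (N <= q)%N by apply/ltnW/ltn_expl/card_fin_gt1.
have fq : map_mx iota (f i ^+ q) = (c ^+ q)%:M.
  have : (mapf iota f - scf a c) i ^+ q = 0.
    by have /ffunP/(_ i) := expf_nilpf fcn qN; rewrite ffunE dffun0E.
  rewrite dffunDE dffunNE !ffunE.
  have -> : map_mx iota (f i) - c%:M = hmx ('X - c%:P) (map_mx iota (f i)).
    by rewrite hmxB hmxX hmxC.
  rewrite -hmx_exp (frob_XsubC iota) hmxB hmxXn hmxC => /eqP; rewrite subr_eq0 => /eqP <-.
  rewrite -/q; elim: q {qN} => [|m IH]; first by rewrite !expr0 map_mx1.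
  by rewrite !exprS -mulmxE map_mxM IH.
(* The candidate b is a diagonal entry of the power of f. It is fixed by the same power map, so (c -
   b)^q = c^q - b = 0. *)
have [b cb] : exists b, c = iota b.
  exists ((f i ^+ q) (Ordinal ai) (Ordinal ai)); set b := _ (Ordinal ai) _.
  have cq : c ^+ q = iota b.
    have := fq => /matrixP/(_ (Ordinal ai) (Ordinal ai)); rewrite !mxE eqxx mulr1n => <- //.
  apply/eqP; rewrite -subr_eq0; have : (c - iota b) ^+ q = 0.
    by rewrite (frob_sub iota) -/q cq -rmorphXn frob_fix subrr.
  by move/eqP; rewrite expf_eq0 => /andP[].
by exists b; rewrite -(nilpf_map iota) mapf_sub_sc -cb.
Qed.

End AbsolutelyIndecomposable.

(** * The radical stays nilpotent after extension of scalars *)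

Section RadicalFiltration.
Variables (n : nat) (Q : quiver n) (k : finFieldType) (a : 'I_n -> nat) (x : mrep k Q a).
Hypothesis xI : indec x.
Local Notation radical f := (homf x x f && nilpf f).

Lemma radicalM f g : radical f -> radical g -> radical (cmp f g).
Proof. by move=> /andP[xf fn] /andP[xg _]; rewrite (homf_cmp xf xg) (indec_nil_cmpl xI). Qed.

Variable i : 'I_n.

(** Modulo U, w = w g implies w = w g^j for every j, and g is nilpotent. *)
Lemma sub_nil_fix (U : 'M[k]_(a i)) (w : 'rV[k]_(a i)) g : radical g ->
  (U *m g i <= U)%MS -> (w - w *m g i <= U)%MS -> (w <= U)%MS.
Proof.
move=> /andP[_ /forallP gn] Ug wg.
have Uj j : (U *m g i ^+ j <= U)%MS.
  elim: j => [|j IH]; first by rewrite expr0 mulmx1.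
  by rewrite exprS mulmxA (submx_trans (submxMr _ Ug)).
have wj j : (w - w *m g i ^+ j <= U)%MS.
  elim: j => [|j IH]; first by rewrite expr0 mulmx1 subrr sub0mx.
  rewrite -(subrK (w *m g i ^+ j) w) -addrA addmx_sub //.
  rewrite subrK exprS mulmxA -mulmxBl; exact: submx_trans (submxMr _ wg) (Uj j).
by have := wj (a i); have := gn i; rewrite /nilpm => /eqP ->; rewrite mulmx0 subr0.
Qed.

Definition radorbit (U : 'M[k]_(a i)) (v : 'rV[k]_(a i)) : {set 'rV[k]_(a i)} :=
  [set w | [exists f : vfam k a a, radical f && (w - v *m f i <= U)%MS]].

(** Take v outside U with the smallest orbit under the radical modulo U. If w = v f were outside U,
    its orbit, contained in that of v, would be equal to it by minimality. Then w would lie in its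
    own orbit, that is w = w g modulo U with g nilpotent, hence in U. *)
Lemma exists_radical_vector (U : 'M[k]_(a i)) : (forall f, radical f -> (U *m f i <= U)%MS) ->
  ~~ row_full U ->
  exists2 v : 'rV_(a i), ~~ (v <= U)%MS & forall f, radical f -> (v *m f i <= U)%MS.
Proof.
move=> US nU; have [v0 v0U] : exists v0 : 'rV_(a i), ~~ (v0 <= U)%MS.
  apply/existsP; apply: contraR nU; rewrite negb_exists => /forallP H.
  by rewrite -sub1mx; apply/row_subP => j; have := H (row j 1%:M); rewrite negbK.
case: (arg_minnP (P := fun v : 'rV_(a i) => ~~ (v <= U)%MS) (fun v => #|radorbit U v|) v0U) => v vU vmin.
exists v => // f rf; apply: contraT => wU; set w := v *m f i in wU.
have wv : radorbit U w \subset radorbit U v.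
  apply/subsetP => y; rewrite !inE => /existsP[g /andP[rg yg]]; apply/existsP; exists (cmp f g).
  by rewrite radicalM // ffunE mulmxA.
have : w \in radorbit U w.
  have := subset_leqif_cards wv => -[_]; rewrite eqn_leq vmin // subset_leq_card // => /esym/eqP ->.
  by rewrite inE; apply/existsP; exists f; rewrite rf subrr sub0mx.
rewrite inE => /existsP[g /andP[rg wg]].
by rewrite (sub_nil_fix rg (US g rg) wg) in wU.
Qed.

Variables (K : fieldType) (iota : {rmorphism k -> K}).

(* Levitzki's argument: the nilpotent endomorphisms form a semigroup, hence kill a
   vector modulo any proper stable U, and this passes to their K-span. *)
Lemma radical_filtration s : exists U : 'M[k]_(a i),
  [/\ (s <= \rank U)%N || row_full U, forall f, radical f -> (U *m f i <= U)%MS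
    & forall r (c : 'I_r -> K) (f : 'I_r -> vfam k a a), (forall b, radical (f b)) ->
      map_mx iota U *m (\sum_b c b *: map_mx iota (f b i)) ^+ s = 0].
Proof.
elim: s => [|s [U [rU US Un]]].
  by exists 0; split=> // [f _|r c f _]; rewrite ?mul0mx ?sub0mx // map_mx0 mul0mx.
case: (boolP (row_full U)) => [fU|nU].
  exists U; split=> // [|r c f rf]; first by rewrite fU orbT.
  by rewrite exprSr mulmxA Un // mul0mx.
rewrite (negbTE nU) orbF in rU.
have [v vU vS] := exists_radical_vector US nU.
exists (U + v)%MS; have USv f : radical f -> ((U + v)%MS *m f i <= U)%MS.
  by move=> rf; rewrite addsmxMr addsmx_sub US // vS.
split=> [|f rf|r c f rf].
- apply/orP; left; apply: leq_ltn_trans rU _; rewrite ltnNge; apply: contra vU => le.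
  have := mxrank_leqif_sup (addsmxSl U v) => -[le1]; rewrite eqn_leq le1 le => /esym.
  by rewrite addsmx_sub => /andP[].
- exact: submx_trans (USv f rf) (addsmxSl _ _).
have /submxP[D DE] : (map_mx iota (U + v)%MS *m (\sum_b c b *: map_mx iota (f b i)) <= map_mx iota U)%MS.
  rewrite mulmx_sumr summx_sub // => b _; rewrite -scalemxAr scalemx_sub //.
  by rewrite -map_mxM map_submx USv.
by rewrite exprS mulmxA DE -mulmxA Un // mulmx0.
Qed.

Lemma radical_span_nil r (c : 'I_r -> K) (f : 'I_r -> vfam k a a) : (forall b, radical (f b)) ->
  nilpm (\sum_b c b *: map_mx iota (f b i)).
Proof.
move=> rf; have [U [rU _ Un]] := radical_filtration (a i).
have fU : row_full U.
  by case/orP: rU => //; rewrite /row_full eqn_leq => ->; rewrite rank_leq_col.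
have mU : map_mx iota U \in unitmx by rewrite map_unitmx -row_full_unit.
by apply/eqP; apply: (can_inj (mulKmx mU)); rewrite mulmx0 Un.
Qed.

End RadicalFiltration.

Section GeometricallyIndecomposable.
Variables (n : nat) (Q : quiver n) (k : finFieldType) (a : 'I_n -> nat) (x : mrep k Q a).
Variables (K : fieldType) (iota : {rmorphism k -> K}).

(* The entries of e are combinations of finitely many elements of K independent
   over k, and comparing coefficients splits e into endomorphisms over k. *)
Lemma endo_span (e : vfam K a a) : homf (mapr iota x) (mapr iota x) e ->
  exists r (c : 'I_r -> K) (f : 'I_r -> vfam k a a),
    (forall b, homf x x (f b)) /\ forall i, e i = \sum_b c b *: map_mx iota (f b i).
Proof.
move=> /forallP xe; pose T := {i : 'I_n & ('I_(a i) * 'I_(a i))%type}.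
pose entry (t : T) := e (tag t) (tagged t).1 (tagged t).2.
have [r [c [ci cs]]] := independent_span iota [seq entry t | t <- enum {: T}].
have [u uE] := @dependent_choice _ (fun=> {ffun 'I_r -> k}) (fun t u => entry t = lcomb iota c u)
  (fun t => cs _ (map_f entry (mem_enum _ t))).
pose f b : vfam k a a := finfun (fun i => \matrix_(p, q)
  u (Tagged (fun i => ('I_(a i) * 'I_(a i))%type) (p, q)) b).
have fE i : e i = \sum_b c b *: map_mx iota (f b i).
  apply/matrixP => p q; have := uE (Tagged (fun i => ('I_(a i) * 'I_(a i))%type) (p, q)).
  rewrite /entry /= => ->; rewrite summxE; apply: eq_bigr => b _.
  by rewrite !mxE ffunE mxE mulrC.
exists r, c, f; split=> // b; apply/forallP => d; rewrite -subr_eq0; apply/eqP/matrixP => p q.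
pose w : {ffun 'I_r -> k} := [ffun b => (x d *m f b (target d) - f b (source d) *m x d) p q].
suff /ci/ffunP/(_ b) : lcomb iota c w = 0 by rewrite !ffunE mxE => ->; rewrite mxE.
have := xe d; rewrite ffunE !fE mulmx_sumr mulmx_suml -subr_eq0 -sumrB => /eqP/matrixP/(_ p q).
rewrite summxE mxE => E; rewrite -[RHS]E; apply: eq_bigr => b' _.
by rewrite ffunE -scalemxAr -scalemxAl -!map_mxM -scalerBr -map_mxB [in RHS]mxE [X in _ = _ * X]mxE mulrC.
Qed.

(** Let e be the idempotent of a splitting over K. It is a K-combination of endomorphisms over k,
    each a scalar plus a radical element, so e = t + m with t in K and m nilpotent. If t = 0, then e
    is nilpotent and idempotent, hence 0; otherwise e is invertible and the complementary summand is
    0. *)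
Lemma indec_map : indec x -> has_resdeg x 1 -> indec (mapr iota x).
Proof.
move=> xI /(resdeg1_scalar xI) xs; split; first exact: xI.1.
move=> U V xU xV UV; have [y [z [i1 [p1 [i2 [p2 [bp i1U i2V]]]]]]] := split_biproduct xU xV UV.
case: bp => h1 k1 h2 k2 e11 e22 _ e21 es.
have [e eD] : exists e, e = cmp p1 i1 by exists (cmp p1 i1).
have xe : homf (mapr iota x) (mapr iota x) e by rewrite eD; apply: homf_cmp k1 h1.
have ee : cmp e e = e by rewrite eD -cmpA (cmpA i1) e11 cmp1l.
have [r [c [f [xf fE]]]] := endo_span xe.
have [b bn] : exists b : 'I_r -> k, forall s, nilpf (f s - scf a (b s)).
  by apply: (@dependent_choice _ (fun=> k) (fun s b => nilpf (f s - scf a b))) => s; apply: xs.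
pose g s := f s - scf a (b s).
have rg s : homf x x (g s) && nilpf (g s) by rewrite bn homfD ?homfN ?homf_sc.
pose t := \sum_s c s * iota (b s).
have eE : e = scf a t + finfun (fun i => \sum_s c s *: map_mx iota (g s i)).
  apply/ffunP => i; rewrite dffunDE !ffunE fE /t.
  have -> : (\sum_s c s * iota (b s))%:M = \sum_s c s *: (iota (b s))%:M :> 'M_(a i).
    by rewrite raddf_sum; apply: eq_bigr => s _; rewrite scale_scalar_mx.
  rewrite -big_split; apply: eq_bigr => s _ /=; rewrite -scalerDr; congr (_ *: _).
  by rewrite /g dffunDE dffunNE !ffunE map_mxB map_scalar_mx addrC subrK.
set m := finfun _ in eE; have mn : nilpf m.
  by apply/forallP => i; rewrite ffunE; apply: (radical_span_nil xI).
have eX N : expf N.+1 e = e.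
  elim: N => [|N IH]; first by apply/ffunP => i; rewrite ffunE.
  by rewrite -[RHS]ee -{3}IH; apply/ffunP => i; rewrite !ffunE exprS.
case: (eqVneq t 0) => [t0|t0].
  have e0 : e = 0.
    rewrite -(eX (ht a)); apply: expf_nilpf (leqnSn _).
    rewrite eE t0 (_ : scf a 0 = 0) ?add0r //; apply/ffunP => i.
    by rewrite ffunE dffun0E raddf0.
  left=> i; apply/eqP; rewrite -submx0 -i1U.
  have : cmp e p1 = p1 by rewrite eD -cmpA e11 cmp1r.
  have : i1 = cmp i1 e by rewrite eD cmpA e11 cmp1l.
  by rewrite e0 cmp0r => -> _; rewrite dffun0E sub0mx.
have eu : unitf e.
  pose m' : vfam K a a := finfun (fun i => - (t^-1 *: m i)).
  have m'n : nilpf m'.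
    apply/forallP => i; rewrite ffunE; have mi := forallP mn i.
    have -> : - (t^-1 *: m i) = m i *m (- t^-1)%:M by rewrite scalar_mxC mul_scalar_mx scaleNr.
    by apply: nilpm_mul_comm => //; rewrite scalar_mxC.
  have E : e = cmp (scf a t) (scf a 1 - m').
    apply/ffunP => i; rewrite eE dffunDE [RHS]ffunE [in RHS]dffunDE dffunNE !ffunE.
    by rewrite opprK mulmxDr mulmx1 mul_scalar_mx scalerA divff // scale1r.
  rewrite E unitf_cmp nilpf_sub1 // andbT; apply/forallP => i; rewrite ffunE unitmxE det_scalar.
  by rewrite unitfE expf_neq0.
right=> i; apply/eqP; rewrite -submx0 -i2V.
have i2e : cmp i2 e = 0 by rewrite eD cmpA e21 cmp0l.
have -> : i2 = 0.
  by rewrite -[i2]cmp1r -(invf_r eu) cmpA i2e cmp0l.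
by rewrite dffun0E sub0mx.
Qed.

End GeometricallyIndecomposable.

(** * Representations on vector spaces *)

Section Coordinates.
Variables (k : fieldType) (vT : vectType k) (m : nat) (phi : 'Hom(vT, 'rV[k]_m)).
Hypothesis phi_bij : bijective phi.

Definition in_coordinates p (U : {vspace vT}) (B : 'M[k]_(p, m)) : Prop :=
  forall v, (v \in U) = (phi v <= B)%MS.

Lemma coord_lker : lker phi == 0%VS.
Proof. by apply/lker0P; apply: bij_inj. Qed.

Lemma coord_inv : cancel phi (phi^-1)%VF.
Proof. exact: lker0_lfunK coord_lker. Qed.

Lemma inv_coord : cancel (phi^-1)%VF phi.
Proof. by move=> u; have [g gK Kg] := phi_bij; rewrite -[u]Kg coord_inv. Qed.

Lemma coordinates_of (U : {vspace vT}) : exists B : 'M_m, in_coordinates U B.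
Proof.
pose h := (phi \o projv U \o phi^-1)%VF; exists (lin1_mx h) => v.
have hE u : u *m lin1_mx h = phi (projv U ((phi^-1)%VF u)) by rewrite mul_rV_lin1 /= !lfunE /= !lfunE.
apply/idP/submxP => [vU|[u]]; last first.
  by rewrite hE => /(bij_inj phi_bij) ->; apply: memv_proj.
by exists (phi v); rewrite hE coord_inv projv_id.
Qed.

Lemma space_of p (B : 'M[k]_(p, m)) : exists U : {vspace vT}, in_coordinates U B.
Proof.
pose h : 'Hom('rV[k]_p, vT) := (phi^-1 \o linfun (mulmxr B))%VF; exists (limg h) => v.
have hE u : h u = (phi^-1)%VF (u *m B) by rewrite /h comp_lfunE lfunE.
apply/memv_imgP/submxP => [[u _ ->]|[u E]]; exists u; rewrite ?memvf ?hE ?inv_coord //.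
by rewrite -E coord_inv.
Qed.

Lemma in_coordinates_dim p (U : {vspace vT}) (B : 'M[k]_(p, m)) : in_coordinates U B -> \dim U = \rank B.
Proof.
move=> UB; pose h : 'Hom('rV[k]_(\rank B), vT) := (phi^-1 \o linfun (mulmxr (row_base B)))%VF.
have hE u : h u = (phi^-1)%VF (u *m row_base B) by rewrite /h comp_lfunE lfunE.
have -> : U = limg h.
  apply/vspaceP => v; rewrite UB -(eq_row_base B).
  apply/submxP/memv_imgP => [[u E]|[u _ ->]]; exists u; rewrite ?memvf ?hE ?inv_coord //.
  by rewrite -E coord_inv.
rewrite limg_dim_eq ?dimvf ?dim_matrix; first exact: mul1n.
apply/eqP; rewrite capfv; apply/lker0P => u w; rewrite !hE => /(can_inj inv_coord).
exact/row_free_inj/row_base_free.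
Qed.

Lemma in_coordinates_cap p q (U V : {vspace vT}) (B : 'M[k]_(p, m)) (C : 'M[k]_(q, m)) :
  in_coordinates U B -> in_coordinates V C -> in_coordinates (U :&: V) (B :&: C)%MS.
Proof. by move=> UB VC v; rewrite memv_cap sub_capmx UB VC. Qed.

Lemma in_coordinates_eq0 p (U : {vspace vT}) (B : 'M[k]_(p, m)) : in_coordinates U B -> U = 0%VS <-> B = 0.
Proof.
move/in_coordinates_dim => E; split=> [U0|B0].
  by apply/eqP; rewrite -mxrank_eq0 -E U0 dimv0.
by apply/eqP; rewrite -dimv_eq0 E B0 mxrank0.
Qed.

Lemma coord_dim : \dim {: vT} = m.
Proof. by rewrite (@in_coordinates_dim m fullv 1%:M) ?mxrank1 // => v; rewrite memvf submx1. Qed.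

Lemma in_coordinates_direct p q (U V : {vspace vT}) (B : 'M[k]_(p, m)) (C : 'M[k]_(q, m)) :
  in_coordinates U B -> in_coordinates V C ->
  ((U + V)%VS = fullv /\ (U :&: V)%VS = 0%VS) <-> ((B + C :=: 1%:M)%MS /\ (B :&: C = 0)%MS).
Proof.
move=> UB VC; have cap := in_coordinates_cap UB VC; have cap0 := in_coordinates_eq0 cap.
have E := dimv_sum_cap U V; have E' := mxrank_sum_cap B C.
rewrite (in_coordinates_dim UB) (in_coordinates_dim VC) (in_coordinates_dim cap) -E' in E.
have {}E := addIn E; split=> [[s /cap0 c]|[s /cap0 c]]; split=> //.
  by apply/eqmxP; rewrite submx1 sub1mx /row_full -E s coord_dim ?eqxx.
by apply/eqP; rewrite eqEdim subvf coord_dim E s mxrank1 leqnn.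
Qed.

End Coordinates.

Section Translation.
Variables (n : nat) (Q : quiver n).

Definition to_rep (k : fieldType) (a : 'I_n -> nat) (x : mrep k Q a) : rep Q k :=
  @Rep n Q k (fun i => 'rV[k]_(a i)) (fun c => linfun (mulmxr (x c))).

Definition spacedim (k : fieldType) (V : rep Q k) (i : 'I_n) : nat := \dim {: rspace V i}.

Definition of_rep (k : fieldType) (V : rep Q k) : mrep k Q (spacedim V) :=
  finfun (fun c => mxof (vbasis {: rspace V (source c)}) (vbasis {: rspace V (target c)}) (rmap V c)).

Section OneField.
Variable k : fieldType.
Implicit Types V W : rep Q k.

Definition chart (a : 'I_n -> nat) V (x : mrep k Q a) (phi : forall i, 'Hom(rspace V i, 'rV[k]_(a i))) : Prop :=
  (forall i, bijective (phi i)) /\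
  forall c v, phi (target c) (rmap V c v) = phi (source c) v *m x c.

(** The interface between vector spaces and matrices: every notion of the statement is transferred
    along this relation. *)
Definition repby (a : 'I_n -> nat) V (x : mrep k Q a) : Prop := exists phi, @chart a V x phi.

Lemma repby_to_rep a (x : mrep k Q a) : repby (to_rep x) x.
Proof.
exists (fun i => \1%VF); split=> [i|c v]; last by rewrite !id_lfunE /= lfunE.
by exists id => v; rewrite id_lfunE.
Qed.

Lemma repby_of_rep V : repby V (of_rep V).
Proof.
have vb i : basis_of {: rspace V i} (vbasis {: rspace V i}) := vbasisP _.
exists (fun i => linfun (rVof (vbasis {: rspace V i}))); split=> [i|c v].
  exists (vecof (vbasis {: rspace V i})) => v; first by rewrite lfunE /= rVofK.
  by rewrite lfunE /= vecofK.
rewrite !lfunE /= ffunE; exact: (rVof_app _ (vb (source c))).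
Qed.

Lemma rep_iso_refl V : rep_iso V V.
Proof.
exists (fun i => \1%VF); split=> [i|c v]; last by rewrite !id_lfunE.
by exists id => v; rewrite id_lfunE.
Qed.

Lemma lfun_rowmx m p (f : 'Hom('rV[k]_m, 'rV[k]_p)) v : v *m lin1_mx f = f v.
Proof. exact: mul_rV_lin1. Qed.

Lemma repby_iso a b V W (x : mrep k Q a) (y : mrep k Q b) : repby V x -> repby W y ->
  rep_iso V W <-> repiso x y.
Proof.
move=> [phi [phib phiE]] [psi [psib psiE]]; split=> [[h [hb hE]]|[f [g [xf yg fg gf]]]].
  pose f : vfam k a b := finfun (fun i => lin1_mx (psi i \o h i \o (phi i)^-1)%VF).
  have hK i : lker (h i) == 0%VS by apply/lker0P/bij_inj.
  have hKi i : cancel (h i)^-1%VF (h i).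
    by move=> u; have [g' gK Kg] := hb i; rewrite -[u]Kg lker0_lfunK.
  pose g : vfam k b a := finfun (fun i => lin1_mx (phi i \o (h i)^-1 \o (psi i)^-1)%VF).
  have fE i v : v *m f i = psi i (h i ((phi i)^-1%VF v)) by rewrite ffunE lfun_rowmx !comp_lfunE.
  have gE i v : v *m g i = phi i ((h i)^-1%VF ((psi i)^-1%VF v)) by rewrite ffunE lfun_rowmx !comp_lfunE.
  have fg : cmp f g = scf a 1.
    apply/ffunP => i; rewrite [LHS]ffunE [RHS]ffunE; apply/row_matrixP => j.
    by rewrite !rowE mulmxA fE gE coord_inv // lker0_lfunK // inv_coord // mulmx1.
  have gf : cmp g f = scf b 1.
    apply/ffunP => i; rewrite [LHS]ffunE [RHS]ffunE; apply/row_matrixP => j.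
    by rewrite !rowE mulmxA gE fE coord_inv // hKi inv_coord // mulmx1.
  have xf : homf x y f.
    apply/forallP => c; apply/eqP/row_matrixP => j; rewrite !rowE !mulmxA fE.
    set u := delta_mx 0 j; have uE := inv_coord (phib (source c)) u.
    by rewrite fE -{1}uE -phiE coord_inv // hE psiE.
  exists f, g; split=> //; apply/forallP => c; apply/eqP.
  have := forallP xf c => /eqP E.
  have fgi i : f i *m g i = 1%:M by have /ffunP/(_ i) := fg; rewrite !ffunE.
  have gfi i : g i *m f i = 1%:M by have /ffunP/(_ i) := gf; rewrite !ffunE.
  by rewrite -[LHS]mul1mx -gfi -!mulmxA (mulmxA (f _)) -E -!mulmxA fgi mulmx1.
have fgi i : f i *m g i = 1%:M by have /ffunP/(_ i) := fg; rewrite !ffunE.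
have gfi i : g i *m f i = 1%:M by have /ffunP/(_ i) := gf; rewrite !ffunE.
exists (fun i => ((psi i)^-1 \o linfun (mulmxr (f i)) \o phi i)%VF); split=> [i|c v].
  exists ((phi i)^-1 \o linfun (mulmxr (g i)) \o psi i)%VF => v.
    by rewrite !comp_lfunE !lfunE /= inv_coord // -mulmxA fgi mulmx1 coord_inv.
  by rewrite !comp_lfunE !lfunE /= inv_coord // -mulmxA gfi mulmx1 coord_inv.
rewrite !comp_lfunE !lfunE /=; apply: (bij_inj (psib _)); rewrite inv_coord // psiE inv_coord // phiE.
by rewrite -!mulmxA (eqP (forallP xf c)).
Qed.

Lemma repby_trans a b V (x : mrep k Q a) (y : mrep k Q b) : repby V x -> repiso x y -> repby V y.
Proof.
move=> [phi [phib phiE]] [f [g [/forallP xf yg fg gf]]].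
have fgi i : f i *m g i = 1%:M by have /ffunP/(_ i) := fg; rewrite !ffunE.
have gfi i : g i *m f i = 1%:M by have /ffunP/(_ i) := gf; rewrite !ffunE.
exists (fun i => (linfun (mulmxr (f i)) \o phi i)%VF); split=> [i|c v].
  exists ((phi i)^-1 \o linfun (mulmxr (g i)))%VF => v.
    by rewrite !comp_lfunE !lfunE /= -mulmxA fgi mulmx1 coord_inv.
  by rewrite !comp_lfunE !lfunE /= inv_coord // -mulmxA gfi mulmx1.
by rewrite !comp_lfunE !lfunE /= phiE -!mulmxA (eqP (xf c)).
Qed.

Section Chart.
Variables (a : 'I_n -> nat) (V : rep Q k) (x : mrep k Q a).
Variable phi : forall i, 'Hom(rspace V i, 'rV[k]_(a i)).
Hypothesis ch : @chart a V x phi.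

Lemma chart_dim i : \dim {: rspace V i} = a i.
Proof. exact: coord_dim (ch.1 i). Qed.

Lemma chart_coordinates (U : forall i, {vspace rspace V i}) :
  exists B : forall i, 'M[k]_(a i), forall i, in_coordinates (phi i) (U i) (B i).
Proof.
apply: (@dependent_choice _ (fun i => 'M[k]_(a i)) (fun i B => in_coordinates (phi i) (U i) B)) => i.
exact: coordinates_of (ch.1 i) _.
Qed.

Lemma chart_space m (B : forall i, 'M[k]_(m i, a i)) :
  exists U : forall i, {vspace rspace V i}, forall i, in_coordinates (phi i) (U i) (B i).
Proof.
apply: (@dependent_choice _ (fun i => {vspace rspace V i}) (fun i U => in_coordinates (phi i) U (B i))) => i.
exact: (space_of (ch.1 i) (B i)).
Qed.

Lemma chart_subrep m (U : forall i, {vspace rspace V i}) (B : forall i, 'M[k]_(m i, a i)) :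
  (forall i, in_coordinates (phi i) (U i) (B i)) -> subrep U <-> stab x B.
Proof.
case: ch => phib phiE UB; split=> [US|/forallP xB c].
  apply/forallP => c; apply/row_subP => j; rewrite row_mul.
  set u := row j (B (source c)); have uE := inv_coord (phib (source c)) u.
  rewrite -uE -phiE -UB; apply: (subvP (US c)); apply: memv_img.
  by rewrite UB uE row_sub.
apply/subvP => w /memv_imgP[v]; rewrite UB => vB ->; rewrite UB phiE.
exact: submx_trans (submxMr _ vB) (xB c).
Qed.

Lemma chart_indecomposable : indecomposable V <-> indec x.
Proof.
have nz (U : forall i, {vspace rspace V i}) (B : forall i, 'M[k]_(a i)) :
    (forall i, in_coordinates (phi i) (U i) (B i)) -> sub_nonzero U <-> ~ forall i, B i = 0.
  move=> UB; split=> [[i Ui] B0|/not_all_ex_not[i Bi]].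
    by apply/Ui/(in_coordinates_eq0 (ch.1 i) (UB i)).
  by exists i => /(in_coordinates_eq0 (ch.1 i) (UB i)).
have hpos : sub_nonzero (fun i => {: rspace V i}%VS) <-> (0 < ht a)%N.
  split=> [[i fi]|h0].
    apply: leq_trans (leq_ht a i); rewrite -chart_dim lt0n dimv_eq0; exact/eqP.
  have [i ai] : exists i, (0 < a i)%N.
    apply/existsP; rewrite -[[exists i, _]]negbK negb_exists; apply/negP => /forallP a0.
    by move: h0; rewrite /ht big1 // => i _; apply/eqP; rewrite -leqn0 leqNgt.
  by exists i => E; move: ai; rewrite -chart_dim E dimv0.
split=> [[/hpos h0 ind]|[h0 ind]]; split; try exact/hpos.
- by [].
- move=> U V' xU xV UV; have [S SU] := chart_space U; have [S' SV] := chart_space V'.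
  apply: NNPP => /not_or_and[nU nV]; apply: ind; exists S, S'; split.
  + exact/(chart_subrep SU).
  + exact/(chart_subrep SV).
  + exact/(nz _ _ SU).
  + exact/(nz _ _ SV).
  + by move=> i; apply/(in_coordinates_direct (ch.1 i) (SU i) (SV i)).
move=> [S [S' [SS SS' nS nS' SD]]].
have [U SU] := chart_coordinates S; have [U' SU'] := chart_coordinates S'.
case: (ind U U'); [exact/(chart_subrep SU)|exact/(chart_subrep SU')| | |].
- by move=> i; apply/(in_coordinates_direct (ch.1 i) (SU i) (SU' i)).
- exact/(nz _ _ SU).
- exact/(nz _ _ SU').
Qed.

End Chart.

Lemma repby_indecomposable a V (x : mrep k Q a) : repby V x -> indecomposable V <-> indec x.
Proof. by case=> phi ch; apply: chart_indecomposable ch. Qed.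

End OneField.
End Translation.

Section ScalarExtensionIso.
Variables (n : nat) (Q : quiver n) (k K : fieldType) (iota : {rmorphism k -> K}).

Lemma mapf_cmp (a b c : 'I_n -> nat) (f : vfam k a b) (g : vfam k b c) :
  mapf iota (cmp f g) = cmp (mapf iota f) (mapf iota g).
Proof. by apply/ffunP => i; rewrite !ffunE map_mxM. Qed.

Lemma repiso_map a b (x : mrep k Q a) (y : mrep k Q b) : repiso x y -> repiso (mapr iota x) (mapr iota y).
Proof.
have sc1 d : mapf iota (scf d 1) = scf d 1.
  by apply/ffunP => i; rewrite !ffunE map_scalar_mx rmorph1.
case=> f [g [xf yg fg gf]]; exists (mapf iota f), (mapf iota g).
by rewrite !homf_map -!mapf_cmp fg gf !sc1.
Qed.

(** [scalar_ext] is formed with the bases [vbasis]; any other coordinates differ from these by an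
    isomorphism over k, which extends to K. *)
Lemma repby_scalar_ext a (V : rep Q k) (x : mrep k Q a) : repby V x -> repby (scalar_ext iota V) (mapr iota x).
Proof.
move=> Vx; apply: (repby_trans (x := mapr iota (of_rep V))); last first.
  by apply: repiso_map; apply/(repby_iso (repby_of_rep V) Vx); apply: rep_iso_refl.
have -> : scalar_ext iota V = to_rep (mapr iota (of_rep V)).
  rewrite /scalar_ext /to_rep; congr Rep; apply: functional_extensionality_dep => c.
  by rewrite !ffunE.
exact: repby_to_rep.
Qed.
End ScalarExtensionIso.

Section AbsoluteIndecomposability.
Variables (n : nat) (Q : quiver n) (k : finFieldType).

(** Forward, one algebraic closure is enough; backward, residue degree 1 keeps an indecomposable so
    over every extension field. *)
Lemma repby_abs_indecomposable a (V : rep Q k) (x : mrep k Q a) : repby V x ->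
  abs_indecomposable V <-> indec x /\ has_resdeg x 1.
Proof.
move=> Vx; split=> [H|[xI xr] K iota _]; last first.
  by apply/(repby_indecomposable (repby_scalar_ext iota Vx)); apply: indec_map.
have [K [iota alg]] := countable_algebraic_closure k.
have /(repby_indecomposable (repby_scalar_ext iota Vx)) xK := H K iota alg.
by split; [apply: indec_of_map xK|apply: resdeg1_of_map xK].
Qed.
End AbsoluteIndecomposability.

(** * Slopes and the weight theta - mu.ht *)

Section Semistability.
Variables (n : nat) (Q : quiver n) (theta : {additive {ffun 'I_n -> int} -> int}) (mu : rat).

Definition theta_weight (i : 'I_n) : rat := (theta [ffun j => (i == j)%:Z])%:~R - mu.
Local Notation l := theta_weight.

Lemma lam_theta (b : 'I_n -> nat) :
  lam l b = (theta_nat theta [ffun i => b i])%:~R - mu * (ht b)%:R.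
Proof.
have -> : theta_nat theta [ffun i => b i] = \sum_i theta [ffun j => (i == j)%:Z] *+ b i.
  rewrite -(eq_bigr _ (fun i _ => raddfMn theta (b i) _)) -raddf_sum; congr (theta _).
  apply/ffunP => j; rewrite sum_ffunE !ffunE (bigD1 j) //= [X in _ + X]big1 ?addr0 => [|i ij].
    by rewrite ffunMnE ffunE eqxx; apply: esym (natz _).
  by rewrite ffunMnE ffunE (negbTE ij) mul0rn.
rewrite /lam raddf_sum /ht natr_sum mulr_sumr -sumrB; apply: eq_bigr => i _.
by rewrite /l mulrBl /= -[theta _ *+ _]mulr_natr intrM rmorph_nat.
Qed.

Lemma in_Delta_lam (alpha : {ffun 'I_n -> nat}) : in_Delta theta mu alpha -> lam l alpha = 0.
Proof.
rewrite /in_Delta lam_theta => E; have -> : [ffun i => alpha i] = alpha.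
  by apply/ffunP => i; rewrite ffunE.
by rewrite E /height /ht subrr.
Qed.

(** Since lam a = 0, the slope of a is mu. *)
Lemma slope_le (b : 'I_n -> nat) (a : 'I_n -> nat) : (0 < ht b)%N -> (0 < ht a)%N -> lam l a = 0 ->
  (slope theta [ffun i => b i] <= slope theta [ffun i => a i]) = (lam l b <= 0).
Proof.
have hE c : height [ffun i => c i] = ht c by apply: eq_bigr => i _; rewrite ffunE.
move=> b0 a0; rewrite !lam_theta => /eqP; rewrite subr_eq0 => /eqP aE.
rewrite /slope aE !hE mulfK ?pnatr_eq0 -?lt0n // ler_pdivrMr ?ltr0n //.
by rewrite subr_le0.
Qed.

Variable k : finFieldType.

(** The definition tests nonzero proper subrepresentations, [fss] tests all of them; the zero and
    the whole representation have weight 0, so the two agree. *)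
Lemma repby_semistable a (V : rep Q k) (x : mrep k Q a) : repby V x -> lam l a = 0 ->
  semistable theta V <-> sss l x.
Proof.
move=> [phi ch] a0; rewrite /sss a0 eqxx andbT.
have dimV : dimvec V = [ffun i => a i].
  by apply/ffunP => i; rewrite !ffunE (chart_dim ch).
have key m (S : forall i, {vspace rspace V i}) (U : forall i, 'M[k]_(m i, a i)) :
    (forall i, in_coordinates (phi i) (S i) (U i)) -> sub_nonzero S -> sub_proper S ->
    (slope theta (sub_dimvec S) <= slope theta (dimvec V)) = (lam l (rk U) <= 0).
  move=> SU [i Si] _.
  have dE j : \dim (S j) = rk U j := in_coordinates_dim (ch.1 j) (SU j).
  have -> : sub_dimvec S = [ffun i => rk U i] by apply/ffunP => j; rewrite !ffunE dE.
  have r0 : (0 < \rank (U i))%N by rewrite -[\rank _]dE lt0n dimv_eq0; apply/eqP.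
  rewrite dimV slope_le //; first exact: leq_trans r0 (leq_ht (rk U) i).
  by apply: leq_trans r0 (leq_trans (rank_leq_col _) (leq_ht a i)).
split=> [ss|/fssP xF S SS S0 Sp]; last first.
  have [U SU] := chart_coordinates ch S; rewrite (key _ _ _ SU S0 Sp).
  exact/xF/(chart_subrep ch SU).
apply/fssP => m U xU; have [S SU] := chart_space ch U.
have dE j : \dim (S j) = rk U j := in_coordinates_dim (ch.1 j) (SU j).
have SS : subrep S by apply/(chart_subrep ch SU).
case: (classic (sub_nonzero S)) => [S0|S0]; last first.
  rewrite (_ : rk U = @dim0 n) ?lam0 //; apply: functional_extensionality => i; rewrite -dE.
  by apply/eqP; rewrite dimv_eq0; apply/eqP; apply: NNPP => Si; apply: S0; exists i.
case: (classic (sub_proper S)) => [Sp|Sp]; first by rewrite -(key _ _ _ SU S0 Sp); apply: ss.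
rewrite (_ : rk U = a) ?a0 //; apply: functional_extensionality => i; rewrite -dE.
rewrite -(chart_dim ch i); congr (\dim _); apply: NNPP => Si; apply: Sp; by exists i.
Qed.
End Semistability.

(** * From canonical representatives to the counting functions *)

Section IsoClassCounts.
Variables (n : nat) (Q : quiver n).

Lemma num_iso_classes_card (k : finFieldType) (alpha : {ffun 'I_n -> nat}) (P : mrep k Q alpha -> bool)
    (R : rep Q k -> Prop) : (forall V x, repby V x -> R V <-> P x) -> (forall V, R V -> dimvec V = alpha) ->
  num_iso_classes R #|classes P|.
Proof.
move=> RP Rd; exists (fun i => to_rep (enum_val i)); split=> [i|i j ij|V RV].
- apply/(RP _ _ (repby_to_rep _)); have := enum_valP i; by rewrite inE => /andP[].
- have := enum_valP i; have := enum_valP j; rewrite !inE => /andP[_ /eqP cj] /andP[_ /eqP ci].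
  apply: enum_val_inj; rewrite -ci -cj; apply: repcan_eq.
  exact/(repby_iso (repby_to_rep _) (repby_to_rep _)).
have [x Vx] : exists x : mrep k Q alpha, repby V x.
  have E : spacedim V = alpha.
    by apply: functional_extensionality => i; rewrite -(Rd V RV) ffunE.
  by case: _ / E; exists (of_rep V); apply: repby_of_rep.
have Vy := repby_trans Vx (repcan_iso x).
have yc : repcan x \in classes P.
  rewrite inE (introT idP (proj1 (RP _ _ Vy) RV)) /=; apply/eqP/esym/repcan_eq.
  exact: repcan_iso.
exists (enum_rank_in yc (repcan x)); rewrite enum_rankK_in //.
by apply/(repby_iso Vx (repby_to_rep _)); apply: repcan_iso.
Qed.

Variable l : 'I_n -> rat.

Lemma indec_resdeg (k : finFieldType) (a : 'I_n -> nat) (x : mrep k Q a) : indec x ->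
  exists d, forall d', has_resdeg x d' = (d' == d).
Proof.
move=> xI; have [L [r [iota [rD _ r0 rsur _]]]] := exists_residue_field xI.
have [d _ cL] := card_field_extension iota; exists d => d'.
by rewrite (has_resdegP _ (card_residue rD r0 rsur)) cL eqn_exp2l ?card_fin_gt1 // eq_sym.
Qed.

(** An indecomposable has exactly one residue degree, and it does not exceed the bound because there
    are no classes of larger degree. *)
Lemma card_indec_classes (k : finFieldType) (a : 'I_n -> nat) :
  #|classes (fun x : mrep k Q a => sss l x && asb (indec x))|
  = (\sum_(d < (n * (ht a).+1 ^ 2).+1) #|indec_classes Q l k a d|)%N.
Proof.
set N := (n * _)%N; rewrite -sum1_card.
transitivity (\sum_(x in classes (fun x : mrep k Q a => sss l x && asb (indec x)))
    \sum_(d < N.+1) has_resdeg x d)%N.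
  apply: eq_bigr => x; rewrite inE => /andP[/andP[xs /asbP xI] xc].
  have [d dP] := indec_resdeg xI.
  have dN : (d < N.+1)%N.
    rewrite ltnS leqNgt; apply/negP => gt.
    have := @indec_classes_eq0 _ Q l k a d; rewrite gt !orbT => /(_ isT) /eqP.
    rewrite cards_eq0 => /eqP/setP/(_ x).
    by rewrite !inE xs xc dP eqxx (introT (asbP _) xI).
  rewrite (bigD1 (Ordinal dN)) //= dP eqxx big1 // => d' d'd.
  by rewrite dP -[d]/(val (Ordinal dN)) (inj_eq val_inj) (negbTE d'd).
rewrite exchange_big; apply: eq_bigr => d _ /=; rewrite -sum1_card big_mkcond [RHS]big_mkcond.
apply: eq_bigr => x _; rewrite !inE; case: (sss l x) => //=; case: (asb _) => //=.
by case: (has_resdeg x d); case: (repcan x == x).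
Qed.

(** The counts over the prime fields supply the natural number values at primes; the polynomial they
    determine then serves all finite fields. *)
Lemma rfc_polynomial (phi : finFieldType -> nat) : rfc (fun k => (phi k)%:R) ->
  exists f : {poly rat}, forall k : finFieldType, (phi k)%:R = f.[#|k|%:R].
Proof.
move=> [r rI rP]; have [|f fP] := nat_valued_isrf_poly rI.
  by move=> p pp; exists (phi 'F_p); rewrite rP card_Fp.
by exists f => k; rewrite rP fP // card_fin_gt1.
Qed.

End IsoClassCounts.

Theorem mainTheorem6 (n : nat) (Q : quiver n)
    (theta : {additive {ffun 'I_n -> int} -> int}) (mu : rat)
    (alpha : {ffun 'I_n -> nat}) :
  in_Delta theta mu alpha ->
  [/\ polynomial_count (isM theta Q alpha),
      polynomial_count (isI theta Q alpha)
    & polynomial_count (isA theta Q alpha)].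
Proof.
move=> /in_Delta_lam a0; set l := theta_weight theta mu in a0.
have dimE (k : finFieldType) (V : rep Q k) (x : mrep k Q alpha) : repby V x -> dimvec V = alpha.
  by case=> phi ch; apply/ffunP => i; rewrite ffunE (chart_dim ch).
have ssE (k : finFieldType) (V : rep Q k) (x : mrep k Q alpha) (Vx : repby V x) :=
  @repby_semistable n Q theta mu k alpha V x Vx a0.
split.
- have [f fP] := rfc_polynomial (ss_count_rfc Q l alpha).
  exists f => k; exists #|classes (fun x : mrep k Q alpha => sss l x)|; last exact: fP.
  apply: num_iso_classes_card => [V x Vx|V []//].
  by split=> [[_ /(ssE _ _ _ Vx)]|xs] //; split; [exact: dimE Vx|exact/(ssE _ _ _ Vx)].
- have [f fP] : exists f : {poly rat}, forall k : finFieldType,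
      #|classes (fun x : mrep k Q alpha => sss l x && asb (indec x))|%:R = f.[#|k|%:R].
    apply: rfc_polynomial; apply: rfc_eq (rfc_sum (index_enum _) (P := xpredT)
      (fun (d : 'I_(n * (ht alpha).+1 ^ 2).+1) _ => indec_count_rfc Q l alpha (val d))) => k.
    by rewrite card_indec_classes natr_sum; apply: eq_bigr.
  exists f => k; exists #|classes (fun x : mrep k Q alpha => sss l x && asb (indec x))|; last exact: fP.
  apply: num_iso_classes_card => [V x Vx|V []//]; split.
    by case=> _ /(ssE _ _ _ Vx) -> /(repby_indecomposable Vx) xI; apply/asbP.
  move=> /andP[xs /asbP xI]; split; first exact: dimE Vx.
    exact/(ssE _ _ _ Vx).
  exact/(repby_indecomposable Vx).
have [f fP] := rfc_polynomial (indec_count_rfc Q l alpha 1).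
exists f => k; exists #|indec_classes Q l k alpha 1|; last exact: fP.
apply: num_iso_classes_card => [V x Vx|V []//]; split.
  by case=> _ /(ssE _ _ _ Vx) -> /(repby_abs_indecomposable Vx)[xI ->]; rewrite andbT; apply/asbP.
move=> /and3P[xs /asbP xI xr]; split; first exact: dimE Vx.
  exact/(ssE _ _ _ Vx).
exact/(repby_abs_indecomposable Vx).
Qed.
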